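(* Let $(u,p)\in (H^1_{loc}(\Omega))^n\times L^2_{loc}(\Omega)$ be a solution in $\Omega$ of the Stokes system $$\Delta u+A(x)\cdot\nabla u+\nabla p=0,\qquad \operatorname{div}u=0,$$ where $A$ satisfies $|A(x)|\le C_0\,|\log|x||^{-3}|x|^{-1}$ for all $x\in\Omega$. Assume that $(u,p)$ vanishes of infinite order at the origin, i.e. for all $N>0$, $$\int_{|x|<R}(|u|^2+|p|^2)\,dx=O(R^N)\quad\text{as } R\to 0.$$ Then $(u,p)\equiv 0$ in $\Omega$.
   Context: $n\ge 2$, and $\Omega\subset\mathbb{R}^n$ is a connected open set containing $0$. $A:\Omega\to\mathbb{R}^n$ is a measurable vector field and $C_0>0$ is a constant. The unknowns are $u=(u_1,\dots,u_n)$ (vector valued) and $p$ (scalar), and $A\cdot\nabla u=(A\cdot\nabla u_1,\dots,A\cdot\nabla u_n)$. Solutions are understood in the weak (distributional) sense.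
   Formalization: The bound on A is infinite at |x|=1 and the claim fails if Ω crosses that sphere; A is additionally assumed locally bounded near points of Ω with |x|=1 (void if Ω misses the sphere). The bound is not required at x=0; measurable means Borel measurable. *)

(* Defs.v *)
From HB Require Import structures.
From mathcomp Require Import all_boot all_order all_algebra.
From mathcomp Require Import all_classical all_reals all_analysis.

Set Implicit Arguments.
Unset Strict Implicit.
Unset Printing Implicit Defensive.

Import Order.TTheory GRing.Theory Num.Theory.
Import numFieldNormedType.Exports.

Local Open Scope classical_set_scope.
Local Open Scope ring_scope.

Definition rV_display : measure_display. Proof. exact. Qed.

Section rV_measurable.
Context {R : realType} {n : nat}.

Let coord (i : 'I_n) (x : 'rV[R]_n) : R := x ord0 i.

Let rV_set0 : g_sigma_preimage coord set0.
Proof. exact: sigma_algebra0. Qed.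

Let rV_setC A : g_sigma_preimage coord A -> g_sigma_preimage coord (~` A).
Proof. exact: sigma_algebraC. Qed.

Let rV_bigcup (F : _^nat) : (forall i, g_sigma_preimage coord (F i)) ->
  g_sigma_preimage coord (\bigcup_i (F i)).
Proof. exact: sigma_algebra_bigcup. Qed.

(* The sigma-algebra generated by the coordinates, i.e. the Borel sets of R^n;
   same construction as for n.-tuple in the library. *)
HB.instance Definition _ := @isMeasurable.Build rV_display 'rV[R]_n
  (g_sigma_preimage coord) rV_set0 rV_setC rV_bigcup.

Lemma measurable_rV_coord (i : 'I_n) :
  measurable_fun [set: 'rV[R]_n] (fun x => x ord0 i).
Proof.
move=> _ Y mY; rewrite setTI; apply: sub_sigma_algebra => /=.
rewrite -bigcup_seq/=; exists i => /=; first by rewrite mem_index_enum.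
by exists Y => //; rewrite setTI.
Qed.

Lemma measurable_fun_rVP d (T : measurableType d) (f : T -> 'rV[R]_n) :
  (forall i, measurable_fun [set: T] (fun x => f x ord0 i)) ->
  measurable_fun [set: T] f.
Proof.
move=> mf _ A mA; rewrite setTI.
suff : preimage_set_system [set: T] f (g_sigma_preimage coord) `<=` measurable.
  by apply; exists A => //; rewrite setTI.
rewrite -g_sigma_preimage_comp.
apply: smallest_sub; first exact: sigma_algebra_measurable.
move=> B; rewrite -bigcup_seq => -[i _ [C mC <-]].
exact: mf.
Qed.

End rV_measurable.

(* The library's instance of sigma-finiteness for product measures is shadowed
   by its subprobability instance, hence this lemma. *)
Lemma sigma_finite_product_measure1 d1 d2 (T1 : measurableType d1)
    (T2 : measurableType d2) (R : realType)
    (m1 : {sigma_finite_measure set T1 -> \bar R})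
    (m2 : {sigma_finite_measure set T2 -> \bar R}) :
  sigma_finite setT (m1 \x m2)%E.
Proof.
have /sigma_finiteP[F [TF ndF Foo]] := sigma_finiteT m1.
have /sigma_finiteP[G [TG ndG Goo]] := sigma_finiteT m2.
exists (fun n => F n `*` G n).
  rewrite -setXTT TF TG predeqE => -[x y]; split.
    move=> [/= [n _ Fnx] [k _ Gky]]; exists (maxn n k) => //; split.
    - by move: x Fnx; exact/subsetPset/ndF/leq_maxl.
    - by move: y Gky; exact/subsetPset/ndG/leq_maxr.
  by move=> [n _ []/= ? ?]; split; exists n.
move=> k; have [? ?] := Foo k; have [? ?] := Goo k.
split; first exact: measurableX.
by rewrite product_measure1E// lte_mul_pinfty// ge0_fin_numE.
Qed.

Section lebesgue_rV.
Context {R : realType}.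

Definition rV_cons n (z : measurableTypeR R * 'rV[R]_n) : 'rV[R]_n.+1 :=
  row_mx (\row_(_ < 1) z.1) z.2.

Definition rV_uncons n (x : 'rV[R]_n.+1) : measurableTypeR R * 'rV[R]_n :=
  (x ord0 ord0, \row_i x ord0 (lift ord0 i)).

Lemma rV_cons0 n z : @rV_cons n z ord0 ord0 = z.1.
Proof.
rewrite /rV_cons mxE; case: splitP => /= j; last by [].
by rewrite mxE.
Qed.

Lemma rV_consS n z i : @rV_cons n z ord0 (lift ord0 i) = z.2 ord0 i.
Proof.
rewrite /rV_cons mxE; case: splitP => /= j.
  by rewrite ord1.
by rewrite /bump /= !add1n => -[] /val_inj ->.
Qed.

Lemma measurable_rV_cons n : measurable_fun setT (@rV_cons n).
Proof.
apply: measurable_fun_rVP => i.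
case: (unliftP ord0 i) => [j ->|->].
  under eq_fun do rewrite rV_consS.
  apply: (@measurableT_comp _ _ _ _ _ _ (fun x : 'rV[R]_n => x ord0 j)).
    exact: measurable_rV_coord.
  exact: measurable_snd.
under eq_fun do rewrite rV_cons0.
exact: measurable_fst.
Qed.

Lemma rV_unconsK n : cancel (@rV_uncons n) (@rV_cons n).
Proof.
move=> x; apply/rowP => i; case: (unliftP ord0 i) => [j ->|->].
  by rewrite rV_consS /rV_uncons /= mxE.
by rewrite rV_cons0.
Qed.

Lemma rV_consK n : cancel (@rV_cons n) (@rV_uncons n).
Proof.
move=> [a x]; rewrite /rV_uncons rV_cons0; congr pair.
by apply/rowP => i; rewrite mxE rV_consS.
Qed.

Lemma measurable_rV_uncons n : measurable_fun setT (@rV_uncons n).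
Proof.
apply: measurable_fun_pair => /=; first exact: measurable_rV_coord.
apply: measurable_fun_rVP => i.
under eq_fun do rewrite mxE.
exact: measurable_rV_coord.
Qed.

Section step.
Variables (n : nat) (mu : {sigma_finite_measure set 'rV[R]_n -> \bar R}).
Local Open Scope ereal_scope.

Definition lebesgue_rV_step : set 'rV[R]_n.+1 -> \bar R :=
  pushforward (@lebesgue_measure R \x mu) (@rV_cons n).

Let step0 : lebesgue_rV_step set0 = 0.
Proof. by rewrite /lebesgue_rV_step /pushforward preimage_set0 measure0. Qed.

Let step_ge0 A : 0 <= lebesgue_rV_step A.
Proof. exact: (measure_ge0 (@lebesgue_measure R \x mu)). Qed.

Let step_sigma_additive : semi_sigma_additive lebesgue_rV_step.
Proof.
have mc : measurable_fun setT (@rV_cons n) by exact: measurable_rV_cons.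
exact: (@measure_semi_sigma_additive _ _ _
  (measure_function_pushforward__canonical__measure_function_Measure
     (@lebesgue_measure R \x mu) mc)).
Qed.

HB.instance Definition _ := isMeasure.Build _ _ _ lebesgue_rV_step
  step0 step_ge0 step_sigma_additive.

Let step_sigma_finite : sigma_finite setT lebesgue_rV_step.
Proof.
have [F UF Foo] := @sigma_finite_product_measure1 _ _ _ _ _
  (@lebesgue_measure R) mu.
exists (fun k => @rV_uncons n @^-1` F k).
  by rewrite -preimage_bigcup -UF preimage_setT.
move=> k; have [mF Fk] := Foo k; split.
  by rewrite -[X in measurable X]setTI; exact: measurable_rV_uncons.
rewrite /lebesgue_rV_step /pushforward -comp_preimage.
rewrite (_ : _ \o _ = id) ?preimage_id//.
by apply/funext => z /=; rewrite rV_consK.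
Qed.

HB.instance Definition _ := Measure_isSigmaFinite.Build _ _ _ lebesgue_rV_step
  step_sigma_finite.

End step.

Fixpoint lebesgue_rV (n : nat) : {sigma_finite_measure set 'rV[R]_n -> \bar R} :=
  match n with
  | 0%N => \d_(0 : 'rV[R]_0)
  | n'.+1 => lebesgue_rV_step (lebesgue_rV n')
  end.

(* With sigma-finiteness, this determines the measure: it is Lebesgue measure. *)
Lemma lebesgue_rV_box n (A : 'I_n -> set R) : (forall i, measurable (A i)) ->
  lebesgue_rV n [set x | forall i, A i (x ord0 i)] =
  (\prod_(i < n) lebesgue_measure (A i))%E.
Proof.
elim: n A => [|n IH] A mA.
  rewrite big_ord0 /= diracE (_ : _ \in _) //.
  by rewrite inE => -[].
have mB : measurable
    [set x : 'rV[R]_n | forall i, A (lift ord0 i) (x ord0 i)].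
  rewrite (_ : mkset _ = \bigcap_(i in [set: 'I_n])
      ((fun x : 'rV[R]_n => x ord0 i) @^-1` A (lift ord0 i))); last first.
    by apply/seteqP; split => x /= H i //=; exact: H.
  apply: fin_bigcap_measurable => // i _.
  by rewrite -[X in measurable X]setTI; exact: measurable_rV_coord.
rewrite big_ord_recl -IH//= /lebesgue_rV_step /pushforward.
rewrite -product_measure1E//; last exact: (mA ord0).
congr (_ _); apply/seteqP; split => [[a x] /= H|[a x] /= [Ha Hx] i].
  split; first by have := H ord0; rewrite rV_cons0.
  by move=> i; have := H (lift ord0 i); rewrite rV_consS.
case: (unliftP ord0 i) => [j ->|->]; first by rewrite rV_consS.
by rewrite rV_cons0.
Qed.

End lebesgue_rV.

Section euclidean.
Context {R : realType} {n : nat}.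
Implicit Types (Omega K : set 'rV[R]_n) (f phi : 'rV[R]_n -> R).

Local Notation mu := (@lebesgue_rV R n).

(* The library's norm on 'rV[R]_n is the sup norm. *)
Definition enorm (x : 'rV[R]_n) : R := Num.sqrt (\sum_i x ord0 i ^+ 2).

Definition eball (r : R) : set 'rV[R]_n := [set x | enorm x < r].

Definition basis_vec (i : 'I_n) : 'rV[R]_n := delta_mx ord0 i.

Definition partial (i : 'I_n) f : 'rV[R]_n -> R := 'D_(basis_vec i) f.

Fixpoint Ck (k : nat) f : Prop :=
  continuous f /\
  match k with
  | 0%N => True
  | k'.+1 => forall i,
      (forall x, derivable f x (basis_vec i)) /\ Ck k' (partial i f)
  end.

Definition smooth f : Prop := forall k, Ck k f.

Definition test_function Omega phi : Prop :=
  smooth phi /\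
  exists K, [/\ compact K, K `<=` Omega & forall x, ~ K x -> phi x = 0].

Definition L2loc Omega f : Prop :=
  measurable_fun Omega f /\
  forall K, K `<=` Omega -> compact K ->
    (\int[mu]_(x in K) (`|f x| ^+ 2)%:E < +oo)%E.

Definition weak_partial Omega (i : 'I_n) f (g : 'rV[R]_n -> R) : Prop :=
  forall phi, test_function Omega phi ->
    \int[mu]_(x in Omega) (f x * partial i phi x) =
    - \int[mu]_(x in Omega) (g x * phi x).

Definition weak_gradient Omega f (g : 'I_n -> 'rV[R]_n -> R) : Prop :=
  forall i, L2loc Omega (g i) /\ weak_partial Omega i f (g i).

Definition H1loc Omega f : Prop :=
  L2loc Omega f /\ exists g, weak_gradient Omega f g.

(* Distributional form of
     Delta u + A . grad u + grad p = 0,  div u = 0  in Omega,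
   componentwise; Du j i is the weak derivative of u_j in the direction i. *)
Definition stokes_solution Omega (A u : 'rV[R]_n -> 'rV[R]_n)
    (p : 'rV[R]_n -> R) : Prop :=
  exists Du : 'I_n -> 'I_n -> 'rV[R]_n -> R,
  [/\ forall j, weak_gradient Omega (fun x => u x ord0 j) (Du j),
      forall j phi, test_function Omega phi ->
        \int[mu]_(x in Omega)
          (- (\sum_i Du j i x * partial i phi x)
           + (\sum_i A x ord0 i * Du j i x) * phi x
           - p x * partial j phi x) = 0
    & forall phi, test_function Omega phi ->
        \int[mu]_(x in Omega) (\sum_i u x ord0 i * partial i phi x) = 0].

Definition vanishes_to_infinite_order_at0 (u : 'rV[R]_n -> 'rV[R]_n)
    (p : 'rV[R]_n -> R) : Prop :=
  forall N : R, 0 < N ->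
    (fun r : R => \int[mu]_(x in eball r) (enorm (u x) ^+ 2 + `|p x| ^+ 2))
      =O_ (0^'+) (fun r : R => r `^ N).

(* |A(x)| <= C0 |log|x||^-3 |x|^-1 on Omega.  The right-hand side is a real
   number only for x <> 0 and |x| <> 1.  It is infinite on the unit sphere,
   where the bound must be read as a finite one, namely local boundedness of A:
   unconstrained growth of order dist(x, sphere)^-3 there would allow nonzero
   solutions supported outside the unit ball.  If Omega does not meet the unit
   sphere, the second clause is void. *)
Definition drift_bound Omega (C0 : R) (A : 'rV[R]_n -> 'rV[R]_n) : Prop :=
  (forall x, Omega x -> x != 0 -> enorm x != 1 ->
     enorm (A x) <= C0 * `|ln (enorm x)| ^- 3 * (enorm x)^-1) /\
  (forall x, Omega x -> enorm x = 1 ->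
     exists M : R, \forall y \near x, enorm (A y) <= M).

End euclidean.

(* Main.v *)
From HB Require Import structures.
Require Import Defs.
From mathcomp Require Import all_boot all_order all_algebra.
From mathcomp Require Import all_classical all_reals all_analysis.
From mathcomp Require Import measurable_realfun lebesgue_integral_under.
From mathcomp Require Import ring lra.

Import Order.TTheory GRing.Theory Num.Theory.
Import numFieldNormedType.Exports.

Set Implicit Arguments.
Unset Strict Implicit.
Unset Printing Implicit Defensive.

Local Open Scope classical_set_scope.
Local Open Scope ring_scope.

(* Work with the Dirac operator [D = \sum_j c_j d_j] built from real skew
   Clifford matrices, [c_i c_j + c_j c_i = - 2 delta_ij].  For a fixed unit
   vector [s] put [U = \sum_i u_i c_i s], [Q = D U] and [P = Q - p s].
   Incompressibility makes [Q] orthogonal to [s], so that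
   [|P|^2 = |Q|^2 + p^2], and the Stokes system becomes [D P = \sum_i F_i c_i s]
   with [F_i = A . grad u_i]: the pressure is absorbed in a first-order system.
   The weights [phi_k = r^(- n - 2 k) |log r|^(- 2 k)] give the Carleman inequality
     [2 k \int phi_k (log r)^(-2) |w|^2 <= \int phi_k r^2 |D w|^2].
   Apply it with [k + 1] to [U] and with [k] to [P], and bound [grad u] by a
   Caccioppoli inequality: the losses add up to [|log r|^(-4)], so the term coming
   from [r^2 |F|^2 <= C0^2 |log r|^(-6) |grad u|^2] is absorbed near the centre.
   The inner cut-off error tends to 0 by vanishing of infinite order, and then
   [k -> oo] gives [u = p = 0] in a ball whose radius depends only on the bound
   for [A].  Away from the origin [A] is locally bounded, hence that radius is
   locally uniform, and connectedness of [Omega] concludes.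
   Only mollified fields are ever differentiated; the inequalities pass to the
   limit in weighted L2 spaces. *)

(** * Translation invariance *)

Section translation.
Context {R : realType}.
Local Notation mu n := (@lebesgue_rV R n).

(** The exponent 3 in the drift bound is the outcome of a count. The drift involves the whole
    gradient, whereas the Dirac operator controls only [Q], that is the divergence and the curl of
    [u]; the rest must come from the Caccioppoli inequality, which costs [k^2] because the weight is
    differentiated. The two Carleman inequalities gain a factor [k] each, at the price of
    [(log r)^(-2)] each: the powers of [k] cancel, the constants are uniform in [k], and the drift
    term has a spare [(log r)^(-2)], small near the centre for all [k] at once. The local argument
    sees the drift only through a bound of [|A|^2 r^2 (log r)^6] in a punctured ball. At the origin
    this is the hypothesis; at another centre it follows from local boundedness, since
    [r^2 (log r)^6] is bounded for [r <= 1]. The radius obtained does not depend on how small the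
    region is where the solution is already known to vanish, and this is what makes propagation
    possible. Infinite order is assumed for [u] and [p] only; the gradient inherits it from the
    Caccioppoli inequality with [k = 1]. *)

Lemma lebesgue_measure_shift (v : R) (A : set R) : measurable A ->
  lebesgue_measure ((fun x => x + v) @^-1` A) = lebesgue_measure A.
Proof.
move=> mA.
have ms : measurable_fun setT (fun x : measurableTypeR R => x + v : measurableTypeR R).
  exact: measurable_funD.
apply/esym.
apply: (lebesgue_measure_unique
  (mu := measure_function_pushforward__canonical__measure_function_Measure (@lebesgue_measure R) ms)) => //.
move=> _ [[a b]] _ <-; rewrite /= /pushforward.
rewrite (_ : _ @^-1` _ = `]a - v, b - v]%classic); last first.
  apply/seteqP; split => x /=; rewrite !in_itv/= => /andP[? ?]; apply/andP; split; lra.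
rewrite !lebesgue_measure_itv/= !lte_fin -!EFinB ltrBlDr subrK.
by case: ifP => // _; congr EFin; lra.
Qed.

Lemma measurable_rV_shift n (v : 'rV[R]_n) :
  measurable_fun setT (fun x : 'rV[R]_n => x + v).
Proof.
apply: measurable_fun_rVP => i; under eq_fun do rewrite mxE.
by apply: measurable_funD => //; exact: measurable_rV_coord.
Qed.

(** Through [rV_cons] a shift becomes the product [S] of a shift of the line and a shift of the
    remaining coordinates. The image of the product measure under [S] agrees with it on rectangles,
    and these determine it. *)
Lemma lebesgue_rV_shift n (v : 'rV[R]_n) (A : set 'rV[R]_n) : measurable A ->
  mu n ((fun x => x + v) @^-1` A) = mu n A.
Proof.
elim: n v A => [|n IH] v A mA.
  by congr (mu _ _); apply/seteqP; split => x /=; rewrite [v]thinmx0 addr0.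
pose a := v ord0 ord0; pose w : 'rV[R]_n := \row_i v ord0 (lift ord0 i).
rewrite /= /lebesgue_rV_step /pushforward.
pose S (z : measurableTypeR R * 'rV[R]_n) : measurableTypeR R * 'rV[R]_n :=
  (z.1 + a, z.2 + w).
have mS : measurable_fun setT S.
  apply: measurable_fun_pair => /=.
    by apply: measurable_funD => //; exact: measurable_fst.
  apply: (@measurableT_comp _ _ _ _ _ _ (fun x : 'rV[R]_n => x + w)).
    exact: measurable_rV_shift.
  exact: measurable_snd.
rewrite -comp_preimage (_ : _ \o _ = @rV_cons R n \o S); last first.
  apply/funext => -[b y] /=; apply/rowP => i.
  case: (unliftP ord0 i) => [j ->|->].
    by rewrite rV_consS/= [LHS]mxE rV_consS/= !mxE.
  by rewrite rV_cons0/= [LHS]mxE rV_cons0.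
rewrite comp_preimage.
have mB : measurable (@rV_cons R n @^-1` A).
  by rewrite -[X in measurable X]setTI; exact: measurable_rV_cons.
apply/esym.
apply: (@product_measure_unique _ _ _ _ _ _ _
  (measure_function_pushforward__canonical__measure_function_Measure (@lebesgue_measure R \x mu n)%E mS)) => // X Y mX mY.
rewrite /= /pushforward (_ : _ @^-1` _ =
   ((fun x => x + a) @^-1` X) `*` ((fun x => x + w) @^-1` Y)); last by [].
have mX' : measurable ((fun x : R => x + a) @^-1` X).
  rewrite -[X in measurable X]setTI.
  by have : measurable_fun setT (fun x : measurableTypeR R => x + a : measurableTypeR R); [exact: measurable_funD | apply].
have mY' : measurable ((fun x : 'rV[R]_n => x + w) @^-1` Y).
  by rewrite -[X in measurable X]setTI; exact: measurable_rV_shift.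
pose X' := (fun x : R => x + a) @^-1` X.
pose Y' := (fun x : 'rV[R]_n => x + w) @^-1` Y.
transitivity (@lebesgue_measure R X' * mu n Y')%E.
  exact: product_measure1E.
rewrite /X' /Y'.
by rewrite lebesgue_measure_shift // IH.
Qed.

Lemma ge0_integral_rV_shift n (v : 'rV[R]_n) (f : 'rV[R]_n -> \bar R) :
  measurable_fun setT f -> (forall x, 0 <= f x)%E ->
  (\int[mu n]_x f (x + v)%R = \int[mu n]_x f x)%E.
Proof.
move=> mf f0; pose s (x : 'rV[R]_n) := x + v.
rewrite -[LHS]/(\int[mu n]_(x in s @^-1` setT) (f \o s) x)%E.
rewrite -ge0_integral_pushforward //; last exact: measurable_rV_shift.
apply: eq_measure_integral; first exact: (measurable_rV_shift v).
by move=> ms A mA _; exact: lebesgue_rV_shift.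
Qed.

Lemma integral_rV_shift n (v : 'rV[R]_n) (f : 'rV[R]_n -> \bar R) :
  measurable_fun setT f ->
  (\int[mu n]_x f (x + v)%R = \int[mu n]_x f x)%E.
Proof.
move=> mf; rewrite integralE [RHS]integralE; congr (_ - _)%E.
  rewrite -[RHS](ge0_integral_rV_shift v) //.
    by apply: eq_integral => x _; rewrite !funeposE.
  exact: measurable_funepos.
rewrite -[RHS](ge0_integral_rV_shift v) //.
  by apply: eq_integral => x _; rewrite !funenegE.
exact: measurable_funeneg.
Qed.

Lemma Rintegral_rV_shift n (v : 'rV[R]_n) (f : 'rV[R]_n -> R) :
  measurable_fun setT f ->
  \int[mu n]_x f (x + v) = \int[mu n]_x f x.
Proof.
by move=> mf; rewrite /Rintegral (@integral_rV_shift _ v (EFin \o f)) //; exact/measurable_EFinP.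
Qed.

(** The sigma-algebra is generated by the coordinates and not by the topology. An open set is the
    union of the countably many cubes [B q], with rational centre and half-side the inverse of an
    integer, that it contains. *)
Lemma measurable_open_rV n (O : set 'rV[R]_n) : open O -> measurable O.
Proof.
move=> oO.
pose B (q : 'rV[rat]_n * nat) : set 'rV[R]_n :=
  [set x | forall i, `|ratr (q.1 ord0 i) - x ord0 i| < q.2.+1%:R^-1].
pose D := [set q | B q `<=` O].
have mB q : measurable (B q).
  rewrite (_ : B q = \bigcap_(i in [set: 'I_n])
      ((fun x : 'rV[R]_n => x ord0 i) @^-1` [set y | `|ratr (q.1 ord0 i) - y| < q.2.+1%:R^-1])); last first.
    by apply/seteqP; split => x /= H i //=; exact: H.
  apply: fin_bigcap_measurable => // i _.
  rewrite -[X in measurable X]setTI; apply: measurable_rV_coord => //.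
  rewrite (_ : mkset _ = ball (ratr (q.1 ord0 i) : R) (q.2.+1%:R^-1)) //.
  exact: measurable_ball.
rewrite (_ : O = \bigcup_(q in D) B q); last first.
  apply/seteqP; split => [x Ox|x [q Dq]]; last exact: Dq.
  have [e /= e0 He] : exists2 e : R, 0 < e & ball x e `<=` O.
    by have /nbhs_ballP := open_nbhs_nbhs (conj oO Ox).
  have [k hk] : exists k : nat, k.+1%:R^-1 < e / 2.
    exists (Num.truncn (e / 2)^-1); rewrite invf_plt ?posrE//; last by rewrite divr_gt0.
    exact: truncnS_gt.
  have k0 : 0 < k.+1%:R^-1 :> R by rewrite invr_gt0.
  have /choice[q Hq] (i : 'I_n) : exists q : rat, `|ratr q - x ord0 i| < k.+1%:R^-1.
    have [q] : exists q : rat, ratr q \in `](x ord0 i - k.+1%:R^-1), (x ord0 i + k.+1%:R^-1)[.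
      by apply: rat_in_itvoo; rewrite ltrD2l; apply: lt_trans k0; rewrite oppr_lt0.
    by rewrite in_itv/= => Hq; exists q; rewrite ltr_distl.
  exists (\row_i q i, k); last by move=> i /=; rewrite mxE.
  move=> y Hy; apply: He; split => // i j; rewrite (ord1 i).
  have /= := Hy j; rewrite mxE => h1; have h2 := Hq j.
  apply: le_lt_trans (ler_distD (ratr (q j)) _ _) _.
  by rewrite (splitr e) ltrD// ?(distrC (x _ _)) (lt_trans _ hk).
rewrite bigcup_mkcond; apply: countable_bigcupT_measurable.
  exact: countableP.
by move=> q; case: ifP => _ //; exact: measurable0.
Qed.

End translation.

(** * Directional derivatives of scalar and matrix fields *)

Section scalar_derivatives.
Context {R : realType} {n : nat}.
Implicit Types (x v : 'rV[R]_n) (f g : 'rV[R]_n -> R).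

Lemma is_derive_ext (x v : 'rV[R]_n) f g (d e : R) :
  is_derive x v f d -> f =1 g -> d = e -> is_derive x v g e.
Proof. by move=> + /funext <- <-. Qed.

(** The bridge to functions of one real variable: the one-dimensional chain rule and differentiation
    under the integral sign are used through it. *)
Lemma is_derive_line x v f (h d : R) :
  is_derive h 1 (fun k : R => f (k *: v + x)) d <-> is_derive (h *: v + x) v f d.
Proof.
have E : (fun k : R => k^-1 *: (((fun k : R => f (k *: v + x)) \o shift h) (k *: 1) - f (h *: v + x)))
  = (fun k => k^-1 *: ((f \o shift (h *: v + x)) (k *: v) - f (h *: v + x))).
  by apply/funext => k; rewrite /= scaler1 scalerDl addrA.
split=> -[df de]; split.
- by rewrite /derivable -E.
- by rewrite -de /derive -E.
- by rewrite /derivable E.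
- by rewrite -de /derive E.
Qed.

Lemma is_derive_comp x v f (phi : R -> R) (d e : R) :
  is_derive (f x) 1 phi e -> is_derive x v f d ->
  is_derive x v (fun y => phi (f y)) (e * d).
Proof.
move=> dphi df.
have df0 : is_derive (0 : R) 1 (fun k : R => f (k *: v + x)) d.
  by apply/is_derive_line; rewrite scale0r add0r.
have := (@is_derive_line x v (fun y => phi (f y)) 0 (e * d)).1.
rewrite scale0r add0r; apply.
have -> : (fun k : R => phi (f (k *: v + x))) = phi \o (fun k : R => f (k *: v + x)) by [].
by apply: is_derive1_comp; rewrite /= scale0r add0r.
Qed.

Lemma is_deriveMf x v f g (d e : R) :
  is_derive x v f d -> is_derive x v g e ->
  is_derive x v (fun y => f y * g y) (d * g x + f x * e).
Proof.
move=> df dg; have := is_deriveM df dg.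
by move=> H; apply: (is_derive_ext H) => //; rewrite /GRing.scale/=; ring.
Qed.

Lemma is_deriveDf x v f g (d e : R) :
  is_derive x v f d -> is_derive x v g e ->
  is_derive x v (fun y => f y + g y) (d + e).
Proof. by move=> df dg; exact: is_deriveD. Qed.

Lemma is_deriveNf x v f (d : R) :
  is_derive x v f d -> is_derive x v (fun y => - f y) (- d).
Proof. by move=> df; exact: is_deriveN. Qed.

Lemma is_derive_sumf (I : Type) (s : seq I) (P : pred I) x v (f : I -> 'rV[R]_n -> R) (d : I -> R) :
  (forall i, P i -> is_derive x v (f i) (d i)) ->
  is_derive x v (fun y => \sum_(i <- s | P i) f i y) (\sum_(i <- s | P i) d i).
Proof.
move=> df; elim: s => [|i s IH].
  rewrite big_nil; apply: (is_derive_ext (is_derive_cst 0 x v)) => // y.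
  by rewrite big_nil.
rewrite big_cons; case: ifPn => Pi.
  apply: (is_derive_ext (is_deriveDf (df i Pi) IH)) => // y.
  by rewrite big_cons Pi.
by apply: (is_derive_ext IH) => // y; rewrite big_cons (negbTE Pi).
Qed.

Lemma is_derive_coord x v (i : 'I_n) :
  is_derive x v (fun y => y ord0 i) (v ord0 i).
Proof.
have := (@is_derive_line x v (fun y => y ord0 i) 0 (v ord0 i)).1.
rewrite scale0r add0r; apply.
have E : (fun k : R => (k *: v + x) ord0 i) = (fun k => k * v ord0 i + x ord0 i).
  by apply/funext => k; rewrite !mxE.
rewrite E.
have H : is_derive (0 : R) 1 ((id : R -> R) * cst (v ord0 i) + cst (x ord0 i)) ((0 : R) *: 0 + v ord0 i *: 1 + 0).
  by apply: is_deriveD; apply: is_deriveM.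
by move: H; rewrite scaler0 add0r addr0 scaler1.
Qed.

End scalar_derivatives.

Section matrix_derivatives.
Context {R : realType} {n : nat}.

(** Entrywise, so that each rule reduces to the scalar one and no norm on matrices is involved. *)
Definition mderive (x v : 'rV[R]_n) p q (F : 'rV[R]_n -> 'M[R]_(p, q)) (D : 'M[R]_(p, q)) :=
  forall a b, is_derive x v (fun y => F y a b) (D a b).

Variables (x v : 'rV[R]_n).

Lemma mderive_ext p q (F G : 'rV[R]_n -> 'M[R]_(p, q)) D E :
  mderive x v F D -> F =1 G -> D = E -> mderive x v G E.
Proof. by move=> + /funext <- <-. Qed.

Lemma mderive_cst p q (C : 'M[R]_(p, q)) : mderive x v (fun=> C) 0.
Proof. by move=> a b; rewrite mxE; exact: is_derive_cst. Qed.

Lemma mderiveD p q (F G : 'rV[R]_n -> 'M[R]_(p, q)) D E :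
  mderive x v F D -> mderive x v G E -> mderive x v (fun y => F y + G y) (D + E).
Proof.
move=> dF dG a b; apply: (is_derive_ext (is_deriveDf (dF a b) (dG a b))); last by rewrite mxE.
by move=> y; rewrite mxE.
Qed.

Lemma mderiveN p q (F : 'rV[R]_n -> 'M[R]_(p, q)) D :
  mderive x v F D -> mderive x v (fun y => - F y) (- D).
Proof.
move=> dF a b; apply: (is_derive_ext (is_deriveNf (dF a b))); last by rewrite mxE.
by move=> y; rewrite mxE.
Qed.

Lemma mderiveB p q (F G : 'rV[R]_n -> 'M[R]_(p, q)) D E :
  mderive x v F D -> mderive x v G E -> mderive x v (fun y => F y - G y) (D - E).
Proof. by move=> dF dG; apply: mderiveD => //; exact: mderiveN. Qed.

Lemma mderive_sum (I : Type) (s : seq I) (P : pred I) p q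
    (F : I -> 'rV[R]_n -> 'M[R]_(p, q)) (D : I -> 'M[R]_(p, q)) :
  (forall i, P i -> mderive x v (F i) (D i)) ->
  mderive x v (fun y => \sum_(i <- s | P i) F i y) (\sum_(i <- s | P i) D i).
Proof.
move=> dF a b.
apply: (is_derive_ext (is_derive_sumf s (f := fun i y => F i y a b) (fun i Pi => dF i Pi a b))).
  by move=> y; rewrite summxE.
by rewrite summxE.
Qed.

Lemma mderive_mul p q r (F : 'rV[R]_n -> 'M[R]_(p, q)) (G : 'rV[R]_n -> 'M[R]_(q, r)) D E :
  mderive x v F D -> mderive x v G E ->
  mderive x v (fun y => F y *m G y) (D *m G x + F x *m E).
Proof.
move=> dF dG a b.
apply: (is_derive_ext (is_derive_sumf (index_enum 'I_q) (P := xpredT)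
  (f := fun i y => F y a i * G y i b) (fun i Pi => is_deriveMf (dF a i) (dG i b)))).
  by move=> y; rewrite mxE.
by rewrite 3!mxE big_split.
Qed.

Lemma mderive_mulc p q r (C : 'M[R]_(p, q)) (G : 'rV[R]_n -> 'M[R]_(q, r)) E :
  mderive x v G E -> mderive x v (fun y => C *m G y) (C *m E).
Proof.
move=> dG; apply: (mderive_ext (mderive_mul (mderive_cst C) dG)) => //.
by rewrite mul0mx add0r.
Qed.

Lemma mderiveZ p q (f : 'rV[R]_n -> R) (d : R) (F : 'rV[R]_n -> 'M[R]_(p, q)) D :
  is_derive x v f d -> mderive x v F D ->
  mderive x v (fun y => f y *: F y) (d *: F x + f x *: D).
Proof.
move=> df dF a b.
by apply: (is_derive_ext (is_deriveMf df (dF a b))) => [y|]; rewrite !mxE.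
Qed.

Lemma mderiveZr p q (f : 'rV[R]_n -> R) (d : R) (C : 'M[R]_(p, q)) :
  is_derive x v f d -> mderive x v (fun y => f y *: C) (d *: C).
Proof.
move=> df; apply: (mderive_ext (mderiveZ df (mderive_cst C))) => //.
by rewrite scaler0 addr0.
Qed.

Lemma mderive_tr p q (F : 'rV[R]_n -> 'M[R]_(p, q)) D :
  mderive x v F D -> mderive x v (fun y => (F y)^T) D^T.
Proof.
by move=> dF a b; apply: (is_derive_ext (dF b a)) => [y|]; rewrite mxE.
Qed.

End matrix_derivatives.

(** * Inner product of column vectors *)

Section dot.
Context {R : realType} {N : nat}.
Implicit Types (u w : 'cV[R]_N).

Definition dot u w : R := (u^T *m w) ord0 ord0.

Lemma dotE u w : dot u w = \sum_a u a ord0 * w a ord0.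
Proof. by rewrite /dot mxE; apply: eq_bigr => a _; rewrite mxE. Qed.

Lemma dotC u w : dot u w = dot w u.
Proof. by rewrite !dotE; apply: eq_bigr => a _; rewrite mulrC. Qed.

Lemma dotDl u1 u2 w : dot (u1 + u2) w = dot u1 w + dot u2 w.
Proof. by rewrite /dot linearD mulmxDl mxE. Qed.

Lemma dotDr u w1 w2 : dot u (w1 + w2) = dot u w1 + dot u w2.
Proof. by rewrite /dot mulmxDr mxE. Qed.

Lemma dotZl c u w : dot (c *: u) w = c * dot u w.
Proof. by rewrite /dot linearZ /= -scalemxAl mxE. Qed.

Lemma dotZr c u w : dot u (c *: w) = c * dot u w.
Proof. by rewrite dotC dotZl dotC. Qed.

Lemma dotNl u w : dot (- u) w = - dot u w.
Proof. by rewrite -scaleN1r dotZl mulN1r. Qed.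

Lemma dotNr u w : dot u (- w) = - dot u w.
Proof. by rewrite dotC dotNl dotC. Qed.

Lemma dotBl u1 u2 w : dot (u1 - u2) w = dot u1 w - dot u2 w.
Proof. by rewrite dotDl dotNl. Qed.

Lemma dotBr u w1 w2 : dot u (w1 - w2) = dot u w1 - dot u w2.
Proof. by rewrite dotDr dotNr. Qed.

Lemma dot0l w : dot 0 w = 0.
Proof. by rewrite -(scale0r (0 : 'cV[R]_N)) dotZl mul0r. Qed.

Lemma dot_suml (I : Type) (s : seq I) (P : pred I) (F : I -> 'cV[R]_N) w :
  dot (\sum_(i <- s | P i) F i) w = \sum_(i <- s | P i) dot (F i) w.
Proof.
elim/big_rec2: _ => [|i a b _ <-]; first by rewrite dot0l.
by rewrite dotDl.
Qed.

Lemma dot_sumr (I : Type) (s : seq I) (P : pred I) (F : I -> 'cV[R]_N) w :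
  dot w (\sum_(i <- s | P i) F i) = \sum_(i <- s | P i) dot w (F i).
Proof. by rewrite dotC dot_suml; apply: eq_bigr => i _; rewrite dotC. Qed.

Lemma dot_mulmxl (B : 'M[R]_N) u w : dot (B *m u) w = dot u (B^T *m w).
Proof. by rewrite /dot trmx_mul mulmxA. Qed.

Lemma dot_mulmxr (B : 'M[R]_N) u w : dot u (B *m w) = dot (B^T *m u) w.
Proof. by rewrite dot_mulmxl trmxK. Qed.

Lemma dot_ge0 u : 0 <= dot u u.
Proof. by rewrite dotE; apply: sumr_ge0 => a _; rewrite -expr2 sqr_ge0. Qed.

Lemma dot_le4 u w : 4 * dot u w <= dot (u + w) (u + w).
Proof.
have := dot_ge0 (u - w).
rewrite !(dotDl, dotDr, dotBl, dotBr, dotNl, dotNr) (dotC w u); lra.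
Qed.

Lemma dotD_le2 u w : dot (u + w) (u + w) <= 2 * dot u u + 2 * dot w w.
Proof.
have := dot_ge0 (u - w).
rewrite !(dotDl, dotDr, dotBl, dotBr, dotNl, dotNr) (dotC w u); lra.
Qed.

Lemma is_derive_dot n (x v : 'rV[R]_n) (F G : 'rV[R]_n -> 'cV[R]_N) D E :
  mderive x v F D -> mderive x v G E ->
  is_derive x v (fun y => dot (F y) (G y)) (dot D (G x) + dot (F x) E).
Proof.
move=> dF dG; have := mderive_mul (mderive_tr dF) dG => /(_ ord0 ord0).
by move=> H; apply: (is_derive_ext H) => //; rewrite mxE.
Qed.

End dot.

(** * Clifford matrices and the Carleman identity for the Dirac operator *)

Section clifford_algebra.
Context {R : realType} {n N : nat}.

Definition clifford (c : 'I_n -> 'M[R]_N) :=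
  (forall i, (c i)^T = - c i) /\
  (forall i j, c i *m c j + c j *m c i = (- (2 * (i == j)%:R))%:M).

Lemma sum_antisym (V : lmodType R) (F : 'I_n -> 'I_n -> V) :
  (forall i j, F i j = - F j i) -> \sum_i \sum_j F i j = 0.
Proof.
move=> FN; have H : \sum_i \sum_j F i j = - \sum_i \sum_j F i j.
  rewrite [LHS]exchange_big -sumrN; apply: eq_bigr => j _.
  by rewrite -sumrN; apply: eq_bigr => i _; exact: FN.
have : (2 : R) *: (\sum_i \sum_j F i j) = 0.
  by rewrite scaler_nat mulr2n {1}H addNr.
by move/eqP; rewrite scaler_eq0 pnatr_eq0 => /eqP.
Qed.

Variable c : 'I_n -> 'M[R]_N.
Hypothesis hc : clifford c.

(* The antisymmetric part of [c i *m c j]. *)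
Definition bivec i j : 'M[R]_N := c i *m c j + ((i == j)%:R)%:M.

Lemma bivecN i j : bivec i j = - bivec j i.
Proof.
have [_ /(_ i j) h] := hc; rewrite /bivec (eq_sym j i).
apply/eqP; rewrite -subr_eq0 opprK addrACA h -!raddfD /=.
by rewrite (_ : _ + _ = 0) ?raddf0//; ring.
Qed.

Lemma bivec_tr i j : (bivec i j)^T = - bivec i j.
Proof.
rewrite -bivecN /bivec linearD /= trmx_mul !(hc.1 _) mulNmx mulmxN opprK.
by rewrite tr_scalar_mx eq_sym.
Qed.

Lemma bivecii i : bivec i i = 0.
Proof.
have H := bivecN i i.
have : (2 : R) *: bivec i i = 0 by rewrite scaler_nat mulr2n {1}H addNr.
by move/eqP; rewrite scaler_eq0 pnatr_eq0 => /eqP.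
Qed.

Lemma cliffM i j : c i *m c j = bivec i j - ((i == j)%:R)%:M.
Proof. by rewrite /bivec addrK. Qed.

Definition cliffv (z : 'I_n -> R) : 'M[R]_N := \sum_i z i *: c i.

Lemma cliffv_tr z : (cliffv z)^T = - cliffv z.
Proof.
rewrite /cliffv linear_sum -sumrN; apply: eq_bigr => i _.
by rewrite linearZ /= (hc.1 i) scalerN.
Qed.

Lemma cliffv_sqr z : cliffv z *m cliffv z = (- \sum_i z i ^+ 2)%:M.
Proof.
rewrite /cliffv mulmx_suml.
transitivity (\sum_i \sum_j (z i * z j) *: bivec i j - \sum_i \sum_j ((z i * z j) *: ((i == j)%:R)%:M : 'M[R]_N)).
  rewrite -sumrB; apply: eq_bigr => i _; rewrite mulmx_sumr -sumrB.
  apply: eq_bigr => j _.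
  by rewrite -scalemxAl -scalemxAr scalerA cliffM scalerBr.
rewrite sum_antisym ?sub0r; last first.
  by move=> i j; rewrite (bivecN i j) scalerN mulrC.
rewrite -scaleN1r.
transitivity (-1 *: (\sum_i (z i ^+ 2)%:M : 'M[R]_N)).
  congr (_ *: _); apply: eq_bigr => i _.
  rewrite (bigD1 i) //= eqxx -[RHS]addr0; congr (_ + _).
    by rewrite scale_scalar_mx mulr1 expr2.
  by rewrite big1 // => j ji; rewrite eq_sym (negbTE ji) raddf0 scaler0.
rewrite scaleN1r -[RHS]scalemx1 scaleNr scaler_suml; congr (- _).
by apply: eq_bigr => i _; rewrite scalemx1.
Qed.

Lemma dot_cliffv z u : dot (cliffv z *m u) (cliffv z *m u) = (\sum_i z i ^+ 2) * dot u u.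
Proof.
rewrite dot_mulmxl cliffv_tr mulNmx dotNr mulmxA cliffv_sqr.
by rewrite mul_scalar_mx dotZr mulNr opprK.
Qed.

Section pointwise.
Variables (z : 'I_n -> R) (w : 'cV[R]_N) (w1 : 'I_n -> 'cV[R]_N)
  (w2 : 'I_n -> 'I_n -> 'cV[R]_N).
Hypothesis w2C : forall i j, w2 i j = w2 j i.

Let s := \sum_i z i ^+ 2.

Definition cN j := \sum_k z k *: bivec k j.
(** An antisymmetric field whose double sum against [w1] is [- 2 euler . Gam] ([sum_w1T]): it
    exhibits the cross term of the Carleman computation as a divergence up to lower order. [cT'] is
    its derivative in the direction [j]. *)
Definition cT i j := z i *: cN j - z j *: cN i.
Definition cT' i j := ((i == j)%:R *: cN j + z i *: bivec j j) - (cN i + z j *: bivec j i).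
Definition euler := \sum_i z i *: w1 i.
(** As [bivec] is antisymmetric, this is the sum over [k < i] of [bivec k i] applied to
    [z_k d_i w - z_i d_k w]. Only angular derivatives occur: it is the spherical Dirac operator,
    while [euler] is the radial derivative [r d_r w]. *)
Definition Gam := \sum_i cN i *m w1 i.
Definition diracop := \sum_i c i *m w1 i.

Lemma cN_tr j : (cN j)^T = - cN j.
Proof.
rewrite /cN linear_sum -sumrN; apply: eq_bigr => i _.
by rewrite linearZ /= bivec_tr scalerN.
Qed.

Lemma cTN i j : cT i j = - cT j i.
Proof. by rewrite /cT opprB. Qed.

Lemma sum_cN0 : \sum_j z j *: cN j = 0.
Proof.
rewrite -[RHS](@sum_antisym _ (fun j k => (z j * z k) *: bivec k j)).
  by apply: eq_bigr => j _; rewrite scaler_sumr; apply: eq_bigr => k _; rewrite scalerA.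
by move=> j k; rewrite bivecN scalerN mulrC.
Qed.

(** Polar decomposition of the Dirac operator: in the products [c i *m c j] the scalar part produces
    the radial derivative and the bivector part the angular operator. *)
Lemma cliffv_diracop : - (cliffv z *m diracop) = euler - Gam.
Proof.
suff -> : cliffv z *m diracop = Gam - euler by rewrite opprB.
rewrite /diracop /cliffv mulmx_suml.
have -> : Gam = \sum_i \sum_j (z i *: bivec i j) *m w1 j.
  rewrite exchange_big; apply: eq_bigr => j _.
  by rewrite /cN mulmx_suml.
have E : (fun i => (z i *: c i) *m \sum_j c j *m w1 j) =1
    (fun i => \sum_j (z i *: bivec i j) *m w1 j - z i *: w1 i).
  move=> i; rewrite mulmx_sumr.
  rewrite (eq_bigr (fun j => (z i *: bivec i j) *m w1 j - z i *: ((i == j)%:R *: w1 j))); last first.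
    move=> j _; rewrite mulmxA -scalemxAl cliffM -!scalemxAl -scalerBr.
    by rewrite mulmxBl mul_scalar_mx.
  rewrite sumrB; congr (_ - _); rewrite (bigD1 i) //= eqxx scale1r big1 ?addr0//.
  by move=> j ji; rewrite eq_sym (negbTE ji) scale0r scaler0.
by rewrite (eq_bigr _ (fun i _ => E i)) sumrB.
Qed.

Lemma sum_zT : \sum_j \sum_i z j * dot w (cT i j *m w1 i) = - (s * dot w Gam).
Proof.
transitivity (\sum_i dot w ((\sum_j z j *: cT i j) *m w1 i)).
  rewrite exchange_big; apply: eq_bigr => i _.
  rewrite mulmx_suml dot_sumr; apply: eq_bigr => j _.
  by rewrite -scalemxAl dotZr.
rewrite /Gam dot_sumr mulr_sumr -sumrN; apply: eq_bigr => i _.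
have -> : \sum_j z j *: cT i j = - s *: cN i.
  rewrite /cT; under eq_bigr do rewrite scalerBr scalerA mulrC -scalerA.
  rewrite sumrB -scaler_sumr sum_cN0 scaler0 sub0r scaleNr; congr (- _).
  by rewrite /s scaler_suml; apply: eq_bigr => j _; rewrite scalerA expr2.
by rewrite -scalemxAl dotZr mulNr.
Qed.

Lemma sum_w1T : \sum_j \sum_i dot (w1 j) (cT i j *m w1 i) = - (2 * dot euler Gam).
Proof.
have E1 : \sum_j \sum_i dot (w1 j) (z i *: cN j *m w1 i) = - dot euler Gam.
  rewrite /Gam dot_sumr -sumrN; apply: eq_bigr => j _.
  rewrite dot_mulmxr cN_tr mulNmx dotNl opprK.
  transitivity (dot (w1 j) (cN j *m euler)).
    rewrite /euler mulmx_sumr dot_sumr; apply: eq_bigr => i _.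
    by rewrite -scalemxAl -scalemxAr.
  by rewrite dotC.
have E2 : \sum_j \sum_i dot (w1 j) (z j *: cN i *m w1 i) = dot euler Gam.
  rewrite /euler dot_suml; apply: eq_bigr => j _.
  rewrite dotZl dot_sumr mulr_sumr; apply: eq_bigr => i _.
  by rewrite -scalemxAl dotZr.
rewrite (eq_bigr (fun j => \sum_i dot (w1 j) (z i *: cN j *m w1 i) - \sum_i dot (w1 j) (z j *: cN i *m w1 i))).
  by rewrite sumrB E1 E2; ring.
by move=> j _; rewrite -sumrB; apply: eq_bigr => i _; rewrite /cT mulmxBl dotBr.
Qed.

Lemma sum_wT' : \sum_j \sum_i dot w (cT' i j *m w1 i) = - (n%:R * dot w Gam).
Proof.
rewrite exchange_big /Gam dot_sumr mulr_sumr -sumrN; apply: eq_bigr => i _.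
rewrite -dot_sumr -mulmx_suml.
have -> : \sum_j cT' i j = - n%:R *: cN i.
  rewrite /cT' sumrB (eq_bigr (fun j => (i == j)%:R *: cN j)); last first.
    by move=> j _; rewrite bivecii scaler0 addr0.
  rewrite (bigD1 i) //= eqxx scale1r big1 ?addr0; last first.
    by move=> j ji; rewrite eq_sym (negbTE ji) scale0r.
  rewrite big_split /= sumr_const card_ord -/(cN i).
  by rewrite opprD addrCA -/(cN i) subrr addr0 scaleNr scaler_nat.
by rewrite -scalemxAl dotZr mulNr.
Qed.

Lemma sum_wTw2 : \sum_j \sum_i dot w (cT i j *m w2 i j) = 0.
Proof.
apply: (@sum_antisym R^o) => i j; rewrite cTN w2C mulNmx dotNr.
by [].
Qed.

Variables (phi f1 q q1 : R).
Hypothesis hf1 : s * f1 = - ((n%:R + 2 * q) * phi).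

(** The flux is [phi * carlK / 2]; [carlK'] and [carlG'] are the formal derivatives of [carlK] and
    of the flux when [d_j phi = f1 z_j] and [d_j q = q1 z_j]. Condition [hf1] reads
    [r phi' = - (n + 2 q) phi]; thanks to it the divergence of [phi q |w|^2 z / 2] is
    [phi q w . (euler - q w)] plus the term in [q1]. *)
Definition carlK j := z j * q * dot w w + \sum_i dot w (cT i j *m w1 i).
Definition carlK' j := (q + z j * (q1 * z j)) * dot w w
   + z j * q * (dot (w1 j) w + dot w (w1 j))
   + \sum_i (dot (w1 j) (cT i j *m w1 i) + dot w (cT' i j *m w1 i + cT i j *m w2 i j)).
Definition carlG' j := 2^-1 * ((f1 * z j) * carlK j + phi * carlK' j).

(* [- (cliffv z *m diracop) = euler - Gam], and [4 a.b <= |a + b|^2] is applied to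
   [a = euler - q w], [b = q w - Gam]; since [cT] is antisymmetric, the second
   derivatives cancel in the divergence of the flux. *)
Lemma carleman_div : \sum_j carlG' j =
  phi * dot (euler - q *: w) (q *: w - Gam) + 2^-1 * (s * q1) * phi * dot w w.
Proof.
have HK : \sum_j z j * carlK j = s * (q * dot w w) - s * dot w Gam.
  rewrite /carlK; under eq_bigr do rewrite mulrDr.
  rewrite big_split /=; congr (_ + _).
    by rewrite /s mulr_suml; apply: eq_bigr => j _; ring.
  by rewrite -sum_zT; apply: eq_bigr => j _; rewrite mulr_sumr.
have HK' : \sum_j carlK' j = (n%:R * q + s * q1) * dot w w + 2 * q * dot euler w
    - 2 * dot euler Gam - n%:R * dot w Gam.
  rewrite /carlK' !big_split /=.
  have -> : \sum_i (q + z i * (q1 * z i)) * dot w w = (n%:R * q + s * q1) * dot w w.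
    rewrite -mulr_suml big_split /= sumr_const card_ord; congr (_ * _).
    rewrite -[q *+ n]mulr_natl; congr (_ + _).
    by rewrite /s mulr_suml; apply: eq_bigr => j _; ring.
  have -> : \sum_j z j * q * (dot (w1 j) w + dot w (w1 j)) = 2 * q * dot euler w.
    rewrite /euler dot_suml mulr_sumr; apply: eq_bigr => j _.
    by rewrite dotZl (dotC w (w1 j)); ring.
  have -> : \sum_j \sum_i (dot (w1 j) (cT i j *m w1 i) + dot w (cT' i j *m w1 i + cT i j *m w2 i j))
     = - (2 * dot euler Gam) - n%:R * dot w Gam.
    rewrite (eq_bigr (fun j => \sum_i dot (w1 j) (cT i j *m w1 i) +
        (\sum_i dot w (cT' i j *m w1 i) + \sum_i dot w (cT i j *m w2 i j)))); last first.
      by move=> j _; rewrite -!big_split; apply: eq_bigr => i _; rewrite /= dotDr.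
    by rewrite !big_split /= sum_w1T sum_wT' sum_wTw2 addr0.
  by ring.
rewrite /carlG' -mulr_sumr big_split /= -!mulr_sumr HK'.
have -> : \sum_i f1 * z i * carlK i = (s * f1) * (q * dot w w - dot w Gam).
  rewrite (eq_bigr (fun i => f1 * (z i * carlK i))); last by move=> i _; ring.
  by rewrite -mulr_sumr HK; ring.
rewrite hf1 !(dotBl, dotBr, dotZl, dotZr).
by field.
Qed.

Lemma carleman_pointwise : 0 <= phi ->
  4 * \sum_j carlG' j - 2 * (s * q1) * phi * dot w w <= phi * (s * dot diracop diracop).
Proof.
move=> phi0; rewrite carleman_div.
have := dot_le4 (euler - q *: w) (q *: w - Gam).
rewrite addrA subrK -cliffv_diracop dotNl dotNr opprK dot_cliffv -/s => H.
have := ler_wpM2l phi0 H; lra.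
Qed.

End pointwise.
End clifford_algebra.

(** Induction on [n], doubling the size: the old generators are placed in the off-diagonal blocks
    and the new one is a rotation by a right angle. The size is positive so that a unit vector [s]
    exists. *)
Lemma clifford_exists (R : realType) (n : nat) :
  exists N : nat, exists c : 'I_n -> 'M[R]_N.+1, clifford c.
Proof.
suff [N [N0 [c hc]]] : exists N : nat, (0 < N)%N /\ exists c : 'I_n -> 'M[R]_N, clifford c.
  by case: N N0 c hc => // N _ c hc; exists N, c.
elim: n => [|n [N [N0 [c [ct cM]]]]].
  by exists 1%N; split=> //; exists (fun=> 0); split => [[]//|[]//].
exists (N + N)%N; split; first by rewrite addn_gt0 N0.
pose d (i : 'I_n.+1) : 'M[R]_(N + N) :=
  if unlift ord0 i is Some j then block_mx 0 (c j) (c j) 0 else block_mx 0 (-1%:M) 1%:M 0.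
exists d; split => [i|i j].
  rewrite /d; case: (unliftP ord0 i) => [k _|_]; rewrite tr_block_mx opp_block_mx.
    by rewrite !trmx0 ct oppr0.
  by rewrite !trmx0 linearN /= !trmx1 opprK oppr0.
rewrite /d; case: (unliftP ord0 i) => [k ->|->]; case: (unliftP ord0 j) => [l ->|->];
  rewrite !mulmx_block add_block_mx !(mul0mx, mulmx0, add0r, addr0, mulmx1, mul1mx, mulmxN, mulNmx).
- by rewrite !cM (inj_eq lift_inj) -scalar_mx_block.
- by rewrite subrr addNr mulr0 oppr0 raddf0 block_mx0.
- by rewrite subrr addNr mulr0 oppr0 raddf0 block_mx0.
- rewrite scalar_mx_block; congr block_mx; apply/matrixP => a b;
    rewrite !mxE eqxx; case: (a == b) => /=; ring.
Qed.

(** * Bounded measurable fields and integration by parts *)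

Section bounded_measurable.
Context {R : realType} {n : nat}.
Local Notation mu := (@lebesgue_rV R n).
Implicit Types f g : 'rV[R]_n -> R.

(** Mollified fields, truncated coordinates and radial weights all belong to this class. It is
    closed under products, and together with bounded support it gives integrability without any
    estimate. *)
Definition bmeas f := measurable_fun [set: 'rV[R]_n] f /\ exists M : R, forall x, `|f x| <= M.

Definition box (r : R) : set 'rV[R]_n := [set x | forall i, `|x ord0 i| <= r].

Definition bsupp f := exists r : R, forall x, ~ box r x -> f x = 0.

Lemma bmeas_cst (c : R) : bmeas (fun=> c).
Proof. by split; [exact: measurable_cst|exists `|c|]. Qed.

Lemma bmeasD f g : bmeas f -> bmeas g -> bmeas (fun x => f x + g x).
Proof.
move=> [mf [M hM]] [mg [L hL]]; split; first exact: measurable_funD.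
by exists (M + L) => x; rewrite (le_trans (ler_normD _ _))// lerD.
Qed.

Lemma bmeasN f : bmeas f -> bmeas (fun x => - f x).
Proof.
move=> [mf [M hM]]; split; first exact: measurable_funN.
by exists M => x; rewrite normrN.
Qed.

Lemma bmeasB f g : bmeas f -> bmeas g -> bmeas (fun x => f x - g x).
Proof. by move=> bf bg; apply: bmeasD => //; exact: bmeasN. Qed.

Lemma bmeasM f g : bmeas f -> bmeas g -> bmeas (fun x => f x * g x).
Proof.
move=> [mf [M hM]] [mg [L hL]]; split; first exact: measurable_funM.
by exists (M * L) => x; rewrite normrM ler_pM.
Qed.

Lemma bmeasX f k : bmeas f -> bmeas (fun x => f x ^+ k).
Proof.
move=> bf; elim: k => [|k IH].
  by under eq_fun do rewrite expr0; exact: bmeas_cst.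
by under eq_fun do rewrite exprS; exact: bmeasM.
Qed.

Lemma bmeas_sum (I : Type) (s : seq I) (P : pred I) (F : I -> 'rV[R]_n -> R) :
  (forall i, P i -> bmeas (F i)) -> bmeas (fun x => \sum_(i <- s | P i) F i x).
Proof.
move=> bF; elim: s => [|i s IH].
  by under eq_fun do rewrite big_nil; exact: bmeas_cst.
case: (boolP (P i)) => Pi.
  under eq_fun do rewrite big_cons Pi.
  by apply: bmeasD => //; exact: bF.
by under eq_fun do rewrite big_cons (negbTE Pi).
Qed.

Lemma bmeas_eq f g : f =1 g -> bmeas f -> bmeas g.
Proof. by move=> /funext ->. Qed.

Lemma bsuppMl f g : bsupp f -> bsupp (fun x => f x * g x).
Proof. by move=> [r hr]; exists r => x /hr ->; rewrite mul0r. Qed.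

Lemma bsuppMr f g : bsupp g -> bsupp (fun x => f x * g x).
Proof. by move=> [r hr]; exists r => x /hr ->; rewrite mulr0. Qed.

Lemma sub_box r r' : r <= r' -> box r `<=` box r'.
Proof. by move=> rr' x bx i; exact: le_trans rr'. Qed.

Lemma bsuppD f g : bsupp f -> bsupp g -> bsupp (fun x => f x + g x).
Proof.
move=> [r hr] [q hq]; exists (Num.max r q) => x nb.
rewrite hr ?hq ?addr0//; apply: contra_not nb; apply: sub_box;
  by rewrite le_max lexx ?orbT.
Qed.

Lemma measurable_box r : measurable (box r).
Proof.
rewrite (_ : box r = \bigcap_(i in [set: 'I_n])
      ((fun x : 'rV[R]_n => x ord0 i) @^-1` `[-r, r]%classic)); last first.
  apply/seteqP; split => x /= H i; first by move=> _; rewrite /= in_itv/= -ler_norml.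
  by have := H i I; rewrite /= in_itv/= -ler_norml.
apply: fin_bigcap_measurable => // i _.
by rewrite -[X in measurable X]setTI; exact: measurable_rV_coord.
Qed.

Lemma lebesgue_rV_box_lty r : (mu (box r) < +oo)%E.
Proof.
rewrite (_ : box r = [set x : 'rV[R]_n | forall i, `[-r, r]%classic (x ord0 i)]); last first.
  by apply/seteqP; split => x /= H i; have := H i; rewrite /= in_itv/= -ler_norml.
rewrite (lebesgue_rV_box (A := fun=> `[-r, r]%classic)) //.
suff /andP[] : (0 <= \prod_(i < n) @lebesgue_measure R `[(- r)%R, r] < +oo)%E by [].
elim/big_ind: _ => [|x y /andP[x0 xy] /andP[y0 yy]|i _].
- by rewrite lee_fin ler01 ltry.
- by rewrite mule_ge0//= lte_mul_pinfty// ge0_fin_numE.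
- rewrite measure_ge0 /= lebesgue_measure_itv/=; case: ifP => _; rewrite ?ltry//.
Qed.

Lemma integrable_bs f : bmeas f -> bsupp f -> mu.-integrable setT (EFin \o f).
Proof.
move=> [mf [M hM]] [r hr].
have -> : EFin \o f = (EFin \o f) \_ (box r).
  apply/funext => x; rewrite /patch; case: ifPn => //= /negP.
  by rewrite inE => /hr ->.
apply: (integrable_mkcond _ (measurable_box r)).1.
apply: measurable_bounded_integrable.
- exact: measurable_box.
- exact: lebesgue_rV_box_lty.
- exact: measurable_funTS.
- exists M; split; first exact: num_real.
  by move=> x Mx y _ /=; rewrite (le_trans (hM y))// ltW.
Qed.

Lemma bmeas_shift f (v : 'rV[R]_n) : bmeas f -> bmeas (fun x => f (x + v)).
Proof.
move=> [mf [M hM]]; split; last by exists M => x.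
by apply: (measurableT_comp mf); exact: measurable_rV_shift.
Qed.

Lemma bsupp_shift f (v : 'rV[R]_n) : bsupp f -> bsupp (fun x => f (x + v)).
Proof.
move=> [r hr]; exists (r + `|v|) => x nb; apply: hr; apply: contra_not nb => nb i.
have -> : x ord0 i = (x + v) ord0 i - v ord0 i by rewrite mxE addrK.
rewrite (le_trans (ler_normB _ _))// lerD//.
rewrite [in leRHS]/Num.Def.normr/= mx_normrE.
exact: (le_bigmax _ (fun i : 'I_1 * 'I_n => `|v i.1 i.2|) (ord0, i)).
Qed.

End bounded_measurable.

(** * Differentiation under the integral sign *)

Section differentiation.
Context {R : realType} {n : nat}.
Local Notation mu := (@lebesgue_rV R n).

Lemma diff_under (f f' : R -> 'rV[R]_n -> R) (G : 'rV[R]_n -> R) :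
  (forall h : R, mu.-integrable setT (EFin \o f h)) ->
  (forall h y, is_derive h (1 : R) (f ^~ y) (f' h y)) ->
  mu.-integrable setT (EFin \o G) ->
  (forall h y, h \in `]-1, 1[ -> `|f' h y| <= G y) ->
  is_derive (0 : R) 1 (fun h => \int[mu]_y f h y) (\int[mu]_y f' 0 y).
Proof.
move=> intf df intG bG.
have I0 : `]-1, 1[%classic (0 : R) by rewrite /= in_itv/= ltrN10 ltr01.
have intf' : forall x : R, `]-1, 1[%classic x -> mu.-integrable setT (EFin \o f x) by [].
have df1 : forall (x : R) y, `]-1, 1[%classic x -> setT y -> derivable (f ^~ y) x 1.
  by move=> x y _ _; have [] := df x y.
have d1E x y : partial1of2 f x y = f' x y.
  by rewrite partial1of2E; have [] := df x y.
have G0 y : 0 <= G y.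
  by apply: le_trans (bG 0 y _) => //; rewrite in_itv/= ltrN10 ltr01.
have bG' : forall (x : R) y, `]-1, 1[%classic x -> setT y -> `|partial1of2 f x y| <= G y.
  by move=> x y Hx _; rewrite d1E; exact: bG.
split.
  exact: (@derivable_under_integral _ _ _ mu f setT measurableT 0 (-1) 1 I0 intf' df1 G G0 intG bG').
have := @differentiation_under_integral _ _ _ mu f setT measurableT 0 (-1) 1 I0 intf' df1 G G0 intG bG'.
rewrite derive1E => ->; apply: eq_Rintegral => y _; exact: d1E.
Qed.

(** By translation invariance the integral of [G (x + h v)] does not depend on [h]; differentiate it
    at [h = 0]. For [|h| < 1] the supports remain in one box, of size [r + |v|], which provides the
    dominating function. *)
Lemma integral_partial0 (v : 'rV[R]_n) (G G' : 'rV[R]_n -> R) :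
  bmeas G -> bsupp G -> (forall x, is_derive x v G (G' x)) ->
  (exists M : R, forall x, `|G' x| <= M) -> bsupp G' ->
  \int[mu]_x G' x = 0.
Proof.
move=> bG sG dG [M hM] [r hr].
pose f (h : R) x := G (x + h *: v).
pose f' (h : R) x := G' (x + h *: v).
pose B := r + `|v|.
have M0 : 0 <= M by exact: le_trans (hM 0).
have mB := @measurable_box R n B.
have intG : mu.-integrable setT (EFin \o (fun x => M * \1_(box B) x)).
  apply: integrable_bs.
    apply: bmeasM; first exact: bmeas_cst.
    split; first exact: measurable_indic.
    by exists 1 => x; rewrite indicE; case: (_ \in _); rewrite ?normr1 ?normr0.
  exists B => x nb; rewrite indicE memNset ?mulr0//.
have df : forall h y, is_derive h (1 : R) (f ^~ y) (f' h y).
  move=> h y; have := (@is_derive_line R n y v G h (G' (h *: v + y))).2 (dG _).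
  by rewrite (_ : (fun k => _) = f ^~ y) /f' ?(addrC y)//; apply/funext => k; rewrite /f addrC.
have vn i : `|v ord0 i| <= `|v|.
  rewrite [in leRHS]/Num.Def.normr/= mx_normrE.
  exact: (le_bigmax _ (fun i : 'I_1 * 'I_n => `|v i.1 i.2|) (ord0, i)).
have bd : forall h y, h \in `]-1, 1[ -> `|f' h y| <= M * \1_(box B) y.
  move=> h y; rewrite in_itv/= => h1; rewrite /f'.
  rewrite indicE; have [|ny] := boolP (y \in box B).
    by rewrite mulr1.
  rewrite mulr0 hr ?normr0// => by_; move/negP: ny; apply; rewrite inE => i.
  have -> : y ord0 i = (y + h *: v) ord0 i - h * v ord0 i by rewrite !mxE addrK.
  rewrite (le_trans (ler_normB _ _))// lerD// normrM.
  rewrite -[leRHS]mul1r ler_pM//; rewrite ler_norml; lra.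
have intf h : mu.-integrable setT (EFin \o f h).
  by apply: integrable_bs; [exact: bmeas_shift|exact: bsupp_shift].
have [_] := diff_under intf df intG bd.
have -> : (fun h : R => \int[mu]_y f h y) = cst (\int[mu]_y G y).
  by apply/funext => h; rewrite /f Rintegral_rV_shift//; case: bG.
rewrite derive_cst => H; rewrite [RHS]H; apply: eq_Rintegral => y _.
by rewrite /f' scale0r addr0.
Qed.

(** All derivatives fall on the kernel, so integrability of [f] is enough. The sign comes from the
    argument [y - x]. *)
Lemma conv_derive (v x : 'rV[R]_n) (f k k' : 'rV[R]_n -> R) :
  mu.-integrable setT (EFin \o f) -> bmeas k ->
  (forall z, is_derive z v k (k' z)) -> bmeas k' ->
  is_derive x v (fun x => \int[mu]_y (f y * k (y - x))) (- \int[mu]_y (f y * k' (y - x))).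
Proof.
move=> intf bk dk bk'.
have [mk' [M hM]] := bk'.
have intfb (g : 'rV[R]_n -> R) : bmeas g -> mu.-integrable setT (EFin \o (fun y => f y * g y)).
  move=> [mg [L hL]].
  have := @integrableMl _ _ _ mu setT measurableT (EFin \o f) g intf mg.
  rewrite (_ : (fun _ => _) = EFin \o (fun y => f y * g y)); last by apply/funext => y /=; rewrite EFinM.
  apply; exists L; split; first exact: num_real.
  by move=> r Lr y _ /=; rewrite (le_trans (hL y))// ltW.
pose F (h : R) y := f y * k (y - (h *: v + x)).
pose F' (h : R) y := - (f y * k' (y - (h *: v + x))).
have dF : forall h y, is_derive h (1 : R) (F ^~ y) (F' h y).
  move=> h y.
  have d1 : is_derive (- h) (1 : R) (fun l => k (l *: v + (y - x))) (k' (y - (h *: v + x))).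
    apply/is_derive_line.
    by rewrite (_ : - h *: v + (y - x) = y - (h *: v + x)) // scaleNr opprD addrCA.
  have d2 : is_derive h (1 : R) (fun l : R => - l) (-1) by exact: is_deriveN.
  have d3 := is_derive1_comp d1 d2.
  have d4 := is_deriveM (is_derive_cst (f y) h (1 : R)) d3.
  have E : cst (f y) * ((fun l => k (l *: v + (y - x))) \o (fun l : R => - l)) = F ^~ y.
    apply/funext => l; rewrite /F /= {1}/GRing.mul /=; congr (_ * k _).
    by rewrite scaleNr opprD addrCA.
  rewrite E in d4; apply: (is_derive_eq d4).
  by rewrite /F' /GRing.scale /=; ring.
have intF h : mu.-integrable setT (EFin \o F h).
  by apply: intfb; exact: bmeas_shift.
have intG : mu.-integrable setT (EFin \o (fun y => M * `|f y|)).
  have := integrableZl measurableT M (integrable_norm intf).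
  by rewrite (_ : (fun _ => _) = EFin \o (fun y => M * `|f y|)).
have bd : forall h y, h \in `]-1, 1[ -> `|F' h y| <= M * `|f y|.
  by move=> h y _; rewrite /F' normrN normrM mulrC ler_wpM2r.
have := diff_under intF dF intG bd.
have -> : \int[mu]_y F' 0 y = - \int[mu]_y (f y * k' (y - x)).
  have := @RintegralZl _ _ _ mu setT (fun y => f y * k' (y - x)) (-1) measurableT (intfb _ (bmeas_shift _ bk')).
  rewrite mulN1r => <-; apply: eq_Rintegral => y _.
  by rewrite /F' scale0r add0r mulN1r.
move=> H; have := (@is_derive_line R n x v (fun x => \int[mu]_y (f y * k (y - x))) 0 (- \int[mu]_y (f y * k' (y - x)))).1 H.
by rewrite scale0r add0r.
Qed.

End differentiation.

(** * The mollifying kernel *)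

Section flat.
Context {R : realType}.

(** The powers of [1 / t] are part of the family because the derivative of a member is a combination
    of the next two. Smoothness then follows by induction, without a formula for the higher
    derivatives. *)
Definition flat (m : nat) (t : R) : R := if 0 < t then t^-1 ^+ m * expR (- t^-1) else 0.

Lemma flat_ge0 m t : 0 <= flat m t.
Proof.
rewrite /flat; case: ifP => // t0.
by rewrite mulr_ge0 ?expR_ge0// exprn_ge0// invr_ge0 ltW.
Qed.

Lemma flat_le0 m t : t <= 0 -> flat m t = 0.
Proof. by move=> t0; rewrite /flat ltNge t0. Qed.

(** A quadratic bound is what makes the derivative at 0 exist and vanish. It comes from
    [y^(m+2) / (m+2)! <= e^y] with [y = 1 / t]. *)
Lemma flat_le m t : flat m t <= (m.+2)`!%:R * t ^+ 2.
Proof.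
rewrite /flat; case: ifPn => [t0|_]; last by rewrite mulr_ge0// sqr_ge0.
have y0 : 0 < t^-1 by rewrite invr_gt0.
set y := t^-1 in y0 *.
have := expR_ge1Dxn m.+1 (ltW y0) => H.
have fpos : (0 : R) < m.+2`!%:R by rewrite ltr0n fact_gt0.
rewrite expRN ler_pdivrMr ?expR_gt0//.
have -> : y ^+ m = y ^+ m.+2 * t ^+ 2.
  by rewrite -addn2 exprD -mulrA -exprMn mulVf ?gt_eqF// expr1n mulr1.
rewrite [leRHS]mulrAC ler_wpM2r ?sqr_ge0//.
rewrite mulrC -ler_pdivrMr//; apply: le_trans H; by rewrite lerDr.
Qed.

Lemma is_derive_flat m (t : R) :
  is_derive t 1 (flat m) (flat m.+2 t - m%:R * flat m.+1 t).
Proof.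
have [t0|t0|->] := ltgtP t 0.
- rewrite !flat_le0 ?ltW// mulr0 subr0.
  have H0 : is_derive t (1 : R) (fun=> 0 : R) 0 by exact: is_derive_cst.
  apply: (near_eq_is_derive _ H0).
  near=> s; rewrite /= flat_le0// ltW//.
  by near: s; exact: lt_nbhsl.
- pose f (s : R) := s^-1 ^+ m * expR (- s^-1).
  have d1 : is_derive t (1 : R) (fun s => s^-1) (- t^-1 ^+ 2).
    split; first by apply: derivableV => //; rewrite gt_eqF.
    by rewrite deriveV ?gt_eqF// derive_id /GRing.scale/= mulr1 exprVn.
  apply: (@near_eq_is_derive _ _ _ f).
    near=> s; rewrite /f /flat ifT//.
    by near: s; exact: lt_nbhsr.
  have d2 : is_derive t (1 : R) (fun s => expR (- s^-1)) (expR (- t^-1) * (t^-1 ^+ 2)).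
    have d3 : is_derive t (1 : R) (fun s => - s^-1) (t^-1 ^+ 2).
      by apply: (is_derive_eq (is_deriveN d1)); rewrite opprK.
    exact: (is_derive1_comp (is_derive_expR _) d3).
  have d4 : is_derive t (1 : R) (fun s => s^-1 ^+ m) (m%:R * t^-1 ^+ m.-1 * (- t^-1 ^+ 2)).
    have := @is_deriveX _ _ (fun s : R => s^-1) m t 1 _ d1.
    by rewrite exprfctE.
  refine (is_derive_eq (is_deriveM d4 d2) _).
  rewrite /flat t0 /GRing.scale/=; case: m {f d4} => [|m] /=.
    by rewrite expr0 !mul0r !mul1r mulr0 addr0 subr0 mulrC.
  by rewrite !exprS; ring.
- rewrite !flat_le0// mulr0 subr0.
  have H : h^-1 *: ((flat m \o shift 0) (h *: (1 : R)) - flat m 0) @[h --> 0^'] --> (0 : R).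
    apply/cvgr0Pnorm_lt => e e0.
    near=> h; rewrite /= scaler1 addr0 (flat_le0 m (lexx 0)) subr0 normrZ normfV.
    rewrite (ger0_norm (flat_ge0 m h)).
    have h0 : h != 0 by near: h; exact: nbhs_dnbhs_neq.
    rewrite ltr_pdivrMl ?normr_gt0//.
    apply: le_lt_trans (flat_le m h) _.
    rewrite -[h ^+ 2](ger0_norm (sqr_ge0 h)) normrX expr2 mulrCA ltr_pM2l ?normr_gt0//.
    rewrite -ltr_pdivlMl ?ltr0n ?fact_gt0//.
    by near: h; apply: dnbhs0_lt; rewrite mulr_gt0// invr_gt0 ltr0n fact_gt0.
  split; first by apply/cvg_ex; exists 0; exact: H.
  exact/cvg_lim.
Unshelve. all: by end_near. Qed.

Lemma continuous_flat m : continuous (flat m).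
Proof.
by move=> t; apply: differentiable_continuous; apply/derivable1_diffP; have [] := is_derive_flat m t.
Qed.

Lemma measurable_flat m : measurable_fun setT (flat m).
Proof. apply: continuous_measurable_fun; exact: continuous_flat. Qed.

End flat.

(** * Functions of class [C^k] *)

Section Ck.
Context {R : realType} {n : nat}.
Implicit Types f g : 'rV[R]_n -> R.

Lemma Ck_cont k f : Ck k f -> continuous f.
Proof. by case: k => [|k] []. Qed.

(** Lets the partial derivatives be any functions given by a formula, in place of [partial]; the
    closure properties are then inductions that use the derivative rules. *)
Lemma CkSP k f : Ck k.+1 f <-> continuous f /\
  forall i, exists g, (forall x, is_derive x (basis_vec i) f (g x)) /\ Ck k g.
Proof.
split=> [[cf H]|[cf H]]; split=> // i.
  have [d ck] := H i; exists (partial i f); split=> // x.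
have [g [dg ckg]] := H i.
have -> : partial i f = g by apply/funext => x; have [] := dg x.
split => // x; by have [] := dg x.
Qed.

Lemma CkW k f : Ck k.+1 f -> Ck k f.
Proof.
elim: k f => [|k IH] f; first by case.
move=> /CkSP[cf H]; apply/CkSP; split=> // i.
by have [g [dg /IH ckg]] := H i; exists g.
Qed.

Lemma Ck_cst k (a : R) : Ck k (fun _ : 'rV[R]_n => a).
Proof.
elim: k a => [|k IH] a; first by split => //; exact: cst_continuous.
apply/CkSP; split; first exact: cst_continuous.
by move=> i; exists (fun=> 0); split => // x; exact: is_derive_cst.
Qed.

Lemma Ck_coord k (i : 'I_n) : Ck k (fun x : 'rV[R]_n => x ord0 i).
Proof.
case: k => [|k]; first by split => //; exact: coord_continuous.
apply/CkSP; split; first exact: coord_continuous.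
move=> j; exists (fun=> (basis_vec j : 'rV[R]_n) ord0 i); split; last exact: Ck_cst.
by move=> x; exact: is_derive_coord.
Qed.

Lemma CkD k f g : Ck k f -> Ck k g -> Ck k (fun x => f x + g x).
Proof.
elim: k f g => [|k IH] f g.
  by move=> [cf _] [cg _]; split => // x; apply: continuousD; [exact: cf|exact: cg].
move=> /CkSP[cf Hf] /CkSP[cg Hg]; apply/CkSP; split.
  by move=> x; apply: continuousD; [exact: cf|exact: cg].
move=> i; have [f' [df Cf]] := Hf i; have [g' [dg Cg]] := Hg i.
exists (fun x => f' x + g' x); split; last exact: IH.
by move=> x; exact: is_deriveDf.
Qed.

Lemma CkM k f g : Ck k f -> Ck k g -> Ck k (fun x => f x * g x).
Proof.
elim: k f g => [|k IH] f g.
  by move=> [cf _] [cg _]; split => // x; apply: continuousM; [exact: cf|exact: cg].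
move=> cf' cg'; have := CkW cf'; have := CkW cg'.
move: cf' cg' => /CkSP[cf Hf] /CkSP[cg Hg] ckg ckf; apply/CkSP; split.
  by move=> x; apply: continuousM; [exact: cf|exact: cg].
move=> i; have [f' [df Cf]] := Hf i; have [g' [dg Cg]] := Hg i.
exists (fun x => f' x * g x + f x * g' x); split.
  by move=> x; exact: is_deriveMf.
by apply: CkD; apply: IH.
Qed.

Lemma Ck_sum k (I : Type) (s : seq I) (F : I -> 'rV[R]_n -> R) :
  (forall i, Ck k (F i)) -> Ck k (fun x => \sum_(i <- s) F i x).
Proof.
move=> cF; elim: s => [|i s IH].
  by under eq_fun do rewrite big_nil; exact: Ck_cst.
by under eq_fun do rewrite big_cons; exact: CkD.
Qed.

Lemma Ck_flat k m f : Ck k f -> Ck k (fun x => flat m (f x)).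
Proof.
elim: k m f => [|k IH] m f ckf.
  split=> // x; apply: continuous_comp; first exact: (Ck_cont ckf).
  exact: continuous_flat.
have ckf' := CkW ckf; move: ckf => /CkSP[cf Hf]; apply/CkSP; split.
  by move=> x; apply: continuous_comp; [exact: cf|exact: continuous_flat].
move=> i; have [f' [df Cf]] := Hf i.
exists (fun x => (flat m.+2 (f x) + (- m%:R) * flat m.+1 (f x)) * f' x); split.
  move=> x; apply: (is_derive_comp _ (df x)).
  by apply: (is_derive_eq (is_derive_flat m (f x))); rewrite mulNr.
apply: CkM => //; apply: CkD; first exact: IH.
by apply: CkM; [exact: Ck_cst|exact: IH].
Qed.

End Ck.

Section kernel.
Context {R : realType} {n : nat} (d : R) (d0 : 0 < d).
Local Notation mu := (@lebesgue_rV R n).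
Implicit Types z : 'rV[R]_n.

Definition nsq z : R := \sum_i z ord0 i ^+ 2.
(** The index is kept because the derivatives of [kap 0] are polynomials times [kap m] with larger
    [m]. The kernel is normalised only in [moll]. *)
Definition kap (m : nat) z : R := flat m (d ^+ 2 - nsq z).

Lemma nsq_ge0 z : 0 <= nsq z.
Proof. by apply: sumr_ge0 => i _; exact: sqr_ge0. Qed.

Lemma coord_le_nsq z i : z ord0 i ^+ 2 <= nsq z.
Proof.
rewrite /nsq (bigD1 i)//= lerDl; apply: sumr_ge0 => j _; exact: sqr_ge0.
Qed.

Lemma nsqN z : nsq (- z) = nsq z.
Proof. by apply: eq_bigr => i _; rewrite mxE sqrrN. Qed.

Lemma measurable_nsq : measurable_fun setT nsq.
Proof.
apply: measurable_sum => i; apply: measurable_funX; exact: measurable_rV_coord.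
Qed.

Lemma is_derive_nsq z (v : 'rV[R]_n) :
  is_derive z v nsq (\sum_i 2 * z ord0 i * v ord0 i).
Proof.
apply: is_derive_sumf => i _.
apply: (is_derive_ext (is_deriveMf (is_derive_coord z v i) (is_derive_coord z v i))).
  by move=> y; rewrite expr2.
by ring.
Qed.

Lemma is_derive_nsq_basis z i : is_derive z (basis_vec i) nsq (2 * z ord0 i).
Proof.
apply: (is_derive_eq (is_derive_nsq z _)).
rewrite (bigD1 i)//= big1 ?addr0.
  by rewrite mxE !eqxx mulr1.
by move=> j ji; rewrite mxE eqxx (negbTE ji) mulr0.
Qed.

Lemma kap_supp m z : d ^+ 2 <= nsq z -> kap m z = 0.
Proof. by move=> h; rewrite /kap flat_le0// subr_le0. Qed.

Lemma kap_ge0 m z : 0 <= kap m z. Proof. exact: flat_ge0. Qed.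

Lemma kap_box m z : ~ box d z -> kap m z = 0.
Proof.
move=> nb; apply: kap_supp; rewrite leNgt; apply/negP => lt; apply: nb => i.
have := le_lt_trans (coord_le_nsq z i) lt.
by rewrite -(real_normK (num_real (z ord0 i))) ltr_sqr ?nnegrE ?(ltW d0)// => /ltW.
Qed.

Lemma measurable_kap m : measurable_fun setT (kap m).
Proof.
apply: (measurableT_comp (measurable_flat m)).
by apply: measurable_funB => //; exact: measurable_nsq.
Qed.

Lemma bmeas_kap m : bmeas (kap m).
Proof.
split; first exact: measurable_kap.
exists (m.+2`!%:R * d ^+ 4) => z; rewrite ger0_norm ?kap_ge0//.
have [h|h] := leP (d ^+ 2) (nsq z); first by rewrite kap_supp// mulr_ge0// exprn_ge0// ltW.
apply: le_trans (flat_le _ _) _; rewrite ler_wpM2l//.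
rewrite (_ : d ^+ 4 = (d ^+ 2) ^+ 2); last by rewrite -exprM.
rewrite ler_sqr ?nnegrE ?sqr_ge0 ?subr_ge0 ?(ltW h)//.
by rewrite gerBl nsq_ge0.
Qed.

Lemma bmeas_coord_kap i m : bmeas (fun z => z ord0 i * kap m z).
Proof.
have [mk [M hM]] := bmeas_kap m.
split; first by apply: measurable_funM => //; exact: measurable_rV_coord.
exists (d * M) => z; have [bz|nb] := pselect (box d z).
  by rewrite normrM ler_pM.
rewrite (kap_box m nb) mulr0 normr0 mulr_ge0 ?(ltW d0)//.
exact: le_trans (normr_ge0 _) (hM 0).
Qed.

Definition kap1 i z : R := - (2 * (z ord0 i * kap 2 z)).
Definition kap2 i j z : R :=
  - (2 * ((i == j)%:R * kap 2 z)) + 4 * (z ord0 i * (z ord0 j * (kap 4 z - 2 * kap 3 z))).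

(** Every symmetry of second derivatives that the Dirac identities require is obtained from this
    explicit formula, by way of [moll2C]. *)
Lemma kap2C i j z : kap2 i j z = kap2 j i z.
Proof. by rewrite /kap2 (eq_sym i j); congr (_ + _ * _); rewrite mulrCA. Qed.

Lemma is_derive_kapm m z i :
  is_derive z (basis_vec i) (kap m) ((kap m.+2 z - m%:R * kap m.+1 z) * (- (2 * z ord0 i))).
Proof.
apply: is_derive_comp; first exact: is_derive_flat.
have := is_deriveDf (is_derive_cst (d ^+ 2) z (basis_vec i)) (is_deriveNf (is_derive_nsq_basis z i)).
by rewrite add0r.
Qed.

Lemma is_derive_kap z i : is_derive z (basis_vec i) (kap 0) (kap1 i z).
Proof.
apply: (is_derive_eq (is_derive_kapm 0 z i)).
by rewrite /kap1 mul0r subr0; ring.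
Qed.

Lemma is_derive_kap1 z i j : is_derive z (basis_vec j) (kap1 i) (kap2 i j z).
Proof.
have h := is_deriveMf (is_derive_coord z (basis_vec j) i) (is_derive_kapm 2 z j).
apply: (is_derive_ext (is_deriveNf (is_deriveMf (is_derive_cst (2 : R) z (basis_vec j)) h))) => //.
by rewrite /kap2 /cst /basis_vec mxE eqxx /= (eq_sym i j); ring.
Qed.

Lemma bmeas_kap1 i : bmeas (kap1 i).
Proof.
apply: bmeasN; apply: bmeasM; first exact: bmeas_cst.
exact: bmeas_coord_kap.
Qed.

Lemma bmeas_kap2 i j : bmeas (kap2 i j).
Proof.
have H m : bmeas (fun z => z ord0 i * (z ord0 j * kap m z)).
  have [mk [M hM]] := bmeas_coord_kap j m.
  split; first by apply: measurable_funM => //; exact: measurable_rV_coord.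
  exists (d * M) => z; have [bz|nb] := pselect (box d z).
    by rewrite normrM ler_pM.
  rewrite (kap_box m nb) !mulr0 normr0 mulr_ge0 ?(ltW d0)//.
  exact: le_trans (normr_ge0 _) (hM 0).
apply: bmeasD.
  apply: bmeasN; apply: bmeasM; first exact: bmeas_cst.
  by apply: bmeasM; [exact: bmeas_cst|exact: bmeas_kap].
apply: bmeasM; first exact: bmeas_cst.
apply: (bmeas_eq (f := fun z => z ord0 i * (z ord0 j * kap 4 z) - 2 * (z ord0 i * (z ord0 j * kap 3 z)))).
  by move=> z; ring.
apply: bmeasB => //; apply: bmeasM => //; exact: bmeas_cst.
Qed.

Lemma bsupp_kap m : bsupp (kap m).
Proof. by exists d => z /kap_box. Qed.

Definition kapint : R := \int[mu]_z kap 0 z.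

Lemma kapint_gt0 : 0 < kapint.
Proof.
(* On the cube of half-side [a] one has [|z|^2 <= d^2 / 2], since
   [n a^2 <= ((n + 1) a)^2 = d^2 / 4]; there the kernel is bounded below. *)
pose a := d / (2 * n.+1%:R).
have a0 : 0 < a by rewrite divr_gt0// mulr_gt0.
have muB : mu (box a) = ((a *+ 2) ^+ n)%:E.
  rewrite (_ : box a = [set x : 'rV[R]_n | forall i, `[-a, a]%classic (x ord0 i)]); last first.
    by apply/seteqP; split => x /= H i; have := H i; rewrite /= in_itv/= -ler_norml.
  rewrite (lebesgue_rV_box (A := fun=> `[-a, a]%classic)) //.
  rewrite (eq_bigr (fun=> (a *+ 2)%:E)); last first.
    by move=> i _; rewrite /= lebesgue_measure_itv/= lte_fin gtrN// -EFinB opprK.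
  by rewrite prodEFin prodr_const card_ord.
have lb z : box a z -> flat 0 (d ^+ 2 / 2) <= kap 0 z.
  move=> bz; have hn : nsq z <= d ^+ 2 / 2.
    apply: (@le_trans _ _ (\sum_(i < n) a ^+ 2)).
      apply: ler_sum => i _; rewrite -(real_normK (num_real (z ord0 i))).
      by rewrite ler_sqr ?nnegrE ?(ltW a0).
    rewrite sumr_const card_ord -[X in X <= _]mulr_natl.
    have n1 : (1 : R) <= n.+1%:R by rewrite ler1n.
    have nn : (n%:R : R) <= n.+1%:R by rewrite ler_nat.
    have aN : n.+1%:R * a = d / 2 by rewrite /a; field; rewrite addrC natr1 pnatr_eq0.
    apply: (@le_trans _ _ ((n.+1%:R * a) ^+ 2)).
      by rewrite [in leRHS]exprMn ler_wpM2r ?sqr_ge0// expr2; nra.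
    by rewrite aN; have := sqr_ge0 d; nra.
  have p1 : 0 < d ^+ 2 / 2 by rewrite divr_gt0// exprn_gt0.
  have p2 : d ^+ 2 / 2 <= d ^+ 2 - nsq z by lra.
  have p3 := lt_le_trans p1 p2.
  rewrite /kap /flat p1 p3 !expr0 !mul1r ler_expR lerN2 lef_pV2//.
have fp : 0 < flat 0 (d ^+ 2 / 2 : R).
  by rewrite /flat divr_gt0 ?exprn_gt0// expr0 mul1r expR_gt0.
apply: (@lt_le_trans _ _ (\int[mu]_z (flat 0 (d ^+ 2 / 2) * \1_(box a) z))).
  rewrite RintegralZl//; last first.
    apply: integrable_bs; last by exists a => x nb; rewrite indicE memNset.
    split; first by apply: measurable_indic; exact: measurable_box.
    by exists 1 => x; rewrite indicE; case: (_ \in _); rewrite ?normr1 ?normr0.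
  apply: mulr_gt0 => //.
  rewrite /Rintegral integral_indic//; last exact: measurable_box.
  rewrite (_ : fine _ = fine ((a *+ 2) ^+ n)%:E); last by congr fine; rewrite setIT; exact: muB.
  by rewrite /= exprn_gt0// mulrn_wgt0.
have bi : bmeas (fun z : 'rV[R]_n => flat 0 (d ^+ 2 / 2) * \1_(box a) z).
  apply: bmeasM; first exact: bmeas_cst.
  split; first by apply: measurable_indic; exact: measurable_box.
  by exists 1 => x; rewrite indicE; case: (_ \in _); rewrite ?normr1 ?normr0.
apply: le_Rintegral => //.
- apply: integrable_bs => //.
  by exists a => x nb; rewrite indicE memNset ?mulr0.
- apply: integrable_bs; [exact: bmeas_kap|exact: bsupp_kap].
- move=> z _; rewrite indicE; have [bz|] := boolP (z \in box a); last by rewrite mulr0 kap_ge0.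
  by rewrite mulr1; apply: lb; rewrite inE in bz.
Qed.

Lemma smooth_kap : smooth (kap 0).
Proof.
move=> k; apply: Ck_flat; apply: CkD; first exact: Ck_cst.
rewrite (_ : (fun x => - nsq x) = (fun x => -1 * \sum_i x ord0 i * x ord0 i)).
  apply: CkM; first exact: Ck_cst.
  by apply: Ck_sum => i; apply: CkM; exact: Ck_coord.
by apply/funext => x; rewrite mulN1r.
Qed.

End kernel.

(** * Mollification *)

Section integrability.
Context {R : realType} {n : nat}.
Local Notation mu := (@lebesgue_rV R n).
Implicit Types f g w : 'rV[R]_n -> R.

Definition intg f := mu.-integrable setT (EFin \o f).

Lemma intg_measurable f : intg f -> measurable_fun setT f.
Proof. by move/integrableP => [/measurable_EFinP]. Qed.

Lemma intg_eq f g : f =1 g -> intg f -> intg g.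
Proof. by move=> /funext ->. Qed.

Lemma intgD f g : intg f -> intg g -> intg (fun x => f x + g x).
Proof. by move=> intf intg'; have := integrableD measurableT intf intg'. Qed.

Lemma intgZ (c : R) f : intg f -> intg (fun x => c * f x).
Proof. by move=> intf; have := integrableZl measurableT c intf. Qed.

Lemma intgN f : intg f -> intg (fun x => - f x).
Proof. by move=> /(intgZ (-1)); apply: intg_eq => x; rewrite mulN1r. Qed.

Lemma intgB f g : intg f -> intg g -> intg (fun x => f x - g x).
Proof. by move=> intf /intgN; exact: intgD. Qed.

Lemma intg_norm f : intg f -> intg (fun x => `|f x|).
Proof. by move=> /integrable_norm. Qed.

Lemma intg_le f g : measurable_fun setT f -> (forall x, `|f x| <= g x) -> intg g -> intg f.
Proof.
move=> mf fg intg'; apply: (le_integrable measurableT _ _ intg').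
  exact/measurable_EFinP.
by move=> x _ /=; rewrite lee_fin (le_trans (fg x))// ler_norm.
Qed.

Lemma intg_mulb f w : intg f -> bmeas w -> intg (fun x => f x * w x).
Proof.
move=> intf [mw [M hM]].
apply: (@intg_le _ (fun x => M * `|f x|)); last by apply/intgZ/intg_norm.
  by apply: measurable_funM => //; exact: intg_measurable.
by move=> x; rewrite normrM mulrC ler_wpM2r.
Qed.

Lemma intg_bmul f w : intg f -> bmeas w -> intg (fun x => w x * f x).
Proof. by move=> intf bw; apply: intg_eq (intg_mulb intf bw) => x; rewrite mulrC. Qed.

Lemma intg_sum (I : Type) (s : seq I) (P : pred I) (F : I -> 'rV[R]_n -> R) :
  (forall i, P i -> intg (F i)) -> intg (fun x => \sum_(i <- s | P i) F i x).
Proof.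
move=> iF; elim: s => [|i s IH].
  apply: (intg_eq (f := fun=> 0)); first by move=> x; rewrite big_nil.
  by apply: integrable_bs; [exact: bmeas_cst|exists 0].
case: (boolP (P i)) => Pi.
  apply: (intg_eq (f := fun x => F i x + \sum_(j <- s | P j) F j x)).
    by move=> x; rewrite big_cons Pi.
  by apply: intgD => //; exact: iF.
by apply: intg_eq IH => x; rewrite big_cons (negbTE Pi).
Qed.

Local Notation I f := (\int[mu]_x f x).

Lemma RID f g : intg f -> intg g -> I (fun x => f x + g x) = I f + I g.
Proof. by move=> intf intg'; exact: RintegralD. Qed.

Lemma RIZ (c : R) f : intg f -> I (fun x => c * f x) = c * I f.
Proof. by move=> intf; exact: RintegralZl. Qed.

Lemma RIN f : intg f -> I (fun x => - f x) = - I f.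
Proof.
move=> intf; rewrite -mulN1r -RIZ//; apply: eq_Rintegral => x _; by rewrite mulN1r.
Qed.

Lemma RIB f g : intg f -> intg g -> I (fun x => f x - g x) = I f - I g.
Proof. by move=> intf intg'; rewrite RID ?RIN//; exact: intgN. Qed.

Lemma RI_eq f g : f =1 g -> I f = I g.
Proof. by move=> /funext ->. Qed.

Lemma RI_sum (J : Type) (s : seq J) (P : pred J) (F : J -> 'rV[R]_n -> R) :
  (forall i, P i -> intg (F i)) ->
  I (fun x => \sum_(i <- s | P i) F i x) = \sum_(i <- s | P i) I (F i).
Proof.
move=> iF; elim: s => [|i s IH].
  rewrite big_nil (RI_eq (g := fun=> 0 * 0)); last by move=> x; rewrite big_nil mul0r.
  rewrite RIZ ?mul0r//; by apply: integrable_bs; [exact: bmeas_cst|exists 0].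
rewrite big_cons; case: (boolP (P i)) => Pi.
  rewrite -IH -RID; [|exact: iF|exact: intg_sum].
  by apply: RI_eq => x; rewrite big_cons Pi.
by rewrite -IH; apply: RI_eq => x; rewrite big_cons (negbTE Pi).
Qed.

Lemma RI_le f g : intg f -> intg g -> (forall x, f x <= g x) -> I f <= I g.
Proof. by move=> intf intg' fg; apply: le_Rintegral. Qed.

Lemma RI_ge0 f : (forall x, 0 <= f x) -> 0 <= I f.
Proof. by move=> f0; apply: Rintegral_ge0. Qed.

Lemma RI_norm_le f : intg f -> `|I f| <= I (fun x => `|f x|).
Proof. by move=> intf; apply: le_normr_Rintegral. Qed.

Lemma RI_EFin f : intg f -> (I f)%:E = (\int[mu]_x (f x)%:E)%E.
Proof.
by move=> intf; rewrite /Rintegral fineK//; exact: integrable_fin_num.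
Qed.

Definition L2 f := measurable_fun setT f /\ intg (fun x => f x ^+ 2).

Lemma L2M f g : L2 f -> L2 g -> intg (fun x => f x * g x).
Proof.
move=> [mf f2] [mg g2]; apply: (@intg_le _ (fun x => f x ^+ 2 + g x ^+ 2)).
- exact: measurable_funM.
- by move=> x; rewrite ler_norml; have := sqr_ge0 (f x - g x); have := sqr_ge0 (f x + g x);
    have := sqr_ge0 (f x); have := sqr_ge0 (g x); nra.
- exact: intgD.
Qed.

Lemma L2Z (c : R) f : L2 f -> L2 (fun x => c * f x).
Proof.
move=> [mf f2]; split; first by apply: measurable_funM => //; exact: measurable_cst.
by apply: intg_eq (intgZ (c ^+ 2) f2) => x; rewrite exprMn.
Qed.

Lemma L2D f g : L2 f -> L2 g -> L2 (fun x => f x + g x).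
Proof.
move=> Lf Lg; have ifg := L2M Lf Lg; move: Lf Lg => [mf f2] [mg g2].
split; first exact: measurable_funD.
apply: intg_eq (intgD (intgD f2 g2) (intgZ 2 ifg)) => x; ring.
Qed.

Lemma L2B f g : L2 f -> L2 g -> L2 (fun x => f x - g x).
Proof.
move=> Lf /(L2Z (-1)) Lg; have [m i] := L2D Lf Lg; split.
  by apply: (eq_measurable_fun _ _ m) => x _; rewrite mulN1r.
by apply: intg_eq i => x; rewrite mulN1r.
Qed.

Lemma L2_bs f : bmeas f -> bsupp f -> L2 f.
Proof.
move=> bf sf; split; first by case: bf.
by apply: integrable_bs; [exact: bmeasX|exact: bsuppMl].
Qed.

Lemma L2_sum (J : Type) (s : seq J) (F : J -> 'rV[R]_n -> R) :
  (forall i, L2 (F i)) -> L2 (fun x => \sum_(i <- s) F i x).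
Proof.
move=> LF; elim: s => [|i s IH].
  under eq_fun do rewrite big_nil.
  by apply: L2_bs; [exact: bmeas_cst|exists 0].
by under eq_fun do rewrite big_cons; exact: L2D.
Qed.

Lemma bmeas_indic (A : set 'rV[R]_n) : measurable A -> bmeas (fun x => \1_A x : R).
Proof.
move=> mA; split; first exact: measurable_indic.
by exists 1 => x; rewrite indicE; case: (_ \in _); rewrite ?normr1 ?normr0.
Qed.

Lemma L2_intg f : L2 f -> bsupp f -> intg f.
Proof.
move=> Lf [r hr].
have Lb : L2 (fun x => \1_(box r) x : R).
  apply: L2_bs; first by apply: bmeas_indic; exact: measurable_box.
  by exists r => x nb; rewrite indicE memNset.
apply: intg_eq (L2M Lf Lb) => x.
have [bx|nb] := pselect (box r x); first by rewrite indicE mem_set// mulr1.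
by rewrite hr// mul0r.
Qed.

Lemma measurable_fubini_sub (f k : 'rV[R]_n -> R) :
  measurable_fun setT f -> measurable_fun setT k ->
  measurable_fun setT (fun xy : 'rV[R]_n * 'rV[R]_n => (f xy.2 * k (xy.2 - xy.1))%:E).
Proof.
move=> mf mk; apply/measurable_EFinP; apply: measurable_funM.
  by apply: (measurableT_comp mf); exact: measurable_snd.
apply: (measurableT_comp mk); apply: measurable_fun_rVP => i.
under eq_fun do rewrite !mxE; apply: measurable_funB.
  apply: (@measurableT_comp _ _ _ _ _ _ (fun x : 'rV[R]_n => x ord0 i)).
    exact: measurable_rV_coord.
  exact: measurable_snd.
apply: (@measurableT_comp _ _ _ _ _ _ (fun x : 'rV[R]_n => x ord0 i)).
  exact: measurable_rV_coord.
exact: measurable_fst.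
Qed.

Lemma bmeas_conv f k : intg f -> bmeas k ->
  bmeas (fun x => I (fun y => f y * k (y - x))).
Proof.
move=> intf bk; have [mk [M hM]] := bk.
split; last first.
  exists (M * I (fun y => `|f y|)) => x.
  have h1 : intg (fun y => f y * k (y - x)) by apply: intg_mulb => //; exact: bmeas_shift.
  apply: le_trans (RI_norm_le h1) _.
  rewrite -RIZ; last exact: intg_norm.
  apply: RI_le; [exact: intg_norm|by apply/intgZ/intg_norm|].
  by move=> y; rewrite normrM mulrC ler_wpM2r.
pose F (xy : 'rV[R]_n * 'rV[R]_n) := (f xy.2 * k (xy.2 - xy.1))%:E.
have mF : measurable_fun setT F by apply: measurable_fubini_sub => //; exact: intg_measurable.
rewrite /Rintegral; apply: (measurableT_comp (@fine_measurable R setT measurableT)).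
(* Tonelli's theorem concerns nonnegative integrands, hence the splitting into positive and negative
   parts. *)
have -> : (fun x => \int[mu]_y (f y * k (y - x))%:E)%E =
   ((fun x => \int[mu]_y F^\+ (x, y)) \- (fun x => \int[mu]_y F^\- (x, y)))%E.
  apply/funext => x; rewrite [LHS]integralE; congr (_ - _)%E.
    by apply: eq_integral => y _; rewrite !funeposE.
  by apply: eq_integral => y _; rewrite !funenegE.
apply: emeasurable_funB.
  by apply: (measurable_fun_fubini_tonelli_F (m2 := mu) F^\+%E) => //; exact: measurable_funepos.
by apply: (measurable_fun_fubini_tonelli_F (m2 := mu) F^\-%E) => //; exact: measurable_funeneg.
Qed.

End integrability.

(** * Convolution with the normalised kernel *)

Section mollifier.
Context {R : realType} {n : nat} (d : R) (d0 : 0 < d).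
Local Notation mu := (@lebesgue_rV R n).
Local Notation I f := (\int[mu]_x f x).
Local Notation kap := (@kap R n d).
Local Notation kap1 := (@kap1 R n d).
Local Notation kap2 := (@kap2 R n d).
Let c : R := (@kapint R n d)^-1.
Let c0 : 0 < c. Proof. by rewrite invr_gt0 kapint_gt0. Qed.
Implicit Types f g w : 'rV[R]_n -> R.

Definition moll f x : R := c * I (fun y => f y * kap 0 (y - x)).
(** The kernel is evaluated at [y - x], so each derivative in [x] costs a sign: one here, two in
    [moll2]. *)
Definition moll1 i f x : R := c * - I (fun y => f y * kap1 i (y - x)).
Definition moll2 i j f x : R := c * I (fun y => f y * kap2 i j (y - x)).

Lemma moll2C i j f x : moll2 i j f x = moll2 j i f x.
Proof. by rewrite /moll2; congr (_ * _); apply: RI_eq => y; rewrite kap2C. Qed.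

Lemma bmeas_moll f : intg f -> bmeas (moll f).
Proof.
move=> intf; apply: bmeasM; first exact: bmeas_cst.
by apply: bmeas_conv => //; exact: bmeas_kap.
Qed.

Lemma bmeas_moll1 i f : intg f -> bmeas (moll1 i f).
Proof.
move=> intf; apply: bmeasM; first exact: bmeas_cst.
by apply: bmeasN; apply: bmeas_conv => //; exact: bmeas_kap1.
Qed.

Lemma bmeas_moll2 i j f : intg f -> bmeas (moll2 i j f).
Proof.
move=> intf; apply: bmeasM; first exact: bmeas_cst.
by apply: bmeas_conv => //; exact: bmeas_kap2.
Qed.

Lemma is_derive_moll f i x : intg f -> is_derive x (basis_vec i) (moll f) (moll1 i f x).
Proof.
move=> intf; have H := conv_derive x intf (@bmeas_kap R n d d0 0) (is_derive_kap d ^~ i) (bmeas_kap1 d0 i).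
apply: (is_derive_ext (is_deriveMf (is_derive_cst c x (basis_vec i)) H)) => //.
by rewrite /moll1 /cst mul0r add0r.
Qed.

Lemma is_derive_moll1 f i j x : intg f ->
  is_derive x (basis_vec j) (moll1 i f) (moll2 i j f x).
Proof.
move=> intf; have H := conv_derive x intf (bmeas_kap1 d0 i) (fun z => is_derive_kap1 d z i j) (bmeas_kap2 d0 i j).
apply: (is_derive_ext (is_deriveMf (is_derive_cst c x (basis_vec j)) (is_deriveNf H))) => //.
by rewrite /moll2 /cst mul0r add0r opprK.
Qed.

Lemma intg_conv f x : intg f -> intg (fun y => f y * kap 0 (y - x)).
Proof. by move=> intf; apply: intg_mulb => //; apply: bmeas_shift; exact: bmeas_kap. Qed.

Lemma mollB f g x : intg f -> intg g -> moll (fun y => f y - g y) x = moll f x - moll g x.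
Proof.
move=> intf ig; rewrite /moll -mulrBr -RIB; try exact: intg_conv.
by congr (_ * _); apply: RI_eq => y; rewrite mulrBl.
Qed.

Lemma kap_sub0 (x y : 'rV[R]_n) : kap 0 (y - x) = kap 0 (x - y).
Proof. by congr (flat _ (_ - _)); rewrite -nsqN opprB. Qed.

Lemma intg_kap_shift x : intg (fun y => kap 0 (y - x)).
Proof.
apply: integrable_bs; first by apply: bmeas_shift; exact: bmeas_kap.
by apply: bsupp_shift; exact: bsupp_kap.
Qed.

Lemma moll1_cst x : c * I (fun y => kap 0 (y - x)) = 1.
Proof.
rewrite (Rintegral_rV_shift (- x)); last exact: measurable_kap.
by rewrite mulVf// gt_eqF// kapint_gt0.
Qed.

Lemma moll_supp f r x : (forall x, ~ box r x -> f x = 0) -> ~ box (r + d) x -> moll f x = 0.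
Proof.
move=> hf nb; rewrite /moll (RI_eq (g := fun=> 0 * 0)).
  by rewrite RIZ ?mul0r ?mulr0//; apply: integrable_bs; [exact: bmeas_cst|exists 0].
move=> y; rewrite mul0r; have [by_|nby] := pselect (box r y); last by rewrite hf// mul0r.
rewrite kap_box ?mulr0// => bz; apply: nb => i.
have -> : x ord0 i = y ord0 i - (y - x) ord0 i by rewrite !mxE opprB addrC subrK.
by rewrite (le_trans (ler_normB _ _))// lerD.
Qed.

Lemma bsupp_moll f : bsupp f -> bsupp (moll f).
Proof. by move=> [r hr]; exists (r + d) => x; exact: moll_supp. Qed.

(* Jensen's inequality, from the nonnegativity of the variance. *)
Lemma moll_sqr_le f x : intg f -> intg (fun y => f y ^+ 2) ->
  moll f x ^+ 2 <= moll (fun y => f y ^+ 2) x.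
Proof.
move=> intf if2.
pose m := moll f x.
have i1 := intg_conv x intf; have i2 := intg_conv x if2; have i0 := intg_kap_shift x.
have : 0 <= c * I (fun y => (f y - m) ^+ 2 * kap 0 (y - x)).
  by rewrite mulr_ge0 ?(ltW c0)//; apply: RI_ge0 => y; rewrite mulr_ge0 ?sqr_ge0 ?kap_ge0.
rewrite (RI_eq (g := fun y => (f y ^+ 2 * kap 0 (y - x) - 2 * m * (f y * kap 0 (y - x)))
   + m ^+ 2 * kap 0 (y - x))); last by move=> y; ring.
rewrite RID; [|by apply: intgB => //; exact: intgZ|exact: intgZ].
rewrite RIB//; last exact: intgZ.
rewrite !RIZ//.
rewrite (_ : c * _ = moll (fun y => f y ^+ 2) x - 2 * m * moll f x + m ^+ 2 * (c * I (fun y => kap 0 (y - x)))).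
  by rewrite moll1_cst -/m => h; rewrite -subr_ge0 (le_trans h)//; lra.
by rewrite /moll; ring.
Qed.

(** Tonelli, together with the evenness of the kernel: integrated in [x] instead of [y] it has the
    same mass. *)
Lemma moll_mass g : intg g -> (forall x, 0 <= g x) -> bsupp g ->
  I (fun x => moll g x) = I g.
Proof.
move=> ig g0 sg.
have im : intg (moll g) by apply: integrable_bs; [exact: bmeas_moll|exact: bsupp_moll].
apply: EFin_inj; rewrite !RI_EFin//.
have mk := @measurable_kap R n d 0.
have mg := intg_measurable ig.
have k0 (z : 'rV[R]_n) : (0 <= (kap 0 z)%:E)%E by rewrite lee_fin kap_ge0.
transitivity (\int[mu]_x (c%:E * \int[mu]_y (g y * kap 0 (y - x))%:E))%E.
  apply: eq_integral => x _; rewrite /moll EFinM; congr (_ * _)%E.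
  by rewrite -RI_EFin//; exact: intg_conv.
have mF := measurable_fubini_sub mg mk.
have F0 (xy : 'rV[R]_n * 'rV[R]_n) : (0 <= (g xy.2 * kap 0 (xy.2 - xy.1))%:E)%E.
  by rewrite lee_fin mulr_ge0 ?kap_ge0.
rewrite ge0_integralZl//; last 3 first.
- exact: (measurable_fun_fubini_tonelli_F (m2 := mu) _ mF F0).
- by move=> x _; apply: integral_ge0 => y _; exact: (F0 (x, y)).
- by rewrite lee_fin ltW.
rewrite (fubini_tonelli (m1 := mu) (m2 := mu) _ mF F0) /=.
rewrite -ge0_integralZl//; last 3 first.
- exact: (measurable_fun_fubini_tonelli_G (m1 := mu) _ mF F0).
- by move=> y _; apply: integral_ge0 => x _; exact: (F0 (x, y)).
- by rewrite lee_fin ltW.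
apply: eq_integral => y _.
have -> : (\int[mu]_x (g y * kap 0 (y - x))%:E)%E = (I (fun x => g y * kap 0 (x - y)))%:E.
  rewrite RI_EFin; last by apply: intgZ; exact: intg_kap_shift.
  by apply: eq_integral => x _; rewrite kap_sub0.
by rewrite RIZ; [rewrite -EFinM mulrCA moll1_cst mulr1|exact: intg_kap_shift].
Qed.

Lemma L2_moll f : intg f -> bsupp f -> L2 (moll f).
Proof. by move=> intf sf; apply: L2_bs; [exact: bmeas_moll|exact: bsupp_moll]. Qed.

Lemma moll_contract f : L2 f -> bsupp f ->
  I (fun x => moll f x ^+ 2) <= I (fun x => f x ^+ 2).
Proof.
move=> Lf sf; have intf := L2_intg Lf sf; have [mf f2] := Lf.
have s2 : bsupp (fun x => f x ^+ 2) by exact: bsuppMl.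
rewrite -(moll_mass f2 _ s2); last by move=> x; exact: sqr_ge0.
apply: RI_le.
- by have [] := L2_moll intf sf.
- by apply: integrable_bs; [exact: bmeas_moll|exact: bsupp_moll].
- by move=> x; exact: moll_sqr_le.
Qed.

Lemma coord_le_norm (v : 'rV[R]_n) i : `|v ord0 i| <= `|v|.
Proof.
rewrite [in leRHS]/Num.Def.normr/= mx_normrE.
exact: (le_bigmax _ (fun i : 'I_1 * 'I_n => `|v i.1 i.2|) (ord0, i)).
Qed.

Lemma norm_le_box (v : 'rV[R]_n) r : 0 <= r -> box r v -> `|v| <= r.
Proof.
move=> r0 bv; rewrite [in leLHS]/Num.Def.normr/= mx_normrE.
by apply: bigmax_le => // -[i j] _ /=; rewrite (ord1 i); exact: bv.
Qed.

Lemma moll_lip g L x : 0 <= L -> intg g -> (forall x y, `|g x - g y| <= L * `|x - y|) ->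
  `|moll g x - g x| <= L * d.
Proof.
move=> L0 ig Lg.
have i1 := intg_conv x ig; have i0 := intg_kap_shift x.
have -> : moll g x - g x = c * I (fun y => (g y - g x) * kap 0 (y - x)).
  rewrite (RI_eq (g := fun y => g y * kap 0 (y - x) - g x * kap 0 (y - x))); last by move=> y; rewrite mulrBl.
  rewrite RIB//; last exact: intgZ.
  by rewrite RIZ// mulrBr (mulrCA c (g x)) moll1_cst mulr1.
have i2 : intg (fun y => (g y - g x) * kap 0 (y - x)).
  apply: intg_eq (intgB i1 (intgZ (g x) i0)) => y; by rewrite mulrBl.
rewrite normrM (ger0_norm (ltW c0)).
apply: le_trans (_ : c * I (fun y => L * d * kap 0 (y - x)) <= _).
  rewrite ler_wpM2l ?(ltW c0)//; apply: le_trans (RI_norm_le i2) _.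
  apply: RI_le; [exact: intg_norm|exact: intgZ|] => y.
  rewrite normrM (ger0_norm (kap_ge0 _ _ _)).
  have [bz|nb] := pselect (box d (y - x)); last by rewrite (kap_box d0 _ nb) !mulr0.
  rewrite ler_wpM2r ?kap_ge0//; apply: le_trans (Lg _ _) _.
  have := norm_le_box (ltW d0) bz => h.
  by rewrite ler_wpM2l.
by rewrite RIZ// mulrCA moll1_cst mulr1.
Qed.

End mollifier.

(** * Density of Lipschitz functions in L2 *)

Section density.
Context {R : realType} {n : nat}.
Local Notation mu := (@lebesgue_rV R n).
Local Notation I f := (\int[mu]_x f x).
Local Notation bx := (@box R n).
Implicit Types f g : 'rV[R]_n -> R.

Lemma continuous_measurable_rV f : continuous f -> measurable_fun setT f.
Proof.
move=> cf; apply: (measurability (@RGenOInfty.G R)).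
  exact: RGenOInfty.measurableE.
move=> _ [_ [a ->] <-]; rewrite setTI; apply: measurable_open_rV.
by move/continuousP : cf; apply; exact: interval_open.
Qed.

Lemma RI_dominated (F : nat -> 'rV[R]_n -> R) (f G : 'rV[R]_n -> R) :
  (forall k, measurable_fun setT (F k)) -> measurable_fun setT f -> intg G ->
  (forall x, F k x @[k --> \oo] --> f x) -> (forall k x, `|F k x| <= G x) ->
  I (F k) @[k --> \oo] --> I f.
Proof.
move=> mF mf iG Ff FG.
have iF k : intg (F k) by apply: (intg_le (mF k) (FG k)).
have [] := @dominated_convergence _ _ _ mu setT measurableT (fun k x => (F k x)%:E)
  (EFin \o f) (EFin \o G).
- by move=> k; exact/measurable_EFinP.
- exact/measurable_EFinP.
- by apply: aeW => x _; apply: cvg_EFin; [exact: nearW|exact: Ff].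
- exact: iG.
- by apply: aeW => x k _ /=; rewrite lee_fin.
move=> if_ _ /= H; apply: fine_cvg.
by rewrite fineK// integrable_fin_num.
Qed.

Lemma RI_dominated_sqr (F : nat -> 'rV[R]_n -> R) f (G : 'rV[R]_n -> R) :
  (forall k, measurable_fun setT (F k)) -> measurable_fun setT f -> intg G ->
  (forall x, F k x @[k --> \oo] --> f x) -> (forall k x, (f x - F k x) ^+ 2 <= G x) ->
  forall e, 0 < e -> exists k, I (fun x => (f x - F k x) ^+ 2) <= e.
Proof.
move=> mF mf iG Ff FG e e0.
have : I (fun x => (f x - F k x) ^+ 2) @[k --> \oo] --> I (fun=> 0 : R).
  apply: (RI_dominated (G := G)) => //.
  - by move=> k; apply: measurable_funX; apply: measurable_funB.
  - move=> x; have : (f x - F k x) ^+ 2 @[k --> \oo] --> (f x - f x) ^+ 2.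
      apply: (@continuous_cvg _ _ _ _ _ _ (fun y : R => y ^+ 2)); first exact: exprn_continuous.
      by apply: cvgB; [exact: cvg_cst|exact: Ff].
    by rewrite subrr expr0n.
  - by move=> k x; rewrite ger0_norm ?sqr_ge0.
have -> : I (fun=> 0 : R) = 0 by rewrite /Rintegral integral0.
move/cvgrPdist_le => /(_ _ e0)[N _ /(_ N (leqnn N))].
by rewrite sub0r normrN => /(le_trans (ler_norm _)) H; exists N.
Qed.

(** The dense class on which mollification is controlled directly: [moll_lip] gives uniform
    convergence, and the bounded support turns it into convergence in L2. *)
Definition lipc g :=
  [/\ exists L : R, 0 <= L /\ forall x y, `|g x - g y| <= L * `|x - y|,
      exists M : R, forall x, `|g x| <= M & bsupp g].

Lemma lipc_bmeas g : lipc g -> bmeas g.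
Proof.
move=> [[L [L0 hL]] [M hM] sg]; split; last by exists M.
apply: continuous_measurable_rV => x.
apply/(@cvgrPdist_lt R R 'rV[R]_n (nbhs x) (nbhs_filter x) g (g x)) => e e0.
have L1 : 0 < L + 1 by rewrite ltr_pwDr.
near=> y; apply: le_lt_trans (hL _ _) _.
apply: (@le_lt_trans _ _ ((L + 1) * `|x - y|)); first by rewrite ler_wpM2r// lerDl.
rewrite -ltr_pdivlMl//.
by near: y; apply: cvgr_dist_lt; rewrite ?mulr_gt0 ?invr_gt0//; exact: cvg_id.
Unshelve. all: by end_near. Qed.

Lemma lipc_L2 g : lipc g -> L2 g.
Proof. by move=> lg; apply: L2_bs; [exact: lipc_bmeas|case: lg]. Qed.

Lemma lipcZ (c : R) g : lipc g -> lipc (fun x => c * g x).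
Proof.
move=> [[L [L0 hL]] [M hM] sg]; split.
- exists (`|c| * L); split; first by rewrite mulr_ge0.
  by move=> x y; rewrite -mulrBr normrM -mulrA ler_wpM2l.
- by exists (`|c| * M) => x; rewrite normrM ler_wpM2l.
- exact: bsuppMr.
Qed.

Lemma lipcD f g : lipc f -> lipc g -> lipc (fun x => f x + g x).
Proof.
move=> [[L [L0 hL]] [M hM] sf] [[K [K0 hK]] [N hN] sg]; split.
- exists (L + K); split; first by rewrite addr_ge0.
  move=> x y; rewrite opprD addrACA mulrDl.
  by apply: le_trans (ler_normD _ _) _; rewrite lerD.
- by exists (M + N) => x; apply: le_trans (ler_normD _ _) _; rewrite lerD.
- exact: bsuppD.
Qed.

Lemma ler_norm_max2 (a b a' b' : R) :
  `|Num.max a b - Num.max a' b'| <= `|a - a'| + `|b - b'|.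
Proof.
have N (u : R) : - `|u| <= u <= `|u| by rewrite -ler_norml.
have /andP[? ?] := N (a - a'); have /andP[? ?] := N (b - b').
have ? := normr_ge0 (a - a'); have ? := normr_ge0 (b - b').
rewrite ler_norml; have [h1|h1] := leP a b; have [h2|h2] := leP a' b'; apply/andP; split; lra.
Qed.

Lemma lipc_max f g : lipc f -> lipc g -> lipc (fun x => Num.max (f x) (g x)).
Proof.
move=> [[L [L0 hL]] [M hM] [r hr]] [[K [K0 hK]] [N hN] [q hq]]; split.
- exists (L + K); split; first by rewrite addr_ge0.
  move=> x y; rewrite mulrDl; apply: le_trans (ler_norm_max2 _ _ _ _) _.
  by rewrite lerD.
- exists (M + N) => x; have := ler_norm_max2 (f x) (g x) 0 0.
  rewrite maxxx !subr0 => h; apply: le_trans h _; by rewrite lerD.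
- exists (Num.max r q) => x nb; rewrite hr ?hq ?maxxx//; apply: contra_not nb; apply: sub_box;
  by rewrite le_max lexx ?orbT.
Qed.

Definition lip_approx f := forall e : R, 0 < e ->
  exists g, lipc g /\ I (fun x => (f x - g x) ^+ 2) <= e.

Lemma RI_sqrD f g : L2 f -> L2 g ->
  I (fun x => (f x + g x) ^+ 2) <= 2 * I (fun x => f x ^+ 2) + 2 * I (fun x => g x ^+ 2).
Proof.
move=> Lf Lg; have [_ i1] := L2D Lf Lg; have [_ i2] := Lf; have [_ i3] := Lg.
rewrite -!RIZ// -RID; try exact: intgZ.
apply: RI_le => //; first by apply: intgD; exact: intgZ.
by move=> x; have := sqr_ge0 (f x - g x); nra.
Qed.

Lemma lip_approx_lim f : L2 f ->
  (forall e : R, 0 < e -> exists f', [/\ L2 f', lip_approx f' &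
     I (fun x => (f x - f' x) ^+ 2) <= e]) -> lip_approx f.
Proof.
move=> Lf H e e0.
have e4 : 0 < e / 4 by rewrite divr_gt0.
have [f' [Lf' af' h1]] := H _ e4; have [g [lg h2]] := af' _ e4.
exists g; split=> //; have Lg := lipc_L2 lg.
have := RI_sqrD (L2B Lf Lf') (L2B Lf' Lg).
rewrite (RI_eq (g := fun x => (f x - g x) ^+ 2)) => [h|x]; last by rewrite subrKA.
apply: le_trans h _; lra.
Qed.

Lemma lip_approxD f g : L2 f -> L2 g -> lip_approx f -> lip_approx g ->
  lip_approx (fun x => f x + g x).
Proof.
move=> Lf Lg af ag e e0.
have e4 : 0 < e / 4 by rewrite divr_gt0.
have [f' [lf' h1]] := af _ e4; have [g' [lg' h2]] := ag _ e4.
exists (fun x => f' x + g' x); split; first exact: lipcD.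
have := RI_sqrD (L2B Lf (lipc_L2 lf')) (L2B Lg (lipc_L2 lg')).
rewrite (RI_eq (g := fun x => (f x + g x - (f' x + g' x)) ^+ 2)) => [h|x]; last first.
  by congr (_ ^+ 2); ring.
apply: le_trans h _; lra.
Qed.

Lemma lip_approxZ (c : R) f : L2 f -> lip_approx f -> lip_approx (fun x => c * f x).
Proof.
move=> Lf af e e0.
have c1 : 0 < c ^+ 2 + 1 by rewrite ltr_pwDr// sqr_ge0.
have [f' [lf' h1]] := af (e / (c ^+ 2 + 1)) (divr_gt0 e0 c1).
exists (fun x => c * f' x); split; first exact: lipcZ.
rewrite (RI_eq (g := fun x => c ^+ 2 * (f x - f' x) ^+ 2)); last by move=> x; ring.
have [_ i] := L2B Lf (lipc_L2 lf').
rewrite RIZ//; apply: le_trans (_ : (c ^+ 2 + 1) * I (fun x => (f x - f' x) ^+ 2) <= _).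
  by rewrite ler_wpM2r ?lerDl//; apply: RI_ge0 => x; exact: sqr_ge0.
by rewrite mulrC -ler_pdivlMr.
Qed.

Lemma lip_approxB f g : L2 f -> L2 g -> lip_approx f -> lip_approx g ->
  lip_approx (fun x => f x - g x).
Proof.
move=> Lf Lg af ag.
have -> : (fun x => f x - g x) = (fun x => f x + (-1) * g x).
  by apply/funext => x; rewrite mulN1r.
by apply: lip_approxD => //; [exact: L2Z|exact: lip_approxZ].
Qed.

(** Meant for unions of sets, because the indicator of a union is a maximum and [max] is Lipschitz
    in both arguments. *)
Lemma lip_approx_max f g : L2 f -> L2 g -> L2 (fun x => Num.max (f x) (g x)) ->
  lip_approx f -> lip_approx g ->
  lip_approx (fun x => Num.max (f x) (g x)).
Proof.
move=> Lf Lg Lm af ag e e0.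
have e4 : 0 < e / 4 by rewrite divr_gt0.
have [f' [lf' h1]] := af _ e4; have [g' [lg' h2]] := ag _ e4.
have lm := lipc_max lf' lg'.
exists (fun x => Num.max (f' x) (g' x)); split => //.
have [_ i1] := L2B Lf (lipc_L2 lf'); have [_ i2] := L2B Lg (lipc_L2 lg').
have [_ i3] := L2B Lm (lipc_L2 lm).
apply: (@le_trans _ _ (I (fun x => 2 * (f x - f' x) ^+ 2 + 2 * (g x - g' x) ^+ 2))).
  apply: RI_le => //; first by apply: intgD; exact: intgZ.
  move=> x; have := ler_norm_max2 (f x) (g x) (f' x) (g' x).
  have E (u : R) : u ^+ 2 = `|u| ^+ 2 by rewrite real_normK ?num_real.
  rewrite (E (Num.max _ _ - _)) (E (f x - _)) (E (g x - _)).
  set a := `|f x - f' x|; set b := `|g x - g' x|; set m := `|_ - _| => h.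
  have m0 : 0 <= m by exact: normr_ge0.
  have a0 : 0 <= a by exact: normr_ge0.
  have b0 : 0 <= b by exact: normr_ge0.
  have : m ^+ 2 <= (a + b) ^+ 2 by rewrite ler_sqr ?nnegrE// addr_ge0.
  have := sqr_ge0 (a - b); nra.
rewrite RID ?RIZ//; try exact: intgZ; lra.
Qed.

(** Dominated convergence: values in [[0, 1]] and a common box make the indicator of the box a
    dominating function. *)
Lemma lip_approx_cvg (F : nat -> 'rV[R]_n -> R) f (r : R) :
  (forall k, lipc (F k)) -> measurable_fun setT f ->
  (forall x, F k x @[k --> \oo] --> f x) ->
  (forall k x, 0 <= F k x <= 1) -> (forall k x, ~ bx r x -> F k x = 0) ->
  lip_approx f.
Proof.
move=> lF mf Ff F1 F0 e e0.
have f1 x : 0 <= f x <= 1.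
  apply/andP; split.
    have /cvg_lim <- // := Ff x.
    by apply: limr_ge; [apply/cvg_ex; exists (f x); exact: Ff|apply: nearW => k; case/andP: (F1 k x)].
  have /cvg_lim <- // := Ff x.
  by apply: limr_le; [apply/cvg_ex; exists (f x); exact: Ff|apply: nearW => k; case/andP: (F1 k x)].
have f0 x : ~ bx r x -> f x = 0.
  move=> nb; have /cvg_lim <- // := Ff x.
  by rewrite (_ : (fun k => F k x) = cst 0) ?lim_cst//; apply/funext => k; exact: F0.
have ib : intg (fun x => \1_(bx r) x : R).
  apply: integrable_bs; first by apply: bmeas_indic; exact: measurable_box.
  by exists r => x nb; rewrite indicE memNset.
have mF k : measurable_fun setT (F k) by have [] := lipc_bmeas (lF k).
have [|k hk] := RI_dominated_sqr mF mf ib Ff _ e0; last by exists (F k).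
move=> k x; have [hx|nb] := pselect (bx r x).
  by rewrite indicE mem_set//=; have /andP[? ?] := F1 k x; have /andP[? ?] := f1 x; nra.
by rewrite F0// f0// subrr expr0n indicE memNset.
Qed.

Definition clamp (t : R) : R := Num.max 0 (Num.min 1 t).

Lemma clamp01 t : 0 <= clamp t <= 1.
Proof.
by rewrite /clamp le_max lexx /= ge_max ler01 ge_min lexx.
Qed.

Lemma clamp_le0 t : t <= 0 -> clamp t = 0.
Proof. by move=> t0; rewrite /clamp (min_idPr _) ?(max_idPl _)// (le_trans t0). Qed.

Lemma clamp_ge1 t : 1 <= t -> clamp t = 1.
Proof. by move=> t1; rewrite /clamp (min_idPl _)// (max_idPr _). Qed.

Lemma clamp_lip s t : `|clamp s - clamp t| <= `|s - t|.
Proof.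
have E u : clamp u = Num.max 0 (- Num.max (-1) (- u)) by rewrite /clamp oppr_max !opprK.
rewrite !E; apply: le_trans (ler_norm_max2 _ _ _ _) _.
rewrite subrr normr0 add0r opprK addrC.
apply: le_trans (ler_norm_max2 _ _ _ _) _.
by rewrite subrr normr0 add0r opprK addrC.
Qed.

Definition box_cut (r : R) (k : nat) (x : 'rV[R]_n) : R := clamp (1 - k.+1%:R * (`|x| - r)).

Lemma box_cut_supp r k x : 0 <= r -> ~ bx (r + 1) x -> box_cut r k x = 0.
Proof.
move=> r0 nb; apply: clamp_le0; rewrite subr_le0.
have h : r + 1 < `|x|.
  rewrite ltNge; apply/negP => xr; apply: nb => i; exact: le_trans (coord_le_norm x i) xr.
have : (1 : R) <= k.+1%:R by rewrite ler1n.
have : 1 <= `|x| - r by lra.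
nra.
Qed.

Lemma lipc_box_cut r k : 0 <= r -> lipc (box_cut r k).
Proof.
move=> r0; split.
- exists k.+1%:R; split=> // x y; apply: le_trans (clamp_lip _ _) _.
  rewrite (_ : _ - _ = - (k.+1%:R * (`|x| - `|y|))); last by ring.
  by rewrite normrN normrM ger0_norm// ler_wpM2l// ler_dist_dist.
- by exists 1 => x; have /andP[a b] := clamp01 (1 - k.+1%:R * (`|x| - r)); rewrite ger0_norm.
- by exists (r + 1) => x; exact: box_cut_supp.
Qed.

Lemma box_cut_cvg r x : 0 <= r -> box_cut r k x @[k --> \oo] --> (\1_(bx r) x : R).
Proof.
move=> r0; have [hx|nb] := pselect (bx r x).
  rewrite indicE mem_set// (_ : (fun k => _) = cst 1); first exact: cvg_cst.
  apply/funext => k; apply: clamp_ge1; rewrite lerDl oppr_ge0.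
  by rewrite pmulr_rle0// subr_le0 norm_le_box.
have h : 0 < `|x| - r.
  rewrite subr_gt0 ltNge; apply/negP => xr; apply: nb => i; exact: le_trans (coord_le_norm x i) xr.
rewrite indicE memNset//; apply: cvg_near_cst.
exists (Num.truncn (`|x| - r)^-1) => // k /= hk.
apply: clamp_le0; rewrite subr_le0 -ler_pdivrMr// mul1r.
apply: le_trans (ltW (truncnS_gt _)) _; by rewrite ler_nat.
Qed.

Lemma lip_approx_box r : 0 <= r -> lip_approx (fun x => \1_(bx r) x : R).
Proof.
move=> r0; apply: (@lip_approx_cvg (box_cut r) _ (r + 1)).
- by move=> k; exact: lipc_box_cut.
- by apply: measurable_indic; exact: measurable_box.
- by move=> x; exact: box_cut_cvg.
- by move=> k x; exact: clamp01.
- by move=> k x; exact: box_cut_supp.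
Qed.

Definition half_cut (i : 'I_n) (a : R) (k : nat) (x : 'rV[R]_n) : R := clamp (k.+1%:R * (x ord0 i - a)).

Lemma half_cut_cvg i a x : half_cut i a k x @[k --> \oo] --> (\1_[set y : 'rV[R]_n | a < y ord0 i] x : R).
Proof.
have [ax|xa] := ltP a (x ord0 i); last first.
  rewrite indicE memNset/=; last by apply/negP; rewrite -leNgt.
  rewrite (_ : (fun k => _) = cst 0); first exact: cvg_cst.
  apply/funext => k; apply: clamp_le0.
  by rewrite pmulr_rle0// subr_le0.
rewrite indicE mem_set//; apply: cvg_near_cst.
have h : 0 < x ord0 i - a by rewrite subr_gt0.
exists (Num.truncn (x ord0 i - a)^-1) => // k /= hk.
apply: clamp_ge1; rewrite -ler_pdivrMr// mul1r.
apply: le_trans (ltW (truncnS_gt _)) _; by rewrite ler_nat.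
Qed.

Lemma lip_approx_half r i a : 0 <= r ->
  lip_approx (fun x => \1_([set y : 'rV[R]_n | a < y ord0 i] `&` bx r) x : R).
Proof.
move=> r0.
have mh : measurable [set y : 'rV[R]_n | a < y ord0 i].
  rewrite (_ : mkset _ = (fun x : 'rV[R]_n => x ord0 i) @^-1` `]a, +oo[%classic).
    by rewrite -[X in measurable X]setTI; apply: measurable_rV_coord.
  by apply/seteqP; split => y /=; rewrite in_itv/= andbT.
apply: (@lip_approx_cvg (fun k x => box_cut r k x * half_cut i a k x) _ (r + 1)).
- move=> k; have [[L [L0 hL]] [M hM] sb] := lipc_box_cut k r0; split.
  + exists (L + k.+1%:R); split; first by rewrite addr_ge0.
    move=> x y.
    have -> : box_cut r k x * half_cut i a k x - box_cut r k y * half_cut i a k y =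
      (box_cut r k x - box_cut r k y) * half_cut i a k x + box_cut r k y * (half_cut i a k x - half_cut i a k y) by ring.
    apply: le_trans (ler_normD _ _) _; rewrite [leRHS]mulrDl !normrM lerD//.
      rewrite -[leRHS]mulr1 ler_pM//.
      by have /andP[u v] := clamp01 (k.+1%:R * (x ord0 i - a)); rewrite ger0_norm.
    rewrite -[leRHS]mul1r ler_pM//.
      by have /andP[u v] := clamp01 (1 - k.+1%:R * (`|y| - r)); rewrite ger0_norm.
    apply: le_trans (clamp_lip _ _) _.
    rewrite (_ : _ - _ = k.+1%:R * ((x - y) ord0 i)); last by rewrite !mxE; ring.
    by rewrite normrM ger0_norm// ler_wpM2l// coord_le_norm.
  + exists 1 => x; have /andP[u v] := clamp01 (1 - k.+1%:R * (`|x| - r)).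
    have /andP[u' v'] := clamp01 (k.+1%:R * (x ord0 i - a)).
    by rewrite normrM !ger0_norm// mulr_ile1.
  + exact: bsuppMl.
- by apply: measurable_indic; apply: measurableI => //; exact: measurable_box.
- move=> x; rewrite indicI /= mulrC; apply: cvgM.
    exact: box_cut_cvg.
  exact: half_cut_cvg.
- move=> k x; have /andP[u v] := clamp01 (1 - k.+1%:R * (`|x| - r)).
  have /andP[u' v'] := clamp01 (k.+1%:R * (x ord0 i - a)).
  by rewrite mulr_ge0//= mulr_ile1.
- by move=> k x nb; rewrite box_cut_supp// mul0r.
Qed.

(** Good-sets principle: intersection with a box gives finite measure, these sets form a
    sigma-algebra, and it contains the half-spaces that generate the measurable sets. *)
Definition approx_sets (r : R) : set (set 'rV[R]_n) :=
  [set E | measurable E /\ lip_approx (fun x => \1_(E `&` bx r) x : R)].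

Lemma L2_indic_box E r : measurable E -> L2 (fun x => \1_(E `&` bx r) x : R).
Proof.
move=> mE; apply: L2_bs.
  by apply: bmeas_indic; apply: measurableI => //; exact: measurable_box.
by exists r => x nb; rewrite indicE memNset// => -[].
Qed.

Lemma sigma_algebra_approx_sets r : 0 <= r -> sigma_algebra setT (approx_sets r).
Proof.
move=> r0; have HC : forall A, approx_sets r A -> approx_sets r (setT `\` A).
  move=> A [mA aA]; split; first exact: measurableD.
  rewrite (_ : (fun x => _) = (fun x => \1_(bx r) x - \1_(A `&` bx r) x)).
    apply: lip_approxB => //; [|exact: L2_indic_box|exact: lip_approx_box].
    by rewrite (_ : \1_(bx r) = fun x => \1_(setT `&` bx r) x :> R); [exact: L2_indic_box|rewrite setTI].
  apply/funext => x; rewrite setTD !indicE !in_setI.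
  have -> : (x \in ~` A) = ~~ (x \in A).
    apply/idP/idP => [/set_mem nA|/negP nA]; first by apply/negP => /set_mem.
    by apply/mem_set => Ax; apply: nA; exact: mem_set.
  by case: (x \in A); case: (x \in bx r); rewrite /= ?subrr ?subr0.
have HU : forall A B, approx_sets r A -> approx_sets r B -> approx_sets r (A `|` B).
  move=> A B [mA aA] [mB aB]; have mAB := measurableU _ _ mA mB; split => //.
  have E : (fun x => \1_((A `|` B) `&` bx r) x : R) = (fun x => Num.max (\1_(A `&` bx r) x : R) (\1_(B `&` bx r) x)).
    apply/funext => x; rewrite !indicE !in_setI in_setU.
    by case: (x \in A); case: (x \in B); case: (x \in bx r); rewrite /= ?maxxx// ?(max_idPl ler01) ?(max_idPr ler01).
  rewrite E; apply: lip_approx_max => //; try exact: L2_indic_box.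
  by rewrite -E; exact: L2_indic_box.
have H0 : approx_sets r set0.
  split; first exact: measurable0.
  rewrite (_ : (fun x => _) = fun x => 0 * \1_(bx r) x).
    apply: lip_approxZ; last exact: lip_approx_box.
    by rewrite (_ : \1_(bx r) = fun x => \1_(setT `&` bx r) x :> R); [exact: L2_indic_box|rewrite setTI].
  by apply/funext => x; rewrite set0I indic0 mul0r.
split => // A HA.
have HV k : approx_sets r (\big[setU/set0]_(i < k) A i).
  by elim/big_ind : _ => [|B C|i _] //; exact: HU.
have mU : measurable (\bigcup_k A k) by apply: bigcup_measurable => k _; case: (HA k).
split => //; apply: lip_approx_lim; first exact: L2_indic_box.
move=> e e0.
have ib : intg (fun x => \1_(bx r) x : R).
  apply: integrable_bs; first by apply: bmeas_indic; exact: measurable_box.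
  by exists r => x nb; rewrite indicE memNset.
pose F k x : R := \1_((\big[setU/set0]_(i < k) A i) `&` bx r) x.
have mF k : measurable_fun setT (F k).
  by apply: measurable_indic; apply: measurableI; [case: (HV k)|exact: measurable_box].
have mf : measurable_fun setT (fun x => \1_(\bigcup_k A k `&` bx r) x : R).
  by apply: measurable_indic; apply: measurableI => //; exact: measurable_box.
have [||k hk] := RI_dominated_sqr mF mf ib _ _ e0; last first.
- by exists (F k); split => //; [apply: L2_indic_box; case: (HV k)|case: (HV k)].
- move=> k x; rewrite /F !indicE !in_setI.
  case: (x \in bx r); rewrite ?andbT ?andbF /= ?subrr ?expr0n//.
  by case: (_ \in _); case: (_ \in _); rewrite /= ?subrr ?subr0 ?sub0r ?sqrrN ?expr0n ?expr1n.
- move=> x; rewrite /F indicI; under eq_fun do rewrite indicI.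
  apply: cvgM; last exact: cvg_cst.
  rewrite indicE; have [|nx] := boolP (x \in \bigcup_k A k).
    rewrite inE => -[N _ AN]; apply: cvg_near_cst; exists N.+1 => // k /= Nk.
    by rewrite indicE mem_set// -bigcup_mkord; exists N.
  rewrite (_ : (fun k => _) = cst 0); first exact: cvg_cst.
  apply/funext => k; rewrite indicE memNset// -bigcup_mkord => -[j _ Aj].
  by move/negP: nx; apply; rewrite inE; exists j.
Qed.

Lemma approx_setsT r E : 0 <= r -> measurable E -> approx_sets r E.
Proof.
move=> r0; have [S0 SC SU] := sigma_algebra_approx_sets r0.
apply: smallest_sub; first by split.
move=> B; rewrite -bigcup_seq => -[i _ [D mD <-]]; rewrite setTI.
have {}mD : <<s @RGenOInfty.G R>> D by rewrite -[X in X D]RGenOInfty.measurableE.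
pose S : set (set R) := [set D | approx_sets r ((fun x : 'rV[R]_n => x ord0 i) @^-1` D)].
suff : S D by [].
move: D mD; apply: smallest_sub.
  split; first by rewrite /S /= preimage_set0.
    by move=> A HA; rewrite /S /= (_ : _ @^-1` _ = setT `\` ((fun x : 'rV[R]_n => x ord0 i) @^-1` A)); first exact: SC.
  by move=> A HA; rewrite /S /= preimage_bigcup; exact: SU.
move=> _ [a ->]; rewrite /S /= (_ : _ @^-1` _ = [set y : 'rV[R]_n | a < y ord0 i]).
  split; last exact: lip_approx_half.
  rewrite (_ : mkset _ = (fun x : 'rV[R]_n => x ord0 i) @^-1` `]a, +oo[%classic).
    by rewrite -[X in measurable X]setTI; apply: measurable_rV_coord.
  by apply/seteqP; split => y /=; rewrite in_itv/= andbT.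
by apply/seteqP; split => y /=; rewrite in_itv/= andbT.
Qed.

Import HBNNSimple.

Lemma lip_approx_ge0 f : L2 f -> bsupp f -> (forall x, 0 <= f x) -> lip_approx f.
Proof.
move=> Lf [r0 hr0] f0; pose r := `|r0|; have rr : 0 <= r by exact: normr_ge0.
have hr x : ~ bx r x -> f x = 0.
  by move=> nb; apply: hr0; apply: contra_not nb; apply: sub_box; exact: ler_norm.
have [mf if2] := Lf.
have mfE : measurable_fun setT (EFin \o f) by exact/measurable_EFinP.
pose h k := nnsfun_approx measurableT mfE k.
have hc x : h k x @[k --> \oo] --> f x.
  have := @cvg_nnsfun_approx _ _ _ setT measurableT _ mfE (fun x _ => f0 x) x Logic.I.
  by move/fine_cvgP => [].
have hle k x : 0 <= h k x <= f x.
  rewrite fun_ge0 /=; have /cvg_lim <- // := hc x.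
  apply: nondecreasing_cvgn_le; last by apply/cvg_ex; exists (f x); exact: hc.
  move=> i j ij; have /lefP := @nd_nnsfun_approx _ _ _ setT measurableT _ mfE i j ij.
  exact.
have mh k : measurable_fun setT (h k) by exact: measurable_funP.
apply: lip_approx_lim => // e e0.
have [|k hk] := RI_dominated_sqr mh mf if2 hc _ e0.
  by move=> k x; have /andP[? ?] := hle k x; nra.
exists (h k).
have E : (h k : _ -> R) = fun x => \sum_(y <- finmap.enum_fset (fset_set (range (h k))))
   y * \1_((h k @^-1` [set y]) `&` bx r) x.
  apply/funext => x; have [hx|nb] := pselect (bx r x).
    rewrite (fimfunE (h k) x) fsbig_finite//=.
    by apply: eq_bigr => y _; rewrite indicI [X in _ * (_ * X)]indicE (mem_set hx) mulr1.
  rewrite big1; last by move=> y _; rewrite indicE memNset ?mulr0// => -[].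
  by have := hle k x; rewrite hr// => /andP[? ?]; apply/eqP; rewrite eq_le; apply/andP.
have mE y : measurable (h k @^-1` [set y]).
  by rewrite -[X in measurable X]setTI; apply: mh.
have LE y : L2 (fun x => y * \1_((h k @^-1` [set y]) `&` bx r) x : R).
  by apply: L2Z; exact: L2_indic_box.
split => //; rewrite E; first exact: L2_sum.
elim: (finmap.enum_fset _) => [|i s IH].
  rewrite (_ : (fun x => _) = fun x => 0 * \1_(bx r) x).
    apply: lip_approxZ; last exact: lip_approx_box.
    by rewrite (_ : \1_(bx r) = fun x => \1_(setT `&` bx r) x :> R); [exact: L2_indic_box|rewrite setTI].
  by apply/funext => x; rewrite big_nil mul0r.
under [X in lip_approx X]eq_fun do rewrite big_cons.
apply: lip_approxD => //; first exact: L2_sum.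
apply: lip_approxZ; first exact: L2_indic_box.
by have [] := approx_setsT rr (mE i).
Qed.

Lemma lip_approxT f : L2 f -> bsupp f -> lip_approx f.
Proof.
move=> Lf sf; have [mf if2] := Lf; have [r hr] := sf.
have H (g : 'rV[R]_n -> R) : L2 g -> bsupp g -> L2 (fun x => Num.max (g x) 0) /\ bsupp (fun x => Num.max (g x) 0).
  move=> [mg ig2] [q hq]; split; last by exists q => x /hq ->; rewrite maxxx.
  split; first by apply: measurable_maxr => //; exact: measurable_cst.
  apply: (@intg_le _ _ _ (fun x => g x ^+ 2)) => //.
    by apply: measurable_funX; apply: measurable_maxr => //; exact: measurable_cst.
  move=> x; rewrite ger0_norm ?sqr_ge0//; rewrite maxEle; case: ifP => _ //.
  by rewrite expr0n sqr_ge0.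
have LN : L2 (fun x => - f x).
  by have := L2Z (-1) Lf; rewrite (_ : (fun x => _) = fun x => - f x)//; apply/funext => x; rewrite mulN1r.
have sN : bsupp (fun x => - f x) by exists r => x /hr ->; rewrite oppr0.
have [L1 s1] := H _ Lf sf; have [L2' s2] := H _ LN sN.
have -> : f = fun x => Num.max (f x) 0 - Num.max (- f x) 0.
  apply/funext => x; rewrite !maxEle; case: ifP => h1; case: ifP => h2; lra.
by apply: lip_approxB => //; apply: lip_approx_ge0 => //; move=> x; rewrite le_max lexx orbT.
Qed.

End density.

(** * Convergence of mollifications in weighted L2 *)

Section mollifier_convergence.
Context {R : realType} {n : nat}.
Local Notation mu := (@lebesgue_rV R n).
Local Notation "'\I' f" := (\int[mu]_x f x) (at level 10, f at level 9).
Implicit Types f g w : 'rV[R]_n -> R.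

Lemma moll_cvg_L2 f : L2 f -> bsupp f -> forall e : R, 0 < e ->
  exists d1 : R, 0 < d1 /\ forall d, 0 < d -> d < d1 ->
    \I (fun x => (moll d f x - f x) ^+ 2) <= e.
Proof.
move=> Lf sf e e0.
(* The difference is split into [moll (f - g)], [moll g - g] and [g - f]. As
   [(x + y + z)^2 <= 3 (x^2 + y^2 + z^2)], each square may contribute [e / 9]. *)
have e9 : 0 < e / 9 by rewrite divr_gt0.
have [g [lg hg]] := lip_approxT Lf sf e9.
have [[L [L0 hL]] _ [r hr]] := lg.
have Lg := lipc_L2 lg; have sg : bsupp g by exists r.
have intf := L2_intg Lf sf; have ig := L2_intg Lg sg.
pose V := \I (fun x => \1_(@box R n (r + 1)) x).
have V0 : 0 <= V by apply: RI_ge0 => x; rewrite indicE.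
have ib : intg (fun x => \1_(@box R n (r + 1)) x : R).
  apply: integrable_bs; first by apply: bmeas_indic; exact: measurable_box.
  by exists (r + 1) => x nb; rewrite indicE memNset.
have C0 : 0 < L ^+ 2 * V + 1 by rewrite ltr_pwDr// mulr_ge0// sqr_ge0.
(* With [d < 1] the supports stay in the box of size [r + 1] and [d^2 <= d], so a condition linear
   in [d] is enough. *)
exists (Num.min 1 (e / 9 / (L ^+ 2 * V + 1))); split.
  by rewrite lt_min ltr01 /= divr_gt0.
move=> d d0; rewrite lt_min => /andP[d1 d2].
have sfg : bsupp (fun x => f x - g x).
  apply: bsuppD => //; by exists r => x /hr ->; rewrite oppr0.
have Lfg := L2B Lf Lg.
have Lm g' (ig' : intg g') (sg' : bsupp g') : L2 (moll d g') by exact: L2_moll.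
have La := Lm _ (L2_intg Lfg sfg) sfg.
have Lb := L2B (Lm _ ig sg) Lg.
have Lc := L2B Lg Lf.
have [_ ia] := La; have [_ ib2] := Lb; have [_ ic] := Lc.
have ha : \I (fun x => moll d (fun y => f y - g y) x ^+ 2) <= e / 9.
  exact: le_trans (moll_contract d0 Lfg sfg) hg.
have hc : \I (fun x => (g x - f x) ^+ 2) <= e / 9.
  by rewrite (RI_eq (g := fun x => (f x - g x) ^+ 2))// => x; ring.
have hb : \I (fun x => (moll d g x - g x) ^+ 2) <= e / 9.
  apply: (@le_trans _ _ (\I (fun x => (L * d) ^+ 2 * \1_(@box R n (r + 1)) x))).
    apply: RI_le => //; first exact: intgZ.
    move=> x; have [bx|nb] := pselect (@box R n (r + 1) x).
      rewrite indicE mem_set//= mulr1.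
      have h := moll_lip d0 x L0 ig hL.
      rewrite -(real_normK (num_real (moll d g x - g x))) ler_sqr ?nnegrE//.
      by rewrite mulr_ge0// ltW.
    rewrite indicE memNset//= mulr0 hr; last first.
      by apply: contra_not nb; apply: sub_box; rewrite lerDl.
    rewrite (moll_supp d0 hr) ?subrr ?expr0n//.
    by apply: contra_not nb; apply: sub_box; rewrite lerD2l ltW.
  rewrite RIZ// -/V exprMn mulrAC.
  have : d ^+ 2 <= d by rewrite expr2 ger_pMl// ltW.
  move: d2; rewrite ltr_pdivlMr// => d2 d3.
  have LV : 0 <= L ^+ 2 * V by rewrite mulr_ge0// sqr_ge0.
  apply: le_trans (_ : L ^+ 2 * V * d <= _); first by rewrite ler_wpM2l.
  nra.
have E x : (moll d f x - f x) ^+ 2 <=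
   3 * moll d (fun y => f y - g y) x ^+ 2 + 3 * (moll d g x - g x) ^+ 2 + 3 * (g x - f x) ^+ 2.
  rewrite mollB//; set A := moll d f x; set B := moll d g x.
  have := sqr_ge0 ((A - B) - (B - g x)); have := sqr_ge0 ((A - B) - (g x - f x)).
  have := sqr_ge0 ((B - g x) - (g x - f x)); nra.
have [_ i0] := L2B (Lm _ intf sf) Lf.
have h3 : intg (fun x => 3 * moll d (fun y => f y - g y) x ^+ 2 + 3 * (moll d g x - g x) ^+ 2).
  by apply: intgD; exact: intgZ.
apply: le_trans (RI_le i0 _ E) _; first by apply: intgD => //; exact: intgZ.
rewrite RID//; last exact: intgZ.
rewrite RID; try exact: intgZ.
rewrite !RIZ//; lra.
Qed.

Lemma moll_weight_cvg f w : L2 f -> bsupp f -> bmeas w ->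
  \I (fun x => w x * moll (k.+1%:R^-1) f x ^+ 2) @[k --> \oo] --> \I (fun x => w x * f x ^+ 2).
Proof.
move=> Lf sf bw; have [mw [M0 hM0]] := bw.
pose M := `|M0| + 1; have M1 : 0 < M by rewrite ltr_pwDr.
have hM x : `|w x| <= M by rewrite (le_trans (hM0 x))// (le_trans (ler_norm _))// lerDl.
have intf := L2_intg Lf sf; have [_ if2] := Lf.
apply/cvgrPdist_le => e e0.
pose J := \I (fun x => f x ^+ 2).
have J0 : 0 <= J by apply: RI_ge0 => x; exact: sqr_ge0.
(* Young's inequality gives [|x^2 - y^2| <= (1 + 1/l) (x - y)^2 + l y^2]. This [l] makes the last
   term at most [e / 2], and [e'] then does the same for the first. [J + 1] avoids division by 0. *)
pose l := e / (2 * (M * (J + 1))).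
have J1 : 0 < J + 1 by rewrite ltr_pwDr.
have l0 : 0 < l by rewrite divr_gt0// !mulr_gt0.
pose e' := e / (2 * (M * (1 + l^-1))).
have li : 0 < 1 + l^-1 by rewrite addr_gt0// invr_gt0.
have e'0 : 0 < e' by rewrite divr_gt0// !mulr_gt0.
have [d1 [d10 H]] := moll_cvg_L2 Lf sf e'0.
exists (Num.truncn d1^-1) => // k /= hk.
set d := k.+1%:R^-1; have d0 : 0 < d by rewrite invr_gt0.
have dd : d < d1.
  rewrite /d invf_plt ?posrE//; apply: lt_le_trans (truncnS_gt _) _.
  by rewrite ler_nat.
have {}H := H d d0 dd.
have Lm : L2 (moll d f) by exact: L2_moll.
have [_ im] := Lm; have Lmf := L2B Lm Lf; have [_ imf] := Lmf.
have i1 : intg (fun x => w x * f x ^+ 2) by exact: intg_bmul.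
have i2 : intg (fun x => w x * moll d f x ^+ 2) by exact: intg_bmul.
rewrite -RIB//.
apply: le_trans (RI_norm_le (intgB i1 i2)) _.
have i3 : intg (fun x => M * (1 + l^-1) * (moll d f x - f x) ^+ 2) by exact: intgZ.
have i4 : intg (fun x => M * l * f x ^+ 2) by exact: intgZ.
apply: (@le_trans _ _ (\I (fun x => M * (1 + l^-1) * (moll d f x - f x) ^+ 2 + M * l * f x ^+ 2))).
  apply: RI_le; [exact/intg_norm/intgB|exact: intgD|] => x.
  rewrite -mulrBr normrM -2!mulrA -mulrDr ler_pM//.
  set a := moll d f x; set b := f x.
  have hl c : 2 * b * c <= l * b ^+ 2 + l^-1 * c ^+ 2.
    rewrite -subr_ge0 (_ : _ - _ = l^-1 * (l * b - c) ^+ 2).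
      by rewrite mulr_ge0 ?sqr_ge0// invr_ge0 ltW.
    by field; rewrite gt_eqF.
  have h1 := hl (a - b); have h2 := hl (- (a - b)); rewrite sqrrN in h2.
  have := sqr_ge0 (a - b) => h; rewrite ler_norml; apply/andP; split; nra.
rewrite RID// !RIZ// -/J.
have cc (c : R) : 0 < c -> c * (e / (2 * c)) = e / 2.
  by move=> c0; field; rewrite gt_eqF.
have h1 : M * (1 + l^-1) * e' = e / 2 by apply: cc; rewrite mulr_gt0.
have h2 : M * l * (J + 1) = e / 2.
  by rewrite mulrAC; apply: cc; rewrite mulr_gt0.
have : M * l * J <= M * l * (J + 1) by rewrite ler_wpM2l ?lerDl// ltW// mulr_gt0.
have : M * (1 + l^-1) * \I (fun x => (moll d f x - f x) ^+ 2) <= M * (1 + l^-1) * e'.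
  by rewrite ler_wpM2l// ltW// mulr_gt0.
lra.
Qed.

End mollifier_convergence.

(** * Integrated Carleman and Caccioppoli inequalities *)

Section matrix_bmeas.
Context {R : realType} {n : nat}.

Definition mbmeas p q (F : 'rV[R]_n -> 'M[R]_(p, q)) := forall a b, bmeas (fun x => F x a b).

Lemma mbmeas_cst p q (C : 'M[R]_(p, q)) : mbmeas (fun=> C).
Proof. by move=> a b; exact: bmeas_cst. Qed.

Lemma mbmeasD p q (F G : 'rV[R]_n -> 'M[R]_(p, q)) :
  mbmeas F -> mbmeas G -> mbmeas (fun x => F x + G x).
Proof. by move=> bF bG a b; under eq_fun do rewrite mxE; exact: bmeasD. Qed.

Lemma mbmeasB p q (F G : 'rV[R]_n -> 'M[R]_(p, q)) :
  mbmeas F -> mbmeas G -> mbmeas (fun x => F x - G x).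
Proof. by move=> bF bG a b; under eq_fun do rewrite !mxE; exact: bmeasB. Qed.

Lemma mbmeasZ p q (f : 'rV[R]_n -> R) (F : 'rV[R]_n -> 'M[R]_(p, q)) :
  bmeas f -> mbmeas F -> mbmeas (fun x => f x *: F x).
Proof. by move=> bf bF a b; under eq_fun do rewrite mxE; exact: bmeasM. Qed.

Lemma mbmeas_sum (I : Type) (s : seq I) p q (F : I -> 'rV[R]_n -> 'M[R]_(p, q)) :
  (forall i, mbmeas (F i)) -> mbmeas (fun x => \sum_(i <- s) F i x).
Proof.
by move=> bF a b; under eq_fun do rewrite summxE; apply: bmeas_sum => i _; exact: bF.
Qed.

Lemma mbmeas_mul p q r (F : 'rV[R]_n -> 'M[R]_(p, q)) (G : 'rV[R]_n -> 'M[R]_(q, r)) :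
  mbmeas F -> mbmeas G -> mbmeas (fun x => F x *m G x).
Proof.
move=> bF bG a b; under eq_fun do rewrite mxE.
by apply: bmeas_sum => i _; exact: bmeasM.
Qed.

Lemma bmeas_dot N (F G : 'rV[R]_n -> 'cV[R]_N) :
  mbmeas F -> mbmeas G -> bmeas (fun x => dot (F x) (G x)).
Proof.
move=> bF bG; under eq_fun do rewrite dotE.
by apply: bmeas_sum => i _; exact: bmeasM.
Qed.

End matrix_bmeas.

(** * Divergence theorem for supported fields, and the two integral inequalities *)

Section region.
Context {R : realType} {n : nat}.
Local Notation mu := (@lebesgue_rV R n).
Local Notation "'\I' f" := (\int[mu]_x f x) (at level 10, f at level 9).
Variables (O K : set 'rV[R]_n).

(* Fields are only differentiable on [O]; those supported in [K] extend by 0. *)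
Definition collar_of := [/\ K `<=` O, (exists r, K `<=` @box R n r) &
  forall x, ~ O x -> \forall y \near x, ~ K y].

Hypothesis hKO : collar_of.

Definition vanish_off (f : 'rV[R]_n -> R) := forall x, ~ K x -> f x = 0.

Lemma intg_vanish f : bmeas f -> vanish_off f -> intg f.
Proof.
move=> bf vf; have [_ [r Kr] _] := hKO.
by apply: integrable_bs => //; exists r => x nb; apply: vf; apply: contra_not nb; exact: Kr.
Qed.

Lemma bsupp_vanish f : vanish_off f -> bsupp f.
Proof.
by move=> vf; have [_ [r Kr] _] := hKO; exists r => x nb; apply: vf; apply: contra_not nb; exact: Kr.
Qed.

Lemma is_derive_glue (v : 'rV[R]_n) (G G' : 'rV[R]_n -> R) :
  (forall x, O x -> is_derive x v G (G' x)) -> vanish_off G -> vanish_off G' ->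
  forall x, is_derive x v G (G' x).
Proof.
move=> dG vG vG' x; have [Ox|nOx] := pselect (O x); first exact: dG.
have [_ _ /(_ x nOx) nK] := hKO.
rewrite vG'; last by exact: (nbhs_singleton nK).
have H0 : is_derive x v (fun=> 0 : R) 0 by exact: is_derive_cst.
apply: (near_eq_is_derive _ H0).
by apply: filterS nK => y nKy; rewrite vG.
Qed.

Lemma divergence_integral0 (G G' : 'I_n -> 'rV[R]_n -> R) :
  (forall j x, O x -> is_derive x (basis_vec j) (G j) (G' j x)) ->
  (forall j, vanish_off (G j)) -> (forall j, vanish_off (G' j)) ->
  (forall j, bmeas (G j)) -> (forall j, bmeas (G' j)) ->
  \I (fun x => \sum_j G' j x) = 0.
Proof.
move=> dG vG vG' bG bG'.
rewrite RI_sum; last by move=> j _; exact: intg_vanish.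
apply: big1 => j _.
apply: (integral_partial0 (bG j) (bsupp_vanish (vG j)) (is_derive_glue (dG j) (vG j) (vG' j))).
  by case: (bG' j).
exact: bsupp_vanish.
Qed.

Variable z : 'I_n -> 'rV[R]_n -> R.
(** To be thought of as [x - x0] on [O], truncated elsewhere, because the coordinate functions of
    the whole space are not bounded. *)
Definition good_coord := (forall i, bmeas (z i)) /\
  forall i j x, O x -> is_derive x (basis_vec j) (z i) ((i == j)%:R).
Hypothesis hz : good_coord.

Local Notation zz x := (fun i => z i x).
Local Notation ssq x := (\sum_i z i x ^+ 2).

Lemma bmeas_ssq : bmeas (fun x => ssq x).
Proof. by apply: bmeas_sum => i _; apply: bmeasX; case: hz. Qed.

Section carleman.
Variables (N : nat) (c : 'I_n -> 'M[R]_N) (hc : clifford c).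
Variables (phi f1 q q1 : 'rV[R]_n -> R).
Hypotheses (bphi : bmeas phi) (bf1 : bmeas f1) (bq : bmeas q) (bq1 : bmeas q1).
Hypothesis dphi : forall j x, O x -> is_derive x (basis_vec j) phi (f1 x * z j x).
Hypothesis dq : forall j x, O x -> is_derive x (basis_vec j) q (q1 x * z j x).
Hypothesis hf1 : forall x, K x -> ssq x * f1 x = - ((n%:R + 2 * q x) * phi x).
Hypothesis phi0 : forall x, K x -> 0 <= phi x.
Variables (om : 'rV[R]_n -> 'cV[R]_N) (om1 : 'I_n -> 'rV[R]_n -> 'cV[R]_N)
  (om2 : 'I_n -> 'I_n -> 'rV[R]_n -> 'cV[R]_N).
Hypotheses (bom : mbmeas om) (bom1 : forall i, mbmeas (om1 i))
  (bom2 : forall i j, mbmeas (om2 i j)).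
Hypothesis dom : forall j x, O x -> mderive x (basis_vec j) om (om1 j x).
Hypothesis dom1 : forall i j x, O x -> mderive x (basis_vec j) (om1 i) (om2 i j x).
Hypothesis om2C : forall i j x, K x -> om2 i j x = om2 j i x.
Hypotheses (vom : forall x, ~ K x -> om x = 0) (vom1 : forall i x, ~ K x -> om1 i x = 0)
  (vom2 : forall i j x, ~ K x -> om2 i j x = 0).

Let cNz j x := cN c (zz x) j.

Let dcN k j x : O x -> mderive x (basis_vec j) (cNz k) (bivec c j k).
Proof.
move=> Ox; apply: (mderive_ext (mderive_sum (index_enum 'I_n) (P := xpredT)
  (fun i _ => mderiveZr (bivec c i k) (hz.2 i j x Ox)))) => //.
rewrite (bigD1 j)//= eqxx scale1r big1 ?addr0// => i ij.
by rewrite (negbTE ij) scale0r.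
Qed.

Let dcT i j x : O x -> mderive x (basis_vec j) (fun y => cT c (zz y) i j) (cT' c (zz x) i j).
Proof.
move=> Ox.
apply: (mderive_ext (mderiveB (mderiveZ (hz.2 i j x Ox) (dcN j j Ox)) (mderiveZ (hz.2 j j x Ox) (dcN i j Ox)))) => //.
by rewrite eqxx scale1r.
Qed.

Let bcN j : mbmeas (cNz j).
Proof.
apply: mbmeas_sum => i; apply: mbmeasZ; last exact: mbmeas_cst.
by case: hz.
Qed.

Let bcT i j : mbmeas (fun y => cT c (zz y) i j).
Proof. by have [bz _] := hz; apply: mbmeasB; apply: mbmeasZ => //; exact: bcN. Qed.

Let bcT' i j : mbmeas (fun y => cT' c (zz y) i j).
Proof.
have [bz _] := hz; apply: mbmeasB; apply: mbmeasD.
- by apply: mbmeasZ; [exact: bmeas_cst|exact: bcN].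
- by apply: mbmeasZ => //; exact: mbmeas_cst.
- exact: bcN.
- by apply: mbmeasZ => //; exact: mbmeas_cst.
Qed.

Let Kf j x := carlK c (zz x) (om x) (fun i => om1 i x) (q x) j.
Let Kf' j x := carlK' c (zz x) (om x) (fun i => om1 i x) (fun i j => om2 i j x) (q x) (q1 x) j.
Let G j x := 2^-1 * (phi x * Kf j x).
Let G' j x := carlG' c (zz x) (om x) (fun i => om1 i x) (fun i j => om2 i j x)
  (phi x) (f1 x) (q x) (q1 x) j.

Let dK j x : O x -> is_derive x (basis_vec j) (Kf j) (Kf' j x).
Proof.
move=> Ox; apply: (is_derive_ext (is_deriveDf
   (is_deriveMf (is_deriveMf (hz.2 j j x Ox) (dq j Ox)) (is_derive_dot (dom j Ox) (dom j Ox)))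
   (is_derive_sumf (index_enum 'I_n) (P := xpredT) (fun i _ =>
      is_derive_dot (dom j Ox) (mderive_mul (dcT i j Ox) (dom1 i j Ox)))))) => //.
by rewrite /Kf' /carlK' eqxx mul1r.
Qed.

Let dG j x : O x -> is_derive x (basis_vec j) (G j) (G' j x).
Proof.
move=> Ox; apply: (is_derive_ext (is_deriveMf (is_derive_cst (2^-1 : R) x (basis_vec j))
  (is_deriveMf (dphi j Ox) (dK j Ox)))) => //.
by rewrite /G' /carlG' mul0r add0r.
Qed.

Let bK j : bmeas (Kf j).
Proof.
have [bz _] := hz; apply: bmeasD.
  by apply: bmeasM; [exact: bmeasM|exact: bmeas_dot].
apply: bmeas_sum => i _; apply: bmeas_dot => //.
by apply: mbmeas_mul.
Qed.

Let bK' j : bmeas (Kf' j).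
Proof.
have [bz _] := hz; apply: bmeasD; first apply: bmeasD.
- apply: bmeasM; last exact: bmeas_dot.
  by apply: bmeasD => //; apply: bmeasM => //; exact: bmeasM.
- apply: bmeasM; first exact: bmeasM.
  by apply: bmeasD; exact: bmeas_dot.
- apply: bmeas_sum => i _; apply: bmeasD; apply: bmeas_dot => //.
    by apply: mbmeas_mul.
  by apply: mbmeasD; apply: mbmeas_mul.
Qed.

Let vK j : vanish_off (Kf j).
Proof.
move=> x nK; rewrite /Kf /carlK vom// dot0l mulr0 add0r big1// => i _.
by rewrite dot0l.
Qed.

Let vK' j : vanish_off (Kf' j).
Proof.
move=> x nK; rewrite /Kf' /carlK' vom// vom1// !(dot0l, addr0, mulr0, add0r) big1// => i _.
by rewrite !(dot0l, addr0).
Qed.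

Lemma carleman_integral :
  \I (fun x => - (2 * (ssq x * q1 x) * phi x * dot (om x) (om x))) <=
  \I (fun x => phi x * (ssq x * dot (diracop c (fun i => om1 i x)) (diracop c (fun i => om1 i x)))).
Proof.
have bG' j : bmeas (G' j).
  have [bz _] := hz; apply: bmeasM; first exact: bmeas_cst.
  apply: bmeasD; last by apply: bmeasM; last exact: bK'.
  by apply: bmeasM; [exact: bmeasM|exact: bK].
have vG' j : vanish_off (G' j).
  move=> x nK; rewrite /G' /carlG' -/(Kf j x) -/(Kf' j x) vK// vK'//.
  by rewrite !mulr0 addr0 mulr0.
have H0 : \I (fun x => \sum_j G' j x) = 0.
  apply: (divergence_integral0 (G := G)) => //.
  - by move=> j x nK; rewrite /G vK// !mulr0.
  - by move=> j; apply: bmeasM; [exact: bmeas_cst|exact: bmeasM].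
have bs := bmeas_ssq.
have bd : mbmeas (fun x => diracop c (fun i => om1 i x)).
  by apply: mbmeas_sum => i; apply: mbmeas_mul => //; exact: mbmeas_cst.
have vd x : ~ K x -> diracop c (fun i => om1 i x) = 0.
  by move=> nK; rewrite /diracop big1// => i _; rewrite vom1// mulmx0.
have i1 : intg (fun x => \sum_j G' j x).
  by apply: intg_sum => j _; apply: intg_vanish.
have i2 : intg (fun x => - (2 * (ssq x * q1 x) * phi x * dot (om x) (om x))).
  apply: intg_vanish; last by move=> x nK; rewrite vom// dot0l mulr0 oppr0.
  apply: bmeasN; apply: bmeasM; last exact: bmeas_dot.
  by do 2 (apply: bmeasM => //); [exact: bmeas_cst|exact: bmeasM].
have i3 : intg (fun x => phi x * (ssq x * dot (diracop c (fun i => om1 i x)) (diracop c (fun i => om1 i x)))).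
  apply: intg_vanish; last by move=> x nK; rewrite vd// dot0l !mulr0.
  by do 2 (apply: bmeasM => //); exact: bmeas_dot.
(* The divergence has integral 0, so 4 times it is added to the left side in order to compare
   integrands by [carleman_pointwise]. *)
have i4 := intgZ 4 i1; have := RID i4 i2.
rewrite (RIZ 4 i1) H0 mulr0 add0r => <-.
apply: RI_le => //; first exact: intgD.
move=> x; have [Kx|nK] := pselect (K x).
  exact: (carleman_pointwise hc (om x) (fun i => om1 i x) (fun i j => om2C i j Kx) (q1 x) (hf1 Kx) (phi0 Kx)).
rewrite vd// vom// !dot0l !mulr0 oppr0 addr0 big1 ?mulr0// => j _.
exact: vG'.
Qed.

End carleman.

Section caccioppoli.
Variables (u : 'I_n -> 'rV[R]_n -> R) (u1 : 'I_n -> 'I_n -> 'rV[R]_n -> R)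
  (u2 : 'I_n -> 'I_n -> 'rV[R]_n -> R) (p : 'rV[R]_n -> R) (p1 : 'I_n -> 'rV[R]_n -> R)
  (F : 'I_n -> 'rV[R]_n -> R) (ze : 'rV[R]_n -> R) (ze1 : 'I_n -> 'rV[R]_n -> R)
  (l l' : 'rV[R]_n -> R).
Hypotheses (bu : forall i, bmeas (u i)) (bu1 : forall i j, bmeas (u1 i j))
  (bu2 : forall i j, bmeas (u2 i j)) (bp : bmeas p) (bp1 : forall i, bmeas (p1 i))
  (bF : forall i, bmeas (F i)) (bze : bmeas ze) (bze1 : forall j, bmeas (ze1 j))
  (bl : bmeas l) (bl' : bmeas l').
Hypotheses (du : forall i j x, O x -> is_derive x (basis_vec j) (u i) (u1 i j x))
  (du1 : forall i j x, O x -> is_derive x (basis_vec j) (u1 i j) (u2 i j x))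
  (dp : forall j x, O x -> is_derive x (basis_vec j) p (p1 j x))
  (dze : forall j x, O x -> is_derive x (basis_vec j) ze (ze1 j x)).
Hypotheses (vze : vanish_off ze) (vze1 : forall j, vanish_off (ze1 j)).
Hypotheses (stokes : forall i x, K x -> \sum_j u2 i j x + F i x + p1 i x = 0)
  (divfree : forall x, K x -> \sum_i u1 i i x = 0)
  (ll' : forall x, K x -> l x * l' x = 1) (l0 : forall x, K x -> 0 < l x).

Let G j x := ze x ^+ 2 * (\sum_i u i x * u1 i j x + p x * u j x).
Let G' j x := 2 * ze x * ze1 j x * (\sum_i u i x * u1 i j x + p x * u j x) +
  ze x ^+ 2 * (\sum_i (u1 i j x * u1 i j x + u i x * u2 i j x) + (p1 j x * u j x + p x * u1 j j x)).

Let dG j x : O x -> is_derive x (basis_vec j) (G j) (G' j x).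
Proof.
move=> Ox.
have h := is_deriveDf (is_derive_sumf (index_enum 'I_n) (P := xpredT)
  (fun i _ => is_deriveMf (du i j Ox) (du1 i j Ox))) (is_deriveMf (dp j Ox) (du j j Ox)).
apply: (is_derive_ext (is_deriveMf (is_deriveMf (dze j Ox) (dze j Ox)) h)) => [y|].
  by rewrite /G expr2.
by rewrite /G'; ring.
Qed.

(** Energy identity: [G] is the flux obtained on multiplying the system by [ze^2 u]. The term
    [ze^2 p div u] vanishes, half of the gradient is absorbed when the derivatives of [ze] are
    estimated by Young's inequality, and the product [u . F] is split with the balancing weights [l]
    and [l' = 1 / l]. *)
Lemma caccioppoli_pointwise x : K x ->
  ze x ^+ 2 * (\sum_i \sum_j u1 i j x ^+ 2) <= 2 * \sum_j G' j x
   + (6 * (\sum_j ze1 j x ^+ 2) * (\sum_i u i x ^+ 2) + 2 * n%:R * ze x ^+ 2 * p x ^+ 2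
     + ze x ^+ 2 * l x * (\sum_i F i x ^+ 2) + ze x ^+ 2 * l' x * (\sum_i u i x ^+ 2)).
Proof.
move=> Kx.
have E1 : \sum_j G' j x = \sum_j 2 * ze x * ze1 j x * (\sum_i u i x * u1 i j x + p x * u j x)
   + ze x ^+ 2 * (\sum_i \sum_j u1 i j x ^+ 2) - ze x ^+ 2 * \sum_i u i x * F i x.
  rewrite /G' big_split /= -addrA; congr (_ + _).
  rewrite -mulr_sumr -mulrBr; congr (_ * _).
  rewrite big_split /= [X in _ + X]big_split /= -[X in _ + (_ + X)]mulr_sumr divfree// mulr0 addr0 exchange_big /=.
  rewrite (eq_bigr (fun i => \sum_j u1 i j x ^+ 2 + u i x * \sum_j u2 i j x)); last first.
    by move=> i _; rewrite mulr_sumr -big_split; apply: eq_bigr => j _; rewrite expr2.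
  rewrite big_split /= -addrA; congr (_ + _).
  rewrite -big_split -sumrN; apply: eq_bigr => i _ /=.
  have -> : \sum_j u2 i j x = - (F i x + p1 i x) by apply/eqP; rewrite -addr_eq0 addrA stokes.
  ring.
have H1 : ze x ^+ 2 * \sum_i u i x * F i x <=
   2^-1 * (ze x ^+ 2 * l x * (\sum_i F i x ^+ 2) + ze x ^+ 2 * l' x * (\sum_i u i x ^+ 2)).
  rewrite (_ : 2^-1 * _ = ze x ^+ 2 * (2^-1 * (l x * (\sum_i F i x ^+ 2) + l' x * (\sum_i u i x ^+ 2)))); last by ring.
  rewrite ler_wpM2l ?sqr_ge0// !mulr_sumr -big_split mulr_sumr /=.
  apply: ler_sum => i _.
  have L := l0 Kx; have LL := ll' Kx.
  have : 0 <= l' x * (l x * F i x - u i x) ^+ 2.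
    rewrite mulr_ge0 ?sqr_ge0//.
    by rewrite -(pmulr_rge0 _ L) LL.
  have -> : l' x * (l x * F i x - u i x) ^+ 2 =
     (l x * l' x) * (l x * F i x ^+ 2) - 2 * (l x * l' x) * (u i x * F i x) + l' x * u i x ^+ 2 by ring.
  rewrite LL; lra.
have H2 j : - (2 * ze x * ze1 j x * (\sum_i u i x * u1 i j x + p x * u j x)) <=
   \sum_i (2 * ze1 j x ^+ 2 * u i x ^+ 2 + 2^-1 * (ze x ^+ 2 * u1 i j x ^+ 2))
    + (ze x ^+ 2 * p x ^+ 2 + ze1 j x ^+ 2 * u j x ^+ 2).
  rewrite mulrDr opprD lerD//.
    rewrite mulr_sumr -sumrN; apply: ler_sum => i _.
    have := sqr_ge0 (2 * (ze1 j x * u i x) + ze x * u1 i j x); nra.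
  have := sqr_ge0 (ze x * p x + ze1 j x * u j x); nra.
have H3 : \sum_j - (2 * ze x * ze1 j x * (\sum_i u i x * u1 i j x + p x * u j x)) <=
   3 * (\sum_j ze1 j x ^+ 2) * (\sum_i u i x ^+ 2) + n%:R * ze x ^+ 2 * p x ^+ 2
   + 2^-1 * (ze x ^+ 2 * (\sum_i \sum_j u1 i j x ^+ 2)).
  apply: le_trans (ler_sum _ (fun j _ => H2 j)) _.
  rewrite big_split /=.
  have -> : \sum_j \sum_i (2 * ze1 j x ^+ 2 * u i x ^+ 2 + 2^-1 * (ze x ^+ 2 * u1 i j x ^+ 2))
     = 2 * (\sum_j ze1 j x ^+ 2) * (\sum_i u i x ^+ 2) + 2^-1 * (ze x ^+ 2 * (\sum_i \sum_j u1 i j x ^+ 2)).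
    rewrite (eq_bigr (fun j => 2 * ze1 j x ^+ 2 * (\sum_i u i x ^+ 2) + \sum_i 2^-1 * (ze x ^+ 2 * u1 i j x ^+ 2))); last first.
      by move=> j _; rewrite big_split /= mulr_sumr.
    rewrite big_split /= -mulr_suml -mulr_sumr; congr (_ + _).
    rewrite exchange_big /= !mulr_sumr; apply: eq_bigr => i _.
    by rewrite !mulr_sumr.
  rewrite big_split /= sumr_const card_ord -mulr_natl.
  have : \sum_i ze1 i x ^+ 2 * u i x ^+ 2 <= (\sum_j ze1 j x ^+ 2) * (\sum_i u i x ^+ 2).
    rewrite mulr_suml; apply: ler_sum => i _; rewrite ler_wpM2l ?sqr_ge0//.
    by rewrite (bigD1 i)//= lerDl; apply: sumr_ge0 => j _; exact: sqr_ge0.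
  lra.
rewrite sumrN in H3; rewrite E1; lra.
Qed.

Lemma caccioppoli_integral :
  \I (fun x => ze x ^+ 2 * (\sum_i \sum_j u1 i j x ^+ 2)) <=
  \I (fun x => 6 * (\sum_j ze1 j x ^+ 2) * (\sum_i u i x ^+ 2) + 2 * n%:R * ze x ^+ 2 * p x ^+ 2
     + ze x ^+ 2 * l x * (\sum_i F i x ^+ 2) + ze x ^+ 2 * l' x * (\sum_i u i x ^+ 2)).
Proof.
have bG0 j : bmeas (fun x => \sum_i u i x * u1 i j x + p x * u j x).
  by apply: bmeasD; [apply: bmeas_sum => i _|]; exact: bmeasM.
have bG j : bmeas (G j) by apply: bmeasM => //; exact: bmeasX.
have bG' j : bmeas (G' j).
  apply: bmeasD; apply: bmeasM => //.
  - by do 2 (apply: bmeasM => //); exact: bmeas_cst.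
  - exact: bmeasX.
  - apply: bmeasD; last by apply: bmeasD; exact: bmeasM.
    by apply: bmeas_sum => i _; apply: bmeasD; exact: bmeasM.
have vG' j : vanish_off (G' j).
  by move=> x nK; rewrite /G' vze// expr0n /= mulr0 !mul0r addr0.
have H0 : \I (fun x => \sum_j G' j x) = 0.
  apply: (divergence_integral0 (G := G)) => //.
  by move=> j x nK; rewrite /G vze// expr0n /= mul0r.
have bsum (f : 'I_n -> 'rV[R]_n -> R) : (forall i, bmeas (f i)) -> bmeas (fun x => \sum_i f i x ^+ 2).
  by move=> bf; apply: bmeas_sum => i _; exact: bmeasX.
have bz2 : bmeas (fun x => ze x ^+ 2) by exact: bmeasX.
have i1 : intg (fun x => ze x ^+ 2 * (\sum_i \sum_j u1 i j x ^+ 2)).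
  apply: intg_vanish; last by move=> x nK; rewrite vze// expr0n /= mul0r.
  by apply: bmeasM => //; apply: bmeas_sum => i _; exact: bsum.
have i2 : intg (fun x => 6 * (\sum_j ze1 j x ^+ 2) * (\sum_i u i x ^+ 2) + 2 * n%:R * ze x ^+ 2 * p x ^+ 2
     + ze x ^+ 2 * l x * (\sum_i F i x ^+ 2) + ze x ^+ 2 * l' x * (\sum_i u i x ^+ 2)).
  apply: intg_vanish; last first.
    move=> x nK; rewrite vze// expr0n /= !(mulr0, mul0r, addr0).
    by rewrite big1 ?mulr0 ?mul0r// => j _; rewrite vze1// expr0n.
  apply: bmeasD; [apply: bmeasD; [apply: bmeasD|]|].
  - apply: bmeasM; last exact: bsum.
    by apply: bmeasM; [exact: bmeas_cst|exact: bsum].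
  - apply: bmeasM; last exact: bmeasX.
    by apply: bmeasM => //; exact: bmeas_cst.
  - by apply: bmeasM; [exact: bmeasM|exact: bsum].
  - by apply: bmeasM; [exact: bmeasM|exact: bsum].
have i3 : intg (fun x => \sum_j G' j x).
  by apply: intg_sum => j _; exact: intg_vanish.
have i4 := intgZ 2 i3; have := RID i4 i2.
rewrite (RIZ 2 i3) H0 mulr0 add0r => <-.
apply: RI_le => //; first exact: intgD.
move=> x; have [Kx|nK] := pselect (K x); first exact: caccioppoli_pointwise.
rewrite vze// expr0n /= !(mulr0, mul0r, addr0).
rewrite big1; last by move=> j _; exact: vG'.
by rewrite mulr0 add0r big1 ?mulr0 ?mul0r// => j _; rewrite vze1// expr0n.
Qed.

End caccioppoli.
End region.

(** * Logarithmic weights on annuli *)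

Section log_weights.
Context {R : realType}.
Implicit Types m l tau : R.

(* In terms of [r = expR tau], this is [r ^ (- m) * |ln r| ^ (- l)]. *)
Definition logweight m l tau : R := expR (- (m * tau + l * ln (- tau))).

Lemma logweight_gt0 m l tau : 0 < logweight m l tau. Proof. exact: expR_gt0. Qed.
Lemma logweight_ge0 m l tau : 0 <= logweight m l tau. Proof. exact: expR_ge0. Qed.

Lemma logweightM m l m' l' tau : logweight m l tau * logweight m' l' tau = logweight (m + m') (l + l') tau.
Proof. by rewrite /logweight -expRD; congr expR; ring. Qed.

Lemma logweight00 tau : logweight 0 0 tau = 1.
Proof. by rewrite /logweight !mul0r addr0 oppr0 expR0. Qed.

Lemma logweight01 tau : tau < 0 -> logweight 0 1 tau = (- tau)^-1.
Proof. by move=> t0; rewrite /logweight mul0r add0r mul1r expRN lnK// posrE oppr_gt0. Qed.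

Lemma logweight_le m l l' tau : tau <= -1 -> l <= l' -> logweight m l' tau <= logweight m l tau.
Proof.
move=> t1 ll; rewrite /logweight ler_expR lerN2 lerD2l ler_wpM2r// ln_ge0//; lra.
Qed.

Lemma is_derive_logweight m l tau : tau < 0 ->
  is_derive tau 1 (logweight m l) (- m * logweight m l tau + l * logweight m (l + 1) tau).
Proof.
move=> t0; have t0' : 0 < - tau by rewrite oppr_gt0.
have d1 : is_derive tau (1 : R) (fun s : R => - s) (-1) by exact: is_deriveN.
have d2 := is_derive1_comp (is_derive1_ln t0') d1.
have d3 : is_derive tau (1 : R) (- (m \*: (id : R -> R) + l \*: (@ln R \o (fun s : R => - s))))
   (- (m *: 1 + l *: ((- tau)^-1 * -1))).
  by apply: is_deriveN; apply: is_deriveD; apply: is_deriveZ.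
have d4 := is_derive1_comp (is_derive_expR _) d3.
have -> : logweight m l = expR \o (- (m \*: (id : R -> R) + l \*: (@ln R \o (fun s : R => - s)))) by [].
refine (is_derive_eq d4 _).
have -> : logweight m (l + 1) tau = logweight m l tau * (- tau)^-1.
  by rewrite -logweight01// logweightM addr0.
rewrite [expR _](_ : _ = logweight m l tau)//.
rewrite [X in - m * X](_ : _ = logweight m l tau)//.
rewrite /GRing.scale /=; ring.
Qed.

Lemma measurable_logweight m l : measurable_fun setT (logweight m l).
Proof.
apply: (measurableT_comp (@measurable_expR R)).
apply: measurable_funN; apply: measurable_funD; apply: measurable_funM => //.
by apply: (measurableT_comp (@measurable_ln R)); exact: measurable_funN.
Qed.

(** The bound is required on an interval only: [radial] truncates to an annulus, and on the whole
    line the weights are unbounded. *)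
Definition bm1 (a b : R) (h : R -> R) := measurable_fun setT h /\
  exists M : R, forall tau, a < tau < b -> `|h tau| <= M.

Lemma bm1M a b h g : bm1 a b h -> bm1 a b g -> bm1 a b (fun tau => h tau * g tau).
Proof.
move=> [mh [M hM]] [mg [L hL]]; split; first exact: measurable_funM.
by exists (M * L) => tau ht; rewrite normrM ler_pM// ?hM ?hL.
Qed.

Lemma bm1D a b h g : bm1 a b h -> bm1 a b g -> bm1 a b (fun tau => h tau + g tau).
Proof.
move=> [mh [M hM]] [mg [L hL]]; split; first exact: measurable_funD.
by exists (M + L) => tau ht; rewrite (le_trans (ler_normD _ _))// lerD ?hM ?hL.
Qed.

Lemma bm1_cst a b c : bm1 a b (fun=> c).
Proof. by split; [exact: measurable_cst|exists `|c|]. Qed.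

Lemma bm1X a b h k : bm1 a b h -> bm1 a b (fun tau => h tau ^+ k).
Proof.
move=> bh; elim: k => [|k IH].
  by under eq_fun do rewrite expr0; exact: bm1_cst.
by under eq_fun do rewrite exprS; exact: bm1M.
Qed.

Lemma bm1_logweight a b m l : b <= -1 -> bm1 a b (logweight m l).
Proof.
move=> b1; split; first exact: measurable_logweight.
exists (expR (`|m| * `|a| + `|l| * `|a|)) => tau /andP[at_ tb].
rewrite ger0_norm ?logweight_ge0// /logweight ler_expR.
have t1 : tau < -1 by exact: lt_le_trans b1.
have ta : - tau <= `|a|.
  have := ler_norm (- a); rewrite normrN; lra.
have lt0 : 0 <= ln (- tau) by rewrite ln_ge0//; lra.
have lta : ln (- tau) <= `|a|.
  apply: le_trans ta; have : 0 < - tau by lra.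
  move=> tp; have := expR_ge1Dx (ln (- tau)); rewrite lnK ?posrE//; lra.
rewrite opprD lerD//.
  rewrite -mulrN (le_trans (ler_norm _))// normrM ler_wpM2l// ger0_norm//; lra.
by rewrite -mulNr (le_trans (ler_norm _))// normrM normrN ler_wpM2l// ger0_norm.
Qed.

End log_weights.

(** * Annuli and radial functions in logarithmic scale *)

Section annulus.
Context {R : realType} {n : nat}.
Variables (x0 : 'rV[R]_n) (a b : R).
Hypotheses (ab : a <= b) (b2 : b <= -2).

Definition sqdist (x : 'rV[R]_n) : R := nsq (x - x0).
(** This is [log |x - x0|], computed from the squared distance, so that it is differentiated without
    a square root. *)
Definition logdist (x : 'rV[R]_n) : R := ln (sqdist x) / 2.
Definition annulus : set 'rV[R]_n := [set x | expR (2 * a) <= sqdist x <= expR (2 * b)].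
(** In the variable [tau = log r], [annulus] is [a <= tau <= b] and this set is
    [a - 1 < tau < b + 1]. With [b <= -2] one has [tau < -1] on it, where the weights decrease as
    the power of the logarithm grows. *)
Definition open_annulus : set 'rV[R]_n := [set x | expR (2 * a - 2) < sqdist x < expR (2 * b + 2)].
Definition radial (h : R -> R) (x : 'rV[R]_n) : R := \1_open_annulus x * h (logdist x).
Definition zt (i : 'I_n) (x : 'rV[R]_n) : R := \1_open_annulus x * (x ord0 i - x0 ord0 i).

Lemma sqdist_expR x : 0 < sqdist x -> sqdist x = expR (2 * logdist x).
Proof. by move=> s0; rewrite /logdist mulrCA divff// mulr1 lnK. Qed.

Lemma annulusE x : annulus x <-> 0 < sqdist x /\ a <= logdist x <= b.
Proof.
split=> [/andP[h1 h2]|[s0]].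
  have s0 := lt_le_trans (expR_gt0 _) h1; split => //.
  by move: h1 h2; rewrite (sqdist_expR s0) !ler_expR !ler_pM2l// => -> ->.
by rewrite /annulus /= (sqdist_expR s0) !ler_expR !ler_pM2l.
Qed.

Lemma open_annulusE x : open_annulus x <-> 0 < sqdist x /\ a - 1 < logdist x < b + 1.
Proof.
split=> [/andP[h1 h2]|[s0]].
  have s0 := lt_trans (expR_gt0 _) h1; split => //.
  move: h1 h2; rewrite (sqdist_expR s0) !ltr_expR => h1 h2; apply/andP; split; lra.
rewrite /open_annulus /= (sqdist_expR s0) !ltr_expR => /andP[h1 h2]; apply/andP; split; lra.
Qed.

Lemma sub_annulus : annulus `<=` open_annulus.
Proof. move=> x /annulusE[s0 /andP[h1 h2]]; apply/open_annulusE; split => //; apply/andP; split; lra. Qed.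

Lemma continuous_sqdist : continuous sqdist.
Proof.
have H i : Ck 0 (fun x : 'rV[R]_n => (x ord0 i + - x0 ord0 i) * (x ord0 i + - x0 ord0 i)).
  by apply: CkM; apply: CkD; [exact: Ck_coord|exact: Ck_cst|exact: Ck_coord|exact: Ck_cst].
have := Ck_cont (Ck_sum (index_enum 'I_n) H).
rewrite (_ : (fun x => _) = sqdist)//; apply/funext => x; rewrite /sqdist /nsq.
by apply: eq_bigr => i _; rewrite !mxE expr2.
Qed.

Lemma near_sqdist_lt x e : sqdist x < e -> \forall y \near x, sqdist y < e.
Proof. by move=> h; have /cvgr_lt := continuous_sqdist (x := x); exact. Qed.

Lemma near_sqdist_gt x e : e < sqdist x -> \forall y \near x, e < sqdist y.
Proof. by move=> h; have /cvgr_gt := continuous_sqdist (x := x); exact. Qed.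

Lemma near_open_annulus x : open_annulus x -> \forall y \near x, open_annulus y.
Proof.
move=> /andP[h1 h2]; have := near_sqdist_lt h2; have := near_sqdist_gt h1.
by apply: filterS2 => y k1 k2; apply/andP.
Qed.

Lemma annulus_collar : collar_of open_annulus annulus.
Proof.
split; first by move=> x; exact: sub_annulus.
- exists (1 + `|x0|) => x /andP[_ h] i.
  have -> : x ord0 i = (x - x0) ord0 i + x0 ord0 i by rewrite !mxE subrK.
  rewrite (le_trans (ler_normD _ _))// lerD ?coord_le_norm//.
  have h1 : (x - x0) ord0 i ^+ 2 <= 1.
    apply: le_trans (coord_le_nsq _ _) _; apply: le_trans h _.
    by rewrite expR_le1; move: b2; lra.
  by rewrite -(@ler_sqr _ `|_| 1) ?nnegrE// real_normK ?num_real// expr1n.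
- move=> x nO; have [h|h] := leP (sqdist x) (expR (2 * a - 2)).
    have h1 : sqdist x < expR (2 * a) by apply: le_lt_trans h _; rewrite ltr_expR; lra.
    by have := near_sqdist_lt h1; apply: filterS => y hy /andP[]; rewrite leNgt hy.
  have h1 : expR (2 * b + 2) <= sqdist x.
    by rewrite leNgt; apply/negP => h2; apply: nO; apply/andP.
  have h2 : expR (2 * b) < sqdist x by apply: lt_le_trans h1; rewrite ltr_expR; lra.
  by have := near_sqdist_gt h2; apply: filterS => y hy /andP[_]; rewrite leNgt hy.
Qed.

Lemma measurable_sqdist : measurable_fun setT sqdist.
Proof.
by apply: (measurableT_comp (@measurable_nsq R n)); exact: measurable_rV_shift.
Qed.

Lemma measurable_logdist : measurable_fun setT logdist.
Proof.
apply: measurable_funM => //; apply: (measurableT_comp (@measurable_ln R)).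
exact: measurable_sqdist.
Qed.

Lemma measurable_open_annulus : measurable open_annulus.
Proof.
rewrite (_ : open_annulus = sqdist @^-1` `]expR (2 * a - 2), expR (2 * b + 2)[%classic).
  by rewrite -[X in measurable X]setTI; apply: measurable_sqdist.
by apply/seteqP; split => x; rewrite /open_annulus /= in_itv.
Qed.

Lemma measurable_annulus : measurable annulus.
Proof.
rewrite (_ : annulus = sqdist @^-1` `[expR (2 * a), expR (2 * b)]%classic).
  by rewrite -[X in measurable X]setTI; apply: measurable_sqdist.
by apply/seteqP; split => x; rewrite /annulus /= in_itv.
Qed.

Lemma rad_in h x : open_annulus x -> radial h x = h (logdist x).
Proof. by move=> Ox; rewrite /radial indicE mem_set// mul1r. Qed.

Lemma rad_out h x : ~ open_annulus x -> radial h x = 0.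
Proof. by move=> Ox; rewrite /radial indicE memNset// mul0r. Qed.

Lemma zt_in i x : open_annulus x -> zt i x = x ord0 i - x0 ord0 i.
Proof. by move=> Ox; rewrite /zt indicE mem_set// mul1r. Qed.

Lemma radM h g x : radial (fun t => h t * g t) x = radial h x * radial g x.
Proof.
have [Ox|nO] := pselect (open_annulus x); first by rewrite !rad_in.
by rewrite !rad_out// mul0r.
Qed.

Lemma rad_ge0 h x : (forall tau, a - 1 < tau < b + 1 -> 0 <= h tau) -> 0 <= radial h x.
Proof.
move=> h0; have [Ox|nO] := pselect (open_annulus x); last by rewrite rad_out.
by rewrite rad_in// h0//; have [_] := (open_annulusE x).1 Ox.
Qed.

Lemma bmeas_rad h : bm1 (a - 1) (b + 1) h -> bmeas (radial h).
Proof.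
move=> [mh [M hM]]; split.
  apply: measurable_funM; first by apply: measurable_indic; exact: measurable_open_annulus.
  by apply: (measurableT_comp mh); exact: measurable_logdist.
exists `|M| => x; have [Ox|nO] := pselect (open_annulus x); last by rewrite rad_out// normr0.
rewrite rad_in// (le_trans (hM _ _)) ?ler_norm//.
by have [_] := (open_annulusE x).1 Ox.
Qed.

Lemma vanish_rad h : (forall tau, ~~ (a <= tau <= b) -> h tau = 0) -> vanish_off annulus (radial h).
Proof.
move=> h0 x nK; have [Ox|nO] := pselect (open_annulus x); last by rewrite rad_out.
rewrite rad_in//; apply: h0; apply/negP => hab; apply: nK; apply/annulusE; split => //.
by have [] := (open_annulusE x).1 Ox.
Qed.

Lemma is_derive_sqdist x j : is_derive x (basis_vec j) sqdist (2 * (x ord0 j - x0 ord0 j)).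
Proof.
have d := is_derive_nsq_basis (x - x0) j.
have := (@is_derive_line R n (x - x0) (basis_vec j) (@nsq R n) 0 (2 * (x ord0 j - x0 ord0 j))).2.
rewrite scale0r add0r => H.
have h : is_derive (0 : R) 1 (fun k : R => nsq (k *: basis_vec j + (x - x0))) (2 * (x ord0 j - x0 ord0 j)).
  by apply: H; move: d; rewrite !mxE.
have := (@is_derive_line R n x (basis_vec j) sqdist 0 (2 * (x ord0 j - x0 ord0 j))).1.
rewrite scale0r add0r; apply.
by move: h; under eq_fun do rewrite addrA.
Qed.

(** The derivative of [log r] in the direction [j] is [z_j / r^2], and [logweight 2 0] is [1 / r^2].
    The derivative is thus again a radial function times [zt j], the form required of [phi] and
    [q]. *)
Lemma is_derive_rad h h' x j : open_annulus x -> is_derive (logdist x) 1 h (h' (logdist x)) ->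
  is_derive x (basis_vec j) (radial h) (radial (fun tau => h' tau * logweight 2 0 tau) x * zt j x).
Proof.
move=> Ox dh; have [s0 _] := (open_annulusE x).1 Ox.
have dl : is_derive x (basis_vec j) (fun y => ln (sqdist y)) ((sqdist x)^-1 * (2 * (x ord0 j - x0 ord0 j))).
  by apply: is_derive_comp; [exact: is_derive1_ln|exact: is_derive_sqdist].
have dt := is_deriveMf dl (is_derive_cst (2^-1 : R) x (basis_vec j)).
have H := is_derive_comp dh dt.
have E : h' (logdist x) * ((sqdist x)^-1 * (2 * (x ord0 j - x0 ord0 j)) * cst (2^-1) x + ln (sqdist x) * 0)
   = radial (fun tau => h' tau * logweight 2 0 tau) x * zt j x.
  rewrite rad_in// zt_in// /logweight mul0r addr0 expRN -sqdist_expR// /cst.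
  by field; rewrite gt_eqF.
rewrite E in H.
apply: (near_eq_is_derive _ H).
by apply: filterS (near_open_annulus Ox) => y Oy; rewrite rad_in.
Qed.

Lemma sum_zt_sqr x : open_annulus x -> \sum_i zt i x ^+ 2 = sqdist x.
Proof. by move=> Ox; rewrite /sqdist /nsq; apply: eq_bigr => i _; rewrite zt_in// !mxE. Qed.

Lemma sum_zt_rad x : \sum_i zt i x ^+ 2 = radial (logweight (-2) 0) x.
Proof.
have [Ox|nO] := pselect (open_annulus x); last first.
  by rewrite rad_out// big1// => i _; rewrite /zt indicE memNset// mul0r expr0n.
rewrite sum_zt_sqr// rad_in// /logweight mul0r addr0 mulNr opprK -sqdist_expR//.
by have [] := (open_annulusE x).1 Ox.
Qed.

Lemma annulus_good_coord : good_coord open_annulus zt.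
Proof.
split=> [i|i j x Ox].
- split.
    apply: measurable_funM; first by apply: measurable_indic; exact: measurable_open_annulus.
    by apply: measurable_funB => //; exact: measurable_rV_coord.
  exists 1 => x; have [Ox|nO] := pselect (open_annulus x); last by rewrite /zt indicE memNset// mul0r normr0.
  rewrite zt_in// -(@ler_sqr _ `|_| 1) ?nnegrE// real_normK ?num_real// expr1n.
  have := coord_le_nsq (x - x0) i; rewrite !mxE => h; apply: le_trans h _.
  have /andP[_ h] := Ox; apply: le_trans (ltW h) _.
  by rewrite expR_le1; move: b2; lra.
- have d := is_deriveDf (is_derive_coord x (basis_vec j) i) (is_derive_cst (- x0 ord0 i) x (basis_vec j)).
  have E : (basis_vec j : 'rV[R]_n) ord0 i + 0 = (i == j)%:R by rewrite mxE eqxx addr0.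
  rewrite E in d; apply: (near_eq_is_derive _ d).
  by apply: filterS (near_open_annulus Ox) => y Oy; rewrite zt_in.
Qed.

End annulus.

Section radial_gradient.
Context {R : realType} {n : nat}.
Variables (x0 : 'rV[R]_n) (a b : R).

Lemma sum_radial_grad_sqr (g : R -> R) x :
  \sum_j (radial x0 a b (fun tau => g tau * logweight 2 0 tau) x * zt x0 a b j x) ^+ 2 =
  radial x0 a b (fun tau => g tau ^+ 2 * logweight 2 0 tau) x.
Proof.
under eq_bigr do rewrite exprMn.
rewrite -mulr_sumr sum_zt_rad expr2 -!radM; congr (radial _ _ _ _ x); apply/funext => tau.
have := logweightM 2 0 (-2) 0 tau; rewrite subrr addr0 logweight00 => h.
transitivity (g tau ^+ 2 * logweight 2 0 tau * (logweight 2 0 tau * logweight (-2) 0 tau)); first ring.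
by rewrite h mulr1.
Qed.

End radial_gradient.

(** * The Carleman inequality with a radial cut-off *)

Section cutoff_carleman.
Context {R : realType} {n N : nat}.
Local Notation mu := (@lebesgue_rV R n).
Local Notation "'\I' f" := (\int[mu]_x f x) (at level 10, f at level 9).
Variables (x0 : 'rV[R]_n) (a b : R).
Hypotheses (ab : a <= b) (b2 : b <= -2).
Local Notation K := (annulus x0 a b).
Local Notation O := (open_annulus x0 a b).
Local Notation rad := (radial x0 a b).
Local Notation z := (zt x0 a b).

Variables (th th1 th2 : R -> R).
Hypotheses (dth : forall tau, is_derive tau (1 : R) th (th1 tau))
  (dth1 : forall tau, is_derive tau (1 : R) th1 (th2 tau)).
Hypotheses (bth : bm1 (a - 1) (b + 1) th) (bth1 : bm1 (a - 1) (b + 1) th1)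
  (bth2 : bm1 (a - 1) (b + 1) th2).
Hypotheses (vth : forall tau, ~~ (a <= tau <= b) -> th tau = 0)
  (vth1 : forall tau, ~~ (a <= tau <= b) -> th1 tau = 0).

Let hKO := annulus_collar (n := n) x0 a b2.
Let hz := annulus_good_coord (n := n) x0 a b2.

Lemma bm1_logweight_ann m l : bm1 (a - 1) (b + 1) (logweight m l).
Proof. by apply: bm1_logweight; move: b2; lra. Qed.

Lemma logdist_lt0 (x : 'rV[R]_n) : O x -> logdist x0 x < 0.
Proof. by move=> /(open_annulusE x0 a b x)[_ /andP[_ h]]; move: b2 h; lra. Qed.

Local Notation dlw20 := (fun tau => th2 tau * logweight 2 0 tau - th1 tau * (2 * logweight 2 0 tau)).

Let chi1 (j : 'I_n) x := rad (fun tau => th1 tau * logweight 2 0 tau) x * z j x.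
Let chi2 (i j : 'I_n) x := rad (fun tau => dlw20 tau * logweight 2 0 tau) x * z j x * z i x
  + rad (fun tau => th1 tau * logweight 2 0 tau) x * (i == j)%:R.

Let dchi (j : 'I_n) x : O x -> is_derive x (basis_vec j) (rad th) (chi1 j x).
Proof. by move=> Ox; exact: (is_derive_rad j Ox (dth _)). Qed.

Let dchi1 (i j : 'I_n) x : O x -> is_derive x (basis_vec j) (chi1 i) (chi2 i j x).
Proof.
move=> Ox; apply: is_deriveMf; last exact: hz.2.
have d : is_derive (logdist x0 x) (1 : R) (fun tau => th1 tau * logweight 2 0 tau) (dlw20 (logdist x0 x)).
  have d := is_deriveM (dth1 (logdist x0 x)) (is_derive_logweight 2 0 (logdist_lt0 Ox)).
  by refine (is_derive_eq d _); rewrite /GRing.scale /=; ring.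
exact: (is_derive_rad (h' := dlw20) j Ox d).
Qed.

Let bz i : bmeas (z i). Proof. by case: hz. Qed.

Let bchi : bmeas (rad th). Proof. exact: bmeas_rad. Qed.
Let brad1 : bmeas (rad (fun tau => th1 tau * logweight 2 0 tau)).
Proof. by apply: bmeas_rad; apply: bm1M => //; exact: bm1_logweight_ann. Qed.
Let bchi1 i : bmeas (chi1 i).
Proof. exact: bmeasM. Qed.
Let bchi2 i j : bmeas (chi2 i j).
Proof.
apply: bmeasD; last by apply: bmeasM => //; exact: bmeas_cst.
do 2 apply: bmeasM => //; apply: bmeas_rad; apply: bm1M; last exact: bm1_logweight_ann.
apply: bm1D; first by apply: bm1M => //; exact: bm1_logweight_ann.
have -> : (fun tau => - (th1 tau * (2 * logweight 2 0 tau))) = (fun tau => (- 2) * (th1 tau * logweight 2 0 tau)).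
  by apply/funext => tau; ring.
by apply: bm1M; [exact: bm1_cst|apply: bm1M => //; exact: bm1_logweight_ann].
Qed.

Let vchi : vanish_off K (rad th). Proof. exact: vanish_rad. Qed.
Let vchi1 i : vanish_off K (chi1 i).
Proof.
move=> x nK; rewrite /chi1 (vanish_rad (a := a) (b := b) _ nK) ?mul0r// => tau h.
by rewrite vth1// mul0r.
Qed.


Variables (c : 'I_n -> 'M[R]_N) (hc : clifford c).
Variables (om : 'rV[R]_n -> 'cV[R]_N) (om1 : 'I_n -> 'rV[R]_n -> 'cV[R]_N)
  (om2 : 'I_n -> 'I_n -> 'rV[R]_n -> 'cV[R]_N).
Hypotheses (bom : mbmeas om) (bom1 : forall i, mbmeas (om1 i))
  (bom2 : forall i j, mbmeas (om2 i j)).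
Hypothesis dom : forall j x, O x -> mderive x (basis_vec j) om (om1 j x).
Hypothesis dom1 : forall i j x, O x -> mderive x (basis_vec j) (om1 i) (om2 i j x).
Hypothesis om2C : forall i j x, O x -> om2 i j x = om2 j i x.
Variable k : R.

Let m := n%:R + 2 * k.
Let ka := rad th.
Let Om x := ka x *: om x.
Let Om1 j x := chi1 j x *: om x + ka x *: om1 j x.
Let Om2 i j x := (chi2 i j x *: om x + chi1 i x *: om1 j x) + (chi1 j x *: om1 i x + ka x *: om2 i j x).

Let D x := diracop c (fun i => om1 i x).

Lemma diracop_cutoff x : diracop c (fun i => Om1 i x) = cliffv c (fun i => chi1 i x) *m om x + ka x *: D x.
Proof.
rewrite /diracop /Om1 /cliffv mulmx_suml /D /diracop scaler_sumr -big_split /=.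
by apply: eq_bigr => i _; rewrite mulmxDr -!scalemxAr -scalemxAl.
Qed.

(** The inequality [carleman_integral] for [th(log r) om]. The commutator of [D] with the cut-off is
    Clifford multiplication by its gradient, of squared length [th1^2 / r^2]; it is separated from
    [D om] by [|A + B|^2 <= 2 |A|^2 + 2 |B|^2]. *)
Lemma cutoff_carleman :
  2 * k * \I (fun x => rad (fun tau => logweight m (2 * k + 2) tau * th tau ^+ 2) x * dot (om x) (om x)) <=
  2 * \I (fun x => rad (fun tau => logweight (m - 2) (2 * k) tau * th tau ^+ 2) x * dot (D x) (D x)) +
  2 * \I (fun x => rad (fun tau => logweight m (2 * k) tau * th1 tau ^+ 2) x * dot (om x) (om x)).
Proof.
pose phi := rad (logweight m (2 * k)).
pose f1 := rad (fun tau => (- m * logweight m (2 * k) tau + 2 * k * logweight m (2 * k + 1) tau) * logweight 2 0 tau).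
(* Forced by [r phi' = - (n + 2 q) phi] for the weight [r^(-m) |log r|^(-2 k)]. Its logarithmic
   derivative [- k / (log r)^2] is the only source of positivity: without the logarithm in the
   weight [q] would be constant and nothing would be gained. *)
pose q := rad (fun tau => k - k * logweight 0 1 tau).
pose q1 := rad (fun tau => - (k * logweight 0 2 tau) * logweight 2 0 tau).
have blw := bm1_logweight_ann.
have bphi : bmeas phi by exact: bmeas_rad.
have bf1 : bmeas f1.
  by apply: bmeas_rad; apply: bm1M => //; apply: bm1D; apply: bm1M => //; exact: bm1_cst.
have bq : bmeas q.
  apply: bmeas_rad; apply: bm1D; first exact: bm1_cst.
  under [X in bm1 _ _ X]eq_fun do rewrite -mulNr.
  by apply: bm1M => //; exact: bm1_cst.
have bq1 : bmeas q1.
  apply: bmeas_rad; apply: bm1M => //.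
  under [X in bm1 _ _ X]eq_fun do rewrite -mulNr.
  by apply: bm1M => //; exact: bm1_cst.
have dphi j x : O x -> is_derive x (basis_vec j) phi (f1 x * z j x).
  move=> Ox; have d := is_derive_logweight m (2 * k) (logdist_lt0 Ox).
  exact: (is_derive_rad (h' := fun tau => - m * logweight m (2 * k) tau + 2 * k * logweight m (2 * k + 1) tau) j Ox d).
have dq j x : O x -> is_derive x (basis_vec j) q (q1 x * z j x).
  move=> Ox; have d : is_derive (logdist x0 x) (1 : R) (fun tau => k - k * logweight 0 1 tau) (- (k * logweight 0 2 (logdist x0 x))).
    have d := is_deriveB (is_derive_cst k (logdist x0 x) (1 : R)) (is_deriveZ k (is_derive_logweight 0 1 (logdist_lt0 Ox))).
    by refine (is_derive_eq d _); rewrite /GRing.scale /= (_ : 1 + 1 = 2 :> R)//; ring.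
  exact: (is_derive_rad (h' := fun tau => - (k * logweight 0 2 tau)) j Ox d).
have hf1 x : K x -> (\sum_i z i x ^+ 2) * f1 x = - ((n%:R + 2 * q x) * phi x).
  move=> /sub_annulus Ox; rewrite sum_zt_rad /f1 /q /phi !rad_in//.
  move: (logdist x0 x) => tau.
  have h1 : logweight (-2) 0 tau * logweight 2 0 tau = 1 :> R by rewrite logweightM addNr addr0 logweight00.
  have h2 : logweight m (2 * k + 1) tau = logweight m (2 * k) tau * logweight 0 1 tau by rewrite logweightM addr0.
  rewrite h2 mulrCA -mulrA h1 mulr1; rewrite /m; ring.
have phi0 x : K x -> 0 <= phi x by move=> _; apply: rad_ge0 => tau _; exact: logweight_ge0.
have bOm : mbmeas Om by exact: mbmeasZ.
have bOm1 i : mbmeas (Om1 i) by apply: mbmeasD; exact: mbmeasZ.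
have bOm2 i j : mbmeas (Om2 i j) by apply: mbmeasD; apply: mbmeasD; exact: mbmeasZ.
have dOm j x : O x -> mderive x (basis_vec j) Om (Om1 j x).
  by move=> Ox; apply: mderiveZ; [exact: dchi|exact: dom].
have dOm1 i j x : O x -> mderive x (basis_vec j) (Om1 i) (Om2 i j x).
  move=> Ox; apply: mderiveD; apply: mderiveZ => //; first exact: dchi1.
  - exact: dom.
  - exact: dchi.
  - exact: dom1.
have Om2C i j x : K x -> Om2 i j x = Om2 j i x.
  move=> /sub_annulus Ox; rewrite /Om2 (om2C i j Ox) -!addrA.
  have -> : chi2 i j x = chi2 j i x by rewrite /chi2 (eq_sym j i) mulrAC.
  by congr (_ + _); rewrite addrCA.
have H := carleman_integral hKO hz hc bphi bf1 bq bq1 dphi dq hf1 phi0 bOm bOm1 bOm2 dOm dOm1 Om2C.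
have vOm x : ~ K x -> Om x = 0 by move=> nK; rewrite /Om /ka vchi// scale0r.
have vOm1 i x : ~ K x -> Om1 i x = 0.
  by move=> nK; rewrite /Om1 /ka vchi// vchi1// !scale0r addr0.
move: H => /(_ vOm vOm1).
have bD : mbmeas D by apply: mbmeas_sum => i; apply: mbmeas_mul => //; exact: mbmeas_cst.
have v2 g x : ~ K x -> rad (fun tau => g tau * th tau ^+ 2) x = 0.
  by move=> nK; apply: (vanish_rad (a := a) (b := b)) nK => tau h; rewrite vth// expr0n mulr0.
have v12 g x : ~ K x -> rad (fun tau => g tau * th1 tau ^+ 2) x = 0.
  by move=> nK; apply: (vanish_rad (a := a) (b := b)) nK => tau h; rewrite vth1// expr0n mulr0.
have i1 : intg (fun x => rad (fun tau => logweight m (2 * k + 2) tau * th tau ^+ 2) x * dot (om x) (om x)).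
  apply: (intg_vanish hKO) => [|x nK]; last by rewrite v2// mul0r.
  apply: bmeasM; last exact: bmeas_dot.
  by apply: bmeas_rad; apply: bm1M => //; exact: bm1X.
have i2 : intg (fun x => rad (fun tau => logweight (m - 2) (2 * k) tau * th tau ^+ 2) x * dot (D x) (D x)).
  apply: (intg_vanish hKO) => [|x nK]; last by rewrite v2// mul0r.
  apply: bmeasM; last exact: bmeas_dot.
  by apply: bmeas_rad; apply: bm1M => //; exact: bm1X.
have i3 : intg (fun x => rad (fun tau => logweight m (2 * k) tau * th1 tau ^+ 2) x * dot (om x) (om x)).
  apply: (intg_vanish hKO) => [|x nK]; last by rewrite v12// mul0r.
  apply: bmeasM; last exact: bmeas_dot.
  by apply: bmeas_rad; apply: bm1M => //; exact: bm1X.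
rewrite -(RIZ (2 * k) i1) -(RIZ 2 i2) -(RIZ 2 i3) -RID; [|exact: intgZ|exact: intgZ].
have e1 x : - (2 * ((\sum_i z i x ^+ 2) * q1 x) * phi x * dot (Om x) (Om x)) =
   2 * k * (rad (fun tau => logweight m (2 * k + 2) tau * th tau ^+ 2) x * dot (om x) (om x)).
  rewrite sum_zt_rad /Om dotZl dotZr /ka.
  have [Ox|nO] := pselect (O x); last by rewrite !rad_out// !(mulr0, mul0r) oppr0.
  rewrite /q1 /phi !rad_in//; move: (logdist x0 x) => tau.
  have h1 : logweight (-2) 0 tau * logweight 2 0 tau = 1 :> R by rewrite logweightM addNr addr0 logweight00.
  have h2 : logweight m (2 * k + 2) tau = logweight m (2 * k) tau * logweight 0 2 tau by rewrite logweightM addr0.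
  transitivity (2 * k * (logweight (-2) 0 tau * logweight 2 0 tau) * (logweight m (2 * k) tau * logweight 0 2 tau) * th tau ^+ 2 * dot (om x) (om x)); first ring.
  by rewrite h1 -h2; ring.
rewrite (RI_eq e1) => /le_trans; apply.
have bDO : mbmeas (fun x => diracop c (fun i => Om1 i x)).
  by apply: mbmeas_sum => i; apply: mbmeas_mul => //; exact: mbmeas_cst.
apply: RI_le.
- apply: (intg_vanish hKO) => [|x nK].
    by do 2 (apply: bmeasM => //); [apply: bmeas_sum => i _; exact: bmeasX|exact: bmeas_dot].
  have -> : diracop c (fun i => Om1 i x) = 0.
    by rewrite /diracop big1// => i _; rewrite vOm1// mulmx0.
  by rewrite dot0l !mulr0.
- by apply: intgD; exact: intgZ.
- move=> x; rewrite diracop_cutoff sum_zt_rad.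
  have [Ox|nO] := pselect (O x); last by rewrite /phi !rad_out// !mul0r !mulr0 addr0.
  set A := _ *m om x; set B := ka x *: D x.
  have h := dotD_le2 A B.
  have eA : dot A A = rad (fun tau => th1 tau ^+ 2 * logweight 2 0 tau) x * dot (om x) (om x).
    by rewrite /A dot_cliffv// sum_radial_grad_sqr.
  have eB : dot B B = th (logdist x0 x) ^+ 2 * dot (D x) (D x).
    by rewrite /B /ka rad_in// dotZl dotZr mulrA expr2.
  move: h; rewrite eA eB /phi !rad_in//; move: (logdist x0 x) => tau h.
  have h1 : logweight (-2) 0 tau * logweight 2 0 tau = 1 :> R by rewrite logweightM addNr addr0 logweight00.
  have h2 : logweight (m - 2) (2 * k) tau = logweight m (2 * k) tau * logweight (-2) 0 tau by rewrite logweightM addr0.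
  have h3 : 0 <= logweight m (2 * k) tau * logweight (-2) 0 tau by rewrite mulr_ge0 ?logweight_ge0.
  rewrite mulrA; apply: le_trans (ler_wpM2l h3 h) _.
  rewrite h2 le_eqVlt; apply/orP; left; apply/eqP.
  transitivity (2 * (logweight m (2 * k) tau * logweight (-2) 0 tau * th tau ^+ 2 * dot (D x) (D x)) +
    2 * (logweight m (2 * k) tau * (logweight (-2) 0 tau * logweight 2 0 tau) * th1 tau ^+ 2 * dot (om x) (om x))); first ring.
  by rewrite h1; ring.
Qed.

End cutoff_carleman.

(** * The Stokes system as a pair of Dirac equations *)

Section clifford_dirac.
Context {R : realType} {n N : nat}.
Variables (c : 'I_n -> 'M[R]_N) (hc : clifford c).
Implicit Types v : 'cV[R]_N.

Lemma dot_clifford i v : dot (c i *m v) (c i *m v) = dot v v.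
Proof.
rewrite dot_mulmxl (hc.1 i) mulNmx mulmxA (cliffM c) (bivecii hc) eqxx sub0r mulNmx.
by rewrite opprK mul1mx.
Qed.

Lemma diracop_diracop (a : 'I_n -> 'I_n -> 'cV[R]_N) : (forall j k, a j k = a k j) ->
  diracop c (fun k => diracop c (fun j => a j k)) = - \sum_j a j j.
Proof.
move=> aC; rewrite /diracop.
transitivity (\sum_k \sum_j bivec c k j *m a j k - \sum_k \sum_j (k == j)%:R *: a j k).
  rewrite -sumrB; apply: eq_bigr => k _; rewrite mulmx_sumr -sumrB; apply: eq_bigr => j _.
  by rewrite mulmxA (cliffM c) mulmxBl mul_scalar_mx.
rewrite (sum_antisym (F := fun k j => bivec c k j *m a j k)) ?sub0r => [|k j]; last first.
  by rewrite (bivecN hc) mulNmx aC.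
congr (- _); apply: eq_bigr => k _; rewrite (bigD1 k)//= eqxx scale1r big1 ?addr0// => j jk.
by rewrite eq_sym (negbTE jk) scale0r.
Qed.

Lemma dot_sum_le (v : 'I_n -> 'cV[R]_N) :
  dot (\sum_i v i) (\sum_i v i) <= n%:R * \sum_i dot (v i) (v i).
Proof.
have H i j : dot (v i) (v j) <= 2^-1 * (dot (v i) (v i) + dot (v j) (v j)).
  by have := dot_ge0 (v i - v j); rewrite dotBl !dotBr (dotC (v j)); lra.
rewrite dot_suml; under eq_bigr do rewrite dot_sumr.
apply: le_trans (ler_sum _ (fun i _ => ler_sum _ (fun j _ => H i j))) _.
rewrite le_eqVlt; apply/orP; left; apply/eqP.
under eq_bigr do rewrite -mulr_sumr big_split /= sumr_const card_ord.
rewrite -mulr_sumr big_split /= sumr_const card_ord sumrMnl mulr_natl -mulr2n.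
by rewrite -[X in _ * X]mulr_natl mulrA mulVf ?mul1r ?pnatr_eq0.
Qed.

Lemma dot_diracop_le (w : 'I_n -> 'cV[R]_N) :
  dot (diracop c w) (diracop c w) <= n%:R * \sum_i dot (w i) (w i).
Proof.
by apply: le_trans (dot_sum_le _) _; under eq_bigr do rewrite dot_clifford.
Qed.

End clifford_dirac.

(** * Weighted integrals over annuli *)

Section radial_integrals.
Context {R : realType} {n : nat}.
Local Notation mu := (@lebesgue_rV R n).
Local Notation "'\I' f" := (\int[mu]_x f x) (at level 10, f at level 9).
Variables (x0 : 'rV[R]_n) (a b : R).
Hypotheses (ab : a <= b) (b2 : b <= -2).
Local Notation K := (annulus x0 a b).
Local Notation O := (open_annulus x0 a b).
Local Notation rad := (radial x0 a b).
Implicit Types (g h : R -> R) (f : 'rV[R]_n -> R).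

Definition cut_weight g := bm1 (a - 1) (b + 1) g /\ forall tau, ~~ (a <= tau <= b) -> g tau = 0.

Definition sqw (h : R -> R) m l tau : R := logweight m l tau * h tau ^+ 2.

Definition radint g f : R := \I (fun x => rad g x * f x).
Local Notation W := radint.

Lemma radint_intg g f : cut_weight g -> bmeas f -> intg (fun x => rad g x * f x).
Proof.
move=> [bg vg] bf; apply: (intg_vanish (annulus_collar x0 a b2)).
  by apply: bmeasM => //; exact: bmeas_rad.
by move=> x nK; rewrite (vanish_rad vg nK) mul0r.
Qed.

Lemma radint_le g f g' f' : cut_weight g -> cut_weight g' -> bmeas f -> bmeas f' ->
  (forall x, O x -> g (logdist x0 x) * f x <= g' (logdist x0 x) * f' x) -> W g f <= W g' f'.
Proof.
move=> cg cg' bf bf' H; apply: RI_le; [exact: radint_intg|exact: radint_intg|move=> x].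
have [Ox|nO] := pselect (O x); last by rewrite !rad_out// !mul0r.
by rewrite !rad_in//; exact: H.
Qed.

Lemma radint_ge0 g f : (forall x, O x -> 0 <= g (logdist x0 x) * f x) -> 0 <= W g f.
Proof.
move=> H; apply: RI_ge0 => x.
have [Ox|nO] := pselect (O x); last by rewrite !rad_out// !mul0r.
by rewrite !rad_in//; exact: H.
Qed.

Lemma radint_bmeasD g f f' : cut_weight g -> bmeas f -> bmeas f' ->
  W g (fun x => f x + f' x) = W g f + W g f'.
Proof.
move=> cg bf bf'; rewrite -RID; [|exact: radint_intg|exact: radint_intg].
by apply: RI_eq => x; rewrite mulrDr.
Qed.

Lemma radint_bmeasZ g f (r : R) : cut_weight g -> bmeas f -> W g (fun x => r * f x) = r * W g f.
Proof.
move=> cg bf; rewrite -RIZ; last exact: radint_intg.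
by apply: RI_eq => x; rewrite mulrCA.
Qed.

Lemma cut_weight_sqw m l g : cut_weight g -> cut_weight (sqw g m l).
Proof.
move=> [bg vg]; split; last by move=> tau h; rewrite /sqw vg// expr0n mulr0.
by apply: bm1M; [apply: bm1_logweight; move: b2; lra|exact: bm1X].
Qed.

Lemma logweight_le_ann m l l' x : O x -> l <= l' -> logweight m l' (logdist x0 x) <= logweight m l (logdist x0 x).
Proof.
move=> /(open_annulusE x0 a b x)[_ /andP[_ h]] ll; apply: logweight_le => //; move: b2 h; lra.
Qed.

End radial_integrals.

(** * Weighted estimates for differentiable solutions of the Stokes system *)

Section stokes_chain.
Context {R : realType} {n : nat}.
Variables (x0 : 'rV[R]_n) (a b : R).
Hypotheses (ab : a <= b) (b2 : b <= -2).
Local Notation O := (open_annulus x0 a b).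
Local Notation rad := (radial x0 a b).
Local Notation W := (radint x0 a b).

Variables (th th1 th2 : R -> R).
Hypotheses (dth : forall tau, is_derive tau (1 : R) th (th1 tau))
  (dth1 : forall tau, is_derive tau (1 : R) th1 (th2 tau)).
Hypotheses (cth : cut_weight a b th) (cth1 : cut_weight a b th1)
  (bth2 : bm1 (a - 1) (b + 1) th2).

Variables (u : 'I_n -> 'rV[R]_n -> R) (w : 'I_n -> 'I_n -> 'rV[R]_n -> R)
  (w1 : 'I_n -> 'I_n -> 'I_n -> 'rV[R]_n -> R)
  (w2 : 'I_n -> 'I_n -> 'I_n -> 'I_n -> 'rV[R]_n -> R)
  (p : 'rV[R]_n -> R) (p1 : 'I_n -> 'rV[R]_n -> R) (p2 : 'I_n -> 'I_n -> 'rV[R]_n -> R)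
  (F : 'I_n -> 'rV[R]_n -> R).
Hypotheses (bu : forall i, bmeas (u i)) (bw : forall i j, bmeas (w i j))
  (bw1 : forall i j k, bmeas (w1 i j k)) (bw2 : forall i j k l, bmeas (w2 i j k l))
  (bp : bmeas p) (bp1 : forall i, bmeas (p1 i)) (bp2 : forall i j, bmeas (p2 i j))
  (bF : forall i, bmeas (F i)).
Hypotheses (du : forall i j x, O x -> is_derive x (basis_vec j) (u i) (w i j x))
  (dw : forall i j k x, O x -> is_derive x (basis_vec k) (w i j) (w1 i j k x))
  (dw1 : forall i j k l x, O x -> is_derive x (basis_vec l) (w1 i j k) (w2 i j k l x))
  (dp : forall j x, O x -> is_derive x (basis_vec j) p (p1 j x))
  (dp1 : forall j k x, O x -> is_derive x (basis_vec k) (p1 j) (p2 j k x)).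
Hypotheses (w1C : forall i j k x, O x -> w1 i j k x = w1 i k j x)
  (w2C : forall i j k l x, O x -> w2 i j k l x = w2 i j l k x)
  (p2C : forall j k x, O x -> p2 j k x = p2 k j x).
Hypotheses (stokes : forall i x, O x -> \sum_j w1 i j j x + F i x + p1 i x = 0)
  (divfree : forall x, O x -> \sum_i w i i x = 0).
Variables (k : R) (k1 : 1 <= k).

Local Notation m := (n%:R + 2 * k).
Local Notation Su := (fun x => \sum_i u i x ^+ 2).
Local Notation Sw := (fun x => \sum_i \sum_j w i j x ^+ 2).
Local Notation SF := (fun x => \sum_i F i x ^+ 2).
Local Notation pp := (fun x => p x ^+ 2).

Let bSu : bmeas Su. Proof. by apply: bmeas_sum => i _; exact: bmeasX. Qed.
Let bSw : bmeas Sw.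
Proof. by apply: bmeas_sum => i _; apply: bmeas_sum => j _; exact: bmeasX. Qed.
Let bSF : bmeas SF. Proof. by apply: bmeas_sum => i _; exact: bmeasX. Qed.
Let bpp : bmeas pp. Proof. exact: bmeasX. Qed.

Let Su0 x : 0 <= Su x. Proof. by apply: sumr_ge0 => i _; exact: sqr_ge0. Qed.
Let Sw0 x : 0 <= Sw x.
Proof. by apply: sumr_ge0 => i _; apply: sumr_ge0 => j _; exact: sqr_ge0. Qed.
Let SF0 x : 0 <= SF x. Proof. by apply: sumr_ge0 => i _; exact: sqr_ge0. Qed.
Let pp0 x : 0 <= pp x. Proof. exact: sqr_ge0. Qed.

Let k0 : 0 <= k. Proof. by move: k1; lra. Qed.

Local Notation wt := (sqw th).
Local Notation wt1 := (sqw th1).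
Let cwt m' l : cut_weight a b (wt m' l). Proof. exact: cut_weight_sqw. Qed.
Let cwt1 m' l : cut_weight a b (wt1 m' l). Proof. exact: cut_weight_sqw. Qed.
Let wt0 m' l tau : 0 <= wt m' l tau. Proof. by rewrite mulr_ge0 ?logweight_ge0 ?sqr_ge0. Qed.
Let wt10 m' l tau : 0 <= wt1 m' l tau. Proof. by rewrite mulr_ge0 ?logweight_ge0 ?sqr_ge0. Qed.

(** The cut-off is [zeta = r^(-m/2) |log r|^(-k-2) th], whose square is the weight of the gradient.
    Its derivative costs a factor of order [k], whence the [k^2] in front of [Su]. The product
    [u . F] is balanced by [l = r^2] and [l' = r^(-2)]. *)
Lemma stokes_caccioppoli : W (wt m (2 * k + 4)) Sw <=
  (12 * (n%:R + 4) ^+ 2 * k ^+ 2 + 1) * W (wt (m + 2) (2 * k + 4)) Su +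
  12 * W (wt1 (m + 2) (2 * k + 2)) Su + 2 * n%:R * W (wt m (2 * k + 2)) pp +
  W (wt (m - 2) (2 * k)) SF.
Proof.
have [bt vt] := cth; have [bt1 vt1] := cth1.
have blw m' l' : bm1 (a - 1) (b + 1) (logweight m' l') by apply: bm1_logweight; move: b2; lra.
pose zeta tau := logweight (m / 2) (k + 2) tau * th tau.
pose zeta' tau := (- (m / 2) * logweight (m / 2) (k + 2) tau + (k + 2) * logweight (m / 2) (k + 2 + 1) tau) * th tau
  + logweight (m / 2) (k + 2) tau * th1 tau.
pose ze := rad zeta; pose ze1 (j : 'I_n) x := rad (fun tau => zeta' tau * logweight 2 0 tau) x * zt x0 a b j x.
have vz' tau : ~~ (a <= tau <= b) -> zeta' tau * logweight 2 0 tau = 0.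
  by move=> h; rewrite /zeta' vt// vt1// !mulr0 addr0 mul0r.
have bz' : bm1 (a - 1) (b + 1) (fun tau => zeta' tau * logweight 2 0 tau).
  apply: bm1M => //; apply: bm1D; last exact: bm1M.
  by apply: bm1M => //; apply: bm1D; apply: bm1M => //; exact: bm1_cst.
have bze : bmeas ze by apply: bmeas_rad; exact: bm1M.
have hz := annulus_good_coord x0 a b2.
have bze1 j : bmeas (ze1 j) by apply: bmeasM; [exact: bmeas_rad|case: hz].
have vze : vanish_off (annulus x0 a b) ze by apply: vanish_rad => tau h; rewrite /zeta vt// mulr0.
have vze1 j : vanish_off (annulus x0 a b) (ze1 j).
  by move=> x nK; rewrite /ze1 (vanish_rad vz' nK) mul0r.
have bl : bmeas (rad (logweight (-2) 0)) by exact: bmeas_rad.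
have bl' : bmeas (rad (logweight 2 0)) by exact: bmeas_rad.
have dze j x : O x -> is_derive x (basis_vec j) ze (ze1 j x).
  move=> Ox; have t0 : logdist x0 x < 0.
    by have [_ /andP[_ h]] := (open_annulusE x0 a b x).1 Ox; move: b2 h; lra.
  have d := is_deriveM (is_derive_logweight (m / 2) (k + 2) t0) (dth (logdist x0 x)).
  have d' : is_derive (logdist x0 x) (1 : R) zeta (zeta' (logdist x0 x)).
    by refine (is_derive_eq d _); rewrite /zeta' /GRing.scale /=; ring.
  exact: (is_derive_rad j Ox d').
have stokesK i x : annulus x0 a b x -> \sum_j w1 i j j x + F i x + p1 i x = 0.
  by move=> /(sub_annulus (b := b)) Ox; exact: stokes.
have divK x : annulus x0 a b x -> \sum_i w i i x = 0.
  by move=> /(sub_annulus (b := b)) Ox; exact: divfree.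
have ll' x : annulus x0 a b x -> rad (logweight (-2) 0) x * rad (logweight 2 0) x = 1.
  by move=> /sub_annulus Ox; rewrite !rad_in// logweightM addNr addr0 logweight00.
have l0 x : annulus x0 a b x -> 0 < rad (logweight (-2) 0) x.
  by move=> /sub_annulus Ox; rewrite rad_in// logweight_gt0.
have := caccioppoli_integral (annulus_collar x0 a b2) bu bw (fun i j => bw1 i j j) bp bp1 bF bze bze1
  bl bl' du (fun i j => dw i j j) dp dze vze vze1 stokesK divK ll' l0.
have LL tau : logweight (m / 2) (k + 2) tau * logweight (m / 2) (k + 2) tau = logweight m (2 * k + 4) tau.
  have h : (k + 2) + (k + 2) = 2 * k + 4 by ring.
  by rewrite logweightM h -splitr.
have ze2 x : ze x ^+ 2 = rad (wt m (2 * k + 4)) x.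
  rewrite /ze expr2 -radM; congr (radial _ _ _ _ x); apply/funext => tau.
  by rewrite /zeta /sqw -LL; ring.
rewrite (RI_eq (g := fun x => rad (wt m (2 * k + 4)) x * Sw x)); last by move=> x; rewrite ze2.
move=> /le_trans; apply.
have i1 := radint_intg x0 b2 (cwt (m + 2) (2 * k + 4)) bSu.
have i2 := radint_intg x0 b2 (cwt1 (m + 2) (2 * k + 2)) bSu.
have i3 := radint_intg x0 b2 (cwt m (2 * k + 2)) bpp.
have i4 := radint_intg x0 b2 (cwt (m - 2) (2 * k)) bSF.
rewrite -(RIZ _ i1) -(RIZ _ i2) -(RIZ _ i3).
have j12 := intgD (intgZ (12 * (n%:R + 4) ^+ 2 * k ^+ 2 + 1) i1) (intgZ 12 i2).
have j123 := intgD j12 (intgZ (2 * n%:R) i3).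
rewrite -(RID (intgZ _ i1) (intgZ _ i2)) -(RID j12 (intgZ _ i3)) -(RID j123 i4).
apply: RI_le; first last.
- move=> x; rewrite ze2 sum_radial_grad_sqr -/(Su x) -/(SF x) -/(pp x).
  have [Ox|nO] := pselect (O x); last by rewrite !rad_out// !(mulr0, mul0r, addr0).
  rewrite !rad_in//; have [_ /andP[_ tb]] := (open_annulusE x0 a b x).1 Ox.
  have hk : 2 * k + 2 <= 2 * k + 4 by lra.
  have hk' : 2 * k <= 2 * k + 4 by lra.
  have := logweight_le_ann b2 (m - 2) Ox hk'; have := logweight_le_ann b2 m Ox hk.
  have := logweight_le_ann b2 (m + 2) Ox hk.
  move: (logdist x0 x) tb => tau tb l1 l2 l3.
  have t0 : tau < -1 by move: b2 tb; lra.
  have n0 : 0 <= n%:R :> R by [].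
  have z2 : zeta' tau ^+ 2 <= 2 * ((n%:R + 4) ^+ 2 * k ^+ 2) * (logweight m (2 * k + 4) tau * th tau ^+ 2)
      + 2 * (logweight m (2 * k + 4) tau * th1 tau ^+ 2).
    pose la := logweight 0 1 tau; pose L := logweight (m / 2) (k + 2) tau.
    have la1 : 0 <= la <= 1.
      rewrite logweight_ge0 /la logweight01 ?invf_le1; move: t0; lra.
    have zE : zeta' tau = (- (m / 2) + (k + 2) * la) * (L * th tau) + L * th1 tau.
      have := logweightM (m / 2) (k + 2) 0 1 tau; rewrite addr0 => lE.
      by rewrite /zeta' -lE -/L -/la; ring.
    (* The two terms have opposite signs and are at most [n / 2 + k] and [k + 2] in absolute value;
       both are bounded by [(n + 4) k] as [k >= 1]. *)
    have hq : (- (m / 2) + (k + 2) * la) ^+ 2 <= (n%:R + 4) ^+ 2 * k ^+ 2.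
      move: la1 => /andP[la0 la1].
      have hnk : n%:R <= n%:R * k by rewrite ler_peMr.
      have hkla : (k + 2) * la <= k + 2 by rewrite ler_piMr//; move: k1; lra.
      have hkla0 : 0 <= (k + 2) * la by rewrite mulr_ge0//; move: k1; lra.
      rewrite -exprMn -[leLHS]real_normK ?num_real// ler_sqr ?nnegrE//.
        by rewrite ler_norml; apply/andP; split; move: k1; lra.
      by rewrite mulr_ge0 ?addr_ge0//; move: k1; lra.
    rewrite zE -LL -/L.
    have := sqr_ge0 ((- (m / 2) + (k + 2) * la) * (L * th tau) - L * th1 tau).
    have := ler_wpM2r (sqr_ge0 (L * th tau)) hq.
    set q := - (m / 2) + (k + 2) * la; set B := (n%:R + 4) ^+ 2 * k ^+ 2.
    nra.
  have lA : logweight m (2 * k + 4) tau * logweight 2 0 tau = logweight (m + 2) (2 * k + 4) tau by rewrite logweightM addr0.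
  have lB : logweight m (2 * k + 4) tau * logweight (-2) 0 tau = logweight (m - 2) (2 * k + 4) tau by rewrite logweightM addr0.
  have g1 := ler_wpM2r (mulr_ge0 (logweight_ge0 2 0 tau) (Su0 x)) z2.
  have g2 := ler_wpM2r (mulr_ge0 (sqr_ge0 (th1 tau)) (Su0 x)) l1.
  have g3 := ler_wpM2r (mulr_ge0 n0 (mulr_ge0 (sqr_ge0 (th tau)) (pp0 x))) l2.
  have g4 := ler_wpM2r (mulr_ge0 (sqr_ge0 (th tau)) (SF0 x)) l3.
  rewrite -lA in g2; rewrite -lB in g4; move: g1 g2 g3 g4.
  rewrite /sqw -lA -(mulrA 12).
  move: (logweight m (2 * k + 4) tau) (logweight m (2 * k + 2) tau) (logweight (m + 2) (2 * k + 2) tau)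
    (logweight (m - 2) (2 * k) tau) (logweight 2 0 tau) (logweight (-2) 0 tau) (Su x) (SF x) (pp x) (zeta' tau)
    (th tau) (th1 tau) (n%:R : R).
  move=> E1 E2 E3 E4 lam mu' s1 s2 s3 z' t t1 n' g1 g2 g3 g4.
  lra.
- by apply: intgD.
- apply: (intg_vanish (annulus_collar x0 a b2)) => [|x nK]; last first.
    rewrite vze// expr0n /= !(mulr0, mul0r, addr0).
    by rewrite big1 ?mulr0 ?mul0r// => j _; rewrite vze1// expr0n.
  have bze2 := bmeasX 2 bze.
  apply: bmeasD; [apply: bmeasD; [apply: bmeasD|]|].
  - apply: bmeasM => //; apply: bmeasM; first exact: bmeas_cst.
    by apply: bmeas_sum => j _; exact: bmeasX.
  - by apply: bmeasM => //; apply: bmeasM => //; exact: bmeas_cst.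
  - by apply: bmeasM => //; exact: bmeasM.
  - by apply: bmeasM => //; exact: bmeasM.
Qed.

Section with_clifford.
Variables (N : nat) (c : 'I_n -> 'M[R]_N.+1) (hc : clifford c).
Let s : 'cV[R]_N.+1 := delta_mx ord0 ord0.

Let ss : dot s s = 1.
Proof.
rewrite dotE (bigD1 ord0)//= mxE eqxx mulr1 big1 ?addr0// => i i0.
by rewrite mxE (negbTE i0) mul0r.
Qed.

Let U x := \sum_i u i x *: (c i *m s).
Let U1 j x := \sum_i w i j x *: (c i *m s).
Let U2 j k x := \sum_i w1 i j k x *: (c i *m s).
(** Third derivatives of [u] enter because [P] contains first derivatives and is differentiated
    twice in the Carleman identity. *)
Let U3 j k l x := \sum_i w2 i j k l x *: (c i *m s).
Let Q x := diracop c (fun j => U1 j x).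
Let P x := Q x - p x *: s.
Let P1 k x := diracop c (fun j => U2 j k x) - p1 k x *: s.
Let P2 k l x := diracop c (fun j => U3 j k l x) - p2 k l x *: s.

Let bvec (f : 'I_n -> 'rV[R]_n -> R) : (forall i, bmeas (f i)) ->
  mbmeas (fun x => \sum_i f i x *: (c i *m s)).
Proof. by move=> bf; apply: mbmeas_sum => i; apply: mbmeasZ => //; exact: mbmeas_cst. Qed.

Let bdir (f : 'I_n -> 'rV[R]_n -> 'cV[R]_N.+1) : (forall i, mbmeas (f i)) ->
  mbmeas (fun x => diracop c (fun j => f j x)).
Proof. by move=> bf; apply: mbmeas_sum => i; apply: mbmeas_mul => //; exact: mbmeas_cst. Qed.

Let bU : mbmeas U. Proof. exact: bvec. Qed.
Let bU1 j : mbmeas (U1 j). Proof. exact: bvec. Qed.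
Let bU2 j l : mbmeas (U2 j l). Proof. exact: bvec. Qed.
Let bU3 j l q : mbmeas (U3 j l q). Proof. exact: bvec. Qed.
Let bQ : mbmeas Q. Proof. exact: bdir. Qed.
Let bps (f : 'rV[R]_n -> R) : bmeas f -> mbmeas (fun x => f x *: s).
Proof. by move=> bf; apply: mbmeasZ => //; exact: mbmeas_cst. Qed.
Let bP : mbmeas P. Proof. by apply: mbmeasB => //; exact: bps. Qed.
Let bP1 j : mbmeas (P1 j). Proof. by apply: mbmeasB; [exact: bdir|exact: bps]. Qed.
Let bP2 j l : mbmeas (P2 j l). Proof. by apply: mbmeasB; [exact: bdir|exact: bps]. Qed.

Let dvec (f : 'I_n -> 'rV[R]_n -> R) (f1 : 'I_n -> 'rV[R]_n -> R) j x :
  (forall i, is_derive x (basis_vec j) (f i) (f1 i x)) ->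
  mderive x (basis_vec j) (fun x => \sum_i f i x *: (c i *m s)) (\sum_i f1 i x *: (c i *m s)).
Proof. by move=> df; apply: mderive_sum => i _; exact: mderiveZr. Qed.

Let ddir (f f1 : 'I_n -> 'rV[R]_n -> 'cV[R]_N.+1) j x :
  (forall i, mderive x (basis_vec j) (f i) (f1 i x)) ->
  mderive x (basis_vec j) (fun x => diracop c (fun j => f j x)) (diracop c (fun j => f1 j x)).
Proof. by move=> df; apply: mderive_sum => i _; exact: mderive_mulc. Qed.

Let dU j x : O x -> mderive x (basis_vec j) U (U1 j x).
Proof. by move=> Ox; apply: (@dvec _ (fun i => w i j)) => i; exact: du. Qed.
Let dU1 j l x : O x -> mderive x (basis_vec l) (U1 j) (U2 j l x).
Proof. by move=> Ox; apply: (@dvec _ (fun i => w1 i j l)) => i; exact: dw. Qed.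
Let dU2 j l q x : O x -> mderive x (basis_vec q) (U2 j l) (U3 j l q x).
Proof. by move=> Ox; apply: (@dvec _ (fun i => w2 i j l q)) => i; exact: dw1. Qed.
Let dP j x : O x -> mderive x (basis_vec j) P (P1 j x).
Proof.
move=> Ox; apply: mderiveB; last by apply: mderiveZr; exact: dp.
by apply: (@ddir _ (fun i => U2 i j)) => i; exact: dU1.
Qed.
Let dP1 j l x : O x -> mderive x (basis_vec l) (P1 j) (P2 j l x).
Proof.
move=> Ox; apply: mderiveB; last by apply: mderiveZr; exact: dp1.
by apply: (@ddir _ (fun i => U3 i j l)) => i; exact: dU2.
Qed.
Let U2C j l x : O x -> U2 j l x = U2 l j x.
Proof. by move=> Ox; apply: eq_bigr => i _; rewrite w1C. Qed.
Let P2C j l x : O x -> P2 j l x = P2 l j x.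
Proof.
move=> Ox; rewrite /P2 p2C//; congr (_ - _); apply: eq_bigr => i _; congr (_ *m _).
by apply: eq_bigr => q _; rewrite w2C.
Qed.

Let dotvec (f : 'I_n -> R) : dot (\sum_i f i *: (c i *m s)) (\sum_i f i *: (c i *m s)) = \sum_i f i ^+ 2.
Proof.
rewrite (_ : \sum_i _ = cliffv c f *m s) ?dot_cliffv// ?ss ?mulr1//.
by rewrite /cliffv mulmx_suml; apply: eq_bigr => i _; rewrite scalemxAl.
Qed.

Let dotQ_le x : dot (Q x) (Q x) <= n%:R * Sw x.
Proof.
apply: le_trans (dot_diracop_le hc _) _; rewrite ler_wpM2l// /Sw exchange_big /=.
by under eq_bigr do rewrite dotvec.
Qed.

(** Since [bivec] is skew, [dot (bivec c j i *m s) s] vanishes. Only the scalar parts of the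
    products [c j *m c i] remain, and they add up to [- div u]. *)
Let dotQs x : O x -> dot (Q x) s = 0.
Proof.
move=> Ox; rewrite /Q /diracop dot_suml.
transitivity (\sum_j \sum_i w i j x * (dot (bivec c j i *m s) s - (i == j)%:R)).
  apply: eq_bigr => j _; rewrite mulmx_sumr dot_suml; apply: eq_bigr => i _.
  rewrite -scalemxAr dotZl mulmxA (cliffM c) mulmxBl mul_scalar_mx dotBl dotZl ss mulr1.
  by rewrite eq_sym.
have h i j : dot (bivec c j i *m s) s = 0.
  have := dot_mulmxl (bivec c j i) s s; rewrite (bivec_tr hc) mulNmx dotNr (dotC s).
  by lra.
transitivity (\sum_j - w j j x); last by rewrite sumrN divfree// oppr0.
apply: eq_bigr => j _.
rewrite (bigD1 j)//= h eqxx big1 ?addr0 => [|i ij]; first by rewrite sub0r mulrN1.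
by rewrite h (negbTE ij) subrr mulr0.
Qed.

Let dotP x : O x -> dot (P x) (P x) = dot (Q x) (Q x) + pp x.
Proof.
move=> Ox; rewrite /P dotBl !dotBr !dotZl !dotZr (dotC s) dotQs// ss.
by rewrite /pp !mulr0 mulr1 subr0 sub0r opprK expr2.
Qed.

(** [D^2 = - Delta] on [U], and [D (p s)] is the sum of the [d_i p] times [c_i s]. Both are
    combinations of the vectors [c_i s], whose coefficients are compared by the momentum
    equation. *)
Let dotDP x : O x -> dot (diracop c (fun j => P1 j x)) (diracop c (fun j => P1 j x)) = SF x.
Proof.
move=> Ox.
have -> : diracop c (fun j => P1 j x) = \sum_i F i x *: (c i *m s).
  transitivity (diracop c (fun k => diracop c (fun j => U2 j k x)) - diracop c (fun k => p1 k x *: s)).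
    by rewrite -sumrB; apply: eq_bigr => j _; rewrite -mulmxBr.
  rewrite (diracop_diracop hc) => [|j l]; last exact: U2C.
  rewrite /U2 exchange_big /diracop -opprD -big_split -sumrN /=.
  apply: eq_bigr => i _; rewrite -scaler_suml -scalemxAr -scalerDl -scaleNr; congr (_ *: _).
  by apply/eqP; rewrite eq_sym -addr_eq0 addrCA addrA stokes.
exact: dotvec.
Qed.

(** The order [k + 1] is chosen so that the weight of [Q] on the right is exactly the weight on the
    left of [step2]. *)
Let step1 : (2 * k + 2) * W (wt (m + 2) (2 * k + 4)) Su <=
  2 * W (wt m (2 * k + 2)) (fun x => dot (Q x) (Q x)) + 2 * W (wt1 (m + 2) (2 * k + 2)) Su.
Proof.
have [bt vt] := cth; have [bt1 vt1] := cth1.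
have := cutoff_carleman b2 dth dth1 bt bt1 bth2 vt vt1 hc bU bU1 bU2 dU dU1 U2C (k + 1).
have -> : n%:R + 2 * (k + 1) = m + 2 by ring.
have -> : m + 2 - 2 = m by ring.
have -> : 2 * (k + 1) + 2 = 2 * k + 4 by ring.
have -> : 2 * (k + 1) = 2 * k + 2 by ring.
by have -> : Su = (fun x => dot (U x) (U x)) by apply/funext => x; rewrite /U dotvec.
Qed.

Let step2 : 2 * k * W (wt m (2 * k + 2)) (fun x => dot (Q x) (Q x) + pp x) <=
  2 * W (wt (m - 2) (2 * k)) SF + 2 * W (wt1 m (2 * k)) (fun x => dot (Q x) (Q x) + pp x).
Proof.
have [bt vt] := cth; have [bt1 vt1] := cth1.
have := cutoff_carleman b2 dth dth1 bt bt1 bth2 vt vt1 hc bP bP1 bP2 dP dP1 P2C k.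
have E g (f f' : 'rV[R]_n -> R) : (forall x, O x -> f x = f' x) ->
    \int[lebesgue_rV n]_x (rad g x * f x) = W g f'.
  move=> ff; apply: RI_eq => x; have [Ox|nO] := pselect (O x); first by rewrite ff.
  by rewrite rad_out// !mul0r.
rewrite (E _ _ (fun x => dot (Q x) (Q x) + pp x)) => [|x]; last exact: dotP.
rewrite (E _ _ SF) => [|x]; last exact: dotDP.
by rewrite (E _ _ (fun x => dot (Q x) (Q x) + pp x)) => [|x]; last exact: dotP.
Qed.


(** [step1] multiplied by [k] and followed by [step2] bounds [k^2] times the weighted norm of [u].
    This is what [stokes_caccioppoli] requires, so the resulting constant depends on [n] only. In
    the errors, [Q] is replaced by the full gradient by means of [dotQ_le]. *)
Lemma stokes_carleman_aux :
  W (wt (m + 2) (2 * k + 4)) Su + W (wt m (2 * k + 2)) pp + W (wt m (2 * k + 4)) Sw <=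
  (12 * (n%:R + 4) ^+ 2 + 16 + 2 * n%:R) * (n%:R ^+ 2 + 1) *
  (W (wt (m - 2) (2 * k)) SF + W (wt1 m (2 * k)) (fun x => Sw x + pp x)
   + k * W (wt1 (m + 2) (2 * k + 2)) Su).
Proof.
have bQQ : bmeas (fun x => dot (Q x) (Q x)) by exact: bmeas_dot.
have n0 : 0 <= n%:R :> R by [].
have nn : n%:R <= n%:R ^+ 2 + 1 :> R by have := sqr_ge0 (n%:R - 1 : R); nra.
have bSp : bmeas (fun x => Sw x + pp x) by exact: bmeasD.
have hE : W (wt1 m (2 * k)) (fun x => dot (Q x) (Q x) + pp x) <=
    (n%:R ^+ 2 + 1) * W (wt1 m (2 * k)) (fun x => Sw x + pp x).
  rewrite -(radint_bmeasZ x0 b2 _ (cwt1 _ _) bSp); apply: (radint_le b2 (cwt1 _ _) (cwt1 _ _)).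
  - exact: bmeasD.
  - by apply: bmeasM => //; exact: bmeas_cst.
  move=> x _; rewrite ler_wpM2l// mulrDr lerD//.
    by apply: le_trans (dotQ_le x) _; rewrite ler_wpM2r.
  by rewrite ler_peMl// lerDr sqr_ge0.
move: step1 step2 stokes_caccioppoli; rewrite (radint_bmeasD x0 b2 (cwt _ _) bQQ bpp).
have := radint_ge0 (x0 := x0) (a := a) (b := b) (fun x _ => mulr_ge0 (wt10 (m + 2) (2 * k + 2) (logdist x0 x)) (Su0 x)).
have := radint_ge0 (x0 := x0) (a := a) (b := b) (fun x _ => mulr_ge0 (wt0 m (2 * k + 2) (logdist x0 x)) (pp0 x)).
have := radint_ge0 (x0 := x0) (a := a) (b := b) (fun x _ => mulr_ge0 (wt0 m (2 * k + 2) (logdist x0 x)) (dot_ge0 (Q x))).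
have := radint_ge0 (x0 := x0) (a := a) (b := b) (fun x _ => mulr_ge0 (wt0 (m - 2) (2 * k) (logdist x0 x)) (SF0 x)).
have := radint_ge0 (x0 := x0) (a := a) (b := b) (fun x _ => mulr_ge0 (wt0 (m + 2) (2 * k + 4) (logdist x0 x)) (Su0 x)).
move: hE.
set X := W (wt (m + 2) (2 * k + 4)) Su; set Yp := W (wt m (2 * k + 2)) pp.
set Yq := W (wt m (2 * k + 2)) _; set Z := W (wt m (2 * k + 4)) Sw.
set Ph := W _ SF; set e1 := W _ Su; set e2 := W _ (fun x => Sw x + pp x); set E2 := W _ _.
move=> hE X0 Ph0 Yq0 Yp0 e10 h1 h2 h3.
pose T := Ph + E2 + k * e1.
have ke1 : e1 <= k * e1 by rewrite ler_peMl.
have kYq : Yq <= k * Yq by rewrite ler_peMl.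
have kYp : Yp <= k * Yp by rewrite ler_peMl.
have kX : 0 <= k * X by rewrite mulr_ge0.
have E20 : 0 <= E2 by apply: radint_ge0 => x _; rewrite mulr_ge0 ?addr_ge0 ?dot_ge0.
have hX : X <= T by rewrite /T; lra.
have hkX : k ^+ 2 * X <= T.
  have h : k * (k * X) <= k * (Yq + e1) by rewrite ler_wpM2l//; lra.
  rewrite expr2 -mulrA; apply: le_trans h _; rewrite /T; lra.
have hYp : Yp <= T by rewrite /T; lra.
have he1 : e1 <= T by rewrite /T; lra.
have hPh : Ph <= T by rewrite /T; lra.
have nYp := ler_wpM2l n0 hYp.
have AkX : (n%:R + 4) ^+ 2 * (k ^+ 2 * X) <= (n%:R + 4) ^+ 2 * T by rewrite ler_wpM2l ?sqr_ge0.
have hT : T <= (n%:R ^+ 2 + 1) * (Ph + e2 + k * e1).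
  have c1 : 1 <= n%:R ^+ 2 + 1 :> R by rewrite lerDr sqr_ge0.
  have d1 := ler_peMl Ph0 c1; have d2 := ler_peMl (le_trans e10 ke1) c1.
  rewrite /T; lra.
have CT : 0 <= 12 * (n%:R + 4) ^+ 2 + 16 + 2 * n%:R :> R.
  by have := sqr_ge0 (n%:R + 4 : R); lra.
rewrite -mulrA; apply: le_trans (ler_wpM2l CT hT); lra.
Qed.

End with_clifford.

Lemma stokes_carleman :
  W (wt (m + 2) (2 * k + 4)) Su + W (wt m (2 * k + 2)) pp + W (wt m (2 * k + 4)) Sw <=
  (12 * (n%:R + 4) ^+ 2 + 16 + 2 * n%:R) * (n%:R ^+ 2 + 1) *
  (W (wt (m - 2) (2 * k)) SF + W (wt1 m (2 * k)) (fun x => Sw x + pp x)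
   + k * W (wt1 (m + 2) (2 * k + 2)) Su).
Proof. by have [N [c hc]] := clifford_exists R n; exact: (stokes_carleman_aux hc). Qed.

End stokes_chain.

(** * Mollified weak solutions *)

Section shifted_tests.
Context {R : realType} {n : nat}.
Local Notation mu := (@lebesgue_rV R n).
Local Notation "'\I' f" := (\int[mu]_x f x) (at level 10, f at level 9).
Implicit Types (f g : 'rV[R]_n -> R) (x y v : 'rV[R]_n).

Lemma is_derive_shift f y c v (e : R) :
  is_derive (y + c) v f e -> is_derive y v (fun z => f (z + c)) e.
Proof.
move=> d; have := (@is_derive_line R n (y + c) v f 0 e).2.
rewrite scale0r add0r => /(_ d) h.
have := (@is_derive_line R n y v (fun z => f (z + c)) 0 e).1.
rewrite scale0r add0r; apply.
by move: h; under eq_fun do rewrite addrA.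
Qed.

Lemma Ck_shift k f c : Ck k f -> Ck k (fun y => f (y + c)).
Proof.
have ct (g : 'rV[R]_n -> R) : continuous g -> continuous (fun y => g (y + c)).
  move=> cg y; apply: (@continuous_comp _ _ _ (fun z : 'rV[R]_n => z + c) g); last exact: cg.
  by apply: continuousD; [exact: cvg_id|exact: cst_continuous].
elim: k f => [|k IH] f /= [cf h]; split; try exact: ct; first by [].
move=> i; have [df Cf] := h i.
have d y := is_derive_shift (derivableP (df (y + c))).
split; first by move=> y; have [] := d y.
have -> : partial i (fun y => f (y + c)) = (fun y => partial i f (y + c)).
  by apply/funext => y; have [_ e] := d y; rewrite /partial e.
exact: IH.
Qed.

Lemma partial_fun i f g : (forall x, is_derive x (basis_vec i) f (g x)) -> partial i f = g.
Proof. by move=> d; apply/funext => x; have [_ <-] := d x. Qed.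

Lemma continuous_nsq : continuous (@nsq R n).
Proof.
have h : Ck 0 (fun x : 'rV[R]_n => \sum_i x ord0 i * x ord0 i).
  by apply: Ck_sum => i; apply: CkM; exact: Ck_coord.
have := Ck_cont h; rewrite (_ : (fun x => _) = @nsq R n)//.
Qed.

Lemma closed_nsq_le x (r : R) : closed [set y : 'rV[R]_n | nsq (y - x) <= r].
Proof.
have -> : [set y : 'rV[R]_n | nsq (y - x) <= r] = (fun y => nsq (y - x)) @^-1` [set t | t <= r] by [].
apply: preimage_closed; last exact: closed_le.
move=> y _; apply: (@continuous_comp _ _ _ (fun z : 'rV[R]_n => z - x) (@nsq R n)).
  by apply: continuousB; [exact: cvg_id|exact: cst_continuous].
exact: continuous_nsq.
Qed.

Lemma compact_nsq_le x (r : R) : compact [set y : 'rV[R]_n | nsq (y - x) <= r].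
Proof.
apply: bounded_closed_compact; last exact: closed_nsq_le.
exists (`|r| + 1 + `|x|); split; first by rewrite num_real.
move=> M hM y /= hy; apply/ltW; apply: le_lt_trans hM.
rewrite -[y in `|y|](subrK x); apply: (le_trans (ler_normD _ _)); rewrite lerD2r norm_le_box//.
move=> i; have h := le_trans (coord_le_nsq (y - x) i) hy.
move: h; rewrite -real_normK ?num_real//; move: (ler_norm r) (normr_ge0 r).
by move: (normr_ge0 ((y - x) ord0 i)); move: `|(y - x) ord0 i| `|r| => t q; nra.
Qed.

Variables (d : R) (d0 : 0 < d).

Lemma is_derive_kap_shift x y i :
  is_derive y (basis_vec i) (fun z => kap d 0 (z - x)) (kap1 d i (y - x)).
Proof. by apply: is_derive_shift; exact: is_derive_kap. Qed.

Lemma is_derive_kap1_shift x y i j :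
  is_derive y (basis_vec j) (fun z => kap1 d i (z - x)) (kap2 d i j (y - x)).
Proof. by apply: is_derive_shift; exact: is_derive_kap1. Qed.

Lemma kap1_supp i x : d ^+ 2 <= nsq x -> kap1 d i x = 0.
Proof. by move=> h; rewrite /kap1 kap_supp// !mulr0 oppr0. Qed.

Lemma kap2_supp i j x : d ^+ 2 <= nsq x -> kap2 d i j x = 0.
Proof. by move=> h; rewrite /kap2 !kap_supp// !(mulr0, oppr0, addr0, subr0). Qed.

Lemma test_kap Omega x : [set y | nsq (y - x) <= d ^+ 2] `<=` Omega ->
  test_function Omega (fun y => kap d 0 (y - x)).
Proof.
move=> sub; split; first by move=> k; apply: Ck_shift; exact: smooth_kap.
exists [set y | nsq (y - x) <= d ^+ 2]; split => //; first exact: compact_nsq_le.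
by move=> y /= /negP; rewrite -ltNge => /ltW; exact: kap_supp.
Qed.

Lemma test_kap1 Omega x i : [set y | nsq (y - x) <= d ^+ 2] `<=` Omega ->
  test_function Omega (fun y => kap1 d i (y - x)).
Proof.
move=> sub; split.
  move=> k; apply: Ck_shift; have [_ /(_ i)[_]] := @smooth_kap R n d k.+1.
  by rewrite (partial_fun (fun x => is_derive_kap d x i)).
exists [set y | nsq (y - x) <= d ^+ 2]; split => //; first exact: compact_nsq_le.
by move=> y /= /negP; rewrite -ltNge => /ltW; exact: kap1_supp.
Qed.

Lemma RI_restrict (Omega : set 'rV[R]_n) f g : (forall y, Omega y -> f y = g y) ->
  (forall y, ~ Omega y -> g y = 0) -> \int[mu]_(y in Omega) f y = \I g.
Proof.
move=> fg g0; rewrite /Rintegral integral_mkcond; congr fine; apply: eq_integral => y _.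
rewrite patchE; case: ifPn => [/set_mem/fg ->//|/negP nO].
by rewrite g0// => Oy; apply: nO; rewrite mem_set.
Qed.

End shifted_tests.

(** * Truncation and mollification of a weak solution *)

Section stokes_mollified.
Context {R : realType} {n : nat}.
Local Notation mu := (@lebesgue_rV R n).
Local Notation "'\I' f" := (\int[mu]_x f x) (at level 10, f at level 9).
Variables (Omega : set 'rV[R]_n) (hO : open Omega).
Variables (x0 : 'rV[R]_n) (a b : R).

(* A neighbourhood of [open_annulus x0 a b] leaving room for a small mollifier. *)
Definition wide_annulus : set 'rV[R]_n :=
  [set x | expR (2 * a - 4) <= sqdist x0 x <= expR (2 * b + 4)].

Hypothesis AO : wide_annulus `<=` Omega.

(** Turns a field that is in L2 only locally in [Omega] into one in L2 of the whole space with
    bounded support. At a small scale its mollification on [open_annulus] does not feel the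
    truncation. *)
Definition cut_wide (f : 'rV[R]_n -> R) (x : 'rV[R]_n) : R := \1_wide_annulus x * f x.

Lemma compact_wide_annulus : compact wide_annulus.
Proof.
apply: (subclosed_compact _ (@compact_nsq_le R n x0 (expR (2 * b + 4)))).
  have -> : wide_annulus = sqdist x0 @^-1` `[expR (2 * a - 4), expR (2 * b + 4)]%classic.
    by apply/seteqP; split => x; rewrite /wide_annulus /= in_itv.
  apply: preimage_closed; last exact: itv_closed.
  by move=> x _; exact: continuous_sqdist.
by move=> x /andP[].
Qed.

Lemma measurable_wide_annulus : measurable wide_annulus.
Proof.
rewrite (_ : wide_annulus = sqdist x0 @^-1` `[expR (2 * a - 4), expR (2 * b + 4)]%classic).
  by rewrite -[X in measurable X]setTI; apply: measurable_sqdist.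
by apply/seteqP; split => x; rewrite /wide_annulus /= in_itv.
Qed.

Lemma cut_wide_in f x : wide_annulus x -> cut_wide f x = f x.
Proof. by move=> Ax; rewrite /cut_wide indicE mem_set// mul1r. Qed.

Lemma cut_wide_out f x : ~ wide_annulus x -> cut_wide f x = 0.
Proof. by move=> Ax; rewrite /cut_wide indicE memNset// mul0r. Qed.

Lemma cut_wide_patch f : cut_wide f = f \_ wide_annulus.
Proof.
apply/funext => x; rewrite patchE /cut_wide indicE.
by case: (x \in wide_annulus); rewrite ?mul1r ?mul0r.
Qed.

Lemma bsupp_cut_wide f : bsupp (cut_wide f).
Proof.
exists (`|expR (2 * b + 4)| + 1 + `|x0|) => x nb; apply: cut_wide_out => Ax; apply: nb => i.
have -> : x ord0 i = (x - x0) ord0 i + x0 ord0 i by rewrite !mxE subrK.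
rewrite (le_trans (ler_normD _ _))// lerD ?coord_le_norm//.
have /andP[_ h] := Ax; have := le_trans (coord_le_nsq (x - x0) i) h.
rewrite -real_normK ?num_real//; move: (expR_gt0 (2 * b + 4)) (normr_ge0 ((x - x0) ord0 i)).
move: `|(x - x0) ord0 i| (expR _) => t q q0 t0; rewrite (gtr0_norm q0); nra.
Qed.

Lemma measurable_cut_wide f : measurable_fun Omega f -> measurable_fun setT (cut_wide f).
Proof.
move=> mf; rewrite cut_wide_patch; apply/(measurable_restrictT _ measurable_wide_annulus).
by apply: measurable_funS mf => //; exact: measurable_open_rV.
Qed.

Lemma L2_cut_wide f : L2loc Omega f -> L2 (cut_wide f).
Proof.
move=> [mf /(_ _ AO compact_wide_annulus) fi]; have mA := measurable_cut_wide mf.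
split => //; apply/integrableP; split.
  by apply/measurable_EFinP; apply: measurable_funX.
move: fi; rewrite integral_mkcond; congr (_ < _)%E; apply: eq_integral => x _.
rewrite /= patchE /cut_wide indicE; case: (x \in wide_annulus); first by rewrite mul1r normrX.
by rewrite mul0r expr0n normr0.
Qed.

Lemma wide_annulus_ball d x y : 4 * d ^+ 2 <= expR (2 * a - 2) -> a <= b -> open_annulus x0 a b x ->
  nsq (y - x) <= d ^+ 2 -> wide_annulus y.
Proof.
move=> hd ab /andP[h1 h2] hy.
have H (v w : 'rV[R]_n) : nsq (v + w) <= 2 * nsq v + 2 * nsq w.
  rewrite /nsq !mulr_sumr -big_split; apply: ler_sum => i _; rewrite !mxE /=.
  by have := sqr_ge0 (v ord0 i - w ord0 i); lra.
(* The two annuli differ by one unit of [log r] on each side, that is by a factor [e^2 >= 4] in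
   squared distances, which pays for the constants in [|v + w|^2 <= 2 |v|^2 + 2 |w|^2]. *)
have e4 : 4 <= expR 2 :> R.
  have -> : 2 = 1 + 1 :> R by [].
  have := expR_ge1Dx (1 : R); rewrite expRD; nra.
have k1 := H (x - x0) (y - x); have k2 := H (y - x0) (x - y).
have E1 : x - x0 + (y - x) = y - x0 by rewrite addrC addrA subrK.
have E2 : y - x0 + (x - y) = x - x0 by rewrite addrC addrA subrK.
rewrite E1 in k1; rewrite E2 -[nsq (x - y)]nsqN opprB in k2.
have f1 : expR (2 * a - 2) = expR (2 * a - 4) * expR 2 by rewrite -expRD; congr expR; ring.
have f2 : expR (2 * b + 4) = expR (2 * b + 2) * expR 2 by rewrite -expRD; congr expR; ring.
have f3 : expR (2 * a - 2) <= expR (2 * b + 2) by rewrite ler_expR; lra.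
have p1 := expR_gt0 (2 * a - 4); have p2 := expR_gt0 (2 * b + 2).
move: h1 h2; rewrite /sqdist => h1 h2.
have q1 := ler_wpM2l (ltW p1) e4; have q2 := ler_wpM2l (ltW p2) e4.
by rewrite /wide_annulus /= /sqdist f2; apply/andP; split; lra.
Qed.

Definition drift (A : 'rV[R]_n -> 'rV[R]_n) (Du : 'I_n -> 'I_n -> 'rV[R]_n -> R) j x :=
  \sum_i A x ord0 i * Du j i x.

Lemma RI_cut_wide f k : (forall y, ~ wide_annulus y -> k y = 0) ->
  \int[mu]_(y in Omega) (f y * k y) = \I (fun y => cut_wide f y * k y).
Proof.
move=> k0; apply: RI_restrict => y h; last first.
  by rewrite cut_wide_out ?mul0r// => /AO.
have [Ay|nA] := pselect (wide_annulus y); first by rewrite cut_wide_in.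
by rewrite k0// !mulr0.
Qed.

Variables (A u : 'rV[R]_n -> 'rV[R]_n) (p : 'rV[R]_n -> R)
  (Du : 'I_n -> 'I_n -> 'rV[R]_n -> R).
Local Notation F := (drift A Du).
Hypotheses (hu : forall j, L2loc Omega (fun x => u x ord0 j)) (hp : L2loc Omega p)
  (hDu : forall j, weak_gradient Omega (fun x => u x ord0 j) (Du j))
  (hmom : forall j phi, test_function Omega phi ->
        \int[mu]_(x in Omega)
          (- (\sum_i Du j i x * partial i phi x)
           + (\sum_i A x ord0 i * Du j i x) * phi x
           - p x * partial j phi x) = 0)
  (hdiv : forall phi, test_function Omega phi ->
        \int[mu]_(x in Omega) (\sum_i u x ord0 i * partial i phi x) = 0)
  (hF : forall j, L2 (cut_wide (F j))).

Local Notation uA i := (cut_wide (fun x => u x ord0 i)).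
Local Notation wA i j := (cut_wide (Du i j)).
Local Notation pA := (cut_wide p).
Local Notation FA i := (cut_wide (F i)).

Let iu i : intg (uA i). Proof. by apply: L2_intg; [exact: L2_cut_wide|exact: bsupp_cut_wide]. Qed.
Let iw i j : intg (wA i j).
Proof. by apply: L2_intg; [apply: L2_cut_wide; have [] := hDu i j|exact: bsupp_cut_wide]. Qed.
Let ip : intg pA. Proof. by apply: L2_intg; [exact: L2_cut_wide|exact: bsupp_cut_wide]. Qed.
Let iF i : intg (FA i). Proof. by apply: L2_intg; [exact: hF|exact: bsupp_cut_wide]. Qed.

Section moll_equations.
Variables (d : R) (d0 : 0 < d) (x : 'rV[R]_n).
Hypothesis hd : forall y, nsq (y - x) <= d ^+ 2 -> wide_annulus y.

Let sub : [set y | nsq (y - x) <= d ^+ 2] `<=` Omega.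
Proof. by move=> y /hd /AO. Qed.

Let far y : ~ wide_annulus y -> d ^+ 2 <= nsq (y - x).
Proof. by move=> nA; rewrite leNgt; apply/negP => /ltW /hd. Qed.

Let pk i : partial i (fun y => kap d 0 (y - x)) = (fun y => kap1 d i (y - x)).
Proof. by apply: partial_fun => y; exact: is_derive_kap_shift. Qed.

Let pk1 i j : partial j (fun y => kap1 d i (y - x)) = (fun y => kap2 d i j (y - x)).
Proof. by apply: partial_fun => y; exact: is_derive_kap1_shift. Qed.

Let ik f i : intg f -> intg (fun y => f y * kap1 d i (y - x)).
Proof. by move=> intf; apply: intg_mulb => //; apply: bmeas_shift; exact: bmeas_kap1. Qed.

Lemma moll1_weak i j : moll1 d j (uA i) x = moll d (wA i j) x.
Proof.
have [_ /(_ _ (test_kap sub))] := hDu i j; rewrite pk.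
rewrite (@RI_cut_wide _ (fun y => kap1 d j (y - x))); last by move=> y /far; exact: kap1_supp.
rewrite (@RI_cut_wide _ (fun y => kap d 0 (y - x))); last by move=> y /far; exact: kap_supp.
by rewrite /moll1 /moll => ->; rewrite opprK.
Qed.

(** Needed for [d_l (D_j u) = d_j (D_l u)] after mollification: the left side here is symmetric by
    [moll2C]. Testing with a derivative of the kernel gives it although [Du] itself has no weak
    derivatives. *)
Lemma moll2_weak i j k : moll2 d k j (uA i) x = moll1 d k (wA i j) x.
Proof.
have [_ /(_ _ (test_kap1 k sub))] := hDu i j; rewrite pk1.
rewrite (@RI_cut_wide _ (fun y => kap2 d k j (y - x))); last by move=> y /far; exact: kap2_supp.
rewrite (@RI_cut_wide _ (fun y => kap1 d k (y - x))); last by move=> y /far; exact: kap1_supp.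
by rewrite /moll1 /moll2 => ->.
Qed.

Lemma moll_divfree : \sum_i moll d (wA i i) x = 0.
Proof.
have := hdiv (test_kap sub).
rewrite (RI_restrict (g := fun y => \sum_i uA i y * kap1 d i (y - x))); first last.
- by move=> y nO; rewrite big1// => i _; rewrite cut_wide_out ?mul0r// => /AO.
- move=> y _; apply: eq_bigr => i _; rewrite pk; have [Ay|/far nA] := pselect (wide_annulus y); first by rewrite cut_wide_in.
  by rewrite kap1_supp// !mulr0.
rewrite RI_sum => [h|i _]; last exact: ik.
under eq_bigr do rewrite -moll1_weak /moll1.
by rewrite -mulr_sumr sumrN h oppr0 mulr0.
Qed.

Lemma moll_momentum i : \sum_j moll1 d j (wA i j) x + moll d (FA i) x + moll1 d i pA x = 0.
Proof.
have := hmom i (test_kap sub).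
rewrite (RI_restrict (g := fun y => (- (\sum_j wA i j y * kap1 d j (y - x))
   + FA i y * kap d 0 (y - x)) - pA y * kap1 d i (y - x))); first last.
- move=> y nO; have nA : ~ wide_annulus y by move=> /AO.
  rewrite big1 => [|j _]; first by rewrite !cut_wide_out// !mul0r oppr0 !addr0.
  by rewrite cut_wide_out// mul0r.
- move=> y _; rewrite pk; have [Ay|/far nA] := pselect (wide_annulus y).
    rewrite !cut_wide_in//; do 2 congr (_ + _); congr (- _).
    by apply: eq_bigr => j _; rewrite pk cut_wide_in.
  rewrite kap_supp// kap1_supp// !mulr0; do 2 congr (_ + _); congr (- _).
  by apply: eq_bigr => j _; rewrite pk kap1_supp// !mulr0.
have i1 : intg (fun y => \sum_j wA i j y * kap1 d j (y - x)).
  by apply: intg_sum => j _; exact: ik.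
have i2 : intg (fun y => FA i y * kap d 0 (y - x)) by exact: intg_conv.
rewrite (RIB (intgD (intgN i1) i2) (ik i ip)) (RID (intgN i1) i2) (RIN i1).
rewrite RI_sum => [h|j _]; last exact: ik.
rewrite /moll1 /moll -mulr_sumr -!mulrDr sumrN; apply/eqP.
by rewrite mulf_eq0 h eqxx orbT.
Qed.

End moll_equations.

End stokes_mollified.

Section weighted_limits.
Context {R : realType} {n : nat}.
Local Notation mu := (@lebesgue_rV R n).
Variables (x0 : 'rV[R]_n) (a b : R).
Hypothesis (b2 : b <= -2).
Local Notation rad := (radial x0 a b).
Local Notation W := (radint x0 a b).
Implicit Types (f : nat -> 'rV[R]_n -> R) (F : 'rV[R]_n -> R).

(** Integrability is included so that such limits can be added. *)
Definition radint_cvg g f F := [/\ forall k, intg (fun x => rad g x * f k x),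
  intg (fun x => rad g x * F x) & W g (f k) @[k --> \oo] --> W g F].

Lemma radintD g F G : intg (fun x => rad g x * F x) -> intg (fun x => rad g x * G x) ->
  W g (fun x => F x + G x) = W g F + W g G.
Proof.
by move=> iF iG; rewrite /radint -RID//; apply: RI_eq => x; rewrite mulrDr.
Qed.

Lemma radint_cvgD g f f' F F' : radint_cvg g f F -> radint_cvg g f' F' ->
  radint_cvg g (fun k x => f k x + f' k x) (fun x => F x + F' x).
Proof.
move=> [h1 h2 h3] [k1 k2 k3]; split=> [k||].
- by apply: intg_eq (intgD (h1 k) (k1 k)) => x; rewrite mulrDr.
- by apply: intg_eq (intgD h2 k2) => x; rewrite mulrDr.
- by rewrite radintD//; under eq_fun do rewrite radintD//; exact: cvgD.
Qed.

Lemma radint_cvg0 g : radint_cvg g (fun _ _ => 0) (fun=> 0).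
Proof.
have h : intg (fun x => rad g x * 0).
  apply: (@intg_eq _ _ (fun=> 0)) => [x|]; first by rewrite mulr0.
  by apply: integrable_bs; [exact: bmeas_cst|exists 0].
by split => //; exact: cvg_cst.
Qed.

Lemma radint_cvg_sum g (I : Type) (s : seq I) (f : I -> nat -> 'rV[R]_n -> R) (F : I -> 'rV[R]_n -> R) :
  (forall i, radint_cvg g (f i) (F i)) ->
  radint_cvg g (fun k x => \sum_(i <- s) f i k x) (fun x => \sum_(i <- s) F i x).
Proof.
move=> H; elim: s => [|i s IH].
  under eq_fun do under eq_fun do rewrite big_nil; under [X in radint_cvg _ _ X]eq_fun do rewrite big_nil.
  exact: radint_cvg0.
under eq_fun do under eq_fun do rewrite big_cons; under [X in radint_cvg _ _ X]eq_fun do rewrite big_cons.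
exact: radint_cvgD.
Qed.

Lemma radint_cvg_moll g F : cut_weight a b g -> L2 F -> bsupp F ->
  radint_cvg g (fun k x => moll k.+1%:R^-1 F x ^+ 2) (fun x => F x ^+ 2).
Proof.
move=> cg LF sF; have iF := L2_intg LF sF; have bg : bmeas (rad g) by apply: bmeas_rad; case: cg.
split=> [k||].
- by apply: radint_intg => //; apply: bmeasX; apply: bmeas_moll => //; rewrite invr_gt0.
- by apply: intg_bmul => //; case: LF.
- exact: moll_weight_cvg.
Qed.

End weighted_limits.

(** * Passage to the limit of the mollification *)

Section stokes_limit.
Context {R : realType} {n : nat}.
Local Notation mu := (@lebesgue_rV R n).
Variables (Omega : set 'rV[R]_n) (hO : open Omega).
Variables (x0 : 'rV[R]_n) (a b : R) (ab : a <= b) (b2 : b <= -2).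
Hypothesis AO : wide_annulus x0 a b `<=` Omega.
Local Notation cut_wide := (cut_wide x0 a b).
Local Notation O := (open_annulus x0 a b).
Local Notation W := (radint x0 a b).

Variables (A u : 'rV[R]_n -> 'rV[R]_n) (p : 'rV[R]_n -> R)
  (Du : 'I_n -> 'I_n -> 'rV[R]_n -> R).
Local Notation F := (drift A Du).
Hypotheses (hu : forall j, L2loc Omega (fun x => u x ord0 j)) (hp : L2loc Omega p)
  (hDu : forall j, weak_gradient Omega (fun x => u x ord0 j) (Du j))
  (hmom : forall j phi, test_function Omega phi ->
        \int[mu]_(x in Omega)
          (- (\sum_i Du j i x * partial i phi x)
           + (\sum_i A x ord0 i * Du j i x) * phi x
           - p x * partial j phi x) = 0)
  (hdiv : forall phi, test_function Omega phi ->
        \int[mu]_(x in Omega) (\sum_i u x ord0 i * partial i phi x) = 0)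
  (hF : forall j, L2 (cut_wide (F j))).

Local Notation uA i := (cut_wide (fun x => u x ord0 i)).
Local Notation wA i j := (cut_wide (Du i j)).
Local Notation pA := (cut_wide p).
Local Notation FA i := (cut_wide (F i)).

Variables (th th1 th2 : R -> R).
Hypotheses (dth : forall tau, is_derive tau (1 : R) th (th1 tau))
  (dth1 : forall tau, is_derive tau (1 : R) th1 (th2 tau)).
Hypotheses (cth : cut_weight a b th) (cth1 : cut_weight a b th1)
  (bth2 : bm1 (a - 1) (b + 1) th2).
Variables (k : R) (k1 : 1 <= k).

Local Notation wt := (sqw th).
Local Notation wt1 := (sqw th1).
Local Notation m := (n%:R + 2 * k).

Let L2w i j : L2 (wA i j). Proof. by apply: (L2_cut_wide hO AO); have [] := hDu i j. Qed.
Let iu i : intg (uA i).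
Proof. by apply: L2_intg; [exact: (L2_cut_wide hO AO)|exact: bsupp_cut_wide]. Qed.
Let iw i j : intg (wA i j). Proof. by apply: L2_intg => //; exact: bsupp_cut_wide. Qed.
Let ip : intg pA. Proof. by apply: L2_intg; [exact: (L2_cut_wide hO AO)|exact: bsupp_cut_wide]. Qed.
Let iF i : intg (FA i). Proof. by apply: L2_intg => //; exact: bsupp_cut_wide. Qed.

Section at_scale.
Variables (d : R) (d0 : 0 < d) (hd : 4 * d ^+ 2 <= expR (2 * a - 2)).
Let hdx x : O x -> forall y, nsq (y - x) <= d ^+ 2 -> wide_annulus x0 a b y.
Proof. by move=> Ox y; exact: wide_annulus_ball. Qed.

Let du i j x : O x -> is_derive x (basis_vec j) (moll d (uA i)) (moll d (wA i j) x).
Proof. by move=> Ox; rewrite -(moll1_weak AO hDu (hdx Ox)); exact: is_derive_moll. Qed.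

Let w1C i j l x : O x -> moll1 d l (wA i j) x = moll1 d j (wA i l) x.
Proof. by move=> Ox; rewrite -!(moll2_weak AO hDu (hdx Ox)) moll2C. Qed.

Let mom i x : O x -> \sum_j moll1 d j (wA i j) x + moll d (FA i) x + moll1 d i pA x = 0.
Proof. by move=> Ox; exact: (moll_momentum hO AO hp hDu hmom hF d0 (hdx Ox)). Qed.

Let dfree x : O x -> \sum_i moll d (wA i i) x = 0.
Proof. by move=> Ox; exact: (moll_divfree hO AO hu hDu hdiv d0 (hdx Ox)). Qed.

Lemma stokes_carleman_moll :
  W (wt (m + 2) (2 * k + 4)) (fun x => \sum_i moll d (uA i) x ^+ 2) +
  W (wt m (2 * k + 2)) (fun x => moll d pA x ^+ 2) +
  W (wt m (2 * k + 4)) (fun x => \sum_i \sum_j moll d (wA i j) x ^+ 2) <=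
  (12 * (n%:R + 4) ^+ 2 + 16 + 2 * n%:R) * (n%:R ^+ 2 + 1) *
  (W (wt (m - 2) (2 * k)) (fun x => \sum_i moll d (FA i) x ^+ 2) +
   W (wt1 m (2 * k)) (fun x => \sum_i \sum_j moll d (wA i j) x ^+ 2 + moll d pA x ^+ 2) +
   k * W (wt1 (m + 2) (2 * k + 2)) (fun x => \sum_i moll d (uA i) x ^+ 2)).
Proof.
exact: (@stokes_carleman R n x0 a b b2 th th1 th2 dth dth1 cth cth1 bth2
  (fun i => moll d (uA i)) (fun i j => moll d (wA i j)) (fun i j l => moll1 d l (wA i j))
  (fun i j l q => moll2 d l q (wA i j)) (moll d pA) (fun i => moll1 d i pA)
  (fun i j => moll2 d i j pA) (fun i => moll d (FA i))
  (fun i => bmeas_moll d0 (iu i)) (fun i j => bmeas_moll d0 (iw i j))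
  (fun i j l => bmeas_moll1 d0 l (iw i j)) (fun i j l q => bmeas_moll2 d0 l q (iw i j))
  (bmeas_moll d0 ip) (fun i => bmeas_moll1 d0 i ip) (fun i j => bmeas_moll2 d0 i j ip)
  (fun i => bmeas_moll d0 (iF i)) du
  (fun i j l x _ => is_derive_moll d0 l x (iw i j))
  (fun i j l q x _ => is_derive_moll1 d0 l q x (iw i j))
  (fun j x _ => is_derive_moll d0 j x ip) (fun j l x _ => is_derive_moll1 d0 j l x ip)
  w1C (fun i j l q x _ => moll2C d l q (wA i j) x) (fun j l x _ => moll2C d j l pA x)
  mom dfree k k1).
Qed.

Lemma stokes_caccioppoli_moll :
  W (wt m (2 * k + 4)) (fun x => \sum_i \sum_j moll d (wA i j) x ^+ 2) <=
  (12 * (n%:R + 4) ^+ 2 * k ^+ 2 + 1) *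
    W (wt (m + 2) (2 * k + 4)) (fun x => \sum_i moll d (uA i) x ^+ 2) +
  12 * W (wt1 (m + 2) (2 * k + 2)) (fun x => \sum_i moll d (uA i) x ^+ 2) +
  2 * n%:R * W (wt m (2 * k + 2)) (fun x => moll d pA x ^+ 2) +
  W (wt (m - 2) (2 * k)) (fun x => \sum_i moll d (FA i) x ^+ 2).
Proof.
exact: (@stokes_caccioppoli R n x0 a b b2 th th1 dth cth cth1
  (fun i => moll d (uA i)) (fun i j => moll d (wA i j)) (fun i j l => moll1 d l (wA i j))
  (moll d pA) (fun i => moll1 d i pA) (fun i => moll d (FA i))
  (fun i => bmeas_moll d0 (iu i)) (fun i j => bmeas_moll d0 (iw i j))
  (fun i j l => bmeas_moll1 d0 l (iw i j)) (bmeas_moll d0 ip) (fun i => bmeas_moll1 d0 i ip)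
  (fun i => bmeas_moll d0 (iF i)) du (fun i j l x _ => is_derive_moll d0 l x (iw i j))
  (fun j x _ => is_derive_moll d0 j x ip) mom dfree k k1).
Qed.

End at_scale.

Lemma near_scale : \forall i \near \oo, 4 * (i.+1%:R^-1) ^+ 2 <= expR (2 * a - 2).
Proof.
pose e := Num.min 1 (expR (2 * a - 2) / 4).
have e0 : 0 < e by rewrite lt_min ltr01 divr_gt0// expR_gt0.
have := near_infty_natSinv_lt (PosNum e0); apply: filterS => i /=.
rewrite lt_min => /andP[h1 h2].
have i0 : 0 <= i.+1%:R^-1 :> R by rewrite invr_ge0.
move: h1 h2 i0; set t := _^-1 => h1 h2 i0; nra.
Qed.

Let W_cut g (f f' : 'rV[R]_n -> R) : (forall x, wide_annulus x0 a b x -> f x = f' x) -> W g f = W g f'.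
Proof.
move=> ff; apply: RI_eq => x; have [Ox|nO] := pselect (O x); last by rewrite !rad_out// !mul0r.
rewrite ff//; move: Ox => /andP[h1 h2]; apply/andP; split; apply: ltW.
  by apply: lt_trans h1; rewrite ltr_expR; lra.
by apply: (lt_trans h2); rewrite ltr_expR; lra.
Qed.

Local Notation Su := (fun x => \sum_i u x ord0 i ^+ 2).
Local Notation Sw := (fun x => \sum_i \sum_j Du i j x ^+ 2).
Local Notation SF := (fun x => \sum_i F i x ^+ 2).
Local Notation pp := (fun x => p x ^+ 2).

Let cvu g : cut_weight a b g ->
  radint_cvg x0 a b g (fun l x => \sum_i moll l.+1%:R^-1 (uA i) x ^+ 2) (fun x => \sum_i uA i x ^+ 2).
Proof.
move=> cg; apply: radint_cvg_sum => i; apply: (radint_cvg_moll x0 b2 cg); last exact: bsupp_cut_wide.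
exact: (L2_cut_wide hO AO).
Qed.

Let cvF g : cut_weight a b g ->
  radint_cvg x0 a b g (fun l x => \sum_i moll l.+1%:R^-1 (FA i) x ^+ 2) (fun x => \sum_i FA i x ^+ 2).
Proof.
by move=> cg; apply: radint_cvg_sum => i; apply: (radint_cvg_moll x0 b2 cg) => //; exact: bsupp_cut_wide.
Qed.

Let cvw g : cut_weight a b g ->
  radint_cvg x0 a b g (fun l x => \sum_i \sum_j moll l.+1%:R^-1 (wA i j) x ^+ 2)
    (fun x => \sum_i \sum_j wA i j x ^+ 2).
Proof.
move=> cg; apply: radint_cvg_sum => i; apply: radint_cvg_sum => j.
by apply: (radint_cvg_moll x0 b2 cg) => //; exact: bsupp_cut_wide.
Qed.

Let cvp g : cut_weight a b g ->
  radint_cvg x0 a b g (fun l x => moll l.+1%:R^-1 pA x ^+ 2) (fun x => pA x ^+ 2).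
Proof.
by move=> cg; apply: (radint_cvg_moll x0 b2 cg); [exact: (L2_cut_wide hO AO)|exact: bsupp_cut_wide].
Qed.

Let eu g : W g Su = W g (fun x => \sum_i uA i x ^+ 2).
Proof. by apply: W_cut => x Ax; apply: eq_bigr => i _; rewrite cut_wide_in. Qed.
Let eF g : W g SF = W g (fun x => \sum_i FA i x ^+ 2).
Proof. by apply: W_cut => x Ax; apply: eq_bigr => i _; rewrite cut_wide_in. Qed.
Let ew g : W g Sw = W g (fun x => \sum_i \sum_j wA i j x ^+ 2).
Proof.
by apply: W_cut => x Ax; apply: eq_bigr => i _; apply: eq_bigr => j _; rewrite cut_wide_in.
Qed.
Let ep g : W g pp = W g (fun x => pA x ^+ 2).
Proof. by apply: W_cut => x Ax; rewrite cut_wide_in. Qed.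
Let ewp g : W g (fun x => Sw x + pp x) = W g (fun x => \sum_i \sum_j wA i j x ^+ 2 + pA x ^+ 2).
Proof.
apply: W_cut => x Ax; rewrite cut_wide_in//; congr (_ + _).
by apply: eq_bigr => i _; apply: eq_bigr => j _; rewrite cut_wide_in.
Qed.

Lemma stokes_carleman_weak :
  W (wt (m + 2) (2 * k + 4)) Su + W (wt m (2 * k + 2)) pp + W (wt m (2 * k + 4)) Sw <=
  (12 * (n%:R + 4) ^+ 2 + 16 + 2 * n%:R) * (n%:R ^+ 2 + 1) *
  (W (wt (m - 2) (2 * k)) SF + W (wt1 m (2 * k)) (fun x => Sw x + pp x)
   + k * W (wt1 (m + 2) (2 * k + 2)) Su).
Proof.
have c m' l : cut_weight a b (wt m' l) by exact: cut_weight_sqw.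
have c1 m' l : cut_weight a b (wt1 m' l) by exact: cut_weight_sqw.
rewrite !eu ep ew eF ewp.
have [_ _ h1] := cvF (c (m - 2) (2 * k)).
have [_ _ h2] := radint_cvgD (cvw (c1 m (2 * k))) (cvp (c1 m (2 * k))).
have [_ _ h3] := cvu (c1 (m + 2) (2 * k + 2)).
have [_ _ h4] := cvu (c (m + 2) (2 * k + 4)).
have [_ _ h5] := cvp (c m (2 * k + 2)).
have [_ _ h6] := cvw (c m (2 * k + 4)).
apply: (ler_cvg_to (cvgD (cvgD h4 h5) h6) (cvgMl_tmp (cvgD (cvgD h1 h2) (cvgMl_tmp h3)))).
near=> l; apply: (@stokes_carleman_moll (l.+1%:R^-1)); first by rewrite invr_gt0.
by near: l; exact: near_scale.
Unshelve. all: by end_near.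
Qed.

Lemma stokes_caccioppoli_weak :
  W (wt m (2 * k + 4)) Sw <=
  (12 * (n%:R + 4) ^+ 2 * k ^+ 2 + 1) * W (wt (m + 2) (2 * k + 4)) Su +
  12 * W (wt1 (m + 2) (2 * k + 2)) Su + 2 * n%:R * W (wt m (2 * k + 2)) pp +
  W (wt (m - 2) (2 * k)) SF.
Proof.
have c m' l : cut_weight a b (wt m' l) by exact: cut_weight_sqw.
have c1 m' l : cut_weight a b (wt1 m' l) by exact: cut_weight_sqw.
rewrite !eu ep ew eF.
have [_ _ h1] := cvF (c (m - 2) (2 * k)).
have [_ _ h3] := cvu (c1 (m + 2) (2 * k + 2)).
have [_ _ h4] := cvu (c (m + 2) (2 * k + 4)).
have [_ _ h5] := cvp (c m (2 * k + 2)).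
have [_ _ h6] := cvw (c m (2 * k + 4)).
apply: (ler_cvg_to h6 (cvgD (cvgD (cvgD (cvgMl_tmp h4) (cvgMl_tmp h3)) (cvgMl_tmp h5)) h1)).
near=> l; apply: (@stokes_caccioppoli_moll (l.+1%:R^-1)); first by rewrite invr_gt0.
by near: l; exact: near_scale.
Unshelve. all: by end_near.
Qed.

Lemma radint_intg_weak g : cut_weight a b g ->
  [/\ intg (fun x => radial x0 a b g x * Su x), intg (fun x => radial x0 a b g x * Sw x),
      intg (fun x => radial x0 a b g x * pp x) & intg (fun x => radial x0 a b g x * SF x)].
Proof.
move=> cg.
have E (f f' : 'rV[R]_n -> R) : (forall x, wide_annulus x0 a b x -> f x = f' x) ->
    intg (fun x => radial x0 a b g x * f x) -> intg (fun x => radial x0 a b g x * f' x).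
  move=> ff; apply: intg_eq => x; have [Ox|nO] := pselect (O x); last by rewrite !rad_out// !mul0r.
  rewrite ff//; move: Ox => /andP[h1 h2]; apply/andP; split; apply: ltW.
    by apply: lt_trans h1; rewrite ltr_expR; lra.
  by apply: (lt_trans h2); rewrite ltr_expR; lra.
split.
- have [_ + _] := cvu cg; apply: E => x Ax.
  by apply: eq_bigr => i _; rewrite cut_wide_in.
- have [_ + _] := cvw cg; apply: E => x Ax.
  by apply: eq_bigr => i _; apply: eq_bigr => j _; rewrite cut_wide_in.
- have [_ + _] := cvp cg; apply: E => x Ax.
  by rewrite cut_wide_in.
- have [_ + _] := cvF cg; apply: E => x Ax.
  by apply: eq_bigr => i _; rewrite cut_wide_in.
Qed.

End stokes_limit.

(** * Radial cut-offs *)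

Section cutoff_functions.
Context {R : realType}.
Implicit Types t a b : R.

(* Positive part to the power [m]: of class C^(m-1). *)
Definition ramp (m : nat) t : R := if 0 < t then t ^+ m else 0.

Lemma ramp_le0 m t : t <= 0 -> ramp m t = 0.
Proof. by move=> t0; rewrite /ramp ltNge t0. Qed.

Lemma ramp_ge0 m t : 0 <= ramp m t.
Proof. by rewrite /ramp; case: ifP => // t0; rewrite exprn_ge0// ltW. Qed.

Lemma ramp_le1 m t : t <= 1 -> ramp m t <= 1.
Proof. by move=> t1; rewrite /ramp; case: ifP => // t0; rewrite exprn_ile1// ltW. Qed.

Lemma ramp_ge1 m t : 1 <= t -> 1 <= ramp m t.
Proof. by move=> t1; rewrite /ramp (lt_le_trans ltr01 t1) exprn_ege1. Qed.

Lemma is_derive_ramp m t : is_derive t (1 : R) (ramp m.+2) (m.+2%:R * ramp m.+1 t).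
Proof.
have [t0|t0|->] := ltgtP t 0.
- rewrite ramp_le0 ?ltW// mulr0.
  have H0 : is_derive t (1 : R) (fun=> 0 : R) 0 by exact: is_derive_cst.
  apply: (near_eq_is_derive _ H0).
  near=> s; rewrite /= ramp_le0// ltW//.
  by near: s; exact: lt_nbhsl.
- apply: (@near_eq_is_derive _ _ _ (fun s : R => s ^+ m.+2)).
    near=> s; rewrite /ramp ifT//.
    by near: s; exact: lt_nbhsr.
  have := @is_deriveX _ _ (id : R -> R) m.+2 t 1 _ (is_derive_id _ _).
  rewrite exprfctE => d; refine (is_derive_eq d _).
  by rewrite /ramp t0 /GRing.scale /= mulr1.
- rewrite ramp_le0// mulr0.
  have H : h^-1 *: ((ramp m.+2 \o shift 0) (h *: (1 : R)) - ramp m.+2 0) @[h --> 0^'] --> (0 : R).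
    apply/cvgr0Pnorm_lt => e e0.
    near=> h; rewrite /= scaler1 addr0 (ramp_le0 m.+2 (lexx 0)) subr0 normrZ normfV.
    rewrite (ger0_norm (ramp_ge0 m.+2 h)).
    have h0 : h != 0 by near: h; exact: nbhs_dnbhs_neq.
    rewrite ltr_pdivrMl ?normr_gt0//.
    have h1 : `|h| < 1 by near: h; apply: dnbhs0_lt.
    have he : `|h| < e by near: h; apply: dnbhs0_lt.
    rewrite /ramp; case: ifPn => [hp|_]; last by rewrite mulr_gt0// normr_gt0.
    rewrite -[h ^+ _]ger0_norm ?exprn_ge0 ?ltW// normrX exprS ltr_pM2l ?normr_gt0//.
    apply: le_lt_trans he; rewrite exprS ler_piMr// exprn_ile1//; exact: ltW.
  split; first by apply/cvg_ex; exists 0; exact: H.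
  exact/cvg_lim.
Unshelve. all: by end_near. Qed.

Lemma measurable_ramp m : measurable_fun setT (ramp m).
Proof.
rewrite /ramp; apply: measurable_fun_ifT => //=.
exact: measurable_fun_ltr.
Qed.

(** A transition of class C^2 from 0 on [t <= 0] to 1 on [t >= 1]: the inner cubic ramp flattens the
    left end, the outer one, applied to its reflection, the right end. Two derivatives suffice, as
    the Carleman identity differentiates the cut-off twice. *)
Definition step t : R := 1 - ramp 3 (1 - ramp 3 t).
Definition step1 t : R := 9 * (ramp 2 (1 - ramp 3 t) * ramp 2 t).
Definition step2 t : R :=
  9 * (- (6 * (ramp 1 (1 - ramp 3 t) * (ramp 2 t * ramp 2 t))) + 2 * (ramp 2 (1 - ramp 3 t) * ramp 1 t)).

Lemma is_derive_step t : is_derive t (1 : R) step (step1 t).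
Proof.
have d1 := is_deriveB (is_derive_cst (1 : R) t 1) (is_derive_ramp 1 t).
have d2 := is_derive1_comp (g := fun s => 1 - ramp 3 s) (is_derive_ramp 1 (1 - ramp 3 t)) d1.
have d3 := is_deriveB (is_derive_cst (1 : R) t 1) d2.
by refine (is_derive_eq d3 _); rewrite /step1; ring.
Qed.

Lemma is_derive_step1 t : is_derive t (1 : R) step1 (step2 t).
Proof.
have d1 := is_deriveB (is_derive_cst (1 : R) t 1) (is_derive_ramp 1 t).
have d2 := is_derive1_comp (g := fun s => 1 - ramp 3 s) (is_derive_ramp 0 (1 - ramp 3 t)) d1.
have d3 := is_deriveM d2 (is_derive_ramp 0 t).
have d4 := is_deriveZ (9 : R) d3.
refine (is_derive_eq d4 _); rewrite /step2 /GRing.scale /=.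
ring.
Qed.

Lemma step_le0 t : t <= 0 -> step t = 0 /\ step1 t = 0.
Proof.
move=> t0; rewrite /step /step1 !(ramp_le0 _ t0) subr0 !mulr0.
by rewrite /ramp ltr01 expr1n subrr.
Qed.

Lemma step_ge1 t : 1 <= t -> step t = 1 /\ step1 t = 0.
Proof.
move=> t1; have h : 1 - ramp 3 t <= 0 by rewrite subr_le0 ramp_ge1.
by rewrite /step /step1 !(ramp_le0 _ h) subr0 mul0r mulr0.
Qed.

Lemma one_sub_ramp_le1 m t : 1 - ramp m t <= 1.
Proof. by rewrite gerBl ramp_ge0. Qed.

Lemma step_itv t : 0 <= step t <= 1.
Proof.
rewrite /step gerBl ramp_ge0 andbT subr_ge0 ramp_le1//; exact: one_sub_ramp_le1.
Qed.

Lemma step1_itv t : 0 <= step1 t <= 9.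
Proof.
have [t1|t1] := leP t 1; last first.
  by have [_ ->] := step_ge1 (ltW t1); rewrite lexx/=.
rewrite mulr_ge0 ?mulr_ge0 ?ramp_ge0//= ger_pMr// mulr_ile1 ?ramp_ge0 ?ramp_le1//.
exact: one_sub_ramp_le1.
Qed.

Definition cutoff a b t := step (t - a) * step (b - t).
Definition cutoff1 a b t := step1 (t - a) * step (b - t) - step (t - a) * step1 (b - t).
Definition cutoff2 a b t := step2 (t - a) * step (b - t) - 2 * (step1 (t - a) * step1 (b - t))
  + step (t - a) * step2 (b - t).

Let dl a t (f : R -> R) (f' : R) : is_derive (t - a) (1 : R) f f' ->
  is_derive t (1 : R) (fun s => f (s - a)) f'.
Proof.
move=> d; have d1 : is_derive t (1 : R) (fun s => s - a) 1.
  by refine (is_derive_eq (is_deriveB (is_derive_id _ _) (is_derive_cst a t 1)) _); rewrite subr0.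
by refine (is_derive_eq (is_derive1_comp (g := fun s => s - a) d d1) _); rewrite mulr1.
Qed.

Let dr b t (f : R -> R) (f' : R) : is_derive (b - t) (1 : R) f f' ->
  is_derive t (1 : R) (fun s => f (b - s)) (- f').
Proof.
move=> d; have d1 : is_derive t (1 : R) (fun s => b - s) (-1).
  by refine (is_derive_eq (is_deriveB (is_derive_cst b t 1) (is_derive_id _ _)) _); rewrite sub0r.
by refine (is_derive_eq (is_derive1_comp (g := fun s => b - s) d d1) _); rewrite mulrN1.
Qed.

Lemma is_derive_cutoff a b t : is_derive t (1 : R) (cutoff a b) (cutoff1 a b t).
Proof.
have d := is_deriveM (dl (is_derive_step (t - a))) (dr (is_derive_step (b - t))).
by refine (is_derive_eq d _); rewrite /cutoff1 /GRing.scale /=; ring.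
Qed.

Lemma is_derive_cutoff1 a b t : is_derive t (1 : R) (cutoff1 a b) (cutoff2 a b t).
Proof.
have d1 := is_deriveM (dl (is_derive_step1 (t - a))) (dr (is_derive_step (b - t))).
have d2 := is_deriveM (dl (is_derive_step (t - a))) (dr (is_derive_step1 (b - t))).
have d := is_deriveB d1 d2.
by refine (is_derive_eq d _); rewrite /cutoff2 /GRing.scale /=; ring.
Qed.

Lemma cutoff_vanish a b t : ~~ (a <= t <= b) -> cutoff a b t = 0 /\ cutoff1 a b t = 0.
Proof.
rewrite negb_and -!ltNge /cutoff /cutoff1 => /orP[h|h].
  have h0 : t - a <= 0 by lra.
  by have [-> ->] := step_le0 h0; rewrite !mul0r subr0.
have h0 : b - t <= 0 by lra.
by have [-> ->] := step_le0 h0; rewrite !mulr0 subr0.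
Qed.

Lemma cutoff_itv a b t : 0 <= cutoff a b t <= 1.
Proof.
have /andP[h1 h2] := step_itv (t - a); have /andP[h3 h4] := step_itv (b - t).
by rewrite /cutoff mulr_ge0//= mulr_ile1.
Qed.

Lemma cutoff_eq1 a b t : a + 1 <= t <= b - 1 -> cutoff a b t = 1.
Proof.
move=> /andP[h1 h2]; rewrite /cutoff.
have k1 : 1 <= t - a by lra.
have k2 : 1 <= b - t by lra.
by have [-> _] := step_ge1 k1; have [-> _] := step_ge1 k2; rewrite mulr1.
Qed.

(** [162 = 2 * 9^2], from [step1 <= 9] and [(x - y)^2 <= 2 x^2 + 2 y^2]. The errors of the cut-off
    thus live in an inner and an outer layer, each of width 1 in [log r]. *)
Lemma cutoff1_sqr_le a b t :
  cutoff1 a b t ^+ 2 <= 162 * ((a <= t <= a + 1)%R%:R + (b - 1 <= t <= b)%R%:R).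
Proof.
have /andP[h1 h2] := step_itv (t - a); have /andP[h3 h4] := step_itv (b - t).
have b1 (s : R) : (step1 s) ^+ 2 <= 81 * (0 <= s <= 1)%R%:R.
  have /andP[k1 k2] := step1_itv s.
  have [h|h] := boolP (0 <= s <= 1); first by rewrite mulr1; nra.
  have -> : step1 s = 0.
    move: h; rewrite negb_and -!ltNge => /orP[h|h].
      by have [] := step_le0 (ltW h).
    by have [] := step_ge1 (ltW h).
  by rewrite expr0n mulr0.
have e1 : (a <= t <= a + 1) = (0 <= t - a <= 1).
  by rewrite subr_ge0 lerBlDl.
have e2 : (b - 1 <= t <= b) = (0 <= b - t <= 1).
  by rewrite subr_ge0 lerBlDl -lerBlDr andbC.
rewrite e1 e2; have := b1 (t - a); have := b1 (b - t).
set B1 : R := (_ : bool)%:R; set B2 : R := (_ : bool)%:R.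
rewrite /cutoff1; move: (step1 (t - a)) (step1 (b - t)) (step (t - a)) (step (b - t)) h1 h2 h3 h4.
move=> x y p q h1 h2 h3 h4 H1 H2.
have q1 : (x * q) ^+ 2 <= x ^+ 2 by rewrite exprMn ler_piMr ?sqr_ge0// exprn_ile1.
have q2 : (p * y) ^+ 2 <= y ^+ 2 by rewrite exprMn ler_piMl ?sqr_ge0// exprn_ile1.
have := sqr_ge0 (x * q + p * y); lra.
Qed.

Lemma bm1_comp_ramp a b (f : R -> R) m : bm1 a b f -> bm1 a b (fun t => ramp m (f t)).
Proof.
move=> [mf [M hM]]; split; first by apply: measurableT_comp => //; exact: measurable_ramp.
exists (`|M| ^+ m) => t /hM h; rewrite ger0_norm ?ramp_ge0// /ramp.
case: ifPn => [f0|_]; last by rewrite exprn_ge0.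
by rewrite lerXn2r ?nnegrE ?(ltW f0)//; move: (ler_norm M) (ler_norm (f t)); lra.
Qed.

Lemma bm1N a b (f : R -> R) : bm1 a b f -> bm1 a b (fun t => - f t).
Proof.
by move=> bf; under [X in bm1 _ _ X]eq_fun do rewrite -mulN1r; apply: bm1M => //; exact: bm1_cst.
Qed.

Lemma bm1_comp_step a b (f : R -> R) : bm1 a b f ->
  [/\ bm1 a b (fun t => step (f t)), bm1 a b (fun t => step1 (f t)) & bm1 a b (fun t => step2 (f t))].
Proof.
move=> bf.
have h : bm1 a b (fun t => 1 - ramp 3 (f t)).
  by apply: bm1D; [exact: bm1_cst|apply: bm1N; exact: bm1_comp_ramp].
have c (x : R) : bm1 a b (fun=> x) by exact: bm1_cst.
have r m g : bm1 a b g -> bm1 a b (fun t => ramp m (g t)) by exact: bm1_comp_ramp.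
split.
- by apply: bm1D => //; apply: bm1N; exact: (r 3).
- by apply: bm1M => //; apply: bm1M; [exact: (r 2)|exact: r].
- apply: bm1M => //; apply: bm1D.
    apply: bm1N; apply: bm1M => //; apply: bm1M; first exact: (r 1).
    by apply: bm1M; exact: r.
  by apply: bm1M => //; apply: bm1M; [exact: (r 2)|exact: r].
Qed.

Lemma bm1_id a b : bm1 a b (fun t => t).
Proof.
split => //; exists (`|a| + `|b|) => t /andP[h1 h2].
rewrite ler_norml; apply/andP; split.
  by have := ler_norm (- a); rewrite normrN; have := normr_ge0 b; lra.
by have := ler_norm b; have := normr_ge0 a; lra.
Qed.

Lemma bm1_cutoff a b c d :
  [/\ bm1 c d (cutoff a b), bm1 c d (cutoff1 a b) & bm1 c d (cutoff2 a b)].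
Proof.
have [l0 l1 l2] : [/\ bm1 c d (fun t => step (t - a)), bm1 c d (fun t => step1 (t - a))
    & bm1 c d (fun t => step2 (t - a))].
  by apply: bm1_comp_step; apply: bm1D; [exact: bm1_id|exact: bm1_cst].
have [r0 r1 r2] : [/\ bm1 c d (fun t => step (b - t)), bm1 c d (fun t => step1 (b - t))
    & bm1 c d (fun t => step2 (b - t))].
  by apply: bm1_comp_step; apply: bm1D; [exact: bm1_cst|apply: bm1N; exact: bm1_id].
split; first exact: bm1M.
  by apply: bm1D; [exact: bm1M|apply: bm1N; exact: bm1M].
apply: bm1D; last exact: bm1M.
apply: bm1D; first exact: bm1M.
by apply: bm1N; apply: bm1M; [exact: bm1_cst|exact: bm1M].
Qed.

Lemma cut_weight_cutoff a b : cut_weight a b (cutoff a b) /\ cut_weight a b (cutoff1 a b).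
Proof.
have [b0 b1 _] := bm1_cutoff a b (a - 1) (b + 1).
by split; split => // t /cutoff_vanish[].
Qed.

End cutoff_functions.

(** * Local uniqueness *)

Section log_weight_bounds.
Context {R : realType}.
Implicit Types m l t : R.

Lemma logweight_m24 t : t < 0 -> logweight (-2) (-4) t = expR (2 * t) * t ^+ 4.
Proof.
move=> t0; rewrite /logweight (_ : - _ = 2 * t + 4%:R * ln (- t)); last by ring.
rewrite expRD [X in _ * X]expRM_natl lnK ?posrE ?oppr_gt0//; ring.
Qed.

Lemma logweight_le_expR m l t : t <= -1 -> 0 <= l -> logweight m l t <= expR (- (m * t)).
Proof.
move=> t1 l0; rewrite /logweight ler_expR lerN2 lerDl mulr_ge0// ln_ge0//; lra.
Qed.

Lemma ln_opp_le_half t : t <= -16 -> ln (- t) <= - t / 2.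
Proof.
move=> t1; have t0 : 0 < - t by lra.
have h : 0 < - t / 4 by lra.
have := expR_ge1Dx (ln (- t / 4)); rewrite lnK ?posrE// lnM ?posrE//.
have h2 : ln (4 : R)^-1 = - ln 4 by rewrite lnV ?posrE.
have h3 : ln 4 <= 3 :> R.
  by have := expR_ge1Dx (ln 4 : R); rewrite lnK ?posrE//; lra.
rewrite h2; lra.
Qed.

(* The weight of order [k] contains the factor [expR (- 2 k (logt t))], [t = ln r]. *)
Definition logt t : R := t + ln (- t).

Lemma logt_mono t s : t <= s -> s <= -1 -> logt t <= logt s.
Proof.
move=> ts s1; have s0 : 0 < - s by lra.
have t0 : 0 < - t by lra.
have h := expR_ge1Dx (ln (- t / - s)).
rewrite lnK ?posrE ?divr_gt0// ln_div ?posrE// in h.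
have h2 : - t / - s - 1 <= s - t.
  rewrite lerBlDr ler_pdivrMr//; nra.
rewrite /logt; lra.
Qed.

(** The limit [k -> oo] lives on this gap: the outer error layer begins at [b - 1], while the region
    where vanishing is proved ends at [b - 2]. *)
Lemma logt_gap b : b <= -1 -> 0 < logt (b - 1) - logt (b - 2).
Proof.
move=> b1; have s0 : 0 < - (b - 1) by lra.
have t0 : 0 < - (b - 2) by lra.
have h := expR_ge1Dx (ln (- (b - 2) / - (b - 1))).
rewrite lnK ?posrE ?divr_gt0// ln_div ?posrE// in h.
have h2 : - (b - 2) / - (b - 1) < 2.
  rewrite ltr_pdivrMr//; lra.
rewrite /logt; lra.
Qed.

Lemma logweight_split m l k t : logweight (m + 2 * k) (2 * k + l) t = logweight m l t * expR (- (2 * k * logt t)).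
Proof. by rewrite /logweight -expRD /logt; congr expR; ring. Qed.

(** The power beats the logarithm, as [l ln |t| <= l |t| / 2 <= m |t|]; this is the purpose of the
    threshold [-16]. The main terms are thereby bounded below with constant 1. *)
Lemma logweight_ge1 m l t : t <= -16 -> 0 <= l -> l <= 2 * m -> 1 <= logweight m l t.
Proof.
move=> t1 l0 lm; have h := ler_wpM2l l0 (ln_opp_le_half t1).
rewrite /logweight -expR0 ler_expR; nra.
Qed.

Lemma logweight_lower k m l b t : 0 <= k -> 0 <= l -> l <= 2 * m -> b <= -16 -> t <= b ->
  expR (- (2 * k * logt b)) <= logweight (m + 2 * k) (2 * k + l) t.
Proof.
move=> k0 l0 lm b16 tb; rewrite logweight_split -[leLHS]mul1r.
apply: ler_pM; [by []|exact: expR_ge0|by apply: logweight_ge1 => //; lra|].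
rewrite ler_expR lerN2 ler_wpM2l ?mulr_ge0// logt_mono//; lra.
Qed.

(** A crude bound for the inner layer, where any dependence on [a] and [k] is beaten by vanishing of
    infinite order. The outer layer needs [logweight_upper_logt], which retains the factor
    [expR (- (2 * k * logt a))]. *)
Lemma logweight_upper k m l a t (M : R) : 0 <= k -> 0 <= m -> m <= M -> 0 <= l ->
  a <= t -> t <= -1 -> logweight (m + 2 * k) (2 * k + l) t <= expR (- ((M + 2 * k) * a)).
Proof.
move=> k0 m0 mM l0 t1 t2.
have kl0 : 0 <= 2 * k + l by lra.
apply: le_trans (logweight_le_expR _ t2 kl0) _.
have p1 : (m + 2 * k) * - t <= (M + 2 * k) * - a by apply: ler_pM; lra.
rewrite ler_expR; lra.
Qed.

Lemma logweight_upper_logt k m l a t (M : R) : 0 <= k -> 0 <= m -> m <= M -> 0 <= l ->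
  a <= t -> t <= -1 ->
  logweight (m + 2 * k) (2 * k + l) t <= expR (- (M * a)) * expR (- (2 * k * logt a)).
Proof.
move=> k0 m0 mM l0 t1 t2; rewrite logweight_split.
apply: ler_pM; [exact: logweight_ge0|exact: expR_ge0| |].
  apply: le_trans (logweight_le_expR _ t2 l0) _.
  have p1 : m * - t <= M * - a by apply: ler_pM; lra.
  rewrite ler_expR; lra.
by rewrite ler_expR lerN2 ler_wpM2l ?mulr_ge0// logt_mono.
Qed.

Lemma sqw_cutoff1_le k m l a b t (M : R) : 0 <= k -> 0 <= m -> m <= M -> 0 <= l ->
  a + 1 <= -1 -> b <= -1 ->
  sqw (cutoff1 a b) (m + 2 * k) (2 * k + l) t <=
  162 * expR (- ((M + 2 * k) * a)) * (a <= t <= a + 1)%R%:R +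
  162 * (expR (- (M * (b - 1))) * expR (- (2 * k * logt (b - 1)))) * (b - 1 <= t <= b)%R%:R.
Proof.
move=> k0 m0 mM l0 a1 b1; have := cutoff1_sqr_le a b t; have := sqr_ge0 (cutoff1 a b t).
rewrite /sqw; move: (cutoff1 a b t ^+ 2) => q q0.
have L0 := logweight_ge0 (m + 2 * k) (2 * k + l) t.
have ha : a <= t <= a + 1 -> logweight (m + 2 * k) (2 * k + l) t <= expR (- ((M + 2 * k) * a)).
  by move=> /andP[t1 t2]; apply: logweight_upper => //; lra.
have hb : b - 1 <= t <= b -> logweight (m + 2 * k) (2 * k + l) t <=
    expR (- (M * (b - 1))) * expR (- (2 * k * logt (b - 1))).
  by move=> /andP[t1 t2]; apply: logweight_upper_logt => //; lra.
have p1 : 0 <= expR (- ((M + 2 * k) * a)) by exact: expR_ge0.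
have p2 : 0 <= expR (- (M * (b - 1))) * expR (- (2 * k * logt (b - 1))).
  by rewrite mulr_ge0 ?expR_ge0.
move: (logweight _ _ t) (expR (- ((M + 2 * k) * a))) (expR _ * _) L0 ha hb p1 p2 => L E1 E2 L0 ha hb p1 p2.
case: (boolP (a <= t <= a + 1)) ha => h1 ha; case: (boolP (b - 1 <= t <= b)) hb => h2 hb /= hq;
  rewrite ?mulr1 ?mulr0 ?addr0 ?add0r.
- have := ha isT; have := hb isT; nra.
- have := ha isT; nra.
- have := hb isT; nra.
- have -> : q = 0 by lra.
  by rewrite mulr0.
Qed.

Lemma mul_expRN_le (k eta : R) : 0 <= k -> 0 < eta -> k * eta ^+ 2 * (k * expR (- (2 * k * eta))) <= 1.
Proof.
move=> k0 e0; have h := expR_ge1Dx (k * eta).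
have ke : 0 <= k * eta by rewrite mulr_ge0// ltW.
have h2 : (k * eta) ^+ 2 <= expR (2 * k * eta).
  have -> : 2 * k * eta = k * eta + k * eta by ring.
  by rewrite expRD; nra.
rewrite expRN; have -> : k * eta ^+ 2 * (k * (expR (2 * k * eta))^-1) = (k * eta) ^+ 2 / expR (2 * k * eta) by ring.
by rewrite ler_pdivrMr ?expR_gt0// mul1r.
Qed.

(** Bookkeeping separated from the integrals: the [A] variables are masses in the inner layer, with
    weight [ea], and the [O] variables masses in the outer layer, with weight [Hk]. The factor
    [162 k] combines the constant of the cut-off with the factor [k] of [Wu]. *)
Lemma collect_errors (CC k ea Hk Au Aw Ap Ou Ow Op L Wu Ww Wp e : R) :
  1 <= k -> 0 < CC -> 0 <= ea -> 0 <= Hk -> 0 <= Au -> 0 <= Aw -> 0 <= Ap ->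
  0 <= Ou -> 0 <= Ow -> 0 <= Op ->
  L <= CC * ((Ww + Wp) + k * Wu) ->
  Wu <= 162 * ea * Au + 162 * Hk * Ou -> Ww <= 162 * ea * Aw + 162 * Hk * Ow ->
  Wp <= 162 * ea * Ap + 162 * Hk * Op ->
  ea * (Au + Aw + Ap) <= e / (CC * (162 * k)) ->
  L <= CC * (162 * k) * (Hk * (Ou + Ow + Op)) + e.
Proof.
move=> k1 CC0 ea0 Hk0 Au0 Aw0 Ap0 Ou0 Ow0 Op0 hL hu hw hp he.
have k0 : 0 < k by lra.
have P0 : 0 < CC * (162 * k) by rewrite !mulr_gt0.
rewrite ler_pdivlMr// in he; apply: le_trans hL _.
have q1 : 0 <= ea * (Aw + Ap) + Hk * (Ow + Op) by rewrite addr_ge0// mulr_ge0// addr_ge0.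
have q2 := ler_wpM2l (ltW k0) hu.
have q3 : ea * (Aw + Ap) + Hk * (Ow + Op) <= k * (ea * (Aw + Ap) + Hk * (Ow + Op)).
  by rewrite ler_peMl.
have q4 : Ww + Wp + k * Wu <= 162 * k * (ea * (Au + Aw + Ap) + Hk * (Ou + Ow + Op)).
  have -> : 162 * k * (ea * (Au + Aw + Ap) + Hk * (Ou + Ow + Op)) =
     162 * (k * (ea * (Aw + Ap) + Hk * (Ow + Op))) + k * (162 * ea * Au + 162 * Hk * Ou) by ring.
  lra.
apply: le_trans (ler_wpM2l (ltW CC0) q4) _; lra.
Qed.

(** Division by [expR (- (2 * k * t2))] leaves [J <= D k e^(- 2 k eta)], and
    [(k eta)^2 <= e^(2 k eta)] turns this into [k eta^2 J <= D] for all [k >= 1]. *)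
Lemma decay_zero (J C h E t1 t2 : R) : 0 <= J -> 0 <= C -> 0 <= h -> 0 <= E -> 0 < t1 - t2 ->
  (forall k, 1 <= k ->
    expR (- (2 * k * t2)) * J <= C * (162 * k) * (h * expR (- (2 * k * t1)) * E)) -> J = 0.
Proof.
move=> J0 C0 h0 E0 eta0 H; set eta := t1 - t2 in eta0.
pose D := C * 162 * (h * E).
have D0 : 0 <= D by rewrite !mulr_ge0.
have main (k : R) : 1 <= k -> k * eta ^+ 2 * J <= D.
  move=> k1; have k0 : 0 <= k by exact: le_trans k1.
  have e2 : expR (- (2 * k * t1)) = expR (- (2 * k * eta)) * expR (- (2 * k * t2)).
    by rewrite -expRD /eta; congr expR; ring.
  have ek0 : 0 < expR (- (2 * k * t2)) by exact: expR_gt0.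
  have H2 : J <= D * (k * expR (- (2 * k * eta))).
    rewrite -(ler_pM2l ek0); apply: le_trans (H _ k1) _; rewrite e2 /D.
    by rewrite le_eqVlt; apply/orP; left; apply/eqP; ring.
  have ke0 : 0 <= k * eta ^+ 2 by rewrite mulr_ge0// sqr_ge0.
  apply: le_trans (ler_wpM2l ke0 H2) _; rewrite mulrCA.
  by rewrite ler_piMr// mul_expRN_le.
apply/eqP; apply/negPn/negP => Jn.
have Jp : 0 < J by rewrite lt_neqAle eq_sym Jn J0.
have q0 : 0 < eta ^+ 2 * J by rewrite mulr_gt0// exprn_gt0.
(* If [J] were positive, this value of [k] would give [D + eta^2 J <= D]. *)
have q1 : 1 <= D / (eta ^+ 2 * J) + 1 by rewrite lerDr divr_ge0// ltW.
have := main _ q1; rewrite -mulrA mulrDl mul1r divfK ?gt_eqF//; apply/negP.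
by rewrite -ltNge ltrDl.
Qed.

End log_weight_bounds.

(** Lagrange's identity: twice the difference of the two sides is a sum of squares. *)
Lemma cauchy_schwarz_sum (R : realType) (n : nat) (f g : 'I_n -> R) :
  (\sum_i f i * g i) ^+ 2 <= (\sum_i f i ^+ 2) * (\sum_i g i ^+ 2).
Proof.
have h : 0 <= \sum_i \sum_j (f i * g j - f j * g i) ^+ 2.
  by apply: sumr_ge0 => i _; apply: sumr_ge0 => j _; exact: sqr_ge0.
have e : \sum_i \sum_j (f i * g j - f j * g i) ^+ 2 =
    2 * ((\sum_i f i ^+ 2) * (\sum_i g i ^+ 2)) - 2 * (\sum_i f i * g i) ^+ 2.
  rewrite expr2 !big_distrlr /=.
  transitivity (\sum_i \sum_j (f i ^+ 2 * g j ^+ 2) + \sum_i \sum_j (f j ^+ 2 * g i ^+ 2)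
     - 2 * \sum_i \sum_j (f i * g i * (f j * g j))).
    rewrite mulr_sumr -big_split -sumrB /=; apply: eq_bigr => i _.
    rewrite mulr_sumr -big_split -sumrB /=; apply: eq_bigr => j _; ring.
  by rewrite [X in _ + X - _]exchange_big /=; ring.
by move: h; rewrite e; lra.
Qed.

(** * Absorption of the drift and the limit in [k] *)

Section local_uniqueness.
Context {R : realType} {n : nat}.
Local Notation mu := (@lebesgue_rV R n).
Local Notation "'\I' f" := (\int[mu]_x f x) (at level 10, f at level 9).
Variables (Omega : set 'rV[R]_n) (hO : open Omega).
Variables (A u : 'rV[R]_n -> 'rV[R]_n) (p : 'rV[R]_n -> R)
  (Du : 'I_n -> 'I_n -> 'rV[R]_n -> R).
Local Notation F := (drift A Du).
Hypotheses (hn : (2 <= n)%N) (hA : measurable_fun Omega A).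
Hypotheses (hu : forall j, L2loc Omega (fun x => u x ord0 j)) (hp : L2loc Omega p)
  (hDu : forall j, weak_gradient Omega (fun x => u x ord0 j) (Du j))
  (hmom : forall j phi, test_function Omega phi ->
        \int[mu]_(x in Omega)
          (- (\sum_i Du j i x * partial i phi x)
           + (\sum_i A x ord0 i * Du j i x) * phi x
           - p x * partial j phi x) = 0)
  (hdiv : forall phi, test_function Omega phi ->
        \int[mu]_(x in Omega) (\sum_i u x ord0 i * partial i phi x) = 0).

Definition carl_cst : R := (12 * (n%:R + 4) ^+ 2 + 16 + 2 * n%:R) * (n%:R ^+ 2 + 1).

Lemma carl_cst_ge1 : 1 <= carl_cst.
Proof.
have h1 : 1 <= 12 * (n%:R + 4) ^+ 2 + 16 + 2 * n%:R :> R.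
  have h := sqr_ge0 (n%:R + 4 : R); have : 0 <= n%:R :> R by []; lra.
have h2 : 1 <= n%:R ^+ 2 + 1 :> R by rewrite lerDr sqr_ge0.
by rewrite -[1]mulr1 ler_pM.
Qed.

Variables (x0 : 'rV[R]_n) (be C1 : R).
Hypothesis PB : forall x, 0 < sqdist x0 x <= expR (2 * be) -> Omega x.
Hypothesis hC : forall x, 0 < sqdist x0 x <= expR (2 * be) ->
  nsq (A x) * sqdist x0 x * logdist x0 x ^+ 6 <= C1.

Local Notation Su := (fun x => \sum_i u x ord0 i ^+ 2).
Local Notation Sw := (fun x => \sum_i \sum_j Du i j x ^+ 2).
Local Notation SF := (fun x => \sum_i F i x ^+ 2).
Local Notation pp := (fun x => p x ^+ 2).
Local Notation Wt a b := (radint x0 a b).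

Let Su0 x : 0 <= Su x. Proof. by apply: sumr_ge0 => i _; exact: sqr_ge0. Qed.
Let Sw0 x : 0 <= Sw x.
Proof. by apply: sumr_ge0 => i _; apply: sumr_ge0 => j _; exact: sqr_ge0. Qed.
Let pp0 x : 0 <= pp x. Proof. exact: sqr_ge0. Qed.

Let F_sqr_le j x : F j x ^+ 2 <= nsq (A x) * \sum_i Du j i x ^+ 2.
Proof. exact: cauchy_schwarz_sum. Qed.

Let SF_le x : SF x <= nsq (A x) * Sw x.
Proof. by rewrite mulr_sumr; apply: ler_sum => j _; exact: F_sqr_le. Qed.

Section radius.
Variables (a b : R).
Hypotheses (ab : a <= b) (hb1 : b <= be - 2) (hb2 : b <= -16).

Let b2 : b <= -2. Proof. by move: hb2; lra. Qed.

(** [wide_annulus] reaches [log r = b + 2], which explains the requirement [b <= be - 2]. *)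
Lemma wide_annulus_sub : wide_annulus x0 a b `<=` Omega.
Proof.
move=> x /andP[h1 h2]; apply: PB; rewrite (lt_le_trans (expR_gt0 _) h1)/=.
by apply: le_trans h2 _; rewrite ler_expR; move: hb1; lra.
Qed.

(** Serves the square integrability of [drift] for a fixed [a], so it does no harm that the bound
    degenerates as [a] decreases. *)
Lemma drift_wide_annulus x : wide_annulus x0 a b x -> nsq (A x) <= C1 * expR (- (2 * a - 4)).
Proof.
move=> /[dup] Ax /andP[h1 h2].
have s0 := lt_le_trans (expR_gt0 _) h1.
have hx : 0 < sqdist x0 x <= expR (2 * be).
  by rewrite s0 (le_trans h2)// ler_expR; move: hb1; lra.
have t1 : logdist x0 x <= -1.
  by move: h2; rewrite (sqdist_expR s0) ler_expR; move: hb2; lra.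
have t6 : 1 <= logdist x0 x ^+ 6.
  by rewrite (_ : logdist x0 x ^+ 6 = (- logdist x0 x) ^+ 6) ?sqrrN ?exprn_ege1//; [lra|ring].
have N0 : 0 <= nsq (A x) := nsq_ge0 _.
rewrite expRN ler_pdivlMr ?expR_gt0//; apply: le_trans (hC hx).
have q1 := ler_wpM2l N0 h1; apply: le_trans q1 _.
by rewrite ler_peMr// mulr_ge0// ltW.
Qed.

Lemma L2_drift j : L2 (cut_wide x0 a b (F j)).
Proof.
have mF : measurable_fun Omega (F j).
  apply: measurable_sum => i; apply: measurable_funM.
    exact: (measurableT_comp (measurable_rV_coord i) hA).
  by have [[]] := hDu j i.
split; first exact: (measurable_cut_wide hO wide_annulus_sub mF).
pose M := `|C1 * expR (- (2 * a - 4))|.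
have iS : intg (fun x => \sum_i cut_wide x0 a b (Du j i) x ^+ 2).
  apply: intg_sum => i _; have [[hD _]] := (hDu j i, tt).
  by have [_] := L2_cut_wide hO wide_annulus_sub hD.
apply: (intg_le _ _ (intgZ M iS)).
  by apply: measurable_funX; exact: (measurable_cut_wide hO wide_annulus_sub mF).
move=> x; rewrite ger0_norm ?sqr_ge0//.
have S0 (f : 'I_n -> R) : 0 <= \sum_i f i ^+ 2 by apply: sumr_ge0 => i _; exact: sqr_ge0.
have [Ax|nA] := pselect (wide_annulus x0 a b x); last first.
  by rewrite cut_wide_out// expr0n (mulr_ge0 (normr_ge0 _) (S0 _)).
rewrite cut_wide_in// (le_trans (F_sqr_le j x))//.
rewrite [in leRHS](eq_bigr (fun i => Du j i x ^+ 2)) => [|i _]; last by rewrite cut_wide_in.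
by rewrite ler_wpM2r// (le_trans (drift_wide_annulus Ax))// ler_norm.
Qed.

Section absorption.
Variables (th th1 th2 : R -> R).
Hypotheses (dth : forall tau, is_derive tau (1 : R) th (th1 tau))
  (dth1 : forall tau, is_derive tau (1 : R) th1 (th2 tau)).
Hypotheses (cth : cut_weight a b th) (cth1 : cut_weight a b th1)
  (bth2 : bm1 (a - 1) (b + 1) th2).
Variables (k : R) (k1 : 1 <= k).
Hypothesis hb3 : 2 * carl_cst * C1 <= b ^+ 2.

Local Notation W := (radint x0 a b).
Local Notation wt := (sqw th).
Local Notation wt1 := (sqw th1).
Local Notation m := (n%:R + 2 * k).

Let cw m' l : cut_weight a b (wt m' l). Proof. exact: cut_weight_sqw. Qed.

Let wint g := @radint_intg_weak R n Omega hO x0 a b b2 wide_annulus_sub A u p Du hu hp hDu L2_drift g.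

Let Z0 : 0 <= W (wt m (2 * k + 4)) Sw.
Proof. by apply: radint_ge0 => x _; rewrite mulr_ge0// mulr_ge0 ?logweight_ge0 ?sqr_ge0. Qed.

(** Compared with the weight [|log r|^(-4)] of [Sw], the bound on the drift leaves a spare
    [|log r|^(-2)], at most [b^(-2)] on the support of the cut-off. By [hb3] the drift term, once
    multiplied by [carl_cst], is at most half of the gradient term, for every [k]. *)
Lemma absorb_drift : 2 * carl_cst * W (wt (m - 2) (2 * k)) SF <= W (wt m (2 * k + 4)) Sw.
Proof.
have [_ _ _ i1] := wint (cw (m - 2) (2 * k)); have [_ i2 _ _] := wint (cw m (2 * k + 4)).
have b0 : 0 < b ^+ 2 by rewrite exprn_even_gt0//= lt_eqF//; move: hb2; lra.
have H : b ^+ 2 * W (wt (m - 2) (2 * k)) SF <= C1 * W (wt m (2 * k + 4)) Sw.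
  rewrite -(RIZ _ i1) -(RIZ _ i2); apply: RI_le; [exact: intgZ|exact: intgZ|move=> x].
  have [Ox|nO] := pselect (open_annulus x0 a b x); last by rewrite !rad_out// !mul0r !mulr0.
  rewrite !rad_in//; have [s0 /andP[_ tb]] := (open_annulusE x0 a b x).1 Ox.
  have [_ vt] := cth.
  have [tab|ntab] := boolP (a <= logdist x0 x <= b); last by rewrite /sqw vt// expr0n !mulr0 !mul0r !mulr0.
  have /andP[_ tb'] := tab.
  have t0 : logdist x0 x < 0 by move: hb2 tb'; lra.
  have hx : 0 < sqdist x0 x <= expR (2 * be).
    by rewrite s0 (sqdist_expR s0) ler_expR; move: hb1 tb'; lra.
  have E : logweight (m - 2) (2 * k) (logdist x0 x) = logweight m (2 * k + 4) (logdist x0 x) * (sqdist x0 x * logdist x0 x ^+ 4).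
    have e2 : 2 * k + 4 + -4 = 2 * k by ring.
    by rewrite [in RHS](sqdist_expR s0) -logweight_m24// logweightM e2.
  rewrite /sqw E; set q := logweight m _ _ * th _ ^+ 2.
  have q0 : 0 <= q by rewrite mulr_ge0 ?logweight_ge0 ?sqr_ge0.
  have hh : b ^+ 2 * (sqdist x0 x * logdist x0 x ^+ 4) * nsq (A x) <= C1.
    apply: le_trans (hC hx); have bt : b ^+ 2 <= logdist x0 x ^+ 2 by move: hb2 tb'; nra.
    have N0 : 0 <= sqdist x0 x * logdist x0 x ^+ 4 * nsq (A x).
      by rewrite mulr_ge0 ?nsq_ge0// mulr_ge0 ?(ltW s0)// exprn_even_ge0.
    have := ler_wpM2r N0 bt.
    by move: (logdist x0 x) (sqdist x0 x) (nsq (A x)) (b ^+ 2) => T S N B; lra.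
  have P0 : 0 <= b ^+ 2 * (sqdist x0 x * logdist x0 x ^+ 4).
    by rewrite mulr_ge0 ?sqr_ge0// mulr_ge0 ?(ltW s0)// exprn_even_ge0.
  have g1 := ler_wpM2l P0 (SF_le x).
  rewrite [X in _ <= X]mulrA in g1; have g2 := le_trans g1 (ler_wpM2r (Sw0 x) hh).
  have := ler_wpM2l q0 g2; rewrite /q.
  move: (SF x) (Sw x) (logweight m (2 * k + 4) (logdist x0 x)) (th (logdist x0 x)) (sqdist x0 x) (logdist x0 x) (b ^+ 2).
  by move=> s1 s2 L T S1 t1 B; lra.
have C0 : 0 <= 2 * carl_cst by have := carl_cst_ge1; lra.
have h1 := ler_wpM2l C0 H.
rewrite -(ler_pM2l b0) mulrCA; apply: le_trans h1 _.
by rewrite mulrA ler_wpM2r.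
Qed.

Lemma carleman_absorbed :
  W (wt (m + 2) (2 * k + 4)) Su + W (wt m (2 * k + 2)) pp <=
  carl_cst * (W (wt1 m (2 * k)) (fun x => Sw x + pp x) + k * W (wt1 (m + 2) (2 * k + 2)) Su).
Proof.
have := stokes_carleman_weak hO ab b2 wide_annulus_sub hu hp hDu hmom hdiv L2_drift dth dth1 cth cth1 bth2 k1.
rewrite -/carl_cst; have := absorb_drift; have := Z0; lra.
Qed.

(** Controls the gradient by [u] and [p] alone; with [k = 1] it transfers to the gradient the
    vanishing that is assumed for [u] and [p]. *)
Lemma caccioppoli_absorbed :
  W (wt m (2 * k + 4)) Sw <=
  2 * ((12 * (n%:R + 4) ^+ 2 * k ^+ 2 + 1) * W (wt (m + 2) (2 * k + 4)) Su +
  12 * W (wt1 (m + 2) (2 * k + 2)) Su + 2 * n%:R * W (wt m (2 * k + 2)) pp).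
Proof.
have := stokes_caccioppoli_weak hO ab b2 wide_annulus_sub hu hp hDu hmom hdiv L2_drift dth cth cth1 k1.
have Ph0 : 0 <= W (wt (m - 2) (2 * k)) SF.
  apply: radint_ge0 => x _; rewrite mulr_ge0//; first by rewrite mulr_ge0 ?logweight_ge0 ?sqr_ge0.
  by apply: sumr_ge0 => i _; exact: sqr_ge0.
have h := ler_wpM2r Ph0 carl_cst_ge1.
have := absorb_drift; lra.
Qed.

End absorption.

End radius.

Definition annint (al rho : R) (f : 'rV[R]_n -> R) := \I (fun x => \1_(annulus x0 al rho) x * f x).

Lemma annulus_indic al rho x : 0 < sqdist x0 x -> \1_(annulus x0 al rho) x = (al <= logdist x0 x <= rho)%R%:R :> R.
Proof.
move=> s0; rewrite indicE (_ : (x \in annulus x0 al rho) = (al <= logdist x0 x <= rho)%R)//.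
by apply/idP/idP => [/set_mem/annulusE[]//|h]; rewrite mem_set//; apply/annulusE.
Qed.

Lemma annint_ge0 al rho f : (forall x, 0 <= f x) -> 0 <= annint al rho f.
Proof. by move=> f0; apply: RI_ge0 => x; rewrite mulr_ge0// indicE. Qed.

Lemma annint_sub al rho al' rho' f : (forall x, 0 <= f x) -> al' <= al -> rho <= rho' ->
  intg (fun x => \1_(annulus x0 al rho) x * f x) ->
  intg (fun x => \1_(annulus x0 al' rho') x * f x) -> annint al rho f <= annint al' rho' f.
Proof.
move=> f0 h1 h2 i1 i2; apply: RI_le => // x; rewrite ler_wpM2r// !indicE.
case: (boolP (x \in annulus x0 al rho)) => [|_]; last by case: (_ \in _).
move=> /set_mem/annulusE[s0 /andP[k1 k2]]; rewrite mem_set//; apply/annulusE.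
by rewrite s0 (le_trans h1 k1) (le_trans k2 h2).
Qed.

Lemma annint_le_radint a b al rho (g : R -> R) (c : R) f : a <= al -> rho <= b ->
  (forall x, 0 <= f x) -> (forall t, 0 <= g t) -> (forall t, al <= t <= rho -> c <= g t) ->
  intg (fun x => \1_(annulus x0 al rho) x * f x) -> intg (fun x => radial x0 a b g x * f x) ->
  c * annint al rho f <= Wt a b g f.
Proof.
move=> aal rb f0 g0 cg i1 i2; rewrite /annint -RIZ//; apply: RI_le => //; first exact: intgZ.
move=> x; rewrite mulrA ler_wpM2r//.
have [/[dup] Kx /annulusE[s0 /andP[k1 k2]]|nK] := pselect (annulus x0 al rho x); last first.
  by rewrite indicE memNset// mulr0 rad_ge0.
rewrite indicE mem_set// mulr1 rad_in; first by rewrite cg// k1.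
by apply: sub_annulus; apply/annulusE; rewrite s0 (le_trans aal k1) (le_trans k2 rb).
Qed.

Lemma radint_le_annint a b (g : R -> R) (M : R) f : (forall x, 0 <= f x) -> cut_weight a b g ->
  (forall t, a <= t <= b -> g t <= M) ->
  intg (fun x => \1_(annulus x0 a b) x * f x) -> intg (fun x => radial x0 a b g x * f x) ->
  Wt a b g f <= M * annint a b f.
Proof.
move=> f0 [_ vg] gM i1 i2; rewrite /annint -RIZ//; apply: RI_le => //; first exact: intgZ.
move=> x; rewrite mulrA ler_wpM2r//.
have [Ox|nO] := pselect (open_annulus x0 a b x); last first.
  by rewrite rad_out// indicE memNset ?mulr0// => /sub_annulus.
rewrite rad_in// annulus_indic; last by have [] := (open_annulusE x0 a b x).1 Ox.
by have [h|h] := boolP (a <= _ <= b); [rewrite mulr1 gM|rewrite mulr0 vg].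
Qed.

Lemma radint_le_annint2 a b al rho al' rho' (g : R -> R) (M M' : R) f : (forall x, 0 <= f x) ->
  0 <= M -> 0 <= M' ->
  (forall t, g t <= M * (al <= t <= rho)%R%:R + M' * (al' <= t <= rho')%R%:R) ->
  intg (fun x => \1_(annulus x0 al rho) x * f x) -> intg (fun x => \1_(annulus x0 al' rho') x * f x) ->
  intg (fun x => radial x0 a b g x * f x) ->
  Wt a b g f <= M * annint al rho f + M' * annint al' rho' f.
Proof.
move=> f0 M0 M0' gM i1 i1' i2; have j := intgZ M i1; have j' := intgZ M' i1'.
rewrite /annint -!RIZ// -RID//; apply: RI_le => //; first exact: intgD.
move=> x; rewrite !mulrA -mulrDl ler_wpM2r//.
have [Ox|nO] := pselect (open_annulus x0 a b x); last first.
  by rewrite rad_out// addr_ge0// mulr_ge0// indicE.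
have [s0 _] := (open_annulusE x0 a b x).1 Ox.
by rewrite rad_in// !annulus_indic.
Qed.

Lemma annintD al rho f f' : intg (fun x => \1_(annulus x0 al rho) x * f x) ->
  intg (fun x => \1_(annulus x0 al rho) x * f' x) ->
  annint al rho (fun x => f x + f' x) = annint al rho f + annint al rho f'.
Proof. by move=> i1 i2; rewrite /annint -RID//; apply: RI_eq => x; rewrite mulrDr. Qed.

(* Keeps [lra] from unfolding its atoms. *)
Opaque annint.

Section fixed_radius.
Variable b : R.
Hypotheses (hb1 : b <= be - 2) (hb2 : b <= -16) (hb3 : 2 * carl_cst * C1 <= b ^+ 2).

Lemma annint_intg al rho : rho <= b -> [/\ intg (fun x => \1_(annulus x0 al rho) x * Su x),
  intg (fun x => \1_(annulus x0 al rho) x * Sw x) & intg (fun x => \1_(annulus x0 al rho) x * pp x)].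
Proof.
move=> rb; have sub := wide_annulus_sub (a := al) hb1.
have KA x : annulus x0 al rho x -> wide_annulus x0 al b x.
  move=> /andP[h1 h2]; apply/andP; split; [apply: le_trans h1|apply: (le_trans h2)];
  rewrite ler_expR; lra.
have E (f f' : 'rV[R]_n -> R) : intg f -> (forall x, wide_annulus x0 al b x -> f x = f' x) ->
    intg (fun x => \1_(annulus x0 al rho) x * f' x).
  move=> intf ff'; have := intg_bmul intf (bmeas_indic (measurable_annulus x0 al rho)).
  apply: intg_eq => x; rewrite indicE.
  by case: (boolP (_ \in _)) => [/set_mem/KA/ff' ->|_]; rewrite ?mul0r.
split.
- apply: (E (fun x => \sum_i cut_wide x0 al b (fun y => u y ord0 i) x ^+ 2)).
    by apply: intg_sum => i _; have [] := L2_cut_wide hO sub (hu i).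
  by move=> x Ax; apply: eq_bigr => i _; rewrite cut_wide_in.
- apply: (E (fun x => \sum_i \sum_j cut_wide x0 al b (Du i j) x ^+ 2)).
    apply: intg_sum => i _; apply: intg_sum => j _; have [hD _] := hDu i j.
    by have [] := L2_cut_wide hO sub hD.
  by move=> x Ax; apply: eq_bigr => i _; apply: eq_bigr => j _; rewrite cut_wide_in.
- apply: (E (fun x => cut_wide x0 al b p x ^+ 2)); first by have [] := L2_cut_wide hO sub hp.
  by move=> x Ax; rewrite cut_wide_in.
Qed.


(** The cut-off between [a - 1] and [a + 2] equals 1 on the layer from [a] to [a + 1]. With [k = 1]
    all weights are at least 1 there and at most [e^(- (n + 4) (a - 1))] on the larger layer;
    [324 = 2 * 162] bounds the square of the derivative of the cut-off. *)
Lemma annint_grad_le a : a + 2 <= b ->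
  annint a (a + 1) Sw <= 2 * (12 * (n%:R + 4) ^+ 2 + 1 + 12 * 324 + 2 * n%:R) *
    expR (- ((n%:R + 4) * (a - 1))) * (annint (a - 1) (a + 2) Su + annint (a - 1) (a + 2) pp).
Proof.
move=> a2b.
have ab : a - 1 <= a + 2 by lra.
have h1 : a + 2 <= be - 2 by move: hb1; lra.
have h2 : a + 2 <= -16 by move: hb2; lra.
(* Absorption only becomes easier towards the centre: [a + 2 <= b < 0] increases the square. *)
have h3 : 2 * carl_cst * C1 <= (a + 2) ^+ 2.
  by apply: (le_trans hb3); move: hb2; nra.
have [c0 c1] := cut_weight_cutoff (a - 1) (a + 2).
have [_ _ b2'] := bm1_cutoff (a - 1) (a + 2) (a - 1 - 1) (a + 2 + 1).
have h2' : a + 2 <= -2 by lra.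
have := caccioppoli_absorbed ab h1 h2 (is_derive_cutoff _ _) c0 c1 (lexx 1) h3.
have rw : n%:R + 2 * 1 + 2 = n%:R + 4 :> R by ring.
rewrite rw !mulr1 expr1n mulr1.
have wi g := @radint_intg_weak R n Omega hO x0 (a - 1) (a + 2) h2' (wide_annulus_sub (a := a - 1) h1) A u p Du
  hu hp hDu (L2_drift (a - 1) h1 h2) g.
have cw m l : cut_weight (a - 1) (a + 2) (sqw (cutoff (a - 1) (a + 2)) m l).
  exact: cut_weight_sqw.
have cw1 m l : cut_weight (a - 1) (a + 2) (sqw (cutoff1 (a - 1) (a + 2)) m l).
  exact: cut_weight_sqw.
have [iv1 iv2 iv3] := annint_intg (a - 1) a2b.
have a1b : a + 1 <= b by lra.
have [ia1 ia2 ia3] := annint_intg a a1b.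
have g1 : 1 * annint a (a + 1) Sw <= Wt (a - 1) (a + 2) (sqw (cutoff (a - 1) (a + 2)) (n%:R + 2) (2 + 4)) Sw.
  have [_ i2 _ _] := wi _ (cw (n%:R + 2) (2 + 4)).
  apply: annint_le_radint => //; [lra|lra|by move=> t; rewrite mulr_ge0 ?logweight_ge0 ?sqr_ge0|].
  move=> t /andP[t1 t2]; rewrite /sqw cutoff_eq1 ?expr1n ?mulr1.
    apply: logweight_ge1; [lra|lra|].
    have : (2 : R) <= n%:R by rewrite ler_nat.
    lra.
  by apply/andP; split; lra.
have bnd m l t : 0 <= m -> m <= n%:R + 4 -> 0 <= l -> a - 1 <= t <= a + 2 -> logweight m l t <= expR (- ((n%:R + 4) * (a - 1))).
  move=> m0 mn l0 /andP[t1 t2]; apply: le_trans (logweight_le_expR _ _ l0) _; first lra.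
  have p1 : m * - t <= (n%:R + 4) * (1 - a).
    by apply: ler_pM => //; lra.
  rewrite ler_expR; lra.
set e := expR _ in bnd *; have e0 : 0 <= e by exact: expR_ge0.
have m4 : 0 <= n%:R + 4 :> R by rewrite addr_ge0.
have m2 : 0 <= n%:R + 2 :> R by rewrite addr_ge0.
have m24 : n%:R + 2 <= n%:R + 4 :> R by lra.
have th1 t : cutoff (a - 1) (a + 2) t ^+ 2 <= 1.
  by have /andP[q1 q2] := cutoff_itv (a - 1) (a + 2) t; rewrite exprn_ile1.
have th2 t : cutoff1 (a - 1) (a + 2) t ^+ 2 <= 324.
  apply: le_trans (cutoff1_sqr_le _ _ _) _.
  rewrite (_ : 324 = 162 * (1 + 1)); last by ring.
  by rewrite ler_pM2l// lerD// lern1 leq_b1.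
have g2 : Wt (a - 1) (a + 2) (sqw (cutoff (a - 1) (a + 2)) (n%:R + 4) (2 + 4)) Su <= e * annint (a - 1) (a + 2) Su.
  have [i2 _ _ _] := wi _ (cw (n%:R + 4) (2 + 4)).
  apply: radint_le_annint => // t ht; rewrite /sqw -[leRHS]mulr1 ler_pM ?logweight_ge0 ?sqr_ge0// bnd//; lra.
have g3 : Wt (a - 1) (a + 2) (sqw (cutoff1 (a - 1) (a + 2)) (n%:R + 4) (2 + 2)) Su <= (e * 324) * annint (a - 1) (a + 2) Su.
  have [i2 _ _ _] := wi _ (cw1 (n%:R + 4) (2 + 2)).
  apply: radint_le_annint => // t ht; rewrite /sqw ler_pM ?logweight_ge0 ?sqr_ge0// bnd//; lra.
have g4 : Wt (a - 1) (a + 2) (sqw (cutoff (a - 1) (a + 2)) (n%:R + 2) (2 + 2)) pp <= e * annint (a - 1) (a + 2) pp.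
  have [_ _ i2 _] := wi _ (cw (n%:R + 2) (2 + 2)).
  apply: radint_le_annint => // t ht; rewrite /sqw -[leRHS]mulr1 ler_pM ?logweight_ge0 ?sqr_ge0// bnd//; lra.
have v1 : 0 <= e * annint (a - 1) (a + 2) Su by rewrite mulr_ge0 ?annint_ge0.
have v2 : 0 <= e * annint (a - 1) (a + 2) pp by rewrite mulr_ge0 ?annint_ge0.
have n0 : 0 <= n%:R :> R by [].
have w1 := mulr_ge0 n0 v1; have w2 := mulr_ge0 (sqr_ge0 (n%:R + 4 : R)) v2.
have g2' := ler_wpM2l (sqr_ge0 (n%:R + 4 : R)) g2; have g4' := ler_wpM2l n0 g4.
lra.
Qed.

Hypothesis hvan : forall N : R, exists B r : R, 0 <= B /\
  forall al rho, rho <= r -> annint al rho Su + annint al rho pp <= B * expR (N * rho).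

Let S0 al rho : [/\ 0 <= annint al rho Su, 0 <= annint al rho Sw & 0 <= annint al rho pp].
Proof. by split; apply: annint_ge0. Qed.

Lemma inner_error_small (M eps : R) : 0 < eps -> exists a1, forall a, a <= a1 ->
  a + 2 <= b /\ expR (- (M * a)) * (annint a (a + 1) Su + annint a (a + 1) Sw + annint a (a + 1) pp) <= eps.
Proof.
(* This order compensates the weight [e^(- M a)] and the loss [e^(- (n + 4) a)] from the gradient
   bound, and leaves a factor [e^a] that tends to 0. *)
move=> eps0; pose N := M + n%:R + 5.
have [B [r [B0 hB]]] := hvan N.
pose K : R := 2 * (12 * (n%:R + 4) ^+ 2 + 1 + 12 * 324 + 2 * n%:R).
have K0 : 0 <= K.
  by have := sqr_ge0 (n%:R + 4 : R); have : 0 <= n%:R :> R by []; rewrite /K; lra.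
pose D := (1 + K) * (B + 1) * expR (n%:R + 4 + 2 * N).
have D0 : 0 < D by rewrite !mulr_gt0 ?expR_gt0//; lra.
have K1 : 0 <= 1 + K by lra.
have BD : (1 + K) * B * expR (n%:R + 4 + 2 * N) <= D.
  by rewrite /D ler_wpM2r ?expR_ge0// ler_wpM2l; lra.
exists (Num.min (b - 2) (Num.min (r - 2) (ln (eps / D)))) => a.
rewrite !le_min => /and3P[ab ar ae].
have a2b : a + 2 <= b by lra.
have am1 : 0 <= - (a - 1) by move: hb2; lra.
split => //.
have ha := annint_grad_le a2b; rewrite -/K in ha.
have hT : annint (a - 1) (a + 2) Su + annint (a - 1) (a + 2) pp <= B * expR (N * (a + 2)).
  by apply: hB; lra.
have a1b : a + 1 <= b by lra.
have [i1 i2 i3] := annint_intg a a1b; have [j1 j2 j3] := annint_intg (a - 1) a2b.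
have l1 : a - 1 <= a by lra.
have l2 : a + 1 <= a + 2 by lra.
have s1 := annint_sub Su0 l1 l2 i1 j1; have s2 := annint_sub pp0 l1 l2 i3 j3.
set T := annint (a - 1) (a + 2) Su + _ in ha hT.
have T0 : 0 <= T by have [? _ ?] := S0 (a - 1) (a + 2); rewrite addr_ge0.
set e1 := expR (- ((n%:R + 4) * (a - 1))) in ha.
have e11 : 1 <= e1.
  by apply: le_trans (expR_ge1Dx _); rewrite lerDl -mulrN mulr_ge0// addr_ge0.
have hS : annint a (a + 1) Su + annint a (a + 1) Sw + annint a (a + 1) pp <= (1 + K) * e1 * T.
  have h : T <= e1 * T by rewrite ler_peMl.
  rewrite addrAC -mulrA mulrDl mul1r mulrA.
  exact: lerD (le_trans (lerD s1 s2) h) ha.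
apply: le_trans (ler_wpM2l (expR_ge0 _) hS) _.
have KE : 0 <= expR (- (M * a)) * ((1 + K) * e1).
  by rewrite mulr_ge0 ?expR_ge0// mulr_ge0 ?expR_ge0.
rewrite [X in X <= _]mulrA; apply: le_trans (ler_wpM2l KE hT) _.
have -> : expR (- (M * a)) * ((1 + K) * e1) * (B * expR (N * (a + 2))) =
    (1 + K) * B * expR (n%:R + 4 + 2 * N) * expR a.
  transitivity ((1 + K) * B * (expR (- (M * a)) * e1 * expR (N * (a + 2)))); first ring.
  rewrite -[in RHS]mulrA -!expRD; congr (_ * expR _); rewrite /N; ring.
have ea : expR a <= eps / D by rewrite -[leRHS]lnK ?posrE ?divr_gt0// ler_expR.
apply: le_trans (ler_wpM2r (expR_ge0 a) BD) _.
by rewrite mulrC -ler_pdivlMr.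
Qed.

(** For fixed [k] the inner radius of the cut-off is sent to 0: the inner layer contributes less
    than any [e], and what is left does not depend on that radius. *)
Lemma carleman_bound (k a0 : R) : 1 <= k -> a0 <= b - 2 ->
  expR (- (2 * k * logt (b - 2))) * (annint a0 (b - 2) Su + annint a0 (b - 2) pp) <=
  carl_cst * (162 * k) * (expR (- ((n%:R + 2) * (b - 1))) * expR (- (2 * k * logt (b - 1))) *
    (annint (b - 1) b Su + annint (b - 1) b Sw + annint (b - 1) b pp)).
Proof.
move=> k1 a0b; have k0 : 0 <= k by lra.
have CC0 : 0 < carl_cst * (162 * k).
  by rewrite !mulr_gt0// ?(lt_le_trans ltr01 carl_cst_ge1)//; lra.
apply/ler_addgt0Pr => e e_gt0.
have [a1 ha1] := inner_error_small (n%:R + 2 * k + 2) (divr_gt0 e_gt0 CC0).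
(* [a <= a0 - 1] makes the cut-off equal to 1 from [a0] to [b - 2]; [a <= a1] makes the inner error
   small. *)
pose a := Num.min a1 (a0 - 1).
have aa0 : a <= a0 - 1 by rewrite ge_min lexx orbT.
have aa1 : a <= a1 by rewrite ge_min lexx.
have [_ ha] := ha1 a aa1; have ab : a <= b by lra.
have [c0 c1] := cut_weight_cutoff a b.
have [_ _ b2'] := bm1_cutoff a b (a - 1) (b + 1).
have b2 : b <= -2 by move: hb2; lra.
have H := carleman_absorbed ab hb1 hb2 (is_derive_cutoff a b) (is_derive_cutoff1 a b) c0 c1 b2' k1 hb3.
have wi g := @radint_intg_weak R n Omega hO x0 a b b2 (wide_annulus_sub (a := a) hb1) A u p Du
  hu hp hDu (L2_drift a hb1 hb2) g.
have cw m l : cut_weight a b (sqw (cutoff a b) m l) by exact: cut_weight_sqw.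
have cw1 m l : cut_weight a b (sqw (cutoff1 a b) m l) by exact: cut_weight_sqw.
have n2 : (2 : R) <= n%:R by rewrite ler_nat.
set ek := expR (- (2 * k * logt (b - 2))); have ek0 : 0 <= ek by exact: expR_ge0.
set Hk := expR (- ((n%:R + 2) * (b - 1))) * expR (- (2 * k * logt (b - 1))).
have Hk0 : 0 <= Hk by rewrite mulr_ge0 ?expR_ge0.
set ea := expR (- ((n%:R + 2 * k + 2) * a)) in ha; have ea0 : 0 <= ea by exact: expR_ge0.
have a0b' : a0 <= b by lra.
have aa0' : a <= a0 by lra.
have bb2 : b - 2 <= b by lra.
have a1b : a + 1 <= b by lra.
have a1m : a + 1 <= -1 by lra.
have bm1' : b <= -1 by lra.
have b216 : b - 2 <= -16 by move: hb2; lra.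
have th1 t : a0 <= t <= b - 2 -> cutoff a b t = 1.
  by move=> /andP[t1 t2]; apply: cutoff_eq1; apply/andP; split; lra.
have low m l f : 0 <= l -> l <= 2 * m -> (forall x, 0 <= f x) ->
    intg (fun x => \1_(annulus x0 a0 (b - 2)) x * f x) ->
    intg (fun x => radial x0 a b (sqw (cutoff a b) (m + 2 * k) (2 * k + l)) x * f x) ->
    ek * annint a0 (b - 2) f <= Wt a b (sqw (cutoff a b) (m + 2 * k) (2 * k + l)) f.
  move=> l0 lm f0 i1 i2; apply: (annint_le_radint aa0' bb2 f0 _ _ i1 i2).
    by move=> t; rewrite mulr_ge0 ?logweight_ge0 ?sqr_ge0.
  move=> t /[dup] ht /andP[t1 t2].
  by rewrite /sqw (th1 _ ht) expr1n mulr1; exact: logweight_lower.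
have up m l f : 0 <= m -> m <= n%:R + 2 -> 0 <= l -> (forall x, 0 <= f x) ->
    intg (fun x => \1_(annulus x0 a (a + 1)) x * f x) ->
    intg (fun x => \1_(annulus x0 (b - 1) b) x * f x) ->
    intg (fun x => radial x0 a b (sqw (cutoff1 a b) (m + 2 * k) (2 * k + l)) x * f x) ->
    Wt a b (sqw (cutoff1 a b) (m + 2 * k) (2 * k + l)) f <=
    162 * ea * annint a (a + 1) f + 162 * Hk * annint (b - 1) b f.
  move=> m0 mn l0 f0 i1 i1' i2.
  apply: (radint_le_annint2 f0 (mulr_ge0 _ ea0) (mulr_ge0 _ Hk0) _ i1 i1' i2) => // t.
  have := sqw_cutoff1_le t k0 m0 mn l0 a1m bm1'.
  by rewrite /ea /Hk (_ : n%:R + 2 + 2 * k = n%:R + 2 * k + 2)//; ring.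
have [_ _ i0] := annint_intg a0 bb2.
have [j1 j2 j3] := annint_intg a a1b; have [l1 l2 l3] := annint_intg (b - 1) (lexx b).
have [iu0 _ _] := annint_intg a0 bb2.
have n0 : 0 <= n%:R :> R by [].
have e22 : n%:R + 2 * k + 2 = n%:R + 2 + 2 * k by ring.
have [w1 _ _ _] := wi _ (cw (n%:R + 2 + 2 * k) (2 * k + 4)).
have [_ _ w2 _] := wi _ (cw (n%:R + 2 * k) (2 * k + 2)).
have [_ w3 w4 _] := wi _ (cw1 (n%:R + 2 * k) (2 * k + 0)).
have [w5 _ _ _] := wi _ (cw1 (n%:R + 2 + 2 * k) (2 * k + 2)).
have n22 : n%:R + 2 <= n%:R + 2 :> R by [].
have n02 : n%:R <= n%:R + 2 :> R by rewrite lerDl.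
have m2 : 0 <= n%:R + 2 :> R by rewrite addr_ge0.
have l4 : (4 : R) <= 2 * (n%:R + 2) by rewrite mulrDr (_ : (2 : R) * 2 = 4) ?lerDr ?mulr_ge0//; ring.
have l2' : (2 : R) <= 2 * n%:R by rewrite ler_peMr// ler1n ltnW.
have L1 := low (n%:R + 2) 4 _ (ler0n _ _) l4 Su0 iu0 w1.
have L2 := low n%:R 2 _ (ler0n _ _) l2' pp0 i0 w2.
have U1 := up n%:R 0 _ n0 n02 (lexx 0) Sw0 j2 l2 w3.
have U2 := up n%:R 0 _ n0 n02 (lexx 0) pp0 j3 l3 w4.
have U3 := up (n%:R + 2) 2 _ m2 n22 (ler0n _ _) Su0 j1 l1 w5.
rewrite !addr0 in U1 U2 w3 w4.
rewrite (radintD w3 w4) e22 in H.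
have H' : ek * (annint a0 (b - 2) Su + annint a0 (b - 2) pp) <= carl_cst *
    ((Wt a b (sqw (cutoff1 a b) (n%:R + 2 * k) (2 * k)) Sw +
      Wt a b (sqw (cutoff1 a b) (n%:R + 2 * k) (2 * k)) pp) +
     k * Wt a b (sqw (cutoff1 a b) (n%:R + 2 + 2 * k) (2 * k + 2)) Su).
  by apply: le_trans H; rewrite mulrDr; exact: lerD L1 L2.
have [su sw sp] := S0 a (a + 1); have [tu tw tp] := S0 (b - 1) b.
have C0 : 0 < carl_cst by exact: lt_le_trans ltr01 carl_cst_ge1.
exact: (collect_errors k1 C0 ea0 Hk0 su sw sp tu tw tp H' U3 U1 U2 ha).
Qed.

Lemma local_zero a0 : a0 <= b - 2 -> annint a0 (b - 2) Su + annint a0 (b - 2) pp = 0.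
Proof.
move=> a0b; have [u0 _ p0] := S0 a0 (b - 2); have [q1 q2 q3] := S0 (b - 1) b.
have bm1' : b <= -1 by apply: (le_trans hb2); rewrite lerN2 ler1n.
apply: (decay_zero (addr_ge0 u0 p0) (ltW (lt_le_trans ltr01 carl_cst_ge1)) (expR_ge0 _)
  (addr_ge0 (addr_ge0 q1 q2) q3) (logt_gap bm1')) => k k1.
exact: carleman_bound.
Qed.

End fixed_radius.

End local_uniqueness.

Transparent annint.

(** * Propagation of the zero set *)

Section almost_everywhere.
Context {R : realType} {n : nat}.
Local Notation mu := (@lebesgue_rV R n).
Implicit Types (x y : 'rV[R]_n).

Lemma intg_ge0_eq0 (f : 'rV[R]_n -> R) : intg f -> (forall x, 0 <= f x) ->
  \int[mu]_x f x = 0 -> {ae mu, forall x, f x = 0}.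
Proof.
move=> intf f0 f1.
have mf : measurable_fun setT (EFin \o f) by apply/measurable_EFinP; exact: intg_measurable intf.
have : (\int[mu]_(x in setT) `|(EFin \o f) x|)%E = 0%E.
  rewrite -[0%E]/(0%:E) -f1 RI_EFin//; apply: eq_integral => x _ /=.
  by rewrite ger0_norm.
move/(ae_eq_integral_abs mu measurableT mf); apply: filterS => x /(_ Logic.I) [].
by [].
Qed.

Lemma lebesgue_rV_set1 x : (0 < n)%N -> mu [set x] = 0%E.
Proof.
case: n x => // m x _.
have -> : [set x] = [set y : 'rV[R]_m.+1 | forall i, [set x ord0 i] (y ord0 i)].
  by apply/seteqP; split => [y -> //|y /= h]; apply/rowP => i; exact: h.
rewrite (lebesgue_rV_box (A := fun i => [set x ord0 i])) => [|i]; last exact: measurable_set1.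
by rewrite big_ord_recl lebesgue_measure_set1 mul0e.
Qed.

Lemma nsqD_le (v w : 'rV[R]_n) : nsq (v + w) <= 2 * nsq v + 2 * nsq w.
Proof.
rewrite /nsq !mulr_sumr -big_split; apply: ler_sum => i _; rewrite !mxE /=.
by have := sqr_ge0 (v ord0 i - w ord0 i); lra.
Qed.

(** Triangle inequality for squared distances; the quarters account for
    [|v + w|^2 <= 2 |v|^2 + 2 |w|^2]. *)
Lemma nsq_sub_lt x y v (r : R) : nsq (x - y) < r / 4 -> nsq (v - x) < r / 4 -> nsq (v - y) < r.
Proof.
move=> h1 h2; have := nsqD_le (v - x) (x - y).
by rewrite addrA subrK; lra.
Qed.

Lemma nsq_eq0 x : nsq x = 0 -> x = 0.
Proof.
move=> /eqP; rewrite /nsq psumr_eq0 => [/allP h|i _]; last exact: sqr_ge0.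
apply/rowP => i; have := h i (mem_index_enum i); rewrite sqrf_eq0 => /eqP ->.
by rewrite mxE.
Qed.

Lemma near_nsq x (r : R) : 0 < r -> \forall y \near x, nsq (y - x) < r.
Proof. by move=> r0; apply: (near_sqdist_lt (x0 := x)); rewrite /sqdist subrr /nsq big1// => i _; rewrite mxE expr0n. Qed.

Lemma nbhs_nsq (P : set 'rV[R]_n) x : nbhs x P ->
  exists2 r : R, 0 < r & forall y, nsq (y - x) < r -> P y.
Proof.
move=> /nbhs_ballP[e /= e0 he].
exists (e ^+ 2) => [|y hy]; first by rewrite exprn_gt0.
apply: he; rewrite -ball_normE /=.
have h i : `|(y - x) ord0 i| < e.
  have := le_lt_trans (coord_le_nsq (y - x) i) hy.
  rewrite -(real_normK (num_real ((y - x) ord0 i))); move: (normr_ge0 ((y - x) ord0 i)).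
  by move: `|(y - x) ord0 i| => t t0; nra.
rewrite distrC [ltLHS]/Num.Def.normr/= mx_normrE.
by apply: bigmax_lt => // -[i j] _ /=; rewrite (ord1 i); exact: h.
Qed.

Lemma open_nsq (Omega : set 'rV[R]_n) x : open Omega -> Omega x ->
  exists2 r : R, 0 < r & forall y, nsq (y - x) < r -> Omega y.
Proof. by move=> oO Ox; apply: nbhs_nsq; exact: open_nbhs_nbhs. Qed.

Lemma nsq_dense x (r : R) : 0 < r -> exists q : 'rV[rat]_n, nsq (x - map_mx ratr q) < r.
Proof.
move=> r0.
pose e := Num.min 1 (r / n.+1%:R).
have e0 : 0 < e by rewrite lt_min ltr01 divr_gt0.
have H i : exists q : rat, `|x ord0 i - ratr q| < e.
  have /rat_in_itvoo[q] : x ord0 i - e < x ord0 i + e by lra.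
  rewrite in_itv /= => /andP[h1 h2]; exists q.
  by rewrite ltr_distl; apply/andP; split; lra.
pose q := \row_i sval (cid (H i)); exists q.
apply: (@le_lt_trans _ _ (\sum_(i < n) r / n.+1%:R)).
  apply: ler_sum => i _; rewrite !mxE; case: cid => c /= hc.
  rewrite -real_normK ?num_real//; set t := `|_| in hc *.
  have t0 : 0 <= t by exact: normr_ge0.
  move: hc; rewrite lt_min => /andP[t1 t2].
  by apply: le_trans (ltW t2); rewrite expr2 ler_piMr// ltW.
have -> : \sum_(i < n) r / n.+1%:R = r * (n%:R / n.+1%:R).
  by rewrite sumr_const card_ord -[LHS]mulr_natl mulrCA.
by rewrite gtr_pMr// ltr_pdivrMr// mul1r ltr_nat.
Qed.

End almost_everywhere.

(** * From vanishing integrals to vanishing almost everywhere *)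

Section unique_continuation.
Context {R : realType} {n : nat}.
Local Notation mu := (@lebesgue_rV R n).
Variables (u : 'rV[R]_n -> 'rV[R]_n) (p : 'rV[R]_n -> R).
Local Notation Su := (fun x => \sum_i u x ord0 i ^+ 2).
Local Notation pp := (fun x => p x ^+ 2).

Let nullP x : \sum_i u x ord0 i ^+ 2 + p x ^+ 2 = 0 -> u x = 0 /\ p x = 0.
Proof.
have s0 : 0 <= \sum_i u x ord0 i ^+ 2 by apply: sumr_ge0 => i _; exact: sqr_ge0.
move=> /eqP; rewrite paddr_eq0 ?sqr_ge0// sqrf_eq0 => /andP[/eqP h /eqP ->]; split => //.
exact: nsq_eq0.
Qed.

Lemma annint_zero_ae x0 (c : R) :
  (forall al, intg (fun x => \1_(annulus x0 al c) x * Su x) /\ intg (fun x => \1_(annulus x0 al c) x * pp x)) ->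
  (forall al, al <= c -> annint x0 al c Su + annint x0 al c pp = 0) ->
  {ae mu, forall y, 0 < sqdist x0 y <= expR (2 * c) -> u y = 0 /\ p y = 0}.
Proof.
move=> hi hV.
(* Countably many annuli, from [c - m] to [c], exhaust the punctured ball, so the null sets can be
   united. *)
have H m : {ae mu, forall y, \1_(annulus x0 (c - m%:R) c) y * (Su y + pp y) = 0}.
  have [i1 i2] := hi (c - m%:R).
  apply: intg_ge0_eq0.
  - by apply: intg_eq (intgD i1 i2) => y; rewrite mulrDr.
  - move=> y; apply: mulr_ge0; first by rewrite indicE.
    by apply: addr_ge0; [apply: sumr_ge0 => i _|]; exact: sqr_ge0.
  - have := annintD i1 i2; rewrite hV ?gerBl// => h; exact: h.
have := ae_foralln H; apply: filterS => y hy /andP[s0 sc]; apply: nullP.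
have [m hm] : exists m : nat, c - logdist x0 y <= m%:R.
  have h := archi_boundP (normr_ge0 (c - logdist x0 y)); eexists.
  exact: le_trans (ler_norm _) (ltW h).
have := hy m; rewrite annulus_indic//.
have -> : c - m%:R <= logdist x0 y <= c.
  apply/andP; split; first by lra.
  by move: sc; rewrite (sqdist_expR s0) ler_expR; lra.
by rewrite mul1r.
Qed.

(** The parameter [r] is the square of the radius. *)
Definition zero_near x (r : R) := {ae mu, forall y, nsq (y - x) < r -> u y = 0 /\ p y = 0}.

Lemma zero_near_sub x x' r r' : (forall y, nsq (y - x') < r' -> nsq (y - x) < r) ->
  zero_near x r -> zero_near x' r'.
Proof. by move=> h; apply: filterS => y hy /h; exact: hy. Qed.

(** Lindelof's argument with balls of rational centre and squared radius [1 / (m + 1)]. The property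
    [P k] holds trivially for the indices whose ball is not known to consist of zeros, so the whole
    enumeration can be handled by one countable intersection. *)
Lemma zero_near_cover (Omega : set 'rV[R]_n) :
  (forall x, Omega x -> exists2 r : R, 0 < r & zero_near x r) ->
  {ae mu, forall x, Omega x -> u x = 0 /\ p x = 0}.
Proof.
move=> H.
pose T := ('rV[rat]_n * nat)%type.
pose P (k : nat) (y : 'rV[R]_n) := if (unpickle k : option T) is Some (q, m) then
  zero_near (map_mx ratr q) (m.+1%:R^-1) -> nsq (y - map_mx ratr q) < m.+1%:R^-1 ->
  u y = 0 /\ p y = 0 else True.
have HP k : {ae mu, forall y, P k y}.
  rewrite /P; case: unpickle => [[q m]|]; last exact: aeW.
  have [z|nz] := pselect (zero_near (map_mx ratr q) (m.+1%:R^-1)); last by apply: aeW => y /nz.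
  by move: (z); apply: filterS => y hy _.
have := ae_foralln HP; apply: filterS => x hx Ox.
have [r r0 zr] := H x Ox.
have [m hm] : exists m : nat, m.+1%:R^-1 < r / 4.
  have r40 : 0 < r / 4 by rewrite divr_gt0.
  by have [N _ /(_ N (leqnn N))] := near_infty_natSinv_lt (PosNum r40); exists N.
have m0 : (0 : R) < m.+1%:R^-1 by rewrite invr_gt0.
have [q hq] := nsq_dense x m0.
have := hx (pickle (q, m)); rewrite /P pickleK; apply => //.
apply: zero_near_sub zr => y hy.
have hq' : nsq (map_mx ratr q - x) < r / 4 by rewrite -nsqN opprB (lt_trans hq).
by apply: (nsq_sub_lt hq'); exact: lt_trans hm.
Qed.

End unique_continuation.

(** * The Euclidean norm and local bounds for the drift *)

Section euclidean_norm.
Context {R : realType} {n : nat}.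
Local Notation mu := (@lebesgue_rV R n).
Implicit Types (x y : 'rV[R]_n).

Lemma enorm_sqr x : enorm x ^+ 2 = nsq x.
Proof. by rewrite sqr_sqrtr// nsq_ge0. Qed.

Lemma enorm_ge0 x : 0 <= enorm x. Proof. exact: sqrtr_ge0. Qed.

Lemma enorm_gt0 x : x != 0 -> 0 < enorm x.
Proof.
move=> x0; rewrite lt_neqAle enorm_ge0 andbT eq_sym; apply: contra x0 => /eqP h.
by apply/eqP; apply: nsq_eq0; rewrite -enorm_sqr h expr0n.
Qed.

Lemma continuous_enorm : continuous (@enorm R n).
Proof.
move=> x; apply: (@continuous_comp _ _ _ (@nsq R n) (@Num.sqrt R)); first exact: continuous_nsq.
exact: sqrt_continuous.
Qed.

Lemma L2loc_intg (Omega K : set 'rV[R]_n) (f : 'rV[R]_n -> R) : open Omega -> L2loc Omega f ->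
  K `<=` Omega -> compact K -> measurable K -> intg (fun x => \1_K x * f x ^+ 2).
Proof.
move=> oO [mf /(_ _ _ _)fi] KO cK mK.
have E : (fun x => \1_K x * f x ^+ 2) = (fun x => f x ^+ 2) \_ K.
  apply/funext => x; rewrite patchE indicE.
  by case: (x \in K); rewrite ?mul1r ?mul0r.
apply/integrableP; split.
  apply/measurable_EFinP; rewrite E; apply/(measurable_restrictT _ mK).
  apply: measurable_funX; apply: measurable_funS mf => //; exact: measurable_open_rV.
move: (fi K KO cK); rewrite integral_mkcond; congr (_ < _)%E; apply: eq_integral => x _.
rewrite /= patchE indicE; case: (x \in K); first by rewrite mul1r normrX.
by rewrite mul0r normr0.
Qed.

(** Away from the unit sphere the right-hand side of the bound is continuous at [z != 0], hence
    bounded nearby; on the sphere the second clause of [drift_bound] is used. *)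
Lemma drift_locally_bounded (Omega : set 'rV[R]_n) C0 (A : 'rV[R]_n -> 'rV[R]_n) z :
  open Omega -> drift_bound Omega C0 A -> Omega z -> z != 0 ->
  exists rM : R * R, [/\ 0 < rM.1, 0 <= rM.2 &
    forall x, nsq (x - z) < rM.1 -> Omega x /\ nsq (A x) <= rM.2].
Proof.
move=> oO [b1 b2] Oz z0.
have near_bound : exists M : R, \forall x \near z, Omega x -> enorm (A x) <= M.
  have [z1|z1] := eqVneq (enorm z) 1.
    by have [M hM] := b2 z Oz z1; exists M; apply: filterS hM.
  have ez := enorm_gt0 z0.
  have cE : enorm x @[x --> z] --> enorm z by exact: continuous_enorm.
  have lz : ln (enorm z) != 0 by rewrite ln_eq0.
  have cL : `|ln (enorm x)| @[x --> z] --> `|ln (enorm z)|.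
    have cl : {for z, continuous (@ln R \o @enorm R n)}.
      by apply: continuous_comp; [exact: continuous_enorm|exact: continuous_ln].
    exact: (cvg_norm cl).
  have c3 : C0 * `|ln (enorm x)| ^- 3 * (enorm x)^-1 @[x --> z] --> C0 * `|ln (enorm z)| ^- 3 * (enorm z)^-1.
    have en0 : enorm z != 0 by rewrite gt_eqF.
    have cX : `|ln (enorm x)| ^+ 3 @[x --> z] --> `|ln (enorm z)| ^+ 3.
      by rewrite !exprS expr0 mulr1; under eq_fun do rewrite !exprS expr0 mulr1; exact: (cvgM cL (cvgM cL cL)).
    have l30 : `|ln (enorm z)| ^+ 3 != 0 by rewrite expf_neq0// normr_eq0.
    exact: (cvgM (cvgMl_tmp (cvgV l30 cX)) (cvgV en0 cE)).
  exists (C0 * `|ln (enorm z)| ^- 3 * (enorm z)^-1 + 1).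
  have n0 : \forall x \near z, x != 0.
    have : \forall x \near z, 0 < nsq x.
      by have /cvgr_gt := @continuous_nsq R n z; apply; rewrite -enorm_sqr exprn_gt0.
    apply: filterS => x; apply: contraTN => /eqP ->.
    by rewrite /nsq big1 ?ltxx// => i _; rewrite mxE expr0n.
  have n1 : \forall x \near z, enorm x != 1.
    move: z1; rewrite neq_lt => /orP[z1|z1].
      by have /cvgr_lt /(_ _ z1) := cE; apply: filterS => x h; rewrite lt_eqF.
    by have /cvgr_gt /(_ _ z1) := cE; apply: filterS => x h; rewrite gt_eqF.
  have n2 : \forall x \near z, C0 * `|ln (enorm x)| ^- 3 * (enorm x)^-1 <=
      C0 * `|ln (enorm z)| ^- 3 * (enorm z)^-1 + 1.
    by apply: (cvgr_le _ c3); rewrite ltrDl.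
  near=> x => Ox; apply: le_trans (b1 x Ox _ _) _; near: x; [exact: n0|exact: n1|exact: n2].
have [M hM] := near_bound; have [r1 r10 hr1] := open_nsq oO Oz.
have [r2 r20 hr2] := nbhs_nsq hM.
exists (Num.min r1 r2, M ^+ 2); split => /=; first by rewrite lt_min r10.
  exact: sqr_ge0.
move=> x; rewrite lt_min => /andP[h1 h2]; have Ox := hr1 x h1; split => //.
have hx := hr2 x h2 Ox.
have M0 : 0 <= M by exact: le_trans (enorm_ge0 _) hx.
by rewrite -enorm_sqr ler_sqr ?nnegrE ?enorm_ge0.
Unshelve. all: by end_near. Qed.

End euclidean_norm.

(** [729 = 3^6], from the sixth power of [x <= e^x] at [x = - t / 3]. It shows that a bounded drift
    satisfies the hypothesis of the local result at every centre, with one constant for all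
    centres. *)
Lemma expR_pow6_le (R : realType) (t : R) : t <= 0 -> expR (2 * t) * t ^+ 6 <= 729.
Proof.
move=> t0; have h := expR_ge1Dx (- t / 3).
have h1 : - t / 3 <= expR (- t / 3) by lra.
have h0 : 0 <= - t / 3 by lra.
have h6 : (- t / 3) ^+ 6 <= expR (- (2 * t)).
  have -> : - (2 * t) = 6%:R * (- t / 3) by field.
  by rewrite expRM_natl lerXn2r ?nnegrE ?expR_ge0.
have := ler_wpM2l (expR_ge0 (2 * t)) h6; rewrite -expRD subrr expR0.
have -> : (- t / 3) ^+ 6 = t ^+ 6 / 729 by field.
rewrite mulrA; lra.
Qed.

(** * Spreading of zeros and connectedness *)

Section final.
Context {R : realType} {n : nat}.
Local Notation mu := (@lebesgue_rV R n).
Variables (Omega : set 'rV[R]_n) (hO : open Omega).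
Variables (A u : 'rV[R]_n -> 'rV[R]_n) (p : 'rV[R]_n -> R)
  (Du : 'I_n -> 'I_n -> 'rV[R]_n -> R).
Hypotheses (hn : (2 <= n)%N) (hA : measurable_fun Omega A).
Hypotheses (hu : forall j, L2loc Omega (fun x => u x ord0 j)) (hp : L2loc Omega p)
  (hDu : forall j, weak_gradient Omega (fun x => u x ord0 j) (Du j))
  (hmom : forall j phi, test_function Omega phi ->
        \int[mu]_(x in Omega)
          (- (\sum_i Du j i x * partial i phi x)
           + (\sum_i A x ord0 i * Du j i x) * phi x
           - p x * partial j phi x) = 0)
  (hdiv : forall phi, test_function Omega phi ->
        \int[mu]_(x in Omega) (\sum_i u x ord0 i * partial i phi x) = 0).
Local Notation Su := (fun x => \sum_i u x ord0 i ^+ 2).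
Local Notation pp := (fun x => p x ^+ 2).

(* Small enough, in terms of the bound [C1] for the drift only, for the drift term
   to be absorbed. *)
Definition radius (be C1 : R) : R := - (`|be| + 18 + 2 * @carl_cst R n * `|C1|).

Lemma radius_spec be C1 : [/\ radius be C1 <= be - 2, radius be C1 <= -16 &
  2 * @carl_cst R n * C1 <= radius be C1 ^+ 2].
Proof.
have c1 := @carl_cst_ge1 R n; rewrite /radius.
have q0 : 0 <= 2 * @carl_cst R n * `|C1| by rewrite !mulr_ge0//; lra.
have q1 : 2 * @carl_cst R n * C1 <= 2 * @carl_cst R n * `|C1|.
  by rewrite ler_wpM2l ?ler_norm//; lra.
have b0 := normr_ge0 be; have b1 := ler_norm (- be); rewrite normrN in b1.
move: (2 * @carl_cst R n * `|C1|) (2 * @carl_cst R n * C1) `|be| q0 q1 b0 b1 => X Y B q0 q1 b0 b1.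
by split; [lra|lra|nra].
Qed.

(** The common form of the starting condition, in logarithmic radii: at the origin it comes from the
    hypothesis, and at a point near which the solution already vanishes it holds with [B = 0]. *)
Definition flat_at x0 := forall N : R, exists B r : R, 0 <= B /\
  forall al rho, rho <= r -> annint x0 al rho Su + annint x0 al rho pp <= B * expR (N * rho).

Section at_point.
Variables (x0 : 'rV[R]_n) (be C1 : R).
Hypothesis PB : forall x, 0 < sqdist x0 x <= expR (2 * be) -> Omega x.
Local Notation b := (radius be C1).

Let Vi al rho : rho <= b -> intg (fun x => \1_(annulus x0 al rho) x * Su x) /\
  intg (fun x => \1_(annulus x0 al rho) x * pp x).
Proof.
have [b1 b2 _] := radius_spec be C1.
by move=> h; have [] := annint_intg hO hu hp hDu PB b1 al h.
Qed.

Lemma local_ae : (forall x, 0 < sqdist x0 x <= expR (2 * be) ->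
    nsq (A x) * sqdist x0 x * logdist x0 x ^+ 6 <= C1) -> flat_at x0 ->
  {ae mu, forall y, 0 < sqdist x0 y <= expR (2 * (b - 2)) -> u y = 0 /\ p y = 0}.
Proof.
move=> hC hvan; have [b1 b2 b3] := radius_spec be C1.
apply: annint_zero_ae => al; first by apply: Vi; lra.
by move=> h; exact: (local_zero hO hn hA hu hp hDu hmom hdiv PB hC b1 b2 b3 hvan h).
Qed.

Lemma zero_near_flat r : 0 < r -> zero_near u p x0 r -> flat_at x0.
Proof.
move=> r0 zr N; exists 0, (Num.min b (ln r / 2 - 1)); split => // al rho.
rewrite le_min mul0r => /andP[rb rr]; have [i1 i2] := Vi al rb.
rewrite -(annintD i1 i2) /annint.
have H : (\int[mu]_x (\1_(annulus x0 al rho) x * (Su x + pp x))%:E)%E = 0%E.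
  rewrite -[RHS](integral0 mu setT); apply: ae_eq_integral => //.
    apply/measurable_EFinP; apply: intg_measurable.
    by apply: intg_eq (intgD i1 i2) => x; rewrite mulrDr.
  apply: filterS zr => x hx _ /=; rewrite indicE.
  case: (boolP (x \in annulus x0 al rho)) => [/set_mem/andP[_ h]|_]; last by rewrite mul0r.
  have [] := hx _.
    apply: le_lt_trans h _; rewrite -[ltRHS]lnK ?posrE// ltr_expR; lra.
  move=> -> ->; rewrite expr0n addr0 big1 ?mulr0// => i _.
  by rewrite mxE expr0n.
by rewrite /Rintegral H.
Qed.

(** The point is that the new radius does not depend on [r]. The local result concerns a punctured
    ball; the centre is covered by the ball already known. *)
Lemma zero_near_spread r : (forall x, 0 < sqdist x0 x <= expR (2 * be) ->
    nsq (A x) * sqdist x0 x * logdist x0 x ^+ 6 <= C1) ->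
  0 < r -> zero_near u p x0 r -> zero_near u p x0 (expR (2 * (b - 2))).
Proof.
move=> hC r0 zr; have := local_ae hC (zero_near_flat r0 zr).
move: (zr); apply: filterS2 => y h1 h2 hy.
have [s0|s0] := ltP 0 (nsq (y - x0)); first by apply: h2; rewrite s0 ltW.
by apply: h1; apply: le_lt_trans r0.
Qed.

End at_point.

Lemma drift_bound_at0 (C0 : R) : drift_bound Omega C0 A -> Omega 0 ->
  exists be, (forall x, 0 < sqdist 0 x <= expR (2 * be) -> Omega x) /\
    forall x, 0 < sqdist 0 x <= expR (2 * be) -> nsq (A x) * sqdist 0 x * logdist 0 x ^+ 6 <= C0 ^+ 2.
Proof.
move=> [hb _] O0; have [r r0 hr] := open_nsq hO O0.
(* [log r <= -1] keeps the ball away from the unit sphere, where the logarithm vanishes; the other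
   bound keeps it inside [Omega]. *)
exists (Num.min (-1) (ln r / 2 - 1)).
have H x : 0 < sqdist 0 x <= expR (2 * Num.min (-1) (ln r / 2 - 1)) -> Omega x /\ logdist 0 x <= -1.
  move=> /andP[s0]; rewrite (sqdist_expR s0) ler_expR ler_pM2l// le_min => /andP[h1 h2].
  split => //; apply: hr; rewrite -/(sqdist 0 x) (sqdist_expR s0) -[ltRHS]lnK ?posrE// ltr_expR; lra.
split => [x /H[]//|x hx]; have [Ox t1] := H x hx; have /andP[s0 _] := hx.
have sE : sqdist 0 x = enorm x ^+ 2 by rewrite enorm_sqr /sqdist subr0.
have xn0 : x != 0.
  by apply: contraTN s0 => /eqP ->; rewrite /sqdist subr0 /nsq big1 ?ltxx// => i _; rewrite mxE expr0n.
have E0 := enorm_gt0 xn0.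
have tE : logdist 0 x = ln (enorm x) by rewrite /logdist sE lnXn// -[X in X / 2]mulr_natr mulfK.
have E1 : enorm x != 1 by apply: contraTN t1 => /eqP e1; rewrite tE e1 ln1 -ltNge; lra.
have := hb x Ox xn0 E1; rewrite -tE sE -enorm_sqr.
have t0 : 0 < `|logdist 0 x| by rewrite normr_gt0; apply: contraTN t1 => /eqP ->; rewrite -ltNge; lra.
rewrite -mulrA -invfM ler_pdivlMr ?mulr_gt0 ?exprn_gt0// => h.
have h' := lerXn2r 2 _ _ h.
rewrite (_ : _ * _ * _ = (enorm (A x) * (`|logdist 0 x| ^+ 3 * enorm x)) ^+ 2).
  have e0 : 0 <= enorm (A x) * (`|logdist 0 x| ^+ 3 * enorm x).
    by rewrite mulr_ge0 ?enorm_ge0// mulr_ge0 ?enorm_ge0// exprn_ge0.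
  by apply: h'; rewrite nnegrE// (le_trans e0).
have -> : logdist 0 x ^+ 6 = `|logdist 0 x| ^+ 6.
  by rewrite -normrX ger0_norm// exprn_even_ge0.
by ring.
Qed.

Lemma flat_at0 : vanishes_to_infinite_order_at0 u p -> Omega 0 -> flat_at 0.
Proof.
move=> hvan O0 N; have [R0 R00 hR] := open_nsq hO O0.
(* The hypothesis concerns positive orders, whereas [flat_at] allows every real [N]. *)
pose N' := Num.max N 1.
have N'0 : 0 < N' by rewrite lt_max ltr01 orbT.
have := hvan N' N'0; move=> /eqO_exP[k k0 hk].
have /nbhs_ballP[e /= e0 he] := hk.
(* [rho <= 0] lets [N'] replace [N]; the second bound puts [r] in the range of the asymptotic
   estimate, and the third puts the ball of radius [r] inside [Omega]. *)
pose r0 := Num.min 0 (Num.min (ln (e / 2) - 1) (ln (R0 / 4) / 2 - 1)).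
exists (k * 2 `^ N'), r0; split; first by rewrite mulr_ge0 ?powR_ge0// ltW.
move=> al rho; rewrite !le_min => /and3P[rho0 rhoe rhoR].
(* The factor 2 is there because [eball] is open while [annulus] contains its outer sphere. *)
pose r := 2 * expR rho.
have rp : 0 < r by rewrite mulr_gt0// expR_gt0.
have re : r < e.
  by rewrite /r mulrC -ltr_pdivlMr// -[ltRHS]lnK ?posrE ?divr_gt0// ltr_expR; lra.
have rR : r ^+ 2 < R0.
  rewrite /r exprMn -expRM_natl (_ : 2 ^+ 2 = 4)//; last by ring.
  rewrite mulrC -ltr_pdivlMr// -[ltRHS]lnK ?posrE ?divr_gt0// ltr_expR; lra.
have rb : ball (0 : R) e r by rewrite -ball_normE /= sub0r normrN gtr0_norm.
have := he r rb rp; rewrite [X in _ <= _ * X]ger0_norm ?powR_ge0// => hI.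
pose B := [set y : 'rV[R]_n | nsq (y - 0) <= r ^+ 2].
have BO : B `<=` Omega by move=> y hy; apply: hR; exact: le_lt_trans rR.
have cB : compact B by exact: compact_nsq_le.
have mB : measurable B.
  rewrite (_ : B = sqdist 0 @^-1` `]-oo, r ^+ 2]%classic).
    by rewrite -[X in measurable X]setTI; apply: measurable_sqdist.
  by apply/seteqP; split => y; rewrite /B /sqdist /= in_itv.
have bB : (eball r : set 'rV[R]_n) `<=` B.
  move=> y /ltW hy; rewrite /B /= subr0 -enorm_sqr ler_sqr ?nnegrE ?enorm_ge0//; exact: ltW.
have KE : annulus 0 al rho `<=` (eball r : set 'rV[R]_n).
  move=> y /andP[_ h]; rewrite /eball /= -(@ltr_pXn2r _ 2) ?nnegrE ?enorm_ge0 ?(ltW rp)//.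
  rewrite enorm_sqr; move: h; rewrite /sqdist subr0 => h; apply: le_lt_trans h _.
  by rewrite /r exprMn -expRM_natl ltr_pMl ?expR_gt0//; rewrite expr2; lra.
have mE : measurable (eball r : set 'rV[R]_n).
  rewrite (_ : eball r = sqdist 0 @^-1` `]-oo, (r ^+ 2)[%classic).
    by rewrite -[X in measurable X]setTI; apply: measurable_sqdist.
  apply/seteqP; split => y; rewrite /eball /sqdist /= in_itv /= subr0 -enorm_sqr;
  by rewrite ltr_pXn2r ?nnegrE ?enorm_ge0 ?(ltW rp).
have iS : intg (fun y => \1_B y * (Su y + pp y)).
  apply: (@intg_eq _ _ (fun y => \sum_i \1_B y * u y ord0 i ^+ 2 + \1_B y * p y ^+ 2)).
    by move=> y; rewrite mulrDr mulr_sumr.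
  apply: intgD; last exact: (L2loc_intg hO hp BO cB mB).
  by apply: intg_sum => i _; exact: (L2loc_intg hO (hu i) BO cB mB).
have S0 y : 0 <= Su y + pp y.
  by rewrite addr_ge0 ?sqr_ge0// sumr_ge0// => i _; exact: sqr_ge0.
have sub_intg (K : set 'rV[R]_n) (f : 'rV[R]_n -> R) : measurable K -> K `<=` B ->
    intg (fun y => \1_B y * f y) -> intg (fun y => \1_K y * f y).
  move=> mK KB intf; apply: intg_eq (intg_bmul intf (bmeas_indic mK)) => y; rewrite !indicE.
  case: (boolP (y \in K)) => [/set_mem/KB yB|_]; last by rewrite !mul0r.
  by rewrite mem_set// mul1r.
have KB : annulus 0 al rho `<=` B by move=> y /KE/bB.
have iu : intg (fun y => \1_(annulus 0 al rho) y * Su y).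
  apply: sub_intg => //; first exact: measurable_annulus.
  apply: (@intg_eq _ _ (fun y => \sum_i \1_B y * u y ord0 i ^+ 2)) => [y|].
    by rewrite mulr_sumr.
  by apply: intg_sum => i _; exact: (L2loc_intg hO (hu i) BO cB mB).
have ip : intg (fun y => \1_(annulus 0 al rho) y * pp y).
  by apply: sub_intg => //; [exact: measurable_annulus|exact: (L2loc_intg hO hp BO cB mB)].
rewrite -(annintD iu ip).
have hV : annint 0 al rho (fun y => Su y + pp y) <=
    \int[mu]_(y in eball r) (enorm (u y) ^+ 2 + `|p y| ^+ 2).
  rewrite (RI_restrict (g := fun y => \1_(eball r) y * (Su y + pp y))); first last.
  - by move=> y ny; rewrite indicE memNset// mul0r.
  - by move=> y hy; rewrite indicE mem_set// mul1r enorm_sqr real_normK ?num_real.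
  apply: RI_le; [by apply: sub_intg => //; exact: measurable_annulus|exact: sub_intg|move=> y].
  rewrite ler_wpM2r// !indicE; case: (boolP (y \in annulus 0 al rho)) => [/set_mem/KE ye|_//].
  by rewrite mem_set.
apply: le_trans hV _; apply: le_trans (ler_norm _) _; apply: le_trans hI _.
rewrite /r powRM ?expR_ge0// -expRM -mulrA ler_wpM2l ?(ltW k0)// ler_wpM2l ?powR_ge0// ler_expR.
have NN : N <= N' by rewrite le_max lexx.
by rewrite mulrC; nra.
Qed.

(** The drift is bounded in a fixed ball about [z], so the radius given by [zero_near_spread] is the
    same for all centres close to [z]. A centre in the zero set that is closer to [z] than this
    radius yields a ball of zeros containing a neighbourhood of [z]. *)
Lemma zero_near_limit (C0 : R) z : drift_bound Omega C0 A -> Omega z -> z != 0 ->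
  (forall e : R, 0 < e -> exists2 x0, nsq (x0 - z) < e & exists2 r, 0 < r & zero_near u p x0 r) ->
  exists2 r : R, 0 < r & zero_near u p z r.
Proof.
move=> hb Oz zn0 hz; have [[rh M] /= [rh0 M0 hrM]] := drift_locally_bounded hO hb Oz zn0.
pose be := Num.min 0 (ln (rh / 4) / 2 - 1).
have be0 : be <= 0 by rewrite ge_min lexx.
have hbe : expR (2 * be) < rh / 4.
  have h : be <= ln (rh / 4) / 2 - 1 by rewrite ge_min lexx orbT.
  by rewrite -[ltRHS]lnK ?posrE ?divr_gt0// ltr_expR; lra.
pose C1 := M * 729; pose e := expR (2 * (radius be C1 - 2)).
have e0 : 0 < e by exact: expR_gt0.
have [x0 hx0 [r r0 zr]] : exists2 x0, nsq (x0 - z) < Num.min (rh / 4) (e / 4) &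
    exists2 r, 0 < r & zero_near u p x0 r.
  by apply: hz; rewrite lt_min !divr_gt0.
move: hx0; rewrite lt_min => /andP[h1 h2].
have H x : 0 < sqdist x0 x <= expR (2 * be) -> Omega x /\ nsq (A x) <= M.
  by move=> /andP[_ hs]; apply: hrM; apply: (nsq_sub_lt h1); exact: le_lt_trans hs hbe.
have PB x : 0 < sqdist x0 x <= expR (2 * be) -> Omega x by move=> /H[].
have hC x : 0 < sqdist x0 x <= expR (2 * be) -> nsq (A x) * sqdist x0 x * logdist x0 x ^+ 6 <= C1.
  move=> hx; have [_ hM] := H x hx; have /andP[s0 hs] := hx.
  have t0 : logdist x0 x <= 0 by apply: le_trans be0; move: hs; rewrite (sqdist_expR s0) ler_expR ler_pM2l.
  rewrite -mulrA; apply: ler_pM => //; first exact: nsq_ge0.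
    by rewrite mulr_ge0 ?(ltW s0)// exprn_even_ge0.
  by rewrite (sqdist_expR s0); exact: expR_pow6_le.
exists (e / 4); first by rewrite divr_gt0.
apply: zero_near_sub (zero_near_spread PB hC r0 zr) => y hy.
by apply: (nsq_sub_lt (x := z)) hy; rewrite -nsqN opprB.
Qed.

Lemma unique_continuation (C0 : R) : drift_bound Omega C0 A -> Omega 0 -> connected Omega ->
  vanishes_to_infinite_order_at0 u p ->
  {ae mu, forall x, Omega x -> u x = 0 /\ p x = 0}.
Proof.
move=> hb O0 hconn hvan; apply: zero_near_cover.
pose Z := [set x | exists2 r : R, 0 < r & zero_near u p x r].
have Z0 : Z 0.
  have [be [PB hC]] := drift_bound_at0 hb O0.
  have h := local_ae PB hC (flat_at0 hvan O0).
  exists (expR (2 * (radius be (C0 ^+ 2) - 2))); first exact: expR_gt0.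
  (* The local result says nothing at the centre itself, which is a null set. *)
  have n0 : {ae mu, forall y : 'rV[R]_n, y <> 0}.
    exists [set 0]; split.
      rewrite (_ : [set 0] = sqdist 0 @^-1` [set 0]).
        by rewrite -[X in measurable X]setTI; apply: measurable_sqdist.
      apply/seteqP; split => y /=; rewrite /sqdist subr0; last exact: nsq_eq0.
      by move=> ->; rewrite /nsq big1// => i _; rewrite mxE expr0n.
      by apply: lebesgue_rV_set1; exact: ltnW.
    by move=> y /= /contrapT.
  move: h n0; apply: filterS2 => y h1 h2 hy; apply: h1; rewrite (ltW hy) andbT.
  rewrite lt_neqAle nsq_ge0 andbT eq_sym; apply/eqP => /nsq_eq0; rewrite subr0; exact: h2.
have oZ : open Z.
  rewrite openE => x [r r0 zr]; rewrite /interior.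
  have r40 : 0 < r / 4 by rewrite divr_gt0.
  apply: filterS (near_nsq x r40) => y hy; exists (r / 4) => //.
  by apply: zero_near_sub zr => v; exact: (nsq_sub_lt hy).
suff -> : Omega = Omega `&` Z by move=> x [].
apply/esym; apply: hconn.
- by exists 0.
- by exists Z.
- exists (closure Z); first exact: closed_closure.
  apply/seteqP; split => x [Ox hx]; split => //; first exact: subset_closure.
  (* The drift may be unbounded near the origin, so [zero_near_limit] does not apply there, but the
     origin is already in [Z]. *)
  have [->//|xn0] := eqVneq x 0.
  apply: (zero_near_limit hb Ox xn0) => e e0.
  by have [y [[r r0 zr] hy]] := hx _ (near_nsq x e0); exists y => //; exists r.
Qed.

End final.

Theorem corollary1p6 (R : realType) (n : nat) (hn : (2 <= n)%N)
    (Omega : set 'rV[R]_n) (hopen : open Omega) (hconn : connected Omega)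
    (h0 : Omega 0)
    (A : 'rV[R]_n -> 'rV[R]_n) (hA : measurable_fun Omega A)
    (C0 : R) (hC0 : 0 < C0) (hbound : drift_bound Omega C0 A)
    (u : 'rV[R]_n -> 'rV[R]_n) (p : 'rV[R]_n -> R)
    (hu : forall j : 'I_n, H1loc Omega (fun x => u x ord0 j))
    (hp : L2loc Omega p)
    (hsol : stokes_solution Omega A u p)
    (hvan : vanishes_to_infinite_order_at0 u p) :
  {ae @lebesgue_rV R n, forall x, Omega x -> u x = 0 /\ p x = 0}.
Proof.
have [Du [hDu hmom hdiv]] := hsol.
apply: (unique_continuation hopen hn hA (fun j => (hu j).1) hp hDu hmom hdiv hbound) => //.
Qed.
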